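(* Let $n\ge 3$ and $k\ge 1$ be integers and let $a,b$ be nonzero complex constants such that the polynomial $z^{n}+az^{n-1}+b$ has no repeated root. Put $S_{1}=\{z\in\mathbb{C}: z^{n}+az^{n-1}+b=0\}$, $S_{2}=\{\infty\}$ and $S_{3}=\{0\}$. Let $f$ and $g$ be two non-constant meromorphic functions in $\mathbb{C}$, with $f^{(k)}$ and $g^{(k)}$ non-constant, such that $$E_{f^{(k)}}(S_{1},k_{1})=E_{g^{(k)}}(S_{1},k_{1}),\qquad E_{f}(S_{2},k_{2})=E_{g}(S_{2},k_{2}),\qquad E_{f^{(k)}}(S_{3},k_{3})=E_{g^{(k)}}(S_{3},k_{3}),$$ where $k_{1}\geq 4$, $k_{2}\geq 0$, $k_{3}\geq 0$ are integers satisfying $$2k_{1}k_{2}k_{3}>k_{1}+k_{2}+2k_{3}+k-2kk_{1}k_{3}-k_{1}k_{2}-kk_{1}+3.$$ Then $f^{(k)}\equiv g^{(k)}$.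
   Context: Meromorphic means meromorphic in the whole complex plane. For a nonnegative integer (or infinity) $m$ and $\alpha\in\mathbb{C}\cup\{\infty\}$, $E_{m}(\alpha;h)$ denotes the set of all $\alpha$-points of the meromorphic function $h$, where an $\alpha$-point of multiplicity $p$ is counted $p$ times if $p\le m$ and $m+1$ times if $p>m$. For a set $S$ of distinct elements of $\mathbb{C}\cup\{\infty\}$, $E_{h}(S,m)=\bigcup_{\alpha\in S}E_{m}(\alpha;h)$ (a set of points in which, for each $\alpha\in S$, an $\alpha$-point of $h$ of multiplicity $p$ is counted $p$ times if $p\le m$ and $m+1$ times if $p>m$). *)

(* Defs.v *)
From mathcomp Require Import all_boot all_order all_algebra.
From mathcomp Require Import all_classical all_reals all_analysis.
From mathcomp Require Export complex.
Import Order.TTheory GRing.Theory Num.Theory numFieldNormedType.Exports.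

Set Implicit Arguments.
Unset Strict Implicit.
Unset Printing Implicit Defensive.

Local Open Scope classical_set_scope.
Local Open Scope ring_scope.

(* Functions with values in the Riemann sphere are functions [C -> option C], [None] being
   the point at infinity.  The definitions are stated over an arbitrary
   numClosedFieldType C, since its topology and its structure of normed module
   over itself are canonical there; they are meant for C := R[i] with
   R : realType, so that [derivable h z 1] and [derive1] are complex
   differentiability and the complex derivative. *)

Definition finpart (C : numClosedFieldType) (f : C -> option C) (z : C) : C :=
  odflt 0 (f z).

Definition holomorphic_at (C : numClosedFieldType) (h : C -> C) (z : C) : Prop :=
  \forall y \near z, derivable h y 1.

(* At each point, f is either finite and holomorphic nearby, or has a pole;
   in particular f is not identically oo. *)
Definition meromorphic (C : numClosedFieldType) (f : C -> option C) : Prop :=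
  forall z : C,
    if f z is Some _ then
      (\forall y \near z, f y <> None) /\ holomorphic_at (finpart f) z
    else
      (\forall y \near z^', f y <> None /\ derivable (finpart f) y 1) /\
      (`|finpart f y| @[y --> z^'] --> +oo).

(* The poles of the derivative are those of f. *)
Definition mderive (C : numClosedFieldType) (f : C -> option C) (z : C) :
    option C :=
  if f z is Some _ then Some (derive1 (finpart f) z) else None.

Definition mderiven (C : numClosedFieldType) (k : nat) (f : C -> option C) :
    C -> option C :=
  iter k (@mderive C) f.

Definition nonconstant (C : numClosedFieldType) (f : C -> option C) : Prop :=
  ~ exists c : option C, forall z : C, f z = c.

(* z is an alpha-point of f of multiplicity p (for alpha = oo, a pole of
   order p). *)
Definition point_of_mult (C : numClosedFieldType) (f : C -> option C)
    (alpha : option C) (z : C) (p : nat) : Prop :=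
  [/\ (0 < p)%N, f z = alpha &
    exists h : C -> C, [/\ holomorphic_at h z, h z != 0 &
      \forall y \near z^',
        f y = if alpha is Some w then Some (w + (y - z) ^+ p * h y)
              else Some (h y / (y - z) ^+ p)]].

(* A set of points counted with multiplicity is represented by the set of
   pairs (point, number of times it is counted).  For distinct alpha the sets
   of alpha-points are disjoint, so the union over alpha never merges counts. *)
Definition Epoints (C : numClosedFieldType) (m : nat) (alpha : option C)
    (f : C -> option C) : set (C * nat) :=
  [set x | exists2 p : nat, point_of_mult f alpha x.1 p &
             x.2 = if (p <= m)%N then p else m.+1].

Definition Eset (C : numClosedFieldType) (f : C -> option C)
    (S : set (option C)) (m : nat) : set (C * nat) :=
  \bigcup_(alpha in S) Epoints m alpha f.

(* Main.v *)
From HB Require Import structures.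
Require Import Defs.
From mathcomp Require Import all_boot all_order all_algebra.
From mathcomp Require Import all_classical all_reals all_analysis.
From mathcomp Require Import ring lra zify.
Import Order.TTheory GRing.Theory Num.Theory numFieldNormedType.Exports.

(** Write [phi = f^(k)], [psi = g^(k)], [P = z^n + a z^(n-1) + b], [X = P(phi)],
    [Y = P(psi)] and suppose that [phi] and [psi] differ.  A zero of [X], a zero of
    [phi] or a pole of [phi] whose multiplicity is not the same for [psi] has
    multiplicity larger than [k1], [k3], resp. [k2 + k] for both functions, hence is
    a zero of order at least [k1], [2 k3 + 1], resp. [k2 + k] of
    [Psi3 = phi'/phi - psi'/psi], [Psi1 = X'/X - Y'/Y], resp. [Psi2 = Psi1 - n Psi3],
    and at most a simple pole of the other two.  By the lemma on the logarithmic
    derivative the counting functions [A], [B], [C] of these three sets of points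
    satisfy, up to small terms,
    [k1 A <= B + C], [(2 k3 + 1) B <= A + C], [(k2 + k) C <= A + B],
    and the hypothesis on [k1], [k2], [k3] says exactly that this forces [A], [B]
    and [C] to be small.  Using [Psi1] and [Psi2] once more, all zeros and poles of
    [phi] and [psi] are rare.  The common simple zeros of [X] and [Y] are zeros of
    [H = W'/W - V'/V], where [W = X'/X^2] and [V = Y'/Y^2], and there are too many of
    them unless [H = 0].  In that case [1/X = c/Y + d], and the second main theorem, applied to [0], [oo] and roots of a polynomial at which
    the other function has a zero or a pole, gives a contradiction, except for
    [X = Y] (or [Psi1 = 0], [Psi2 = 0]); there [phi/psi] omits [0] and [oo] and takes
    some root of unity only with multiplicity at least 2.

    The Nevanlinna theory rests on Jensen's formula between two circles, and that on
    Goursat's lemma.  The exceptional set of the usual error terms is avoided by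
    fixing the total characteristic [Tot] as the only measure of growth: an
    inequality [Tot <= O(log Tot + log (rho / (rho - r)))] for all [r < rho] bounds
    [Tot], and a nonconstant function has unbounded characteristic. *)

Set Implicit Arguments.
Unset Strict Implicit.
Unset Printing Implicit Defensive.

Local Open Scope classical_set_scope.
Local Open Scope ring_scope.
Local Open Scope complex_scope.

Local Notation Re := (@complex.Re _).
Local Notation Im := (@complex.Im _).

(* The topology of [R[i]] is taken from the regular module [R[i]^o], whose structures come
   from [numClosedFieldType] alone, as in [holomorphic_at] and [meromorphic]. *)
#[export, non_forgetful_inheritance]
HB.instance Definition _ (R : realType) := PseudoPointedMetric.copy R[i] R[i]^o.
#[export, non_forgetful_inheritance]
HB.instance Definition _ (R : realType) := GRing.ComAlgebra.copy R[i] R[i]^o.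
#[export, non_forgetful_inheritance]
HB.instance Definition _ (R : realType) := Vector.copy R[i] R[i]^o.
#[export, non_forgetful_inheritance]
HB.instance Definition _ (R : realType) := NormedModule.copy R[i] R[i]^o.

(** The functions studied are total maps [C -> C] with arbitrary values at their poles, so orders
    and identities are read on punctured neighbourhoods only. All means are taken over circles
    missing a discrete set [B] that holds the zeros and poles of the finitely many functions in
    play: logarithms are then continuous on them, and integrals are increments of antiderivatives.
    Counting starts at a circle of radius [r0], so a zero or pole at the origin needs no special
    treatment. The inequalities for [A], [B], [C] have the matrix with diagonal [x = k1],
    [y = 2 k3 + 1], [z = k2 + k] and all other entries [-1]. Its determinant is
    [x y z - x - y - z - 2], its adjugate has nonnegative entries, and the hypothesis is the
    positivity of this determinant. The [2] in [2 k3 + 1] is a lower bound for [n - 1], as [P - b]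
    has the factor [z^(n-1)]. When [H] is not zero, the second main theorem yields [n Tot], from
    which [n Tot / 2] is lost to the zeros of [X] and [Y] and [Tot] to the nonzero critical point of
    [P]; a positive part remains because [n >= 3]. *)

Section ComplexBasics.
Context {R : realType}.
Local Notation C := R[i].
Implicit Types (z w : C) (x y : R).

(** The norm of [R[i]] takes its values in [R[i]]; its real part lies in the ordered field [R],
    where [lra] and suprema work. *)
Definition nrm z : R := Re `|z|.

Lemma nrmE z : (nrm z)%:C = `|z|.
Proof. by rewrite /nrm normc_def. Qed.

Lemma nrm_sqrt z : nrm z = Num.sqrt (Re z ^+ 2 + Im z ^+ 2).
Proof. by rewrite /nrm normc_def. Qed.

Lemma nrm_ge0 z : 0 <= nrm z.
Proof. by rewrite nrm_sqrt sqrtr_ge0. Qed.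
#[local] Hint Extern 0 (is_true (@Order.le _ _ _ (nrm _))) =>
  solve [apply: nrm_ge0] : core.

Lemma nrmM z w : nrm (z * w) = nrm z * nrm w.
Proof. by apply: (@complexI R); rewrite rmorphM /= !nrmE normrM. Qed.

Lemma nrm1 : nrm 1 = 1.
Proof. by apply: (@complexI R); rewrite nrmE normr1. Qed.

Lemma nrm0 : nrm 0 = 0.
Proof. by apply: (@complexI R); rewrite nrmE normr0. Qed.

Lemma nrmN z : nrm (- z) = nrm z.
Proof. by rewrite /nrm normrN. Qed.

Lemma nrmB z w : nrm (z - w) = nrm (w - z).
Proof. by rewrite -nrmN opprB. Qed.

Lemma nrmV z : nrm z^-1 = (nrm z)^-1.
Proof. by apply: (@complexI R); rewrite fmorphV /= !nrmE normfV. Qed.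

Lemma nrmX z n : nrm (z ^+ n) = nrm z ^+ n.
Proof. by apply: (@complexI R); rewrite rmorphXn /= !nrmE normrX. Qed.

Lemma nrmXz z (m : int) : nrm (z ^ m) = nrm z ^ m.
Proof. by case: m => m; rewrite ?NegzE -?exprnN -?exprnP ?nrmV nrmX. Qed.

Lemma nrm_eq0 z : (nrm z == 0) = (z == 0).
Proof. by rewrite -[RHS]normr_eq0 -nrmE -(inj_eq (@complexI R)). Qed.

Lemma nrm_gt0 z : (0 < nrm z) = (z != 0).
Proof. by rewrite lt_def nrm_ge0 andbT nrm_eq0. Qed.

Lemma nrmD z w : nrm (z + w) <= nrm z + nrm w.
Proof. by rewrite -lecR rmorphD /= !nrmE ler_normD. Qed.

Lemma nrm_tri z w v : nrm (z - v) <= nrm (z - w) + nrm (w - v).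
Proof. by apply: le_trans (nrmD _ _); rewrite addrA subrK. Qed.

Lemma nrmBD z w : nrm z - nrm w <= nrm (z - w).
Proof. by rewrite lerBlDr (le_trans _ (nrmD _ _)) // subrK. Qed.

Lemma nrm_real x : nrm x%:C = `|x|.
Proof. by rewrite nrm_sqrt /= expr0n addr0 sqrtr_sqr. Qed.

Lemma nrm_nat n : nrm n%:R = n%:R.
Proof. by rewrite -(rmorph_nat (real_complex R)) nrm_real normr_nat. Qed.

Lemma nrm_sum I (s : seq I) (P : pred I) (F : I -> C) :
  nrm (\sum_(i <- s | P i) F i) <= \sum_(i <- s | P i) nrm (F i).
Proof.
elim/big_rec2: _ => [|i y1 y2 _ h]; first by rewrite nrm0.
by rewrite (le_trans (nrmD _ _)) // lerD2l.
Qed.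

Lemma rcD x y : (x + y)%:C = x%:C + y%:C :> C. Proof. exact: rmorphD. Qed.
Lemma rcB x y : (x - y)%:C = x%:C - y%:C :> C. Proof. exact: rmorphB. Qed.
Lemma rcM x y : (x * y)%:C = x%:C * y%:C :> C. Proof. exact: rmorphM. Qed.
Lemma rcV x : (x^-1)%:C = x%:C^-1 :> C. Proof. exact: fmorphV. Qed.
Lemma rc_eq0 x : (x%:C == 0 :> C) = (x == 0). Proof. exact: fmorph_eq0. Qed.

Lemma cReD z w : Re (z + w) = Re z + Re w. Proof. by case: z; case: w. Qed.
Lemma cImD z w : Im (z + w) = Im z + Im w. Proof. by case: z; case: w. Qed.
Lemma cReN z : Re (- z) = - Re z. Proof. by case: z. Qed.
Lemma cImN z : Im (- z) = - Im z. Proof. by case: z. Qed.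
Lemma cReM z w : Re (z * w) = Re z * Re w - Im z * Im w.
Proof. by case: z; case: w. Qed.
Lemma cImM z w : Im (z * w) = Re z * Im w + Im z * Re w.
Proof. by case: z; case: w. Qed.
Lemma cReMr x z : Re (x%:C * z) = x * Re z.
Proof. by rewrite cReM /= mul0r subr0. Qed.
Lemma cImMr x z : Im (x%:C * z) = x * Im z.
Proof. by rewrite cImM /= mul0r addr0. Qed.

Lemma complex_ext z w : Re z = Re w -> Im z = Im w -> z = w.
Proof. by case: z => a b; case: w => c d /= -> ->. Qed.

Lemma Re_le_nrm z : `|Re z| <= nrm z.
Proof. by rewrite nrm_sqrt -sqrtr_sqr ler_wsqrtr // lerDl sqr_ge0. Qed.

Lemma Im_le_nrm z : `|Im z| <= nrm z.
Proof. by rewrite nrm_sqrt -sqrtr_sqr ler_wsqrtr // lerDr sqr_ge0. Qed.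

Lemma nrm_le_ReIm z : nrm z <= `|Re z| + `|Im z|.
Proof.
rewrite nrm_sqrt -[leRHS]ger0_norm ?addr_ge0 // -sqrtr_sqr ler_wsqrtr //.
by rewrite sqrrD !real_normK ?num_real // addrAC lerDl mulrn_wge0 // mulr_ge0.
Qed.

Lemma nearCP (P : C -> Prop) (a : C) :
  (\forall z \near a, P z) <-> exists2 d : R, 0 < d & forall z, nrm (z - a) < d -> P z.
Proof.
split=> [/nbhs_ballP [e /= e0 h]|[d d0 h]].
- exists (Re e).
    by move: e0; rewrite ltcE => /andP[_]; rewrite raddf0.
  move=> z hz; apply: h; rewrite /ball /= distrC -nrmE.
  move: e0; rewrite !ltcE /= => /andP[/eqP-> _]; by rewrite eqxx /=.
- apply/nbhs_ballP; exists d%:C => /=; first by rewrite ltcR.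
  by move=> z; rewrite /ball /= distrC -nrmE ltcR; exact: h.
Qed.

Lemma nearCx (P : C -> Prop) (a : C) :
  (\forall z \near a^', P z) <->
  exists2 d : R, 0 < d & forall z, z != a -> nrm (z - a) < d -> P z.
Proof.
split=> [|[d d0 h]]; rewrite near_withinE.
- by move=> /nearCP[d d0 h]; exists d => // z za zd; apply: h.
- by apply/nearCP; exists d => // z zd za; apply: h.
Qed.

Lemma nearRP (P : R -> Prop) (a : R) :
  (\forall x \near a, P x) <-> exists2 d : R, 0 < d & forall x, `|x - a| < d -> P x.
Proof.
split=> [/nbhs_ballP [e /= e0 h]|[d d0 h]].
- by exists e => // x hx; apply: h; rewrite /ball /= distrC.
- by apply/nbhs_ballP; exists d => //= x; rewrite /ball /= distrC; exact: h.
Qed.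

Lemma nearCI (P : C -> Prop) (a : C) (d : R) : 0 < d ->
  (forall z, nrm (z - a) < d -> P z) -> \forall z \near a, P z.
Proof. by move=> d0 h; apply/nearCP; exists d. Qed.

Lemma nearRI (P : R -> Prop) (a : R) (d : R) : 0 < d ->
  (forall x, `|x - a| < d -> P x) -> \forall x \near a, P x.
Proof. by move=> d0 h; apply/nearRP; exists d. Qed.

Lemma nearCxE (P : C -> Prop) (a : C) : (\forall z \near a^', P z) ->
  exists2 d : R, 0 < d & forall z, z != a -> nrm (z - a) < d -> P z.
Proof. by move/nearCx. Qed.

Lemma nearRxE (P : R -> Prop) (a : R) : (\forall z \near a^', P z) ->
  exists2 d : R, 0 < d & forall x : R, x != a -> `|x - a| < d -> P x.
Proof.
rewrite near_withinE => /nearRP[d d0 h]; exists d => // x xa xd; exact: h.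
Qed.

Lemma cvgCE (T : Type) (F : set_system T) {FF : Filter F} (f : T -> C) (l : C) :
  f @ F --> l -> forall e : R, 0 < e -> \forall x \near F, nrm (f x - l) < e.
Proof. by move=> h e e0; exact: (h _ (nearCI e0 (fun z => id))). Qed.

Lemma cvgCI (T : Type) (F : set_system T) {FF : Filter F} (f : T -> C) (l : C) :
  (forall e : R, 0 < e -> \forall x \near F, nrm (f x - l) < e) -> f @ F --> l.
Proof.
by move=> h A /nearCP[d d0 hA]; apply: filterS (h _ d0) => x /hA.
Qed.

Lemma cvgRE (T : Type) (F : set_system T) {FF : Filter F} (f : T -> R) (l : R) :
  f @ F --> l -> forall e : R, 0 < e -> \forall x \near F, `|f x - l| < e.
Proof. by move=> h e e0; exact: (h _ (nearRI e0 (fun x => id))). Qed.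

Lemma cvgRI (T : Type) (F : set_system T) {FF : Filter F} (f : T -> R) (l : R) :
  (forall e : R, 0 < e -> \forall x \near F, `|f x - l| < e) -> f @ F --> l.
Proof.
by move=> h A /nearRP[d d0 hA]; apply: filterS (h _ d0) => x /hA.
Qed.

Lemma continuous_Re : continuous (Re : C -> R).
Proof.
move=> z; apply: (cvgRI (FF := nbhs_filter z)) => e e0; apply: (nearCI e0) => w.
by apply: le_lt_trans; rewrite -cReN -cReD Re_le_nrm.
Qed.

Lemma continuous_Im : continuous (Im : C -> R).
Proof.
move=> z; apply: (cvgRI (FF := nbhs_filter z)) => e e0; apply: (nearCI e0) => w.
by apply: le_lt_trans; rewrite -cImN -cImD Im_le_nrm.
Qed.

End ComplexBasics.
#[export] Hint Extern 0 (is_true (@Order.le _ _ _ (nrm _))) =>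
  solve [apply: nrm_ge0] : core.

(** * Complex derivatives, Goursat's lemma *)

Section Diff.
Context {R : realType}.
Local Notation C := R[i].

(* Differentiability along an embedding [i : T -> C], with a complex derivative:
   [i := id] gives complex differentiability, [i := real_complex] curves. *)
Definition gd (T : Type) (i : T -> C) (f : T -> C) (t : T) (l : C) :=
  forall e : R, 0 < e -> exists2 d : R, 0 < d &
    forall s, nrm (i s - i t) < d ->
      nrm (f s - f t - l * (i s - i t)) <= e * nrm (i s - i t).

Section gd.
Variables (T : Type) (i : T -> C).

Lemma gd_cst (c : C) t : gd i (fun=> c) t 0.
Proof.
move=> e e0; exists 1 => // s _; rewrite subrr mul0r subr0 nrm0.
by rewrite mulr_ge0 // ltW.
Qed.

Lemma gd_emb t : gd i i t 1.
Proof.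
move=> e e0; exists 1 => // s _; rewrite mul1r subrr nrm0.
by rewrite mulr_ge0 // ltW.
Qed.

Lemma gdD f g t l m : gd i f t l -> gd i g t m ->
  gd i (fun s => f s + g s) t (l + m).
Proof.
move=> hf hg e e0; have e2 : 0 < e / 2 by rewrite divr_gt0.
have [d d0 hd] := hf _ e2; have [d' d'0 hd'] := hg _ e2.
exists (Num.min d d'); first by rewrite lt_min d0.
move=> s; rewrite lt_min => /andP[/hd h1 /hd' h2].
have -> : f s + g s - (f t + g t) - (l + m) * (i s - i t) =
  (f s - f t - l * (i s - i t)) + (g s - g t - m * (i s - i t)) by ring.
apply: le_trans (nrmD _ _) _; rewrite [e]splitr mulrDl; exact: lerD.
Qed.

Lemma gd_lip f t l : gd i f t l -> exists2 d : R, 0 < d &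
  forall s, nrm (i s - i t) < d -> nrm (f s - f t) <= (nrm l + 1) * nrm (i s - i t).
Proof.
move=> /(_ _ ltr01)[d d0 hd]; exists d => // s /hd h.
rewrite -[f s - f t](subrK (l * (i s - i t))).
by rewrite (le_trans (nrmD _ _)) // nrmM mulrDl addrC lerD.
Qed.

Lemma gd_cont f t l : gd i f t l -> forall e : R, 0 < e -> exists2 d : R, 0 < d &
  forall s, nrm (i s - i t) < d -> nrm (f s - f t) < e.
Proof.
move=> /gd_lip[d d0 hd] e e0.
have l1 : 0 < nrm l + 1 by rewrite ltr_wpDl.
exists (Num.min d (e / (nrm l + 1))); first by rewrite lt_min d0 divr_gt0.
move=> s; rewrite lt_min => /andP[/hd h1 h2]; apply: le_lt_trans h1 _.
by rewrite mulrC -ltr_pdivlMr.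
Qed.

Lemma gdM f g t l m : gd i f t l -> gd i g t m ->
  gd i (fun s => f s * g s) t (l * g t + f t * m).
Proof.
move=> hf hg e e0.
have p0 : 0 < nrm (g t) + 1 by rewrite ltr_wpDl.
have q0 : 0 < nrm (f t) + 1 by rewrite ltr_wpDl.
have r0 : 0 < nrm l + 1 by rewrite ltr_wpDl.
have e1 : 0 < e / 3 / (nrm (g t) + 1) by rewrite !divr_gt0.
have e2 : 0 < e / 3 / (nrm (f t) + 1) by rewrite !divr_gt0.
have e3 : 0 < e / 3 / (nrm l + 1) by rewrite !divr_gt0.
have [d1 d10 h1] := hf _ e1; have [d2 d20 h2] := hg _ e2.
have [d3 d30 h3] := gd_lip hf; have [d4 d40 h4] := gd_cont hg e3.
exists (Num.min (Num.min d1 d2) (Num.min d3 d4)); first by rewrite !lt_min d10 d20 d30.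
move=> s; rewrite !lt_min => /andP[/andP[/h1 k1 /h2 k2] /andP[/h3 k3 /h4 k4]].
set D := nrm (i s - i t) in k1 k2 k3 *.
have D0 : 0 <= D by exact: nrm_ge0.
have -> : f s * g s - f t * g t - (l * g t + f t * m) * (i s - i t) =
  (f s - f t - l * (i s - i t)) * g t + f t * (g s - g t - m * (i s - i t))
  + (f s - f t) * (g s - g t) by ring.
have -> : e * D = e / 3 * D + e / 3 * D + e / 3 * D by field.
apply: le_trans (nrmD _ _) (lerD (le_trans (nrmD _ _) (lerD _ _)) _); rewrite nrmM.
- apply: le_trans (_ : (e / 3 / (nrm (g t) + 1) * D) * (nrm (g t) + 1) <= _).
    by apply: ler_pM => //; rewrite lerDl.
  by rewrite mulrAC divfK ?gt_eqF.
- apply: le_trans (_ : (nrm (f t) + 1) * (e / 3 / (nrm (f t) + 1) * D) <= _).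
    by apply: ler_pM => //; rewrite lerDl.
  by rewrite mulrCA mulrA divfK ?gt_eqF // mulrC.
- apply: le_trans (_ : ((nrm l + 1) * D) * (e / 3 / (nrm l + 1)) <= _).
    by apply: ler_pM => //; exact: ltW.
  by rewrite mulrC mulrA divfK ?gt_eqF.
Qed.

Lemma gdZ c f t l : gd i f t l -> gd i (fun s => c * f s) t (c * l).
Proof. by move=> h; have := gdM (gd_cst c t) h; rewrite mul0r add0r. Qed.

Lemma gdN f t l : gd i f t l -> gd i (fun s => - f s) t (- l).
Proof.
move=> h e e0; have [d d0 hd] := h _ e0; exists d => // s /hd.
by rewrite -nrmN; congr (nrm _ <= _); ring.
Qed.

Lemma gdB f g t l m : gd i f t l -> gd i g t m ->
  gd i (fun s => f s - g s) t (l - m).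
Proof. by move=> hf hg; apply: gdD => //; exact: gdN. Qed.

Lemma gd_near f g t l : (exists2 d : R, 0 < d & forall s, nrm (i s - i t) < d -> f s = g s) ->
  gd i f t l -> gd i g t l.
Proof.
move=> [d0 d00 h] hf e e0; have [d d1 hd] := hf _ e0.
exists (Num.min d d0); first by rewrite lt_min d1.
move=> s; rewrite lt_min => /andP[/hd h1 /h h2].
by rewrite -h2 -h // subrr nrm0.
Qed.

Definition gc (f : T -> C) (t : T) :=
  forall e : R, 0 < e -> exists2 d : R, 0 < d &
    forall s, nrm (i s - i t) < d -> nrm (f s - f t) < e.

Lemma gd_gc f t l : gd i f t l -> gc f t.
Proof. exact: gd_cont. Qed.

Lemma gc_cst (c : C) t : gc (fun=> c) t.
Proof. exact: gd_gc (gd_cst c t). Qed.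

Lemma gc_emb t : gc i t.
Proof. exact: gd_gc (gd_emb t). Qed.

Lemma gcD f g t : gc f t -> gc g t -> gc (fun s => f s + g s) t.
Proof.
move=> hf hg e e0; have e2 : 0 < e / 2 by rewrite divr_gt0.
have [d d0 hd] := hf _ e2; have [d' d'0 hd'] := hg _ e2.
exists (Num.min d d'); first by rewrite lt_min d0.
move=> s; rewrite lt_min => /andP[/hd h1 /hd' h2].
have -> : f s + g s - (f t + g t) = (f s - f t) + (g s - g t) by ring.
apply: le_lt_trans (nrmD _ _) _; rewrite [e]splitr; exact: ltrD.
Qed.

Lemma gcN f t : gc f t -> gc (fun s => - f s) t.
Proof.
move=> h e e0; have [d d0 hd] := h _ e0; exists d => // s /hd.
by rewrite -nrmN; congr (nrm _ < _); ring.
Qed.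

Lemma gcB f g t : gc f t -> gc g t -> gc (fun s => f s - g s) t.
Proof. by move=> hf hg; apply: gcD => //; exact: gcN. Qed.

Lemma gcM f g t : gc f t -> gc g t -> gc (fun s => f s * g s) t.
Proof.
move=> hf hg e e0.
have p0 : 0 < nrm (g t) + 1 by rewrite ltr_wpDl.
have q0 : 0 < nrm (f t) + 1 by rewrite ltr_wpDl.
have e1 : 0 < e / 2 / (nrm (g t) + 1) by rewrite !divr_gt0.
have e2 : 0 < e / 2 / (nrm (f t) + 1) by rewrite !divr_gt0.
have [d1 d10 h1] := hf _ e1; have [d2 d20 h2] := hg _ e2.
have [d3 d30 h3] := hg _ ltr01.
exists (Num.min d1 (Num.min d2 d3)); first by rewrite !lt_min d10 d20 d30.
move=> s; rewrite !lt_min => /andP[/h1 k1 /andP[/h2 k2 /h3 k3]].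
have -> : f s * g s - f t * g t = (f s - f t) * g s + f t * (g s - g t) by ring.
have k4 : nrm (g s) <= nrm (g t) + 1.
  by rewrite -lerBlDl (le_trans (nrmBD _ _)) // ltW.
apply: le_lt_trans (nrmD _ _) _; rewrite !nrmM [e]splitr; apply: ler_ltD.
- rewrite -[leRHS](divfK (lt0r_neq0 p0)); apply: ler_pM => //; exact: ltW.
- apply: le_lt_trans (_ : nrm (f t) * (e / 2 / (nrm (f t) + 1)) < _).
    by rewrite ler_wpM2l // ltW.
  rewrite mulrA ltr_pdivrMr // mulrC ltr_pM2l ?divr_gt0 //.
  by rewrite ltrDl.
Qed.

Lemma gcZ c f t : gc f t -> gc (fun s => c * f s) t.
Proof. by move=> h; apply: gcM => //; exact: gc_cst. Qed.

Lemma gcV f t : f t != 0 -> gc f t -> gc (fun s => (f s)^-1) t.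
Proof.
move=> ft0 h e e0; have p0 : 0 < nrm (f t) by rewrite nrm_gt0.
have e1 : 0 < nrm (f t) / 2 by rewrite divr_gt0.
have e2 : 0 < e * (nrm (f t) / 2 * nrm (f t)) by rewrite !mulr_gt0.
have [d1 d10 h1] := h _ e1; have [d2 d20 h2] := h _ e2.
exists (Num.min d1 d2); first by rewrite !lt_min d10 d20.
move=> s; rewrite !lt_min => /andP[/h1 k1 /h2 k2].
have k3 : nrm (f t) / 2 < nrm (f s).
  have := nrmBD (f t) (f s); rewrite nrmB => k; lra.
have q0 : 0 < nrm (f s) by exact: lt_trans k3.
have fs0 : f s != 0 by rewrite -nrm_gt0.
have -> : (f s)^-1 - (f t)^-1 = - (f s - f t) * (f s * f t)^-1.
  by field; rewrite fs0 ft0.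
rewrite nrmM nrmN nrmV nrmM ltr_pdivrMr ?mulr_gt0 //.
apply: lt_le_trans k2 _; apply: ler_wpM2l; first exact: ltW.
by rewrite ler_pM2r // ltW.
Qed.

Lemma gdV f t l : f t != 0 -> gd i f t l -> gd i (fun s => (f s)^-1) t (- l / f t ^+ 2).
Proof.
move=> ft0 h e e0; have p0 : 0 < nrm (f t) by rewrite nrm_gt0.
have l0 : 0 < nrm l + 1 by rewrite ltr_wpDl.
have v0 : 0 < nrm (f t) ^+ 2 by rewrite exprn_gt0.
have e1 : 0 < nrm (f t) / 2 by rewrite divr_gt0.
have e2 : 0 < e / 4 * nrm (f t) ^+ 2 by rewrite mulr_gt0 // divr_gt0.
have e3 : 0 < e / 4 * nrm (f t) ^+ 2 * nrm (f t) / (nrm l + 1) by rewrite divr_gt0 // mulr_gt0.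
have [d1 d10 h1] := gd_gc h e1; have [d2 d20 h2] := h _ e2; have [d3 d30 h3] := gd_gc h e3.
exists (Num.min d1 (Num.min d2 d3)); first by rewrite !lt_min d10 d20.
move=> s; rewrite !lt_min => /andP[/h1 k1 /andP[/h2 k2 /h3 k3]].
set D := nrm (i s - i t) in k2 *; have D0 : 0 <= D by exact: nrm_ge0.
have k4 : nrm (f t) / 2 < nrm (f s).
  have := nrmBD (f t) (f s); rewrite nrmB => k; lra.
have q0 : 0 < nrm (f s) by exact: lt_trans k4.
have fs0 : f s != 0 by rewrite -nrm_gt0.
have -> : (f s)^-1 - (f t)^-1 - - l / f t ^+ 2 * (i s - i t) =
  (- (f s - f t - l * (i s - i t)) * f t + l * (i s - i t) * (f s - f t)) * (f s * f t ^+ 2)^-1.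
  by field; rewrite fs0 ft0.
rewrite nrmM nrmV nrmM nrmX ler_pdivrMr ?mulr_gt0 //.
apply: le_trans (nrmD _ _) _; rewrite !nrmM nrmN -/D.
apply: le_trans (_ : e / 4 * nrm (f t) ^+ 2 * D * nrm (f t) + (nrm l + 1) * D *
   (e / 4 * nrm (f t) ^+ 2 * nrm (f t) / (nrm l + 1)) <= _).
  apply: lerD; first by rewrite ler_wpM2r.
  by apply: ler_pM => //; [exact: mulr_ge0 | rewrite ler_wpM2r // lerDl | exact: ltW].
have -> : e / 4 * nrm (f t) ^+ 2 * D * nrm (f t) + (nrm l + 1) * D *
   (e / 4 * nrm (f t) ^+ 2 * nrm (f t) / (nrm l + 1)) =
   e * D * (nrm (f t) / 2 * nrm (f t) ^+ 2) by field; rewrite gt_eqF.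
by rewrite ler_wpM2l ?mulr_ge0 ?(ltW e0) // ler_pM2r // ltW.
Qed.

Lemma gc_near f g t : (exists2 d : R, 0 < d & forall s, nrm (i s - i t) < d -> f s = g s) ->
  gc f t -> gc g t.
Proof.
move=> [d0 d00 h] hf e e0; have [d d1 hd] := hf _ e0.
exists (Num.min d d0); first by rewrite lt_min d1.
move=> s; rewrite lt_min => /andP[/hd h1 /h h2].
by rewrite -h2 -h // subrr nrm0.
Qed.

End gd.

Lemma gc_comp (T : Type) (i : T -> C) (f : C -> C) u t :
  gc id f (u t) -> gc i u t -> gc i (f \o u) t.
Proof.
move=> hf hu e e0; have [d d0 hd] := hf _ e0; have [d' d'0 hd'] := hu _ d0.
by exists d' => // s /hd' /hd.
Qed.

Lemma gd_comp (T : Type) (i : T -> C) (f : C -> C) u t l m :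
  gd id f (u t) l -> gd i u t m -> gd i (f \o u) t (l * m).
Proof.
move=> hf hu e e0.
have m0 : 0 < nrm m + 1 by rewrite ltr_wpDl.
have l0 : 0 < nrm l + 1 by rewrite ltr_wpDl.
have e1 : 0 < e / 2 / (nrm m + 1) by rewrite !divr_gt0.
have e2 : 0 < e / 2 / (nrm l + 1) by rewrite !divr_gt0.
have [d1 d10 h1] := hf _ e1; have [d2 d20 h2] := hu _ e2.
have [d3 d30 h3] := gd_lip hu; have [d4 d40 h4] := gd_cont hu d10.
exists (Num.min d2 (Num.min d3 d4)); first by rewrite !lt_min d20 d30.
move=> s; rewrite !lt_min => /andP[/h2 k2 /andP[/h3 k3 /h4 /h1 /= k4]].
set D := nrm (i s - i t) in k2 k3 *.
have -> : f (u s) - f (u t) - l * m * (i s - i t) =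
  (f (u s) - f (u t) - l * (u s - u t)) + l * (u s - u t - m * (i s - i t)) by ring.
apply: le_trans (nrmD _ _) _; rewrite nrmM.
have -> : e * D = e / 2 * D + e / 2 * D by field.
apply: lerD.
- apply: le_trans k4 _; apply: le_trans (ler_wpM2l (ltW e1) k3) _.
  by rewrite mulrA divfK ?gt_eqF.
- apply: le_trans (_ : (nrm l + 1) * (e / 2 / (nrm l + 1) * D) <= _).
    by apply: ler_pM => //; rewrite lerDl.
  by rewrite mulrCA mulrA divfK ?gt_eqF // mulrC.
Qed.

Definition cd : (C -> C) -> C -> C -> Prop := gd (fun z => z).
Definition rd : (R -> C) -> R -> C -> Prop := gd (fun t => t%:C).
Definition cc : (C -> C) -> C -> Prop := gc (fun z => z).
Definition rc : (R -> C) -> R -> Prop := gc (fun t => t%:C).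

Lemma cdP f z l : cd f z l <-> is_derive z (1 : C) f l.
Proof.
split=> [h|].
- have H : h^-1 *: (f (h *: (1:C) + z) - f z) @[h --> 0^'] --> l.
    apply: cvgCI => e e0; have e2 : 0 < e / 2 by rewrite divr_gt0.
    have [d d0 hd] := h _ e2; apply/nearCx; exists d => // w w0.
    rewrite subr0 => wd; have := hd (w + z); rewrite addrK => /(_ wd).
    rewrite -[w *: 1]/(w * 1) mulr1 => k.
    have w0' : 0 < nrm w by rewrite nrm_gt0.
    rewrite -[_^-1 *: _]/(w^-1 * _).
    have -> : w^-1 * (f (w + z) - f z) - l = w^-1 * (f (w + z) - f z - l * w).
      by rewrite [in RHS]mulrBr [w^-1 * (l * w)]mulrCA mulVf // mulr1.
    rewrite nrmM nrmV mulrC ltr_pdivrMr //; apply: le_lt_trans k _.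
    by rewrite ltr_pM2r // ltr_pdivrMr // ltr_pMr // ltr1n.
  by apply: DeriveDef; [apply/cvg_ex; exists l | exact: cvg_lim H].
- move=> [df dl] e e0.
  have H : h^-1 *: (f (h *: (1:C) + z) - f z) @[h --> 0^'] --> l by rewrite -dl.
  have [d d0 hd] := nearCxE (cvgCE H e0); exists d => // w wd.
  have [->|wz] := eqVneq w z; first by rewrite !subrr mulr0 subr0 nrm0 mulr0.
  have w0 : w - z != 0 by rewrite subr_eq0.
  have w0' : 0 < nrm (w - z) by rewrite nrm_gt0.
  have := hd (w - z) w0; rewrite subr0 => /(_ wd) /ltW.
  rewrite -[_ *: 1]/(_ * 1) mulr1 subrK -[_^-1 *: _]/(_^-1 * _) => k.
  have -> : f w - f z - l * (w - z) = ((w - z)^-1 * (f w - f z) - l) * (w - z).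
    by rewrite mulrBl mulrAC mulVf // mul1r.
  by rewrite nrmM ler_pM2r.
Qed.

Lemma cd_derivable (f : C -> C) z l : cd f z l -> derivable f z 1 /\ derive1 f z = l.
Proof. by move=> /cdP[h1 h2]; split; [exact: h1 | rewrite derive1E]. Qed.

Lemma derivable_cd (f : C -> C) z : derivable f z 1 -> cd f z (derive1 f z).
Proof. by move=> h; apply/cdP; rewrite derive1E; exact: derivableP. Qed.

Lemma is_deriveRP (u : R -> R) t (l : R) : is_derive t (1 : R) u l <->
  forall e : R, 0 < e -> exists2 d : R, 0 < d &
    forall s, `|s - t| < d -> `|u s - u t - l * (s - t)| <= e * `|s - t|.
Proof.
split=> [[df dl] e e0|h].
- have H : h^-1 *: (u (h *: (1:R) + t) - u t) @[h --> 0^'] --> l by rewrite -dl.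
  have [d d0 hd] := nearRxE (cvgRE H e0); exists d => // w wd.
  have [->|wz] := eqVneq w t; first by rewrite !subrr mulr0 subr0 normr0 mulr0.
  have w0 : w - t != 0 by rewrite subr_eq0.
  have w0' : 0 < `|w - t| by rewrite normr_gt0.
  have := hd (w - t) w0; rewrite subr0 => /(_ wd) /ltW.
  rewrite -[_ *: 1]/(_ * 1) mulr1 subrK -[_^-1 *: _]/(_^-1 * _) => k.
  have -> : u w - u t - l * (w - t) = ((w - t)^-1 * (u w - u t) - l) * (w - t).
    by rewrite mulrBl mulrAC mulVf // mul1r.
  by rewrite normrM ler_pM2r.
- have H : h^-1 *: (u (h *: (1:R) + t) - u t) @[h --> 0^'] --> l.
    apply: cvgRI => e e0; have e2 : 0 < e / 2 by rewrite divr_gt0.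
    have [d d0 hd] := h _ e2; rewrite near_withinE; apply: (nearRI d0) => w.
    rewrite subr0 => wd w0; have := hd (w + t); rewrite addrK => /(_ wd).
    rewrite -[w *: 1]/(w * 1) mulr1 => k.
    have w0' : 0 < `|w| by rewrite normr_gt0.
    rewrite -[_^-1 *: _]/(w^-1 * _).
    have -> : w^-1 * (u (w + t) - u t) - l = w^-1 * (u (w + t) - u t - l * w).
      by rewrite [in RHS]mulrBr [w^-1 * (l * w)]mulrCA mulVf // mulr1.
    rewrite normrM normfV mulrC ltr_pdivrMr //; apply: le_lt_trans k _.
    by rewrite ltr_pM2r // ltr_pdivrMr // ltr_pMr // ltr1n.
  by apply: DeriveDef; [apply/cvg_ex; exists l | exact: cvg_lim H].
Qed.

Lemma rdP (u : R -> C) t l : rd u t l <->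
  is_derive t (1 : R) (fun s => Re (u s)) (Re l) /\
  is_derive t (1 : R) (fun s => Im (u s)) (Im l).
Proof.
have E s : s%:C - t%:C = (s - t)%:C by rewrite rmorphB.
have ER s : Re (u s - u t - l * (s%:C - t%:C)) = Re (u s) - Re (u t) - Re l * (s - t).
  by rewrite E [l * _]mulrC !cReD !cReN cReMr [(s - t) * _]mulrC.
have EI s : Im (u s - u t - l * (s%:C - t%:C)) = Im (u s) - Im (u t) - Im l * (s - t).
  by rewrite E [l * _]mulrC !cImD !cImN cImMr [(s - t) * _]mulrC.
split=> [h|[/is_deriveRP h1 /is_deriveRP h2] e e0].
- split; apply/is_deriveRP => e e0; have [d d0 hd] := h _ e0; exists d => // s sd;
  have := hd s; rewrite [in nrm (_ - t%:C)]E nrm_real => /(_ sd); apply: le_trans.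
  + by rewrite -ER Re_le_nrm.
  + by rewrite -EI Im_le_nrm.
- have e2 : 0 < e / 2 by rewrite divr_gt0.
  have [d d0 hd] := h1 _ e2; have [d' d'0 hd'] := h2 _ e2.
  exists (Num.min d d'); first by rewrite lt_min d0.
  move=> s; rewrite lt_min [in nrm (_ - t%:C)]E nrm_real => /andP[/hd k /hd' k'].
  apply: le_trans (nrm_le_ReIm _) _; rewrite ER EI.
  have -> : e * `|s - t| = e / 2 * `|s - t| + e / 2 * `|s - t| by field.
  exact: lerD.
Qed.

Lemma is_derive_continuousR (u : R -> R) t (l : R) : is_derive t (1 : R) u l ->
  {for t, continuous u}.
Proof. by move=> [+ _] => /derivable1_diffP /differentiable_continuous. Qed.

(* The constant 2 comes from bounding the real and imaginary parts separately. *)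
Lemma rd_mvi (u du : R -> C) (a b M : R) : a <= b ->
  (forall t, a <= t <= b -> rd u t (du t)) ->
  (forall t, a <= t <= b -> nrm (du t) <= M) ->
  nrm (u b - u a) <= 2 * M * (b - a).
Proof.
move=> ab hd hM.
have inab t : t \in `]a, b[%R -> a <= t <= b.
  by rewrite in_itv /= => /andP[/ltW -> /ltW ->].
have cRe : {within `[a, b], continuous (fun s => Re (u s))}.
  apply/continuous_in_subspaceT => t; rewrite inE /= in_itv /= => h.
  by have /rdP[+ _] := hd _ h; exact: is_derive_continuousR.
have cIm : {within `[a, b], continuous (fun s => Im (u s))}.
  apply/continuous_in_subspaceT => t; rewrite inE /= in_itv /= => h.
  by have /rdP[_ +] := hd _ h; exact: is_derive_continuousR.
have [c1 h1 e1] := MVT_segment ab (fun t h => ((rdP _ _ _).1 (hd _ (inab t h))).1) cRe.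
have [c2 h2 e2] := MVT_segment ab (fun t h => ((rdP _ _ _).1 (hd _ (inab t h))).2) cIm.
apply: le_trans (nrm_le_ReIm _) _; rewrite cReD cReN cImD cImN e1 e2 !normrM.
rewrite in_itv /= in h1; rewrite in_itv /= in h2.
have ba : 0 <= b - a by rewrite subr_ge0.
rewrite (ger0_norm ba) -mulrDl ler_wpM2r // mulr_natl mulr2n lerD //.
- exact: le_trans (Re_le_nrm _) (hM _ h1).
- exact: le_trans (Im_le_nrm _) (hM _ h2).
Qed.

Lemma rd_cst (u : R -> C) (a b : R) : a <= b ->
  (forall t, a <= t <= b -> rd u t 0) -> u b = u a.
Proof.
move=> ab h; apply/eqP; rewrite -subr_eq0 -nrm_eq0 eq_le nrm_ge0 andbT.
have := @rd_mvi u (fun=> 0) a b 0 ab h; rewrite mulr0 mul0r; apply.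
by move=> t _; rewrite nrm0.
Qed.

End Diff.

(** * Line integrals as increments of antiderivatives *)

Section Integral.
Context {R : realType}.
Local Notation C := R[i].

(** The lower limit [-1] makes the derivative two-sided at [0], where all later integrals start. *)
Lemma antiderivativeR (u : R -> R) : continuous u ->
  exists U : R -> R, forall t : R, -1 < t -> is_derive t (1 : R) U (u t).
Proof.
move=> cu.
pose F (x : R) : R := (\int[lebesgue_measure]_(t in [set` `[(-1 : R), x]]) (u t))%R.
exists F => t t1.
have [] := @continuous_FTC1_closed R u (-1) t (t + 1) _ _ t1 (cu t).
- by rewrite ltrDl.
- apply: continuous_compact_integrable; first exact: segment_compact.
  exact: continuous_subspaceT.
- by move=> dF <-; apply: DeriveDef; [exact: dF | rewrite derive1E].
Qed.

Definition rcont (u : R -> C) := forall t, rc u t.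

Lemma antiderivative (u : R -> C) : rcont u ->
  exists U : R -> C, forall t, -1 < t -> rd U t (u t).
Proof.
move=> cu'; have cu : continuous u.
  move=> t; apply: (cvgCI (FF := nbhs_filter t)) => e /(cu' t)[d d0 hd].
  by apply: (nearRI d0) => s st; apply: hd; rewrite -rcB nrm_real.
have [V hV] : exists U : R -> R, forall t : R, -1 < t -> is_derive t (1 : R) U (Re (u t)).
  apply: (@antiderivativeR (fun t => Re (u t))) => t.
  exact: (continuous_comp (cu t) (@continuous_Re R (u t))).
have [W hW] : exists U : R -> R, forall t : R, -1 < t -> is_derive t (1 : R) U (Im (u t)).
  apply: (@antiderivativeR (fun t => Im (u t))) => t.
  exact: (continuous_comp (cu t) (@continuous_Im R (u t))).
by exists (fun t => V t +i* W t) => t t1; apply/rdP; split; [exact: hV | exact: hW].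
Qed.

Definition prim (u : R -> C) : R -> C :=
  xget (fun=> 0) [set U : R -> C | forall t, -1 < t -> rd U t (u t)].

Lemma primP (u : R -> C) : rcont u -> forall t, -1 < t -> rd (prim u) t (u t).
Proof. by move=> /antiderivative[U hU]; exact: (@xgetPex _ _ [set U | _] (ex_intro _ U hU)). Qed.

(** Two antiderivatives differ by a constant, so the choice made by [prim] does not matter, and
    identities between integrals are proved by differentiating ([cintE]). *)
Definition cint (u : R -> C) (b : R) : C := prim u b - prim u 0.

Lemma cintE (u U : R -> C) (b : R) : 0 <= b -> rcont u ->
  (forall t, 0 <= t <= b -> rd U t (u t)) -> cint u b = U b - U 0.
Proof.
move=> b0 cu h.
have /eqP : prim u b - U b = prim u 0 - U 0.
  apply: (@rd_cst _ (fun t => prim u t - U t) 0 b b0) => t tb.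
  rewrite -[0](subrr (u t)); apply: gdB; last exact: h.
  by apply: primP => //; case/andP: tb => t0 _; rewrite (lt_le_trans _ t0) // ltrN10.
by rewrite /cint subr_eq => /eqP ->; ring.
Qed.

Lemma rd_prim (u : R -> C) t : rcont u -> 0 <= t -> rd (prim u) t (u t).
Proof. by move=> cu t0; apply: primP => //; rewrite (lt_le_trans _ t0) // ltrN10. Qed.

Lemma cint_bound (u : R -> C) (b M : R) : 0 <= b -> rcont u ->
  (forall t, 0 <= t <= b -> nrm (u t) <= M) -> nrm (cint u b) <= 2 * M * b.
Proof.
move=> b0 cu hM; rewrite -[in leRHS](subr0 b).
by apply: (rd_mvi b0 _ hM) => t /andP[t0 _]; exact: rd_prim.
Qed.

Lemma cintD (u v : R -> C) (b : R) : 0 <= b -> rcont u -> rcont v ->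
  cint (fun t => u t + v t) b = cint u b + cint v b.
Proof.
move=> b0 cu cv; rewrite (@cintE _ (fun t => prim u t + prim v t)).
- by rewrite /cint; ring.
- exact: b0.
- by move=> t; apply: gcD; [exact: cu | exact: cv].
- by move=> t /andP[t0 _]; apply: gdD; exact: rd_prim.
Qed.

Lemma cintZ (c : C) (u : R -> C) (b : R) : 0 <= b -> rcont u ->
  cint (fun t => c * u t) b = c * cint u b.
Proof.
move=> b0 cu; rewrite (@cintE _ (fun t => c * prim u t)).
- by rewrite /cint mulrBr.
- exact: b0.
- by move=> t; apply: gcZ; exact: cu.
- by move=> t /andP[t0 _]; apply: gdZ; exact: rd_prim.
Qed.

Lemma cint_eq (u v : R -> C) (b : R) : 0 <= b -> rcont u -> rcont v ->
  (forall t, 0 <= t <= b -> u t = v t) -> cint u b = cint v b.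
Proof.
move=> b0 cu cv e; apply: cintE => // t tb; rewrite e //.
by apply: rd_prim => //; case/andP: tb.
Qed.

(* Clamping the parameter makes curves continuous on the whole real line, where
   continuous functions have antiderivatives. *)
Definition clamp (t : R) : R := if t < 0 then 0 else if 1 < t then 1 else t.

Lemma clamp_id t : 0 <= t <= 1 -> clamp t = t.
Proof. by move=> /andP[t0 t1]; rewrite /clamp ltNge t0 ltNge t1. Qed.

Lemma clamp01 t : 0 <= clamp t <= 1.
Proof.
rewrite /clamp; case: (ltP t 0) => [_|t0]; first by rewrite lexx ler01.
by case: (ltP 1 t) => [_|t1]; [rewrite ler01 lexx | rewrite t0 t1].
Qed.

Lemma clamp_lip s t : `|clamp s - clamp t| <= `|s - t|.
Proof.
have h1 := ler_norm (s - t); have h2 := ler_norm (t - s).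
rewrite [`|t - s|]distrC in h2; rewrite ler_norml /clamp.
case: (ltP s 0) => s0; case: (ltP t 0) => t0; try (case: (ltP 1 s) => s1);
  try (case: (ltP 1 t) => t1); apply/andP; split; lra.
Qed.

Lemma clamp_rcont : rcont (fun t : R => (clamp t)%:C).
Proof.
move=> t e e0; exists e => // s; rewrite -!rcB !nrm_real.
by apply: le_lt_trans; exact: clamp_lip.
Qed.

Definition seg (p q : C) (t : R) : C := p + (clamp t)%:C * (q - p).

Lemma seg_rcont p q : rcont (seg p q).
Proof.
move=> t; apply: gcD; first exact: gc_cst.
by apply: gcM; [exact: clamp_rcont | exact: gc_cst].
Qed.

Definition sint (f : C -> C) (p q : C) : C := cint (fun t => f (seg p q t) * (q - p)) 1.

Definition convexC (K : set C) := forall p q (t : R), K p -> K q -> 0 <= t <= 1 ->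
  K (p + t%:C * (q - p)).

Section Segment.
Variables (K : set C) (f : C -> C).
Hypothesis (Kcvx : convexC K) (fK : forall z, K z -> cc f z).

Lemma seg_comp_rcont p q : K p -> K q -> rcont (fun t => f (seg p q t)).
Proof.
move=> Kp Kq t; apply: gc_comp; last exact: seg_rcont.
by apply: fK; apply: Kcvx => //; exact: clamp01.
Qed.

Lemma sint_cont p q : K p -> K q -> rcont (fun t => f (seg p q t) * (q - p)).
Proof.
by move=> Kp Kq t; apply: gcM; [exact: seg_comp_rcont | exact: gc_cst].
Qed.

Lemma sintE p q (V : R -> C) : K p -> K q ->
  (forall t, 0 <= t <= 1 -> rd V t (f (p + t%:C * (q - p)) * (q - p))) ->
  sint f p q = V 1 - V 0.
Proof.
move=> Kp Kq h; apply: cintE; [exact: ler01 | exact: sint_cont |].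
by move=> t t01; rewrite /seg clamp_id //; exact: h.
Qed.

Lemma rd_affine (p q : C) (t : R) : rd (fun t => p + t%:C * q) t q.
Proof.
rewrite -[X in rd _ _ X]add0r; apply: gdD; first exact: gd_cst.
by have := gdM (gd_emb (fun t : R => t%:C) t) (gd_cst _ q t); rewrite mul1r mulr0 addr0.
Qed.

Lemma rd_real_affine (c d t : R) (V : R -> C) l : rd V (c + t * d) l ->
  rd (fun t => V (c + t * d)) t (l * d%:C).
Proof.
move=> hV e e0.
have [d0|d0] := eqVneq d 0.
  exists 1 => // s _; rewrite d0 !mulr0 mul0r !subrr nrm0 ?subr0 ?nrm0.
  by rewrite mulr_ge0 // ltW.
have d0' : 0 < `|d| by rewrite normr_gt0.
have [r r0 hr] := hV (e / `|d|) (divr_gt0 e0 d0').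
exists (r / `|d|); first exact: divr_gt0.
move=> s; rewrite -rmorphB nrm_real ltr_pdivlMr // => k.
have E : (c + s * d)%:C - (c + t * d)%:C = (s - t)%:C * d%:C.
  by rewrite -rmorphB -rmorphM; congr (_%:C); ring.
have := hr (c + s * d); rewrite E nrmM !nrm_real => /(_ k).
have -> : e / `|d| * (`|s - t| * `|d|) = e * `|s - t| by field; rewrite normr_eq0.
by congr (nrm _ <= _); ring.
Qed.

(** Every part of the segment is integrated with the one antiderivative taken along [[p, q]];
    subdivision and reversal of orientation then become telescoping. *)
Lemma sint_seg p q (s t : R) : K p -> K q -> 0 <= s <= 1 -> 0 <= t <= 1 ->
  sint f (p + s%:C * (q - p)) (p + t%:C * (q - p)) =
  prim (fun t => f (seg p q t) * (q - p)) t - prim (fun t => f (seg p q t) * (q - p)) s.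
Proof.
move=> Kp Kq s01 t01; set V := prim _.
rewrite (@sintE _ _ (fun x => V (s + x * (t - s)))); last 1 first.
- move=> x x01.
  have y01 : 0 <= s + x * (t - s) <= 1.
    by case/andP: s01 => ? ?; case/andP: t01 => ? ?; case/andP: x01 => ? ?; nra.
  have := @rd_real_affine s (t - s) x V _ (rd_prim (sint_cont Kp Kq) (proj1 (andP y01))).
  rewrite /seg clamp_id //.
  congr (rd _ _ _); rewrite -mulrA; congr (f _ * _); rewrite ?rcD ?rcM ?rcB; ring.
- by congr (V _ - V _); ring.
- exact: Kcvx.
- exact: Kcvx.
Qed.

Lemma sint_split p q (t : R) : K p -> K q -> 0 <= t <= 1 ->
  sint f p q = sint f p (p + t%:C * (q - p)) + sint f (p + t%:C * (q - p)) q.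
Proof.
move=> Kp Kq t01.
have E0 : p = p + 0%:C * (q - p) by rewrite mul0r addr0.
have E1 : q = p + 1%:C * (q - p) by rewrite mul1r addrC subrK.
have I0 : 0 <= (0:R) <= 1 by rewrite lexx ler01.
have I1 : 0 <= (1:R) <= 1 by rewrite lexx ler01.
have := sint_seg Kp Kq I0 I1; rewrite -E0 -E1 => ->.
have := sint_seg Kp Kq I0 t01; rewrite -E0 => ->.
have := sint_seg Kp Kq t01 I1; rewrite -E1 => ->.
ring.
Qed.

Lemma sint_sym p q : K p -> K q -> sint f q p = - sint f p q.
Proof.
move=> Kp Kq.
have E0 : p = p + 0%:C * (q - p) by rewrite mul0r addr0.
have E1 : q = p + 1%:C * (q - p) by rewrite mul1r addrC subrK.
have I0 : 0 <= (0:R) <= 1 by rewrite lexx ler01.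
have I1 : 0 <= (1:R) <= 1 by rewrite lexx ler01.
have := sint_seg Kp Kq I0 I1; rewrite -E0 -E1 => ->.
have := sint_seg Kp Kq I1 I0; rewrite -E0 -E1 => ->.
by rewrite opprB.
Qed.

Lemma sint_bound p q M : K p -> K q ->
  (forall t, 0 <= t <= 1 -> nrm (f (p + t%:C * (q - p))) <= M) ->
  nrm (sint f p q) <= 2 * M * nrm (q - p).
Proof.
move=> Kp Kq hM; rewrite -mulrA -[leRHS]mulr1.
apply: le_trans (_ : 2 * (M * nrm (q - p)) * 1 <= _) => //.
apply: cint_bound; [exact: ler01 | exact: sint_cont |].
move=> t t01; rewrite /seg clamp_id // nrmM ler_wpM2r //; exact: hM.
Qed.

(* Goursat's subtraction of the affine part of [f] at [w]. *)
Lemma sint_affine p q (c l w : C) : K p -> K q ->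
  sint f p q = sint (fun z => f z - c - l * (z - w)) p q +
    (c * (q - p) + l * ((q - w) ^+ 2 - (p - w) ^+ 2) / 2).
Proof.
move=> Kp Kq; rewrite (@sintE _ _ (fun t =>
  prim (fun t => (f (seg p q t) - c - l * (seg p q t - w)) * (q - p)) t +
  (c * (t%:C * (q - p)) + l * ((p + t%:C * (q - p) - w) ^+ 2) / 2))) //.
  rewrite /sint /cint mul0r addr0 mul1r [p + (q - p)]addrC subrK; ring.
move=> t t01.
have -> : f (p + t%:C * (q - p)) * (q - p) =
  (f (seg p q t) - c - l * (seg p q t - w)) * (q - p) +
  (c * (q - p) + l * ((q - p) * (p + t%:C * (q - p) - w) +
     (p + t%:C * (q - p) - w) * (q - p)) / 2).
  by rewrite /seg clamp_id //; field.
apply: gdD.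
  apply: rd_prim; last by case/andP: t01.
  move=> s; apply: gcM; last exact: gc_cst.
  apply: gcB; first by apply: gcB; [exact: seg_comp_rcont | exact: gc_cst].
  by apply: gcZ; apply: gcB; [exact: seg_rcont | exact: gc_cst].
have A := rd_affine 0 (q - p) t; have B := rd_affine (p - w) (q - p) t.
apply: gdD.
  by apply: gdZ; apply: gd_near A; exists 1 => // s _; rewrite add0r.
apply: (@gd_near _ _ _ (fun t => (l * ((p - w + t%:C * (q - p)) * (p - w + t%:C * (q - p)))) / 2)).
  by exists 1 => // s _; rewrite expr2; congr (_ * (_ * _) / _); ring.
have := gdM (gdZ l (gdM B B)) (gd_cst _ (2^-1) t); rewrite mulr0 addr0.
by congr (gd _ _ _ (l * _ * _)); ring.
Qed.

End Segment.

Lemma pow2_small (x y : R) : 0 < x -> exists n, y / 2 ^+ n < x.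
Proof.
move=> x0; pose n := Num.truncn (y / x).
have h : y / x < n.+1%:R by rewrite truncnS_gt.
exists n.+1; rewrite ltr_pdivrMr ?exprn_gt0 //.
rewrite ltr_pdivrMr // in h; apply: lt_le_trans h _.
by rewrite mulrC ler_pM2l // -natrX ler_nat ltnW // ltn_expl.
Qed.

(** The margin [2 * D / 2 ^+ n] is the sum of all later steps, so the intervals of this radius
    around [x n] are nested; the supremum of their left ends lies in all of them. *)
Lemma geometric_cvgR (x : nat -> R) (D : R) :
  (forall n, `|x n.+1 - x n| <= D / 2 ^+ n) ->
  exists l, forall n, `|x n - l| <= 2 * D / 2 ^+ n.
Proof.
move=> h; pose y n := x n - 2 * D / 2 ^+ n; pose z n := x n + 2 * D / 2 ^+ n.
have E n : 2 * D / 2 ^+ n = D / 2 ^+ n + 2 * D / 2 ^+ n.+1.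
  by rewrite exprS; field; rewrite expf_neq0.
have y1 n : y n <= y n.+1.
  by rewrite /y E; have := h n; rewrite ler_norml => /andP[? ?]; lra.
have z1 n : z n.+1 <= z n.
  by rewrite /z (E n); have := h n; rewrite ler_norml => /andP[? ?]; lra.
have D0 : 0 <= D by have := h 0%N; rewrite expr0 divr1; exact: le_trans.
have yz0 n : y n <= z n.
  have : 0 <= 2 * D / 2 ^+ n by rewrite divr_ge0 ?mulr_ge0 ?exprn_ge0.
  by rewrite /y /z => ?; lra.
have ym : {homo y : m n / (m <= n)%N >-> m <= n} by apply: homo_leq => //; exact: le_trans.
have zm m n : (m <= n)%N -> z n <= z m.
  by move=> /subnKC <-; elim: (n - m)%N => [|k IH]; rewrite ?addn0 // addnS (le_trans (z1 _)).
have yz m n : y m <= z n.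
  have [mn|nm] := leqP m n; first exact: le_trans (ym _ _ mn) (yz0 n).
  exact: le_trans (yz0 m) (zm _ _ (ltnW nm)).
pose l := sup (range y).
have ub m : ubound (range y) (z m) by move=> _ [k _ <-]; exact: yz.
have hs : has_sup (range y) by split; [exists (y 0%N), 0%N | exists (z 0%N)].
exists l => n; rewrite ler_norml; apply/andP; split.
- have : l <= z n by apply: ge_sup; [exists (y 0%N), 0%N | exact: ub].
  by rewrite /z => ?; lra.
- have : y n <= l by apply: ub_le_sup; [exists (z 0%N) | exists n].
  by rewrite /y => ?; lra.
Qed.

Lemma geometric_cvgC (x : nat -> C) (D : R) :
  (forall n, nrm (x n.+1 - x n) <= D / 2 ^+ n) ->
  exists l, forall n, nrm (x n - l) <= 4 * D / 2 ^+ n.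
Proof.
move=> h.
have [p hp] : exists p, forall n, `|Re (x n) - p| <= 2 * D / 2 ^+ n.
  by apply: geometric_cvgR => n; rewrite -cReN -cReD (le_trans (Re_le_nrm _)).
have [q hq] : exists q, forall n, `|Im (x n) - q| <= 2 * D / 2 ^+ n.
  by apply: geometric_cvgR => n; rewrite -cImN -cImD (le_trans (Im_le_nrm _)).
exists (p +i* q) => n; apply: le_trans (nrm_le_ReIm _) _.
rewrite cReD cImD cReN cImN /=; have := hp n; have := hq n; rewrite -!mulrA; lra.
Qed.

Definition closedC (K : set C) :=
  forall z, (forall e : R, 0 < e -> exists2 w, K w & nrm (w - z) < e) -> K z.

Section Goursat.
Variables (K : set C) (f : C -> C).
Hypothesis (Kcvx : convexC K) (Kcl : closedC K)
  (fK : forall z, K z -> exists l, cd f z l).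

Let fKc z : K z -> cc f z.
Proof. by case/fK => l; exact: gd_gc. Qed.

Definition tri (T : C * C * C) : C :=
  let: (a, b, c) := T in sint f a b + sint f b c + sint f c a.
Definition per (T : C * C * C) : R :=
  let: (a, b, c) := T in nrm (b - a) + nrm (c - b) + nrm (a - c).
Definition inK (T : C * C * C) := let: (a, b, c) := T in [/\ K a, K b & K c].

Let mid (p q : C) : C := p + (2^-1)%:C * (q - p).

Let half01 : 0 <= (2^-1 : R) <= 1.
Proof. by rewrite invr_ge0 ler0n invf_le1 // ler1n. Qed.

Let half : (2^-1)%:C = 2^-1 :> C.
Proof. by rewrite rcV (rmorph_nat (real_complex R)). Qed.

Let nrm_half (z : C) : nrm (2^-1 * z) = nrm z / 2.
Proof. by rewrite nrmM nrmV nrm_nat mulrC. Qed.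

Let sum4_le (x y z w : R) : [\/ x + y + z + w <= 4 * x, x + y + z + w <= 4 * y,
  x + y + z + w <= 4 * z | x + y + z + w <= 4 * w].
Proof.
have [?|?] := lerP x y; have [?|?] := lerP z w.
- by have [?|?] := lerP y w; [apply: Or44 | apply: Or42]; lra.
- by have [?|?] := lerP y z; [apply: Or43 | apply: Or42]; lra.
- by have [?|?] := lerP x w; [apply: Or44 | apply: Or41]; lra.
- by have [?|?] := lerP x z; [apply: Or43 | apply: Or41]; lra.
Qed.

Let avg (x y z : R) : [/\ x / 2 + y / 2 + z / 2 <= (x + y + z) / 2,
  y / 2 + z / 2 + x / 2 <= (x + y + z) / 2 & z / 2 + x / 2 + y / 2 <= (x + y + z) / 2].
Proof. by split; lra. Qed.

Let avg1 (x y z w : R) : 0 <= x -> 0 <= y -> 0 <= z ->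
  [/\ 0 <= x + y + z, x / 2 <= x + y + z & (w <= x + y / 2 -> w <= x + y + z)].
Proof. by move=> x0 y0 z0; split => *; lra. Qed.

(** The midpoints cut the triangle into four; the integrals over inner sides cancel, so one of the
    four carries at least a quarter. The bound on the first vertex makes the successive triangles
    converge to a point. *)
Lemma goursat_step T : inK T -> exists T', [/\ inK T', per T' <= per T / 2,
  nrm (T'.1.1 - T.1.1) <= per T & nrm (tri T) <= 4 * nrm (tri T')].
Proof.
case: T => [[a b] c] [Ka Kb Kc] /=.
pose m := mid a b; pose q := mid b c; pose p := mid c a.
have Km : K m by exact: Kcvx. have Kq : K q by exact: Kcvx.
have Kp : K p by exact: Kcvx.
have E : sint f a b + sint f b c + sint f c a =
  tri (a, m, p) + tri (m, b, q) + tri (q, c, p) + tri (m, q, p).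
  rewrite /tri (sint_split Kcvx fKc Ka Kb half01) -/(mid a b) -/m.
  rewrite (sint_split Kcvx fKc Kb Kc half01) -/(mid b c) -/q.
  rewrite (sint_split Kcvx fKc Kc Ka half01) -/(mid c a) -/p.
  rewrite (sint_sym Kcvx fKc Kp Km) (sint_sym Kcvx fKc Km Kq) (sint_sym Kcvx fKc Kq Kp).
  ring.
have n1 := nrm_ge0 (b - a); have n2 := nrm_ge0 (c - b); have n3 := nrm_ge0 (a - c).
have ma : nrm (m - a) = nrm (b - a) / 2.
  by rewrite /m /mid half -nrm_half; congr nrm; field.
have bm : nrm (b - m) = nrm (b - a) / 2.
  by rewrite /m /mid half -nrm_half; congr nrm; field.
have qb : nrm (q - b) = nrm (c - b) / 2.
  by rewrite /q /mid half -nrm_half; congr nrm; field.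
have cq : nrm (c - q) = nrm (c - b) / 2.
  by rewrite /q /mid half -nrm_half; congr nrm; field.
have pc : nrm (p - c) = nrm (a - c) / 2.
  by rewrite /p /mid half -nrm_half; congr nrm; field.
have ap : nrm (a - p) = nrm (a - c) / 2.
  by rewrite /p /mid half -nrm_half; congr nrm; field.
have pm : nrm (p - m) = nrm (c - b) / 2.
  by rewrite /p /m /mid half -nrm_half; congr nrm; field.
have mq : nrm (q - m) = nrm (a - c) / 2.
  by rewrite nrmB /q /m /mid half -nrm_half; congr nrm; field.
have qp : nrm (p - q) = nrm (b - a) / 2.
  by rewrite nrmB /q /p /mid half -nrm_half; congr nrm; field.
have aa : nrm (a - a) = 0 by rewrite subrr nrm0.
have qa : nrm (q - a) <= nrm (b - a) + nrm (c - b) / 2.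
  by apply: le_trans (nrm_tri _ b _) _; rewrite qb addrC.
have [v1 v2 v3] := avg (nrm (b - a)) (nrm (c - b)) (nrm (a - c)).
have [w1 w2 w3] := avg1 (nrm (q - a)) n1 n2 n3.
rewrite E; set t1 := tri (a, m, p); set t2 := tri (m, b, q).
set t3 := tri (q, c, p); set t4 := tri (m, q, p).
have S : nrm (t1 + t2 + t3 + t4) <= nrm t1 + nrm t2 + nrm t3 + nrm t4.
  apply: le_trans (nrmD _ _) _; rewrite lerD2r.
  by apply: le_trans (nrmD _ _) _; rewrite lerD2r nrmD.
have [h|h|h|h] := sum4_le (nrm t1) (nrm t2) (nrm t3) (nrm t4).
- exists (a, m, p); split => //=; last exact: le_trans h.
  + by rewrite ma pm ap.
  + by rewrite aa.
- exists (m, b, q); split => //=; last exact: le_trans h.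
  + by rewrite bm qb (nrmB m q) mq.
  + by rewrite ma.
- exists (q, c, p); split => //=; last exact: le_trans h.
  + by rewrite cq pc (nrmB q p) qp.
  + exact: w3.
- exists (m, q, p); split => //=; last exact: le_trans h.
  + by rewrite mq qp (nrmB m p) pm.
  + by rewrite ma.
Qed.

Lemma goursat T0 : inK T0 -> tri T0 = 0.
Proof.
move=> K0.
have /choice[nx hnx] : forall T, exists T', inK T -> [/\ inK T', per T' <= per T / 2,
  nrm (T'.1.1 - T.1.1) <= per T & nrm (tri T) <= 4 * nrm (tri T')].
  by move=> T; have [/goursat_step[T' h]|h] := pselect (inK T); [exists T' | exists T].
pose t n := iter n nx T0; pose P := per T0.
have KT n : inK (t n) by elim: n => //= n /hnx[].
have perT n : per (t n) <= P / 2 ^+ n.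
  elim: n => [|n IH]; first by rewrite expr0 divr1.
  have [_ h _ _] := hnx _ (KT n); apply: le_trans h _.
  by rewrite exprSr invfM mulrA ler_wpM2r // invr_ge0.
have triT n : nrm (tri T0) <= 4 ^+ n * nrm (tri (t n)).
  elim: n => [|n IH]; first by rewrite expr0 mul1r.
  have [_ _ _ h] := hnx _ (KT n); apply: le_trans IH _.
  by rewrite exprSr -mulrA ler_pM2l // exprn_gt0.
have [z hz] := @geometric_cvgC (fun n => (t n).1.1) P (fun n =>
  let: And4 _ _ h _ := hnx _ (KT n) in le_trans h (perT n)).
have P0 : 0 <= P by rewrite /P; case: (T0) => [[a b] c]; rewrite /per !addr_ge0.
have Kz : K z.
  apply: Kcl => e e0; have [n hn] := @pow2_small e (4 * P) e0.
  exists (t n).1.1; last exact: le_lt_trans hn.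
  by move: (KT n); case: (t n) => [[a b] c] [].
have [l fl] := fK Kz.
have key (e : R) : 0 < e -> nrm (tri T0) <= e.
  move=> e0.
  (* The error on the small triangle is [2 * (eps * 6 u) * u] with [u = P / 2 ^+ n]; times [4 ^+ n]
     it equals [eps * 12 P^2]. *)
  have Q0 : 0 < 12 * P * P + 1 by rewrite ltr_wpDl // !mulr_ge0.
  have [d d0 hd] := fl _ (divr_gt0 e0 Q0).
  (* The limit [z] is within [4 u] of the first vertex and the perimeter is at most [u], so the
     whole boundary lies within [6 u] of [z]. *)
  have [n hn] := @pow2_small d (6 * P) d0.
  apply: le_trans (triT n) _.
  have := hz n; have := perT n; have := KT n; case: (t n) => [[a b] c] /=.
  move=> [Ka Kb Kc] hper ha.
  set u := P / 2 ^+ n in hper.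
  have ha' : nrm (a - z) <= 4 * u by rewrite /u mulrA.
  have hn' : 6 * u < d by rewrite /u mulrA.
  have u0 : 0 <= u by rewrite divr_ge0 // exprn_ge0.
  have n1 := nrm_ge0 (b - a); have n2 := nrm_ge0 (c - b); have n3 := nrm_ge0 (a - c).
  set eps := e / _ in hd; have eps0 : 0 < eps by rewrite divr_gt0.
  have near w : nrm (w - z) <= 6 * u -> nrm (f w - f z - l * (w - z)) <= eps * (6 * u).
    move=> h; apply: le_trans (hd w (le_lt_trans h hn')) _.
    by rewrite ler_pM2l.
  have side p q : K p -> K q -> nrm (p - z) + nrm (q - p) <= 6 * u ->
    nrm (sint (fun w => f w - f z - l * (w - z)) p q) <= 2 * (eps * (6 * u)) * nrm (q - p).
    move=> Kp Kq h; apply: (sint_bound Kcvx) => //.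
      move=> w /fKc fw; apply: gcB; first by apply: gcB => //; exact: gc_cst.
      by apply: gcZ; apply: gcB; [exact: gc_emb | exact: gc_cst].
    move=> s /andP[s0 s1]; apply: near; apply: le_trans h.
    have -> : p + s%:C * (q - p) - z = (p - z) + s%:C * (q - p) by ring.
    apply: le_trans (nrmD _ _) _; rewrite lerD2l nrmM nrm_real ger0_norm //.
    by rewrite ler_piMl.
  have pz : nrm (b - z) <= nrm (b - a) + nrm (a - z) by exact: nrm_tri.
  have qz : nrm (c - z) <= nrm (a - c) + nrm (a - z) by rewrite (nrmB a c) nrm_tri.
  have := side _ _ Ka Kb; have := side _ _ Kb Kc; have := side _ _ Kc Ka.
  move=> /(_ ltac:(lra)) s3 /(_ ltac:(lra)) s2 /(_ ltac:(lra)) s1.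
  have -> : sint f a b + sint f b c + sint f c a = sint (fun w => f w - f z - l * (w - z)) a b +
     sint (fun w => f w - f z - l * (w - z)) b c + sint (fun w => f w - f z - l * (w - z)) c a.
    rewrite (sint_affine Kcvx fKc (f z) l z Ka Kb).
    rewrite (sint_affine Kcvx fKc (f z) l z Kb Kc) (sint_affine Kcvx fKc (f z) l z Kc Ka).
    by field.
  apply: le_trans (_ : 4 ^+ n * (2 * (eps * (6 * u)) * u) <= _).
    rewrite ler_pM2l ?exprn_gt0 //; apply: le_trans (nrmD _ _) _.
    apply: le_trans (lerD (nrmD _ _) (lexx _)) _.
    apply: le_trans (lerD (lerD s1 s2) s3) _.
    have eps1 := ltW eps0.
    by rewrite -mulrDr -mulrDr; apply: ler_wpM2l => //; do 3 (apply: mulr_ge0 => //).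
  have -> : 4 ^+ n * (2 * (eps * (6 * u)) * u) = eps * (12 * P * P).
    have -> : (4 : R) ^+ n = 2 ^+ n * 2 ^+ n by rewrite -exprMn -natrM.
    by rewrite /u; field; rewrite expf_neq0.
  rewrite /eps -mulrA ler_piMr ?(ltW e0) // mulrC ler_pdivrMr // mul1r.
  by rewrite lerDl.
apply/eqP; rewrite -nrm_eq0 eq_le nrm_ge0 andbT; apply/ler_addgt0Pl => e e0.
by rewrite addr0 key.
Qed.

(** Goursat's lemma for the triangle [(c, z, w)] turns the increment into the integral over
    [[z, w]], from which [sint_affine] with slope [0] splits off [f z * (w - z)]. *)
Lemma cd_sint (c z : C) : K c -> (exists2 d : R, 0 < d & forall w, nrm (w - z) < d -> K w) ->
  cd (sint f c) z (f z).
Proof.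
move=> Kc [d d0 hd] e e0.
have Kz : K z by apply: hd; rewrite subrr nrm0.
have e2 : 0 < e / 2 by rewrite divr_gt0.
have [d' d'0 hd'] := fKc Kz e2.
exists (Num.min d d'); first by rewrite lt_min d0.
move=> w; rewrite lt_min => /andP[wd wd'].
have Kw := hd _ wd.
have /= := @goursat (c, z, w) ltac:(by split).
move=> /eqP; rewrite (sint_sym Kcvx fKc Kc Kw) subr_eq0 => /eqP E.
have -> : sint f c w - sint f c z - f z * (w - z) =
   sint (fun x => f x - f z - 0 * (x - z)) z w.
  rewrite -E (sint_affine Kcvx fKc (f z) 0 z Kz Kw); ring.
have -> : e * nrm (w - z) = 2 * (e / 2) * nrm (w - z) by field.
apply: (sint_bound Kcvx) => //.
  move=> x /fKc fx; apply: gcB; first by apply: gcB => //; exact: gc_cst.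
  by apply: gcZ; apply: gcB; [exact: gc_emb | exact: gc_cst].
move=> t /andP[t0 t1]; rewrite mul0r subr0; apply/ltW/hd'.
rewrite [z + _]addrC addrK nrmM nrm_real ger0_norm //.
by apply: le_lt_trans wd'; rewrite ler_piMl.
Qed.

End Goursat.
End Integral.

(** * Circle means and Cauchy's formula *)

Section CircleMean.
Context {R : realType}.
Local Notation C := R[i].

Definition cis (t : R) : C := cos t +i* sin t.
Definition cexp (z : C) : C := (expR (Re z))%:C * cis (Im z).
Definition circ (r t : R) : C := r%:C * cis t.

Lemma nrm_cis t : nrm (cis t) = 1.
Proof. by rewrite nrm_sqrt /= cos2Dsin2 sqrtr1. Qed.

Lemma nrm_circ r t : 0 <= r -> nrm (circ r t) = r.
Proof. by move=> r0; rewrite nrmM nrm_cis mulr1 nrm_real ger0_norm. Qed.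

Lemma nrm_cexp z : nrm (cexp z) = expR (Re z).
Proof. by rewrite nrmM nrm_cis mulr1 nrm_real ger0_norm ?expR_ge0. Qed.

Lemma cisD s t : cis (s + t) = cis s * cis t.
Proof.
apply: complex_ext; rewrite ?cReM ?cImM /= ?cosD ?sinD //.
by rewrite [LHS]addrC.
Qed.

Lemma cexpD z w : cexp (z + w) = cexp z * cexp w.
Proof.
rewrite /cexp cReD cImD expRD cisD rcM; ring.
Qed.

Lemma cis2pi t : cis (t + 2 * pi) = cis t.
Proof. by rewrite /cis mulr_natl cosD2pi sinD2pi. Qed.

Lemma cis0 : cis 0 = 1.
Proof. by apply: complex_ext; rewrite /= ?cos0 ?sin0. Qed.

Lemma rd_cis t : rd cis t ('i * cis t).
Proof.
apply/rdP; split; rewrite ?cReM ?cImM /= ?mul0r ?mul1r ?add0r ?sub0r.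
- exact: is_derive_cos.
- exact: is_derive_sin.
Qed.

Lemma circ_cexp s t : circ (expR s) t = cexp (s%:C + 'i * t%:C).
Proof.
by rewrite /circ /cexp cReD cImD cReM cImM /= !mul0r !mul1r subrr !add0r addr0.
Qed.

Lemma cd_cexp0 : cd cexp 0 1.
Proof.
move=> e e0.
have e4 : 0 < e / 8 by rewrite divr_gt0.
have [d1 d10 h1] := (is_deriveRP _ _ _).1 (@is_derive_expR R 0) _ e4.
have [d2 d20 h2] := rd_cis 0 e4.
exists (Num.min (Num.min 1 (e / 2)) (Num.min d1 d2)).
  by rewrite !lt_min ltr01 divr_gt0 ?d10.
move=> h; rewrite !lt_min !subr0 => /andP[/andP[k0 k1] /andP[k2 k3]].
have X := Re_le_nrm h; have Y := Im_le_nrm h.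
set x := Re h in X *; set y := Im h in Y *; set H := nrm h in k0 k1 k2 k3 X Y *.
have hx := h1 x; rewrite !subr0 expR0 mul1r in hx.
have {}hx := hx (le_lt_trans X k2).
have hy := h2 y; rewrite -rcB subr0 nrm_real cis0 mulr1 in hy.
have {}hy := hy (le_lt_trans Y k3).
have -> : cexp h - cexp 0 - 1 * h = (expR x - 1 - x)%:C * cis y +
  ((1 + x)%:C * (cis y - 1 - 'i * y%:C) + (x * y)%:C * 'i).
  rewrite /cexp /= expR0 cis0 mul1r [X in _ - _ - X](_ : _ = x%:C + 'i * y%:C); last first.
    by rewrite -complexE.
  rewrite !rcB rcD rcM -/x -/y; ring.
apply: le_trans (nrmD _ _) _; rewrite nrmM nrm_cis mulr1 nrm_real.
have n3 : nrm ((1 + x)%:C * (cis y - 1 - 'i * y%:C)) <= 2 * (e / 8 * H).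
  rewrite nrmM nrm_real; apply: ler_pM => //.
    apply: le_trans (ler_normD _ _) _; rewrite normr1.
    by have := le_trans X (ltW k0) => ?; lra.
  by apply: le_trans hy _; rewrite ler_pM2l.
have n4 : nrm ((x * y)%:C * 'i) <= e / 2 * H.
  rewrite nrmM nrm_real normrM [nrm 'i](_ : _ = 1); last first.
    by rewrite nrm_sqrt /= expr0n expr1n add0r sqrtr1.
  by rewrite mulr1; apply: ler_pM => //; apply: le_trans X (ltW k1).
have n5 := nrmD ((1 + x)%:C * (cis y - 1 - 'i * y%:C)) ((x * y)%:C * 'i).
have n6 : `|expR x - 1 - x| <= e / 8 * H by apply: le_trans hx _; rewrite ler_pM2l.
have H0 : 0 <= H by exact: nrm_ge0.
have : 0 <= e * H by rewrite mulr_ge0 // ltW.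
move: n3 n4 n5 n6; set u := nrm _; set v := nrm _; set w := nrm _; set q := `|_|.
by rewrite !mulrA; nra.
Qed.

Lemma cd_cexp z : cd cexp z (cexp z).
Proof.
have A : cd (fun w => w - z) z 1 by rewrite -[1]subr0; apply: gdB; [exact: gd_emb | exact: gd_cst].
have B : cd cexp (z - z) 1 by rewrite subrr; exact: cd_cexp0.
have := gdZ (cexp z) (gd_comp (i := fun z => z) (u := fun w => w - z) B A).
rewrite !mulr1; apply: gd_near; exists 1 => // w _ /=.
by rewrite -cexpD addrC subrK.
Qed.

Definition con (r : R) (f : C -> C) := rcont (fun t => f (circ r t)).

Lemma rcont_circ r : rcont (circ r).
Proof. by move=> t; apply: gcZ; exact: gd_gc (rd_cis t). Qed.

Lemma conI r f : 0 <= r -> (forall z, nrm z = r -> cc f z) -> con r f.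
Proof.
move=> r0 h t; apply: gc_comp; last exact: rcont_circ.
by apply: h; rewrite nrm_circ.
Qed.

Let twopi : 0 <= 2 * pi :> R.
Proof. by rewrite mulr_ge0 // pi_ge0. Qed.

Let twopi_neq0 : (2 * pi : R) != 0.
Proof. by rewrite mulf_neq0 ?pnatr_eq0 // gt_eqF // pi_gt0. Qed.

Definition cmean (f : C -> C) (r : R) : C :=
  ((2 * pi)^-1)%:C * cint (fun t => f (circ r t)) (2 * pi).

Lemma cmeanD f g r : con r f -> con r g ->
  cmean (fun z => f z + g z) r = cmean f r + cmean g r.
Proof. by move=> cf cg; rewrite /cmean cintD // mulrDr. Qed.

Lemma cmeanZ c f r : con r f -> cmean (fun z => c * f z) r = c * cmean f r.
Proof. by move=> cf; rewrite /cmean cintZ // mulrCA. Qed.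

Lemma conD r f g : con r f -> con r g -> con r (fun z => f z + g z).
Proof. by move=> cf cg t; apply: gcD; [exact: cf | exact: cg]. Qed.

Lemma conN r f : con r f -> con r (fun z => - f z).
Proof. by move=> cf t; apply: gcN; exact: cf. Qed.

Lemma conM r f g : con r f -> con r g -> con r (fun z => f z * g z).
Proof. by move=> cf cg t; apply: gcM; [exact: cf | exact: cg]. Qed.

Lemma con_cst r c : con r (fun=> c).
Proof. by move=> t; exact: gc_cst. Qed.

Lemma con_id r : con r id.
Proof. exact: rcont_circ. Qed.

Lemma conV r f : 0 <= r -> con r f -> (forall z, nrm z = r -> f z != 0) ->
  con r (fun z => (f z)^-1).
Proof.
move=> r0 cf h t; apply: gcV; last exact: cf.
by apply: h; rewrite nrm_circ.
Qed.

Lemma cmean_eq f g r : 0 <= r -> con r f -> con r g ->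
  (forall z, nrm z = r -> f z = g z) -> cmean f r = cmean g r.
Proof.
move=> r0 cf cg h; congr (_ * _); apply: cint_eq => // t _.
by apply: h; rewrite nrm_circ.
Qed.

Lemma cmean_cst c r : cmean (fun=> c) r = c.
Proof.
rewrite /cmean (@cintE _ _ (fun t => c * t%:C)) //.
- by rewrite mulr0 subr0 mulrCA -rcM mulVf // mulr1.
- by move=> t; exact: gc_cst.
- move=> t _; have := gdZ c (gd_emb (fun t : R => t%:C) t); by rewrite mulr1.
Qed.

Lemma cmean_bound f r M : 0 <= r -> con r f ->
  (forall t, 0 <= t <= 2 * pi -> nrm (f (circ r t)) <= M) -> nrm (cmean f r) <= 2 * M.
Proof.
move=> r0 cf h; rewrite /cmean nrmM nrm_real ger0_norm ?invr_ge0 // mulrC.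
by rewrite ler_pdivrMr ?lt_def ?twopi_neq0 //; apply: cint_bound.
Qed.

Lemma cmeanB f g r : con r f -> con r g ->
  cmean (fun z => f z - g z) r = cmean f r - cmean g r.
Proof.
move=> cf cg; have -> : (fun z => f z - g z) = (fun z => f z + - 1 * g z).
  by apply/funext => z; rewrite mulN1r.
rewrite cmeanD; [by rewrite cmeanZ // mulN1r | exact: cf |].
by apply: conM; [exact: con_cst | exact: cg].
Qed.

Definition hol_on (D : C -> Prop) (f : C -> C) := forall z, D z -> exists l, cd f z l.

Lemma hol_on_cc D f z : hol_on D f -> D z -> cc f z.
Proof. by move=> h /h[l]; exact: gd_gc. Qed.

Lemma circ_ln r t : 0 < r -> circ r t = cexp ((ln r)%:C + 'i * t%:C).
Proof. by move=> r0; rewrite -circ_cexp lnK. Qed.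

(** In the coordinate [log z] the annulus becomes a convex strip, on which [f \o cexp] has a
    primitive [L]. The mean over radius [x] is an increment of [L] over the period [2 pi i] starting
    at [ln x]; its derivative in [ln x] vanishes by periodicity. *)
Lemma cmean_annulus f (r1 r2 r r' : R) : 0 <= r1 ->
  hol_on (fun z => r1 < nrm z < r2) f -> r1 < r -> r <= r' -> r' < r2 ->
  cmean f r = cmean f r'.
Proof.
move=> r10 hf r1r rr' r'r2.
have r0 : 0 < r by exact: le_lt_trans r1r.
have r'0 : 0 < r' by exact: lt_le_trans rr'.
(* [cd_sint] wants a closed convex set, so the strip is closed and lies over a slightly smaller
   annulus. *)
pose a := (r1 + r) / 2; pose b := (r' + r2) / 2.
have ar : a < r by rewrite /a; lra.
have ra : r1 < a by rewrite /a; lra.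
have br : r' < b by rewrite /b; lra.
have rb : b < r2 by rewrite /b; lra.
have a0 : 0 < a by exact: le_lt_trans ra.
have b0 : 0 < b by exact: lt_trans br.
pose K := [set w : C | ln a <= Re w <= ln b].
have Kcvx : convexC K.
  move=> p q t /andP[p1 p2] /andP[q1 q2] /andP[t0 t1].
  rewrite /K /= cReD cReMr cReD cReN; apply/andP; split; nra.
have Kcl : closedC K.
  move=> z h; apply/andP; split; apply/ler_addgt0Pl => e /h[w /andP[w1 w2]];
    rewrite nrmB => /(le_lt_trans (Re_le_nrm _)); rewrite cReD cReN ltr_norml => /andP[? ?]; lra.
pose g := f \o cexp.
have gK z : K z -> exists l, cd g z l.
  move=> /andP[z1 z2]; have [|l hl] := hf (cexp z).
    rewrite nrm_cexp; apply/andP; split.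
    - by apply: lt_le_trans ra _; rewrite -[leLHS]lnK // ler_expR.
    - by apply: le_lt_trans rb; rewrite -[leRHS]lnK // ler_expR.
  by eexists; exact: gd_comp hl (cd_cexp z).
pose c : C := (ln a)%:C.
have lnr x : r <= x <= r' -> ln a < ln x < ln b.
  move=> /andP[x1 x2]; have x0 : 0 < x by exact: lt_le_trans x1.
  rewrite !ltr_ln // (lt_le_trans ar) // (le_lt_trans x2) //.
have Kc : K c.
  by rewrite /K /c /= lexx /= ler_ln // ltW // (lt_trans ar) // (le_lt_trans rr').
pose L := sint g c.
have dL w : ln a < Re w < ln b -> cd L w (g w).
  move=> /andP[w1 w2]; apply: (cd_sint Kcvx Kcl gK Kc).
  exists (Num.min (Re w - ln a) (ln b - Re w)); first by rewrite lt_min !subr_gt0 w1.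
  move=> z; rewrite lt_min => /andP[/(le_lt_trans (Re_le_nrm _)) h1 /(le_lt_trans (Re_le_nrm _)) h2].
  move: h1 h2; rewrite cReD cReN !ltr_norml => /andP[? ?] /andP[? ?].
  apply/andP; split; lra.
have cx x : r <= x <= r' -> con x f.
  move=> /andP[x1 x2]; have x0 : 0 < x by exact: lt_le_trans x1.
  apply: conI => [|z zx]; first exact: ltW.
  apply: (hol_on_cc hf); rewrite zx (lt_le_trans r1r) // (le_lt_trans x2) //.
have mE x : r <= x <= r' ->
  cint (fun t => f (circ x t)) (2 * pi) =
  - 'i * (L ((ln x)%:C + 'i * (2 * pi)%:C) - L (ln x)%:C).
  move=> hx; have x0 : 0 < x by case/andP: hx => x1 _; exact: lt_le_trans x1.
  rewrite (@cintE _ _ (fun t => - 'i * L ((ln x)%:C + 'i * t%:C))) //; last 2 first.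
  - exact: cx.
  - move=> t _.
    have A : rd (fun t => (ln x)%:C + 'i * t%:C) t 'i.
      rewrite -[X in rd _ _ X]add0r; apply: gdD; first exact: gd_cst.
      by have := gdZ 'i (gd_emb (fun t : R => t%:C) t); rewrite mulr1.
    have B : cd L ((ln x)%:C + 'i * t%:C) (g ((ln x)%:C + 'i * t%:C)).
      by apply: dL; rewrite cReD cReM /= !mul0r mul1r subrr addr0; exact: lnr.
    have := gdZ (- 'i) (gd_comp (u := fun t : R => (ln x)%:C + 'i * t%:C) B A); congr (gd _ _ _ _).
    rewrite circ_ln // /g /= mulrCA mulNr -expr2 sqr_i opprK mulr1 //.
  have -> : (ln x)%:C + 'i * 0%:C = (ln x)%:C by rewrite (_ : 0%:C = 0) // mulr0 addr0.
  by ring.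
rewrite /cmean !mE ?lexx ?rr' //; congr (_ * (_ * _)).
pose D (s : R) := L (s%:C + 'i * (2 * pi)%:C) - L s%:C.
apply/esym/(@rd_cst _ D (ln r) (ln r')); first by rewrite ler_ln.
move=> s /andP[s1 s2].
have sab : ln a < s < ln b.
  have /andP[h1 _] := lnr r (introT andP (conj (lexx r) rr')).
  have /andP[_ h2] := lnr r' (introT andP (conj rr' (lexx r'))).
  by rewrite (lt_le_trans h1) // (le_lt_trans s2).
have E : g (s%:C + 'i * (2 * pi)%:C) = g s%:C.
  rewrite /g /= /cexp !cReD !cImD !cReM !cImM /= !mul0r !mul1r subrr !addr0.
  by rewrite !add0r -[in RHS](cis2pi 0) add0r.
have -> : (0 : C) = g (s%:C + 'i * (2 * pi)%:C) * 1 - g s%:C * 1 by rewrite E subrr.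
apply: gdB.
- apply: (gd_comp (u := fun s : R => s%:C + 'i * (2 * pi)%:C)).
    by apply: dL; rewrite cReD cReM /= !mul0r mul1r subrr addr0.
  by rewrite -[X in gd _ _ _ X]addr0; apply: gdD; [exact: gd_emb | exact: gd_cst].
- by apply: (gd_comp (u := fun s : R => s%:C)); [exact: dL | exact: gd_emb].
Qed.

(** Compactness of [[0, 2 pi]] makes the tolerance on the radius uniform in the angle. *)
Lemma circle_near (f : C -> C) (r0 e : R) : 0 <= r0 -> 0 < e ->
  (forall z, nrm z = r0 -> cc f z) ->
  exists2 d : R, 0 < d & forall r t : R, `|r - r0| < d -> 0 <= t <= 2 * pi ->
    nrm (f (circ r t) - f (circ r0 t)) < e.
Proof.
move=> r00 e0 hf.
have cpt : compact (`[0, 2 * pi] : set R) by exact: segment_compact.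
have := (compact_near_coveringP _).1 cpt R (nbhs r0)
  (fun r t => nrm (f (circ r t) - f (circ r0 t)) < e) _.
case.
- move=> t tpi.
  have e2 : 0 < e / 2 by rewrite divr_gt0.
  have [d d0 hd] := hf (circ r0 t) (nrm_circ t r00) _ e2.
  have d2 : 0 < d / 2 by rewrite divr_gt0.
  have q0 : 0 < d / 2 / (r0 + 1) by rewrite divr_gt0 // ltr_wpDl.
  have [d1 d10 h1] := gd_gc (rd_cis t) q0.
  exists ([set t' : R | `|t' - t| < d1], [set r : R | `|r - r0| < d / 2]).
    by split; [apply: (nearRI d10) | apply: (nearRI d2)].
  move=> [t' r] /= [h2 h3].
  have h4 := h1 t'; rewrite -rcB nrm_real in h4; have {}h4 := h4 h2.
  have E0 : nrm (circ r0 t' - circ r0 t) < d / 2.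
    rewrite /circ -mulrBr nrmM nrm_real ger0_norm //.
    have r1 : 0 < r0 + 1 by rewrite ltr_wpDl.
    rewrite -(ltr_pM2l r1) in h4; apply: le_lt_trans (_ : (r0 + 1) * nrm (cis t' - cis t) < _).
      by rewrite ler_wpM2r // lerDl.
    by rewrite mulrCA mulfV ?gt_eqF // mulr1 in h4.
  have E1 : nrm (circ r t' - circ r0 t') < d / 2.
    by rewrite /circ -mulrBl -rcB nrmM nrm_cis mulr1 nrm_real.
  have E2 : nrm (circ r t' - circ r0 t) < d.
    by apply: le_lt_trans (nrm_tri _ (circ r0 t') _) _; rewrite [d]splitr ltrD.
  have k1 := hd _ E2.
  have k2 := hd _ (lt_trans E0 (ltac:(lra) : d / 2 < d)).
  apply: le_lt_trans (nrm_tri _ (f (circ r0 t)) _) _.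
  by rewrite [e]splitr; apply: ltrD => //; rewrite nrmB.
- move=> d /= d0 hd; exists d => // r t rd tpi.
  apply: (hd r) => /=; first by rewrite distrC.
  by rewrite /= in_itv.
Qed.

(** Carries a mean value across a circle on which [f] is only known to be continuous. *)
Lemma cmean_limit f (r0 : R) c : 0 <= r0 -> (forall z, nrm z = r0 -> cc f z) ->
  (forall d : R, 0 < d -> exists r : R, [/\ `|r - r0| < d, con r f & cmean f r = c]) ->
  cmean f r0 = c.
Proof.
move=> r00 hf h; apply/eqP; rewrite -subr_eq0 -nrm_eq0 eq_le nrm_ge0 andbT.
apply/ler_addgt0Pl => e e0; rewrite addr0.
have e2 : 0 < e / 2 by rewrite divr_gt0.
have [d d0 hd] := circle_near r00 e2 hf.
have [r [rr0 cr <-]] := h _ d0.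
have c0 : con r0 f by exact: conI.
rewrite /cmean -mulrBr nrmM nrm_real ger0_norm ?invr_ge0 // mulrC.
rewrite ler_pdivrMr ?lt_def ?twopi_neq0 //.
have E : cint (fun t => f (circ r0 t) + - 1 * f (circ r t)) (2 * pi) =
  cint (fun t => f (circ r0 t)) (2 * pi) - cint (fun t => f (circ r t)) (2 * pi).
  rewrite cintD //; first by rewrite cintZ // mulN1r.
  by move=> t; apply: gcZ; exact: cr.
rewrite -E; have -> : e = 2 * (e / 2) by field.
apply: cint_bound => // [t|t tpi].
  by apply: gcD; [exact: c0 | apply: gcZ; exact: cr].
by rewrite mulN1r nrmB; apply/ltW/hd.
Qed.

Lemma cmean0 f : cc f 0 -> cmean f 0 = f 0.
Proof.
move=> f0; rewrite -[RHS](cmean_cst (f 0) 0); apply: cmean_eq => //.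
- by apply: conI => // z /eqP; rewrite nrm_eq0 => /eqP ->.
- exact: con_cst.
- by move=> z /eqP; rewrite nrm_eq0 => /eqP ->.
Qed.

(** The annuli on either side of the circle through [w] are covered by [cmean_annulus], and
    continuity joins them. A single point of mere continuity is what the difference quotient in
    Cauchy's formula has. *)
Lemma mean_value_except F (w : C) (rho r : R) : nrm w < r -> r < rho ->
  (forall z, nrm z < rho -> cc F z) ->
  hol_on (fun z => nrm z < rho /\ z != w) F -> cmean F r = F 0.
Proof.
move=> wr rrho cF hF.
have cn (x : R) : 0 <= x -> x < rho -> con x F.
  by move=> x0 xr; apply: conI => // z zx; apply: cF; rewrite zx.
have up : cmean F (nrm w) = cmean F r.
  apply: cmean_limit => [//|z zw|d d0]; first by apply: cF; rewrite zw (lt_trans wr).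
  have [x wx xm] : exists2 x, nrm w < x & x < Num.min r (nrm w + d).
    exists ((nrm w + Num.min r (nrm w + d)) / 2); rewrite ?midf_lt // ?lt_min ?wr ?ltrDl //.
  move: xm; rewrite lt_min => /andP[xr xd]; exists x; split.
  - by rewrite ger0_norm ?subr_ge0 ?ltW // ltrBlDl.
  - by apply: cn; [exact: le_trans (ltW wx) | exact: lt_trans rrho].
  - apply: (@cmean_annulus F (nrm w) rho) => //; last exact: ltW.
    move=> z /andP[z1 z2]; apply: hF; split => //.
    by apply: contraTneq z1 => ->; rewrite ltxx.
rewrite -{}up; have [->|w0] := eqVneq w 0.
  by rewrite nrm0; apply: cmean0; apply: cF; rewrite nrm0 (le_lt_trans _ rrho) // (le_trans _ (ltW wr)).
have m0 : 0 < nrm w by rewrite nrm_gt0.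
have mrho : nrm w < rho by exact: lt_trans rrho.
have below (x y : R) : 0 < x -> x <= y -> y < nrm w -> cmean F x = cmean F y.
  move=> x0 xy ym; apply: (@cmean_annulus F 0 (nrm w)) => //.
  move=> z /andP[z1 z2]; apply: hF; split; first exact: lt_trans mrho.
  by apply: contraTneq z2 => ->; rewrite ltxx.
rewrite -cmean0; last by apply: cF; rewrite nrm0 (lt_trans m0).
have h0 : 0 < nrm w / 2 by rewrite divr_gt0.
have h1 : nrm w / 2 < nrm w by rewrite gtr_pMr // invf_lt1 // ltr1n.
have -> : cmean F (nrm w) = cmean F (nrm w / 2).
  apply: cmean_limit => [//|z zw|d d0]; first by apply: cF; rewrite zw.
  have [x xm wx] : exists2 x, Num.max (nrm w / 2) (nrm w - d) < x & x < nrm w.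
    exists ((Num.max (nrm w / 2) (nrm w - d) + nrm w) / 2).
      by rewrite midf_lt // gt_max h1 gtrBl.
    by rewrite midf_lt // gt_max h1 gtrBl.
  move: xm; rewrite gt_max => /andP[xr xd]; exists x; split.
  - by rewrite distrC ger0_norm ?subr_ge0 ?(ltW wx) //; lra.
  - by apply: cn; [exact: le_trans (ltW h0) (ltW xr) | exact: lt_trans mrho].
  - by apply/esym/below => //; exact: ltW.
apply/esym/cmean_limit => [//|z /eqP|d d0].
  by rewrite nrm_eq0 => /eqP ->; apply: cF; rewrite nrm0 (lt_trans m0).
have [x x0 xm] : exists2 x, 0 < x & x < Num.min (nrm w / 2) d.
  have h2 : 0 < Num.min (nrm w / 2) d by rewrite lt_min h0.
  exists (Num.min (nrm w / 2) d / 2); first by rewrite divr_gt0.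
  by rewrite gtr_pMr // invf_lt1 // ltr1n.
move: xm; rewrite lt_min => /andP[xr xd]; exists x; split.
- by rewrite subr0 ger0_norm // ltW.
- by apply: cn; [exact: ltW | rewrite (lt_trans xr) // (lt_trans h1)].
- by apply: below => //; exact: ltW.
Qed.

Lemma mean_value f (rho r : R) : 0 <= r -> r < rho ->
  hol_on (fun z => nrm z < rho) f -> cmean f r = f 0.
Proof.
move=> r0 rr hf; have cf z : nrm z < rho -> cc f z by exact: hol_on_cc hf.
have [->|rn0] := eqVneq r 0.
  by apply: cmean0; apply: cf; rewrite nrm0 (le_lt_trans r0).
apply: (@mean_value_except f 0 rho r) => //; first by rewrite nrm0 lt_def rn0.
by move=> z [/hf].
Qed.

Lemma con_hol f (rho r : R) : 0 <= r -> r < rho ->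
  hol_on (fun z => nrm z < rho) f -> con r f.
Proof. by move=> r0 rr hf; apply: conI => // z zr; apply: (hol_on_cc hf); rewrite zr. Qed.

Lemma circle_sub_neq0 (w z : C) (r : R) : nrm w < r -> nrm z = r -> z - w != 0.
Proof. by move=> wr zr; rewrite subr_eq0; apply: contraTneq wr => <-; rewrite zr ltxx. Qed.

Lemma con_sub (w : C) (r : R) : con r (fun z => z - w).
Proof. by apply: conD; [exact: con_id | exact: con_cst]. Qed.

Lemma con_kernel (w : C) (r : R) : nrm w < r -> con r (fun z => (z - w)^-1).
Proof.
move=> wr; apply: conV; first exact: le_trans (ltW wr).
- exact: con_sub.
- by move=> z; exact: circle_sub_neq0.
Qed.

(** The mean is the same for all radii [x > nrm w], and the integrand tends to [1] as [x] grows. *)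
Lemma cmean_kernel (w : C) (r : R) : nrm w < r -> cmean (fun z => z * (z - w)^-1) r = 1.
Proof.
move=> wr; have k x : nrm w < x -> con x (fun z => z * (z - w)^-1).
  by move=> wx; apply: conM; [exact: con_id | exact: con_kernel].
have b x : r < x -> nrm (cmean (fun z => z * (z - w)^-1) r - 1) <= 2 * (nrm w / (x - nrm w)).
  move=> rx; have wx : nrm w < x by exact: lt_trans rx.
  have -> : cmean (fun z => z * (z - w)^-1) r = cmean (fun z => z * (z - w)^-1) x.
    apply: (@cmean_annulus _ (nrm w) (x + 1)) => //; rewrite ?(ltW rx) ?ltrDl //.
    move=> z /andP[z1 _]; have zw : z - w != 0.
      by rewrite subr_eq0; apply: contraTneq z1 => ->; rewrite ltxx.
    eexists; apply: gdM; first exact: gd_emb.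
    by apply: gdV => //; apply: gdB; [exact: gd_emb | exact: gd_cst].
  rewrite -[X in _ - X](cmean_cst 1 x) -cmeanB; [|exact: k|exact: con_cst].
  have x0 : 0 <= x by exact: le_trans (ltW wx).
  apply: cmean_bound => //.
    by apply: conD; [exact: k | exact: conN (con_cst _ _)].
  move=> t _; set z := circ x t; have zx : nrm z = x by rewrite nrm_circ.
  have zw := circle_sub_neq0 wx zx.
  have -> : z * (z - w)^-1 - 1 = w * (z - w)^-1 by field.
  rewrite nrmM nrmV ler_wpM2l // lef_pV2 ?posrE ?subr_gt0 //; last by rewrite nrm_gt0.
  by rewrite -zx nrmBD.
apply/eqP; rewrite -subr_eq0 -nrm_eq0 eq_le nrm_ge0 andbT.
apply/ler_addgt0Pl => e e0; rewrite addr0.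
(* Makes [x > r] and [x - nrm w >= 2 * nrm w / e], so that the bound is at most [e]. *)
pose x := r + 1 + nrm w + 2 * nrm w / e.
have we : 0 <= 2 * nrm w / e by rewrite divr_ge0 ?mulr_ge0 // ltW.
have rx : r < x by rewrite /x; have := nrm_ge0 w; lra.
apply: le_trans (b x rx) _; rewrite mulrA ler_pdivrMr; last by have := nrm_ge0 w; rewrite /x; lra.
have -> : 2 * nrm w = e * (2 * nrm w / e) by field; rewrite gt_eqF.
rewrite ler_pM2l // /x; have := le_lt_trans (nrm_ge0 w) wr; lra.
Qed.

(** The mean value property is applied to [z * (f z - f w) / (z - w)], extended continuously to [w].
    The factor [z] makes the value at [0] vanish and converts the contour integral of
    [f z / (z - w)] into a circle mean. *)
Lemma cauchy_formula f (w : C) (rho r : R) : nrm w < r -> r < rho ->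
  hol_on (fun z => nrm z < rho) f ->
  f w = cmean (fun z => f z * z * (z - w)^-1) r.
Proof.
move=> wr rr hf; have cf z : nrm z < rho -> cc f z by exact: hol_on_cc hf.
have r0 : 0 <= r by exact: le_trans (ltW wr).
have wrho : nrm w < rho by exact: lt_trans rr.
have [l fl] := hf w wrho.
pose g z := if z == w then w * l else z * ((f z - f w) * (z - w)^-1).
have gz z : nrm z < rho -> z != w -> exists m, cd g z m.
  move=> zr zw; have zw' : z - w != 0 by rewrite subr_eq0.
  have [m hm] := hf z zr.
  eexists; apply: (@gd_near _ _ _ (fun z => z * ((f z - f w) * (z - w)^-1))); last first.
    apply: gdM; first exact: gd_emb; apply: gdM.
      by apply: gdB; [exact: hm | exact: gd_cst].
    by apply: gdV => //; apply: gdB; [exact: gd_emb | exact: gd_cst].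
  exists (nrm (z - w)); first by rewrite nrm_gt0.
  move=> s sz; rewrite /g; case: eqVneq => // sw.
  by move: sz; rewrite sw nrmB ltxx.
have gw : cc g w.
  suff : cc (fun z => if z == w then l else (f z - f w) * (z - w)^-1) w.
    move=> h; apply: (@gc_near _ _ _ (fun z => z * (if z == w then l else (f z - f w) * (z - w)^-1))).
      by exists 1 => // s _; rewrite /g; case: eqVneq => // ->.
    by apply: gcM => //; exact: gc_emb.
  move=> e e0; have [d d0 hd] := fl _ (divr_gt0 e0 (ltr0n _ 2)).
  exists d => // s /hd; rewrite eqxx; case: eqVneq => [_|sw] h; first by rewrite subrr nrm0.
  have sw' : s - w != 0 by rewrite subr_eq0.
  have -> : (f s - f w) * (s - w)^-1 - l = (f s - f w - l * (s - w)) * (s - w)^-1 by field.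
  rewrite nrmM nrmV ltr_pdivrMr ?nrm_gt0 //; apply: le_lt_trans h _.
  by rewrite ltr_pM2r ?nrm_gt0 // ltr_pdivrMr // ltr_pMr // ltr1n.
have : cmean g r = g 0.
  apply: (@mean_value_except g w rho) => //.
  - move=> z zr; have [->//|zw] := eqVneq z w.
    by have [m] := gz z zr zw; exact: gd_gc.
  - by move=> z [zr zw]; exact: gz.
have -> : g 0 = 0 by rewrite /g; case: eqVneq => [<-|_]; rewrite mul0r.
have cfr : con r f by exact: con_hol hf.
have ck := con_kernel wr.
have c1 : con r (fun z => f z * z * (z - w)^-1).
  by apply: conM => //; apply: conM => //; exact: con_id.
have c2 : con r (fun z => z * (z - w)^-1) by apply: conM => //; exact: con_id.
have c3 : con r (fun z => f w * (z * (z - w)^-1)).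
  by apply: conM => //; exact: con_cst.
rewrite (@cmean_eq g (fun z => f z * z * (z - w)^-1 - f w * (z * (z - w)^-1))) //.
- rewrite cmeanB // cmeanZ // cmean_kernel // mulr1 => /eqP.
  by rewrite subr_eq0 => /eqP.
- apply: conI => // z zr; have [->//|zw] := eqVneq z w.
  by have [m] := gz z ltac:(by rewrite zr) zw; exact: gd_gc.
- by apply: conD => //; exact: conN.
- move=> z zr; rewrite /g; case: eqVneq => [zw|_]; last by ring.
  by move: wr; rewrite -zw zr ltxx.
Qed.

End CircleMean.

(** * Removable singularities and factorisation *)

Section Analytic.
Context {R : realType}.
Local Notation C := R[i].

Lemma half_lt (x : R) : 0 < x -> 0 < x / 2 /\ x / 2 < x.
Proof. by move=> x0; split; lra. Qed.

Lemma circle_bounded (u : C -> C) (r : R) : con r u ->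
  exists2 M : R, 0 < M & forall t, 0 <= t <= 2 * pi -> nrm (u (circ r t)) <= M.
Proof.
move=> cu.
have p0 : 0 <= 2 * pi :> R by rewrite mulr_ge0 // pi_ge0.
have cn : {within `[0, 2 * pi], continuous (fun t => nrm (u (circ r t)))}.
  apply/continuous_subspaceT => t; apply: (cvgRI (FF := nbhs_filter t)) => e /(cu t)[d d0 hd].
  apply: (nearRI d0) => s; rewrite -(nrm_real (s - t)) rcB => /hd.
  apply: le_lt_trans; rewrite ler_norml; apply/andP; split; last exact: nrmBD.
  by rewrite lerNl opprB nrmB nrmBD.
have [c _ hc] := EVT_max p0 cn.
exists (nrm (u (circ r c)) + 1); first by rewrite ltr_wpDl.
by move=> t tpi; apply: le_trans (hc t _) _; rewrite ?in_itv //= lerDl.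
Qed.

Lemma cd_cmean (k : C -> C -> C) (k' : C -> C) (r d B : R) (w : C) : 0 <= r -> 0 < d ->
  0 <= B -> (forall h, nrm h < d -> con r (k (w + h))) -> con r k' ->
  (forall h t, nrm h < d -> 0 <= t <= 2 * pi -> nrm (k (w + h) (circ r t) -
     k w (circ r t) - h * k' (circ r t)) <= B * nrm h ^+ 2) ->
  cd (fun w => cmean (k w) r) w (cmean k' r).
Proof.
move=> r0 d0 B0 ck ck' hk e e0.
have B1 : 0 < 2 * B + 1 by rewrite ltr_wpDl // mulr_ge0.
exists (Num.min d (e / (2 * B + 1))); first by rewrite lt_min d0 divr_gt0.
move=> s; rewrite lt_min => /andP[sd se].
set h := s - w in sd se *.
have Es : s = w + h by rewrite /h addrC subrK.
have cw : con r (k w) by have := ck 0; rewrite nrm0 addr0; apply.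
have cs : con r (k s) by rewrite Es; exact: ck.
have -> : cmean (k s) r - cmean (k w) r - cmean k' r * h =
  cmean (fun z => k s z - k w z - h * k' z) r.
  rewrite !cmeanB //; last 2 first.
  - by apply: conD => //; exact: conN.
  - by apply: conM => //; exact: con_cst.
  by rewrite cmeanZ // mulrC.
apply: le_trans (_ : 2 * (B * nrm h ^+ 2) <= _).
  apply: cmean_bound => // [|t tpi].
    by apply: conD; [apply: conD => //; exact: conN | apply: conN; apply: conM => //; exact: con_cst].
  by rewrite Es; exact: hk.
rewrite expr2 !mulrA; apply: ler_wpM2r => //.
rewrite ltr_pdivlMr // in se; apply: le_trans (ltW se); rewrite mulrC.
by apply: ler_wpM2l => //; rewrite lerDl.
Qed.

Lemma kernel_lower (w h z : C) (r d : R) : d = (r - nrm w) / 2 -> nrm w < r -> nrm h < d ->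
  nrm z = r -> 2 * d <= nrm (z - w) /\ d <= nrm (z - (w + h)).
Proof.
move=> dE wr hd zr; have h1 := nrmBD z w; rewrite zr in h1.
have h2 := nrmBD (z - w) h; split; first by rewrite dE; lra.
by rewrite opprD addrA; lra.
Qed.

Lemma cd_kernel1 (u : C -> C) (r : R) (w : C) : con r u -> nrm w < r ->
  cd (fun w => cmean (fun z => u z * (z - w)^-1) r) w
     (cmean (fun z => u z * ((z - w)^-1 * (z - w)^-1)) r).
Proof.
move=> cu wr; have [M M0 hM] := circle_bounded cu.
have [d dE] : exists d, d = (r - nrm w) / 2 by eexists.
have d0 : 0 < d by rewrite dE divr_gt0 // subr_gt0.
have d0' := ltW d0; have M0' := ltW M0.
have r0 : 0 <= r by exact: le_trans (ltW wr).
apply: (@cd_cmean _ _ r d (M / (d * d * d))) => //.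
- by rewrite divr_ge0 ?mulr_ge0.
- move=> h hd; apply: conM => //; apply: con_kernel.
  by apply: le_lt_trans (nrmD _ _) _; lra.
- by apply: conM => //; apply: conM; exact: con_kernel.
move=> h t hd tpi; set z := circ r t.
have zr : nrm z = r by rewrite nrm_circ.
have [l1 l2] := kernel_lower dE wr hd zr.
have z1 : z - w != 0 by rewrite -nrm_gt0; lra.
have z2 : z - (w + h) != 0 by rewrite -nrm_gt0; lra.
have -> : u z * (z - (w + h))^-1 - u z * (z - w)^-1 - h * (u z * ((z - w)^-1 * (z - w)^-1)) =
  u z * ((z - w)^-1 * (z - w)^-1 * (z - (w + h))^-1) * h ^+ 2 by field; rewrite z1 z2.
rewrite nrmM nrmX; apply: ler_wpM2r; first exact: exprn_ge0.
rewrite !nrmM !nrmV.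
apply: ler_pM; rewrite ?mulr_ge0 ?invr_ge0 //; first exact: hM.
rewrite -!invfM lef_pV2 ?posrE ?mulr_gt0 //; try lra.
by apply: ler_pM; rewrite ?mulr_ge0 ?(ltW d0) //; apply: ler_pM; rewrite ?(ltW d0) //; lra.
Qed.

(** Differentiates the Cauchy integral of the derivative once more; this is why derivatives of
    holomorphic functions are holomorphic. *)
Lemma cd_kernel2 (u : C -> C) (r : R) (w : C) : con r u -> nrm w < r ->
  cd (fun w => cmean (fun z => u z * ((z - w)^-1 * (z - w)^-1)) r) w
     (cmean (fun z => u z * (2 * (z - w)^-1 * (z - w)^-1 * (z - w)^-1)) r).
Proof.
move=> cu wr; have [M M0 hM] := circle_bounded cu.
have [d dE] : exists d, d = (r - nrm w) / 2 by eexists.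
have d0 : 0 < d by rewrite dE divr_gt0 // subr_gt0.
have d0' := ltW d0; have M0' := ltW M0.
have r0 : 0 <= r by exact: le_trans (ltW wr).
apply: (@cd_cmean _ _ r d (M * (4 / (d * d * (d * d))))) => //.
- by rewrite mulr_ge0 // divr_ge0 // !mulr_ge0.
- move=> h hd; apply: conM => //.
  have wh : nrm (w + h) < r by apply: le_lt_trans (nrmD _ _) _; lra.
  by apply: conM; apply: con_kernel.
- have ck := con_kernel wr.
  by do 4 (apply: conM => //); exact: con_cst.
move=> h t hd tpi; set z := circ r t.
have zr : nrm z = r by rewrite nrm_circ.
have [l1 l2] := kernel_lower dE wr hd zr.
have z1 : z - w != 0 by rewrite -nrm_gt0; lra.
have z2 : z - (w + h) != 0 by rewrite -nrm_gt0; lra.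
have -> : u z * ((z - (w + h))^-1 * (z - (w + h))^-1) - u z * ((z - w)^-1 * (z - w)^-1)
    - h * (u z * (2 * (z - w)^-1 * (z - w)^-1 * (z - w)^-1)) =
  u z * ((3 * (z - w) - 2 * h) * (z - w)^-1 *
   ((z - w)^-1 * (z - w)^-1 * ((z - (w + h))^-1 * (z - (w + h))^-1))) * h ^+ 2.
  by field; rewrite z1 z2.
rewrite nrmM nrmX; apply: ler_wpM2r; first exact: exprn_ge0.
rewrite nrmM; apply: ler_pM => //; first exact: hM.
rewrite nrmM; apply: ler_pM => //.
  rewrite nrmM nrmV ler_pdivrMr ?nrm_gt0 //.
  apply: le_trans (nrmD _ _) _; rewrite nrmN !nrmM !nrm_nat; lra.
rewrite !nrmM !nrmV -!invfM lef_pV2 ?posrE ?mulr_gt0 ?nrm_gt0 //.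
by apply: ler_pM; rewrite ?mulr_ge0 ?(ltW d0) //; apply: ler_pM; rewrite ?(ltW d0) //; lra.
Qed.

Lemma cd_unique f (z l m : C) : cd f z l -> cd f z m -> l = m.
Proof. by move=> /cd_derivable[_ <-] /cd_derivable[]. Qed.

Section Disc.
Variables (rho : R) (rho0 : 0 < rho).
Local Notation disc := (fun z : C => nrm z < rho).

Lemma hol_derive_disc f : hol_on disc f ->
  exists f' : C -> C, (forall z, disc z -> cd f z (f' z)) /\ hol_on disc f'.
Proof.
move=> hf; exists (derive1 f).
have df z : disc z -> cd f z (derive1 f z).
  by move=> /hf[l hl]; have [_ ->] := cd_derivable hl.
split => // w wr; pose r := (nrm w + rho) / 2.
have [wr1 rr] : nrm w < r /\ r < rho by rewrite /r; split; lra.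
have r0 : 0 <= r by exact: le_trans (ltW wr1).
pose u z := f z * z.
have cu : con r u by apply: conM; [exact: con_hol hf | exact: con_id].
eexists; apply: (@gd_near _ _ _ (fun w => cmean (fun z => u z * ((z - w)^-1 * (z - w)^-1)) r));
  last exact: cd_kernel2.
exists (r - nrm w); first by rewrite subr_gt0.
move=> s sw; have sr : nrm s < r.
  by have := nrmD (s - w) w; rewrite subrK => ?; lra.
apply: (@cd_unique f s); last by apply: df; exact: lt_trans rr.
apply: gd_near (cd_kernel1 cu sr).
exists (r - nrm s); first by rewrite subr_gt0.
move=> x xs; apply/esym/(@cauchy_formula _ f x rho r) => //.
by have := nrmD (x - s) s; rewrite subrK => ?; lra.
Qed.

(** By Cauchy's formula the quotient [(f w - f 0) / w] is the mean of [f z / (z - w)] for small [w],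
    and that mean is differentiable in [w] at [0] too. *)
Lemma hol_div_disc f : hol_on disc f ->
  exists g : C -> C, hol_on disc g /\ forall z, disc z -> f z = f 0 + z * g z.
Proof.
have n00 : nrm (0 : C) < rho by rewrite nrm0.
move=> hf; have [l f0] := hf 0 n00.
exists (fun z => if z == 0 then l else (f z - f 0) * z^-1); split; last first.
  by move=> z _; case: eqVneq => [->|z0]; [rewrite mul0r addr0 | field].
move=> z zr; have [z0|z0] := eqVneq z 0; last first.
  have [m hm] := hf z zr; eexists.
  apply: (@gd_near _ _ _ (fun z => (f z - f 0) * z^-1)); last first.
    by apply: gdM; [apply: gdB; [exact: hm | exact: gd_cst] | apply: gdV => //; exact: gd_emb].
  exists (nrm z); first by rewrite nrm_gt0.
  by move=> s; case: eqVneq => // ->; rewrite sub0r nrmN ltxx.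
pose r := rho / 2.
have [r0 rr] : 0 < r /\ r < rho := half_lt rho0.
have cf : con r f by apply: con_hol hf => //; exact: ltW.
exists (cmean (fun z => f z * ((z - 0)^-1 * (z - 0)^-1)) r).
apply: (@gd_near _ _ _ (fun w => cmean (fun z => f z * (z - w)^-1) r)); last first.
  by rewrite z0; apply: cd_kernel1 => //; rewrite nrm0.
exists r => // w; rewrite z0 subr0 => wr.
case: eqVneq => [->|w0]; last first.
  rewrite (@cauchy_formula _ f w rho r) // (@cauchy_formula _ f 0 rho r) ?nrm0 //.
  rewrite -cmeanB; last 2 first.
  - by apply: conM; [apply: conM => //; exact: con_id | exact: con_kernel].
  - by apply: conM; [apply: conM => //; exact: con_id | apply: con_kernel; rewrite nrm0].
  rewrite mulrC -cmeanZ; last first.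
    apply: conD.
      by apply: conM; [apply: conM => //; exact: con_id | exact: con_kernel].
    by apply: conN; apply: conM; [apply: conM => //; exact: con_id | apply: con_kernel; rewrite nrm0].
  apply: cmean_eq; [exact: ltW | by apply: conM => //; exact: con_kernel | |].
    apply: conM; first exact: con_cst; apply: conD.
      by apply: conM; [apply: conM => //; exact: con_id | exact: con_kernel].
    by apply: conN; apply: conM; [apply: conM => //; exact: con_id | apply: con_kernel; rewrite nrm0].
  move=> z1 zr1; have h1 := circle_sub_neq0 wr zr1.
  have h2 : z1 != 0 by rewrite -nrm_gt0 zr1.
  by rewrite subr0; field; rewrite h1 h2 w0.
apply: (@cd_unique f 0); last exact: f0.
have n0 : nrm (0 : C) < r by rewrite nrm0.
pose u z := f z * z.
have cu : con r u by apply: conM => //; exact: con_id.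
have -> : cmean (fun z1 => f z1 * (z1 - 0)^-1) r =
   cmean (fun z => u z * ((z - 0)^-1 * (z - 0)^-1)) r.
  have ck := con_kernel n0.
  apply: cmean_eq; [exact: ltW | exact: conM | by do 2 (apply: conM => //) |].
  move=> z1 zr1; have h2 : z1 != 0 by rewrite -nrm_gt0 zr1.
  by rewrite /u subr0; field.
apply: gd_near (cd_kernel1 cu n0).
exists r => // x; rewrite subr0 => xr.
exact/esym/(@cauchy_formula _ f x rho r).
Qed.

Lemma hol_iter_div f : hol_on disc f ->
  (exists m g, [/\ hol_on disc g, g 0 != 0 & forall z, disc z -> f z = z ^+ m * g z]) \/
  forall m, exists2 g, hol_on disc g & forall z, disc z -> f z = z ^+ m * g z.
Proof.
move=> hf; have [|n] := pselect (exists m g, [/\ hol_on disc g, g 0 != 0 &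
  forall z, disc z -> f z = z ^+ m * g z]); [by left | right].
elim=> [|m [g hg fg]]; first by exists f => // z _; rewrite mul1r.
have g0 : g 0 = 0.
  by apply/eqP; apply: contra_notT n => g0; exists m, g.
have [k [hk gk]] := hol_div_disc hg; exists k => // z zr.
by rewrite fg // gk // g0 add0r exprSr mulrA.
Qed.

(** If every power [z ^+ m] divides [f], Cauchy's formula for the quotient on [nrm z = r] gives
    [nrm (f w) <= 4 * M / 2 ^+ m] whenever [nrm w < r / 2], hence [f w = 0]. *)
Lemma hol_factor_disc f : hol_on disc f ->
  (exists2 d : R, 0 < d & forall z, nrm z < d -> f z = 0) \/
  exists m g, [/\ hol_on disc g, g 0 != 0 & forall z, disc z -> f z = z ^+ m * g z].
Proof.
move=> hf; have [h|h] := hol_iter_div hf; [by right | left].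
pose r := rho / 2.
have [r0 rr] : 0 < r /\ r < rho := half_lt rho0.
have cf : con r f by apply: con_hol hf => //; exact: ltW.
have [M M0 hM] := circle_bounded cf.
exists (r / 2); first by rewrite divr_gt0.
move=> w wr; have wr' : nrm w < r by lra.
have wrho : nrm w < rho by exact: lt_trans rr.
have key m : nrm (f w) <= 4 * M / 2 ^+ m.
  have [g hg fg] := h m.
  have cg : con r g by apply: con_hol hg => //; exact: ltW.
  have gw : nrm (g w) <= 2 * (M / r ^+ m * 2).
    rewrite (@cauchy_formula _ g w rho r) //; apply: cmean_bound; first exact: ltW.
      by apply: conM; [apply: conM => //; exact: con_id | exact: con_kernel].
    move=> t tpi; set z := circ r t; have zr : nrm z = r by rewrite nrm_circ // ltW.
    rewrite -mulrA nrmM; apply: ler_pM => //.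
      rewrite ler_pdivlMr ?exprn_gt0 // -zr -nrmX -nrmM mulrC -fg ?zr //.
      exact: hM.
    rewrite nrmM nrmV zr ler_pdivrMr ?nrm_gt0 ?(circle_sub_neq0 wr' zr) //.
    by have := nrmBD z w; rewrite zr; lra.
  rewrite fg // nrmM nrmX.
  apply: le_trans (_ : (r / 2) ^+ m * (2 * (M / r ^+ m * 2)) <= _).
    apply: ler_pM => //; first exact: exprn_ge0.
    have r0' := ltW r0; apply: lerXn2r; [by rewrite nnegrE | by rewrite nnegrE divr_ge0 | exact: ltW].
  rewrite exprMn exprVn le_eqVlt; apply/orP; left; apply/eqP; field.
  by rewrite !expf_neq0 ?gt_eqF.
apply/eqP; rewrite -nrm_eq0 eq_le nrm_ge0 andbT; apply/ler_addgt0Pl => e e0.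
have [m hm] := @pow2_small R e (4 * M) e0.
by rewrite addr0; apply: le_trans (key m) (ltW hm).
Qed.

(** Boundedness makes [z^2 * f z], completed by [0], differentiable at [0] with derivative [0];
    dividing by [z] twice gives the extension. *)
Lemma removable_disc f (M : R) : (forall z, z != 0 -> disc z -> nrm (f z) <= M) ->
  hol_on (fun z => disc z /\ z != 0) f ->
  exists2 g, hol_on disc g & forall z, z != 0 -> disc z -> f z = g z.
Proof.
move=> hM hf.
pose F z := if z == 0 then 0 else z * z * f z.
have hF : hol_on disc F.
  move=> z zr; have [z0|z0] := eqVneq z 0; last first.
    have [l hl] := hf z (conj zr z0); eexists.
    apply: (@gd_near _ _ _ (fun z => z * z * f z)); last first.
      by apply: gdM; [apply: gdM; exact: gd_emb | exact: hl].
    exists (nrm z); first by rewrite nrm_gt0.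
    by move=> s; rewrite /F; case: eqVneq => // ->; rewrite sub0r nrmN ltxx.
  exists 0 => e e0; have M1 : 0 < `|M| + 1 by rewrite ltr_wpDl.
  exists (Num.min rho (e / (`|M| + 1))); first by rewrite lt_min rho0 divr_gt0.
  move=> s; rewrite z0 !subr0 lt_min => /andP[s1 s2].
  rewrite /F eqxx subr0 mul0r subr0; case: eqVneq => [->|s0]; first by rewrite nrm0 mulr0.
  rewrite -mulrA nrmM [leRHS]mulrC ler_wpM2l // nrmM.
  rewrite ltr_pdivlMr // in s2; apply: le_trans (ltW s2); apply: ler_wpM2l => //.
  by apply: le_trans (hM s s0 s1) _; apply: le_trans (ler_norm _) _; rewrite lerDl.
have [g1 [hg1 F1]] := hol_div_disc hF.
have F0 : F 0 = 0 by rewrite /F eqxx.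
have g1E z : z != 0 -> disc z -> g1 z = z * f z.
  move=> z0 zr; apply: (mulfI z0); have := F1 z zr.
  by rewrite F0 add0r /F (negbTE z0) mulrA.
have g10 : g1 0 = 0.
  apply/eqP; rewrite -nrm_eq0 eq_le nrm_ge0 andbT; apply/ler_addgt0Pl => e e0; rewrite addr0.
  have e2 : 0 < e / 2 by rewrite divr_gt0.
  have d00 : disc 0 by rewrite nrm0.
  have [d d0 hd] := hol_on_cc hg1 d00 e2.
  have M1 : 0 < `|M| + 1 by rewrite ltr_wpDl.
  have q0 : 0 < Num.min (Num.min rho d) (e / 2 / (`|M| + 1)) by rewrite !lt_min rho0 d0 divr_gt0.
  set q := Num.min _ _ in q0; pose x : C := (q / 2)%:C.
  have nx : nrm x = q / 2 by rewrite nrm_real ger0_norm // divr_ge0 // ltW.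
  have : nrm x < q by rewrite nx gtr_pMr // invf_lt1 // ltr1n.
  rewrite /q !lt_min => /andP[/andP[x1 x2] x3].
  have x0 : x != 0 by rewrite -nrm_gt0 nx divr_gt0.
  have := hd x; rewrite subr0 => /(_ x2); rewrite g1E // => k.
  have k2 : nrm (x * f x) <= e / 2.
    rewrite nrmM; rewrite ltr_pdivlMr // in x3; apply: le_trans (ltW x3).
    apply: ler_wpM2l => //; apply: le_trans (hM x x0 x1) _.
    by apply: le_trans (ler_norm _) _; rewrite lerDl.
  rewrite nrmB in k; have := nrmD (g1 0 - x * f x) (x * f x); rewrite subrK => ?; lra.
have [g2 [hg2 G2]] := hol_div_disc hg1.
exists g2 => // z z0 zr; apply: (mulfI z0); rewrite -g1E //.
by rewrite G2 // g10 add0r.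
Qed.

End Disc.
End Analytic.

(** * Orders of meromorphic functions *)

Section Near.
Context {R : realType}.
Local Notation C := R[i].

Definition nb (a : C) (P : C -> Prop) :=
  exists2 d : R, 0 < d & forall z, nrm (z - a) < d -> P z.
(** Punctured neighbourhoods, since the value of a total function at its own pole carries no
    information. *)
Definition nr (a : C) (P : C -> Prop) :=
  exists2 d : R, 0 < d & forall z, z != a -> nrm (z - a) < d -> P z.

Lemma nrW a (P : C -> Prop) : (forall z, z != a -> P z) -> nr a P.
Proof. by move=> h; exists 1 => // z za _; exact: h. Qed.

Lemma nrS a (P Q : C -> Prop) : (forall z, z != a -> P z -> Q z) -> nr a P -> nr a Q.
Proof. by move=> h [d d0 hd]; exists d => // z za zd; apply: h => //; exact: hd. Qed.

Lemma nrS2 a (P Q S : C -> Prop) : (forall z, z != a -> P z -> Q z -> S z) ->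
  nr a P -> nr a Q -> nr a S.
Proof.
move=> h [d d0 hd] [d' d'0 hd']; exists (Num.min d d'); first by rewrite lt_min d0.
by move=> z za; rewrite lt_min => /andP[zd zd']; apply: h => //; [exact: hd | exact: hd'].
Qed.

Lemma nrS3 a (P Q S T : C -> Prop) : (forall z, z != a -> P z -> Q z -> S z -> T z) ->
  nr a P -> nr a Q -> nr a S -> nr a T.
Proof.
move=> h hP hQ; apply: (@nrS2 a (fun z => P z /\ Q z)); first by move=> z za [Pz Qz]; exact: h.
by apply: nrS2 hP hQ.
Qed.

Lemma nb_nr a P : nb a P -> nr a P.
Proof. by move=> [d d0 h]; exists d => // z _; exact: h. Qed.

Lemma nb_nrP a P : nb a P <-> nr a P /\ P a.
Proof.
split=> [h|[[d d0 hd] Pa]].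
  by split; [exact: nb_nr | case: h => d d0; apply; rewrite subrr nrm0].
by exists d => // z zd; have [->//|za] := eqVneq z a; exact: hd.
Qed.

Lemma nb_at a P : nb a P -> P a. Proof. by case/nb_nrP. Qed.

Lemma nbW a (P : C -> Prop) : (forall z, P z) -> nb a P.
Proof. by move=> h; exists 1. Qed.

Lemma nbS a (P Q : C -> Prop) : (forall z, P z -> Q z) -> nb a P -> nb a Q.
Proof. by move=> h [d d0 hd]; exists d => // z zd; apply: h; exact: hd. Qed.

Lemma nbS2 a (P Q S : C -> Prop) : (forall z, P z -> Q z -> S z) -> nb a P -> nb a Q -> nb a S.
Proof.
move=> h [d d0 hd] [d' d'0 hd']; exists (Num.min d d'); first by rewrite lt_min d0.
by move=> z; rewrite lt_min => /andP[zd zd']; apply: h => //; [exact: hd | exact: hd'].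
Qed.

Lemma nr_ex a P : nr a P -> exists2 z, z != a & P z.
Proof.
move=> [d d0 hd]; have [h0 h1] := half_lt d0.
have n : nrm (a + (d / 2)%:C - a) = d / 2.
  by rewrite addrC addKr nrm_real ger0_norm // ltW.
exists (a + (d / 2)%:C); last by apply: hd; rewrite ?n // -subr_eq0 -nrm_gt0 n.
by rewrite -subr_eq0 -nrm_gt0 n.
Qed.

Lemma nr_false a : ~ nr a (fun=> False).
Proof. by case/nr_ex. Qed.

Lemma nb_nb a P : nb a P -> nb a (fun z => nb z P).
Proof.
move=> [d d0 hd]; exists d => // z zd; exists (d - nrm (z - a)); first by rewrite subr_gt0.
move=> w wz; apply: hd; rewrite ltrBrDr in wz.
by apply: le_lt_trans (nrm_tri w z a) _.
Qed.

Lemma nr_nb a P : nr a P -> nr a (fun z => nb z P).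
Proof.
move=> [d d0 hd]; exists d => // z za zd.
have z0 : 0 < nrm (z - a) by rewrite nrm_gt0 subr_eq0.
exists (Num.min (nrm (z - a)) (d - nrm (z - a))); first by rewrite lt_min z0 subr_gt0.
move=> w; rewrite lt_min => /andP[w1 w2]; apply: hd.
  by apply: contraTneq w1 => ->; rewrite nrmB ltxx.
by rewrite ltrBrDr in w2; apply: le_lt_trans (nrm_tri w z a) _.
Qed.

Lemma nr_nbhsP a (P : C -> Prop) : nr a P <-> \forall z \near a^', P z.
Proof. by split=> [h|/nearCx]; [apply/nearCx|]. Qed.

Lemma nb_nbhsP a (P : C -> Prop) : nb a P <-> \forall z \near a, P z.
Proof. by split=> [h|/nearCP]; [apply/nearCP|]. Qed.

End Near.

Section Holomorphic.
Context {R : realType}.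
Local Notation C := R[i].
Implicit Types (f g h u v : C -> C) (a z : C).

Definition hol f a := nb a (fun z => exists l, cd f z l).

Lemma holP f a : holomorphic_at f a <-> hol f a.
Proof.
rewrite /holomorphic_at -nb_nbhsP; split; apply: nbS => z.
- by move=> /derivable_cd; exists (derive1 f z).
- by move=> [l /cd_derivable[]].
Qed.

Lemma hol_at f a : hol f a -> exists l, cd f a l.
Proof. exact: nb_at. Qed.

Lemma hol_cc f a : hol f a -> cc f a.
Proof. by move/hol_at=> [l]; exact: gd_gc. Qed.

Lemma hol_cd f a : hol f a -> cd f a (derive1 f a).
Proof. by move/hol_at => [l hl]; have [_ ->] := cd_derivable hl. Qed.

Lemma hol_nb f a : hol f a -> nb a (hol f).
Proof. exact: nb_nb. Qed.

Lemma cd_near f g z l : nb z (fun w => f w = g w) -> cd f z l -> cd g z l.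
Proof. exact: gd_near. Qed.

Lemma hol_ext f g a : nb a (fun w => f w = g w) -> hol f a -> hol g a.
Proof.
move=> /nb_nb e; apply: (nbS2 _ e) => z ez [l fl]; exists l; exact: cd_near fl.
Qed.

Lemma hol_cst (c : C) a : hol (fun=> c) a.
Proof. by apply: nbW => z; exists 0; exact: gd_cst. Qed.

Lemma hol_id a : hol id a.
Proof. by apply: nbW => z; exists 1; exact: gd_emb. Qed.

Lemma holD f g a : hol f a -> hol g a -> hol (fun z => f z + g z) a.
Proof. by apply: nbS2 => z [l fl] [m gm]; exists (l + m); exact: gdD. Qed.

Lemma holN f a : hol f a -> hol (fun z => - f z) a.
Proof. by apply: nbS => z [l fl]; exists (- l); exact: gdN. Qed.

Lemma holB f g a : hol f a -> hol g a -> hol (fun z => f z - g z) a.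
Proof. by move=> hf hg; apply: holD => //; exact: holN. Qed.

Lemma holM f g a : hol f a -> hol g a -> hol (fun z => f z * g z) a.
Proof. by apply: nbS2 => z [l fl] [m gm]; eexists; exact: gdM fl gm. Qed.

Lemma cc_neq0 f a : cc f a -> f a != 0 -> nb a (fun z => f z != 0).
Proof.
move=> cf fa; have [d d0 hd] := cf (nrm (f a)) ltac:(by rewrite nrm_gt0).
exists d => // z /hd; apply: contraTneq => ->.
by rewrite sub0r nrmN ltxx.
Qed.

Lemma holV f a : f a != 0 -> hol f a -> hol (fun z => (f z)^-1) a.
Proof.
move=> fa hf; have := cc_neq0 (hol_cc hf) fa.
by apply: nbS2 hf => z [l fl] fz; eexists; exact: gdV fl.
Qed.

Lemma holX f n a : hol f a -> hol (fun z => f z ^+ n) a.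
Proof.
move=> hf; elim: n => [|n IH]; first exact: hol_cst.
apply: (@hol_ext (fun z => f z * f z ^+ n)); last exact: holM.
by apply: nbW => z; rewrite exprS.
Qed.

Lemma hol_sub a b : hol (fun z => z - b) a.
Proof. by apply: holB; [exact: hol_id | exact: hol_cst]. Qed.

Lemma hol_exprz f a (m : int) : f a != 0 -> hol f a -> hol (fun z => f z ^ m) a.
Proof.
case: m => m fa hf; first exact: holX.
by rewrite NegzE; apply: holV; [rewrite expf_neq0 | exact: holX].
Qed.

Lemma hol_shift f a : hol f a -> exists2 d : R, 0 < d & hol_on (fun z => nrm z < d) (fun z => f (a + z)).
Proof.
move=> [d d0 hd]; exists d => // z zd.
have [l hl] := hd (a + z) ltac:(by rewrite addrC addKr).
exists (l * 1); apply: (gd_comp (u := fun z => a + z)); first exact: hl.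
by rewrite -[X in gd _ _ _ X]add0r; apply: gdD; [exact: gd_cst | exact: gd_emb].
Qed.

Lemma hol_unshift f a (d : R) : 0 < d -> hol_on (fun z => nrm z < d) f -> hol (fun z => f (z - a)) a.
Proof.
move=> d0 hf; exists d => // z zd; have [l hl] := hf _ zd.
exists (l * 1); apply: (gd_comp (u := fun z => z - a)); first exact: hl.
by rewrite -[X in gd _ _ _ X]subr0; apply: gdB; [exact: gd_emb | exact: gd_cst].
Qed.

Lemma hol_derive f a : hol f a -> hol (derive1 f) a.
Proof.
move=> hf; have [d d0 hd] := hol_shift hf.
have [f' [df' hf']] := hol_derive_disc hd.
apply: (hol_ext _ (hol_unshift a d0 hf')); exists d => // z zd.
have := df' _ zd; move=> /(gd_comp (u := fun z => z - a)) k.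
have {}k : cd (fun z => f (a + (z - a))) z (f' (z - a) * 1).
  by apply: k; rewrite -[X in gd _ _ _ X]subr0; apply: gdB; [exact: gd_emb | exact: gd_cst].
have [_] := cd_derivable k; rewrite mulr1 => <-; congr (derive1 _ z).
by apply/funext => w; rewrite addrC subrK.
Qed.

Lemma hol_zero_or_factor f a : hol f a -> nb a (fun z => f z = 0) \/
  exists m g, [/\ hol g a, g a != 0 & nb a (fun z => f z = (z - a) ^+ m * g z)].
Proof.
move=> hf; have [d d0 hd] := hol_shift hf.
have [[d' d'0 h]|[m [g [hg g0 fg]]]] := hol_factor_disc d0 hd; [left | right].
  by exists d' => // z zd; have := h _ zd; rewrite addrC subrK.
exists m, (fun z => g (z - a)); split.
- exact: hol_unshift hg.
- by rewrite subrr.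
- by exists d => // z zd; rewrite -fg // addrC subrK.
Qed.

Lemma hol_removable f a (M : R) : nr a (fun z => nrm (f z) <= M) -> nr a (fun z => exists l, cd f z l) ->
  exists2 g, hol g a & nr a (fun z => f z = g z).
Proof.
move=> [d1 d10 h1] [d2 d20 h2].
have d0 : 0 < Num.min d1 d2 by rewrite lt_min d10.
pose F z := f (a + z).
have [||g hg Fg] := @removable_disc R (Num.min d1 d2) d0 F M.
- move=> z z0; rewrite lt_min => /andP[z1 _]; apply: h1; last by rewrite addrC addKr.
  by rewrite -subr_eq0 addrC addKr.
- move=> z []; rewrite lt_min => /andP[_ z1] z0.
  have [||l hl] := h2 (a + z).
  + by rewrite -subr_eq0 addrC addKr.
  + by rewrite addrC addKr.
  exists (l * 1); apply: (gd_comp (u := fun z => a + z)); first exact: hl.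
  by rewrite -[X in gd _ _ _ X]add0r; apply: gdD; [exact: gd_cst | exact: gd_emb].
exists (fun z => g (z - a)); first exact: hol_unshift hg.
exists (Num.min d1 d2) => // z za zd; rewrite -Fg ?subr_eq0 //.
by rewrite /F addrC subrK.
Qed.

Lemma nr_bounded f a : cc f a -> nb a (fun z => nrm (f z) <= nrm (f a) + 1).
Proof.
move=> cf; have [d d0 hd] := cf _ ltr01; exists d => // z /hd h.
by have := nrmBD (f z) (f a); lra.
Qed.

Lemma cc_agree f g a : cc f a -> cc g a -> nr a (fun z => f z = g z) -> f a = g a.
Proof.
move=> cf cg e; apply/eqP; rewrite -subr_eq0; apply: contraT => n.
have [z za [/eqP]] : exists2 z, z != a & f z - g z != 0 /\ f z = g z.
  apply: nr_ex; apply: nrS2 e (nb_nr (cc_neq0 (gcB cf cg) n)) => z _ -> //.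
by move=> h1 h2; case: h1; rewrite h2 subrr.
Qed.

End Holomorphic.

Section Meromorphic.
Context {R : realType}.
Local Notation C := R[i].
Implicit Types (f g h u v : C -> C) (a z : C) (m k : int).

(** The holomorphic factor [u] stands for the Laurent expansion. [ordge] admits functions that
    vanish near [a], [hasord] does not; accordingly [nzm] describes meromorphic functions that
    vanish identically near no point. *)
Definition ordge h a m := exists2 u, hol u a & nr a (fun z => h z = u z * (z - a) ^ m).
Definition hasord h a m := exists u, [/\ hol u a, u a != 0 &
  nr a (fun z => h z = u z * (z - a) ^ m)].
Definition zat h a := nr a (fun z => h z = 0).
Definition mero h := forall a, exists m, ordge h a m.
Definition nzm h := forall a, exists m, hasord h a m.

Lemma hasord_ge h a m : hasord h a m -> ordge h a m.
Proof. by case=> u [hu _ e]; exists u. Qed.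

Lemma nzm_mero h : nzm h -> mero h.
Proof. by move=> hh a; have [m /hasord_ge] := hh a; exists m. Qed.

Lemma ordge_ext h g a m : nr a (fun z => h z = g z) -> ordge h a m -> ordge g a m.
Proof. by move=> e [u hu hE]; exists u => //; apply: nrS2 e hE => z _ <-. Qed.

Lemma hasord_ext h g a m : nr a (fun z => h z = g z) -> hasord h a m -> hasord g a m.
Proof. by move=> e [u [hu u0 hE]]; exists u; split => //; apply: nrS2 e hE => z _ <-. Qed.

Lemma subC_neq0 z a : z != a -> z - a != 0. Proof. by rewrite subr_eq0. Qed.

Lemma ordge_weak h a m k : (k <= m)%R -> ordge h a m -> ordge h a k.
Proof.
move=> km [u hu hE]; have [n nE] : exists n : nat, m = k + n%:Z.
  by exists `|m - k|%N; lia.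
exists (fun z => u z * (z - a) ^+ n).
  by apply: holM => //; apply: holX; exact: hol_sub.
apply: nrS hE => z /subC_neq0 za ->; rewrite nE expfzDr // mulrCA mulrC.
by rewrite mulrAC -mulrA.
Qed.

Lemma ordgeD f g a m : ordge f a m -> ordge g a m -> ordge (fun z => f z + g z) a m.
Proof.
move=> [u hu e1] [v hv e2]; exists (fun z => u z + v z); first exact: holD.
by apply: nrS2 e1 e2 => z _ -> ->; rewrite mulrDl.
Qed.

Lemma ordgeN f a m : ordge f a m -> ordge (fun z => - f z) a m.
Proof.
move=> [u hu e1]; exists (fun z => - u z); first exact: holN.
by apply: nrS e1 => z _ ->; rewrite mulNr.
Qed.

Lemma ordgeB f g a m : ordge f a m -> ordge g a m -> ordge (fun z => f z - g z) a m.
Proof. by move=> hf hg; apply: ordgeD => //; exact: ordgeN. Qed.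

Lemma ordgeM f g a m k : ordge f a m -> ordge g a k -> ordge (fun z => f z * g z) a (m + k).
Proof.
move=> [u hu e1] [v hv e2]; exists (fun z => u z * v z); first exact: holM.
by apply: nrS2 e1 e2 => z /subC_neq0 za -> ->; rewrite expfzDr // mulrACA.
Qed.

Lemma hol_ordge f a : hol f a -> ordge f a 0.
Proof. by move=> hf; exists f => //; apply: nrW => z _; rewrite expr0z mulr1. Qed.

Lemma hol_hasord0 f a : hol f a -> f a != 0 -> hasord f a 0.
Proof.
by move=> hf fa; exists f; split => //; apply: nrW => z _; rewrite expr0z mulr1.
Qed.

Lemma hasordM f g a m k : hasord f a m -> hasord g a k -> hasord (fun z => f z * g z) a (m + k).
Proof.
move=> [u [hu u0 e1]] [v [hv v0 e2]]; exists (fun z => u z * v z); split.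
- exact: holM.
- by rewrite mulf_neq0.
- by apply: nrS2 e1 e2 => z /subC_neq0 za -> ->; rewrite expfzDr // mulrACA.
Qed.

Lemma hasordV f a m : hasord f a m -> hasord (fun z => (f z)^-1) a (- m).
Proof.
move=> [u [hu u0 e1]]; exists (fun z => (u z)^-1); split.
- exact: holV.
- by rewrite invr_eq0.
- by apply: nrS e1 => z za ->; rewrite invfM invr_expz.
Qed.

Lemma hasord_div f g a m k : hasord f a m -> hasord g a k -> hasord (fun z => f z / g z) a (m - k).
Proof. by move=> hf hg; apply: hasordM => //; exact: hasordV. Qed.

Lemma hasordX f a m n : hasord f a m -> hasord (fun z => f z ^+ n) a (m *+ n).
Proof.
move=> hf; elim: n => [|n IH].
  rewrite mulr0n; apply: (@hasord_ext (fun=> 1)); first by apply: nrW => z _; rewrite expr0.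
  by apply: hol_hasord0; [exact: hol_cst | exact: oner_neq0].
rewrite mulrS; apply: hasord_ext (hasordM hf IH).
by apply: nrW => z _; rewrite exprS.
Qed.

Lemma hasord_neq0 f a m : hasord f a m -> nr a (fun z => f z != 0).
Proof.
move=> [u [hu u0 e]]; apply: nrS2 e (nb_nr (cc_neq0 (hol_cc hu) u0)) => z za -> uz.
by rewrite mulf_neq0 // expfz_neq0 // subC_neq0.
Qed.

Lemma hasord_zat f a m : hasord f a m -> ~ zat f a.
Proof.
move=> /hasord_neq0 h1 h2; apply: (@nr_false R a); apply: nrS2 h1 h2 => z _ /eqP h e.
by case: h.
Qed.

Lemma hasord_uniq_le f a m k : hasord f a m -> ordge f a k -> (k <= m)%R.
Proof.
move=> [u [hu u0 e1]] [v hv e2]; rewrite leNgt; apply/negP => mk.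
have [n nE] : exists n : nat, k = m + n.+1%:Z.
  by exists `|k - m|.-1; lia.
have : u a = v a * (a - a) ^+ n.+1.
  apply: (@cc_agree _ u (fun z => v z * (z - a) ^+ n.+1)); first exact: hol_cc.
    by apply: hol_cc; apply: holM => //; apply: holX; exact: hol_sub.
  apply: nrS2 e1 e2 => z /subC_neq0 za -> /eqP.
  rewrite nE expfzDr // mulrCA mulrC -subr_eq0 -mulrBr.
  rewrite mulf_eq0 (negbTE (expfz_neq0 _ za)) /= subr_eq0 => /eqP ->.
  by [].
by rewrite subrr expr0n mulr0 => /eqP; rewrite (negbTE u0).
Qed.

Lemma hasord_uniq f a m k : hasord f a m -> hasord f a k -> m = k.
Proof.
move=> h1 h2; apply/eqP; rewrite eq_le.
by rewrite (hasord_uniq_le h1 (hasord_ge h2)) (hasord_uniq_le h2 (hasord_ge h1)).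
Qed.

Lemma ordge_dich f a m : ordge f a m -> zat f a \/ exists2 k, (m <= k)%R & hasord f a k.
Proof.
move=> [u hu e]; have [z0|[n [g [hg g0 ug]]]] := hol_zero_or_factor hu; [left | right].
  by apply: nrS2 e (nb_nr z0) => z _ -> ->; rewrite mul0r.
exists (m + n%:Z); first by rewrite lerDl.
exists g; split => //; apply: nrS2 e (nb_nr ug) => z /subC_neq0 za -> ->.
by rewrite expfzDr // -mulrA mulrC -mulrA.
Qed.

Lemma hasordD f g a m : hasord f a m -> ordge g a (m + 1) -> hasord (fun z => f z + g z) a m.
Proof.
move=> [u [hu u0 e1]] [v hv e2]; exists (fun z => u z + v z * (z - a)); split.
- by apply: holD => //; apply: holM => //; exact: hol_sub.
- by rewrite subrr mulr0 addr0.
- apply: nrS2 e1 e2 => z /subC_neq0 za -> ->.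
  by rewrite expfzDr // expr1z mulrDl; congr (_ + _); rewrite mulrAC mulrA.
Qed.

Lemma mero_cst (c : C) : mero (fun=> c).
Proof. by move=> a; exists 0; apply: hol_ordge; exact: hol_cst. Qed.

Lemma meroD f g : mero f -> mero g -> mero (fun z => f z + g z).
Proof.
move=> hf hg a; have [m fm] := hf a; have [k gk] := hg a.
by exists (Num.min m k); apply: ordgeD; apply: ordge_weak;
  [|exact: fm| |exact: gk]; rewrite ge_min lexx ?orbT.
Qed.

Lemma meroN f : mero f -> mero (fun z => - f z).
Proof. by move=> hf a; have [m fm] := hf a; exists m; exact: ordgeN. Qed.

Lemma meroB f g : mero f -> mero g -> mero (fun z => f z - g z).
Proof. by move=> hf hg; apply: meroD => //; exact: meroN. Qed.

Lemma meroM f g : mero f -> mero g -> mero (fun z => f z * g z).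
Proof.
by move=> hf hg a; have [m fm] := hf a; have [k gk] := hg a; exists (m + k); exact: ordgeM.
Qed.

Lemma cd_sub_exprz a z m : z != a -> cd (fun z => (z - a) ^ m) z (m%:~R * (z - a) ^ (m - 1)).
Proof.
move=> za; have z0 := subC_neq0 za.
have D : cd (fun z => z - a) z 1.
  by rewrite -[X in cd _ _ X]subr0; apply: gdB; [exact: gd_emb | exact: gd_cst].
have X n : cd (fun z => (z - a) ^+ n.+1) z (n.+1%:R * (z - a) ^+ n).
  elim: n => [|n IH]; first by rewrite mul1r.
  have -> : n.+2%:R * (z - a) ^+ n.+1 = 1 * (z - a) ^+ n.+1 + (z - a) * (n.+1%:R * (z - a) ^+ n).
    by rewrite exprS -[n.+2]addn1 natrD; ring.
  by apply: gd_near (gdM D IH); exists 1 => // s _; rewrite exprS.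
case: m => [[|n]|n].
- by rewrite mul0r; exact: gd_cst.
- by rewrite (_ : n.+1%:Z - 1 = n%:Z); [exact: X | lia].
rewrite (_ : Negz n - 1 = Negz n.+1); last by lia.
have := gdV (f := fun z => (z - a) ^+ n.+1) _ (X n).
rewrite expf_neq0 // => /(_ isT).
have -> : (Negz n)%:~R * (z - a) ^ Negz n.+1 = - (n.+1%:R * (z - a) ^+ n) / ((z - a) ^+ n.+1) ^+ 2.
  rewrite NegzE mulrNz /= -[(z - a) ^ Negz n.+1]/(((z - a) ^+ n.+2)^-1) !exprS.
  by field; rewrite expf_neq0 // z0.
by [].
Qed.

Lemma ordge_cd h a m : ordge h a m -> nr a (fun z => cd h z (derive1 h z)).
Proof.
move=> [u hu e]; apply: nrS2 (nr_nb e) (nb_nr hu) => z za ez [l ul].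
have D := gdM ul (cd_sub_exprz m za).
have : cd h z (l * (z - a) ^ m + u z * (m%:~R * (z - a) ^ (m - 1))).
  by apply: cd_near D; apply: nbS ez => w ->.
by move=> /cd_derivable[/derivable_cd].
Qed.

Lemma mero_cd h a : mero h -> nr a (fun z => cd h z (derive1 h z)).
Proof. by move=> hh; have [m /ordge_cd] := hh a. Qed.

Lemma derive1_near f g a : nr a (fun z => f z = g z) ->
  nr a (fun z => cd f z (derive1 f z)) -> nr a (fun z => derive1 f z = derive1 g z).
Proof.
move=> /nr_nb e; apply: nrS2 e => z _ ez fz.
by have [_ ->] := cd_derivable (cd_near ez fz).
Qed.

Lemma derive_factor u h a m : hol u a -> nr a (fun z => h z = u z * (z - a) ^ m) ->
  nr a (fun z => derive1 h z = (derive1 u z * (z - a) + m%:~R * u z) * (z - a) ^ (m - 1)).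
Proof.
move=> hu e; apply: nrS2 (nr_nb e) (nb_nr (hol_nb hu)) => z za ez uz.
have z0 := subC_neq0 za.
have D := gdM (hol_cd uz) (cd_sub_exprz m za).
have [_ ->] := cd_derivable (cd_near (f := fun z => u z * (z - a) ^ m) (g := h)
  (nbS (fun w => @esym _ _ _) ez) D).
rewrite -{1}[m](subrK 1) expfzDr // expr1z; ring.
Qed.

Lemma ordge_derive h a m : ordge h a m -> ordge (derive1 h) a (m - 1).
Proof.
move=> [u hu e]; exists (fun z => derive1 u z * (z - a) + m%:~R * u z).
  apply: holD; first by apply: holM; [exact: hol_derive | exact: hol_sub].
  by apply: holM => //; exact: hol_cst.
exact: derive_factor.
Qed.

Lemma ordge_derive0 h a : ordge h a 0 -> ordge (derive1 h) a 0.
Proof.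
move=> h0; have [u hu e] := h0; exists (derive1 u); first exact: hol_derive.
have {}e : nr a (fun z => h z = u z) by apply: nrS e => z _ ->; rewrite expr0z mulr1.
by apply: nrS (derive1_near e (ordge_cd h0)) => z _ ->; rewrite expr0z mulr1.
Qed.

Lemma hasord_derive h a m : m != 0 -> hasord h a m -> hasord (derive1 h) a (m - 1).
Proof.
move=> m0 [u [hu u0 e]]; exists (fun z => derive1 u z * (z - a) + m%:~R * u z); split.
- apply: holD; first by apply: holM; [exact: hol_derive | exact: hol_sub].
  by apply: holM => //; exact: hol_cst.
- by rewrite subrr mulr0 add0r mulf_neq0 // intr_eq0.
- exact: derive_factor.
Qed.

Lemma mero_derive h : mero h -> mero (derive1 h).
Proof. by move=> hh a; have [m hm] := hh a; exists (m - 1); exact: ordge_derive. Qed.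

Lemma hasord_logder h a m : hasord h a m -> exists2 v, hol v a &
  nr a (fun z => derive1 h z / h z = m%:~R / (z - a) + v z).
Proof.
move=> [u [hu u0 e]]; exists (fun z => derive1 u z * (u z)^-1).
  by apply: holM; [exact: hol_derive | exact: holV].
apply: nrS3 (derive_factor hu e) e (nb_nr (cc_neq0 (hol_cc hu) u0)) => z /subC_neq0 za -> -> uz.
have E : (z - a) ^ m = (z - a) ^ (m - 1) * (z - a).
  by rewrite -[in LHS](subrK 1 m) expfzDr // expr1z.
have q0 : (z - a) ^ (m - 1) != 0 by exact: expfz_neq0.
by rewrite E; field; rewrite q0 za uz.
Qed.

Lemma ordge_logder h a m : hasord h a m -> ordge (fun z => derive1 h z / h z) a (- 1).
Proof.
move=> /hasord_logder[v hv e]; exists (fun z => m%:~R + v z * (z - a)).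
  by apply: holD; [exact: hol_cst | apply: holM => //; exact: hol_sub].
apply: nrS e => z /subC_neq0 za ->; rewrite exprN1; by field.
Qed.

Lemma ordge_logder_sub h g a m : hasord h a m -> hasord g a m ->
  ordge (fun z => derive1 h z / h z - derive1 g z / g z) a 0.
Proof.
move=> /hasord_logder[v hv e] /hasord_logder[w hw e']; exists (fun z => v z - w z).
  exact: holB.
apply: nrS2 e e' => z _ E1 E2.
apply: (etrans (congr2 (fun x y => x - y) E1 E2)); rewrite [RHS]mulr1.
by move: (m%:~R / (z - a)) => x; ring.
Qed.

Lemma hasord_discrete h a m : hasord h a m -> nr a (fun z => hasord h z 0).
Proof.
move=> [u [hu u0 e]].
apply: nrS3 (nr_nb e) (nb_nr (hol_nb hu)) (nb_nr (cc_neq0 (hol_cc hu) u0)) => z za ez uz u1.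
have z0 := subC_neq0 za.
apply: (@hasord_ext (fun w => u w * (w - a) ^ m)); first by apply: nb_nr; apply: nbS ez.
apply: hol_hasord0; last by rewrite mulf_neq0 // expfz_neq0.
by apply: holM => //; apply: hol_exprz => //; exact: hol_sub.
Qed.

Lemma zat_open h a : zat h a -> nb a (zat h).
Proof.
move=> h0; apply/nb_nrP; split=> //.
by apply: nrS (nr_nb h0) => z _; exact: nb_nr.
Qed.

(** Connectedness of [[0, 1]], through the supremum of the initial segments on which [P] holds. *)
Lemma connected_segment (P : R -> Prop) : P 0 ->
  (forall t, 0 <= t <= 1 -> P t -> exists2 d : R, 0 < d & forall s, `|s - t| < d -> P s) ->
  (forall t, 0 <= t <= 1 -> ~ P t -> exists2 d : R, 0 < d & forall s, `|s - t| < d -> ~ P s) -> P 1.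
Proof.
move=> P0 hP hN.
pose E := [set t : R | 0 <= t <= 1 /\ forall s, 0 <= s <= t -> P s].
have E0 : E 0.
  by split=> [|s]; rewrite ?lexx ?ler01 //= => /andP[s0 s1]; rewrite (@le_anti _ _ s 0) // s1 s0.
have ubE : ubound E 1 by move=> t [/andP[]].
have hs : has_sup E by split; [exists 0 | exists 1].
set c := sup E.
have c0 : 0 <= c by apply: ub_le_sup => //; exists 1.
have c1 : c <= 1 by apply: ge_sup => //; exists 0.
have below s : 0 <= s -> s < c -> P s.
  move=> s0 sc; have [t [_ tE] st] := sup_adherent (ltac:(by rewrite subr_gt0) : 0 < c - s) hs.
  by apply: tE; rewrite s0 /=; apply: ltW; move: st; rewrite /c subKr.
have Pc : P c.
  apply: contrapT => /(hN c (introT andP (conj c0 c1)))[d d0 hd].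
  have [cp|cn] := ltP 0 c; last by apply: (hd 0) => //; rewrite sub0r normrN (@le_anti _ _ c 0) ?cn ?normr0.
  pose s := Num.max 0 (c - d / 2).
  have s0 : 0 <= s by rewrite le_max lexx.
  have sc : s < c by rewrite gt_max cp gtrBl divr_gt0.
  apply: (hd s); last exact: below.
  rewrite distrC ger0_norm ?subr_ge0 ?(ltW sc) //.
  have : c - d / 2 <= s by rewrite le_max lexx orbT.
  by move=> ?; lra.
have [d d0 hd] := hP c (introT andP (conj c0 c1)) Pc.
have [c1'|//] := ltP c 1; last by move=> h; rewrite (@le_anti _ _ 1 c) // h c1.
pose t := Num.min 1 (c + d / 2).
have ct : c < t by rewrite lt_min c1' ltrDl divr_gt0.
have : t <= c.
  apply: ub_le_sup; first by exists 1.
  split; first by rewrite (le_trans c0 (ltW ct)) ge_min lexx.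
  move=> s /andP[s0 st]; have [sc|cs] := ltP s c; first exact: below.
  apply: hd; rewrite ger0_norm ?subr_ge0 //.
  have : t <= c + d / 2 by rewrite ge_min lexx orbT.
  by move=> ?; lra.
by rewrite leNgt ct.
Qed.

(** Vanishing near a point is an open condition, and so is its negation: where [h] has an order, it
    is nonzero throughout a punctured neighbourhood. Hence the condition is constant along the
    segment from [a] to [b]. *)
Lemma identity_theorem h a b : mero h -> zat h a -> zat h b.
Proof.
move=> hh ha; pose c (t : R) := a + t%:C * (b - a).
have cE s t : c s - c t = (s - t)%:C * (b - a) by rewrite /c rcB; ring.
have L : 0 < nrm (b - a) + 1 by rewrite ltr_wpDl.
have cd t (d : R) : 0 < d -> exists2 d', 0 < d' & forall s, `|s - t| < d' -> nrm (c s - c t) < d.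
  move=> d0; exists (d / (nrm (b - a) + 1)); first exact: divr_gt0.
  move=> s; rewrite ltr_pdivlMr // cE nrmM nrm_real; apply: le_lt_trans.
  by apply: ler_wpM2l => //; rewrite lerDl.
have := @connected_segment (fun t => zat h (c t)).
rewrite /c mul0r addr0 mul1r [a + _]addrC subrK; apply=> // t _ ht.
- have [d d0 hd] := zat_open ht; have [d' d'0 hd'] := cd t d d0.
  by exists d' => // s /hd' /hd.
- have [m /ordge_dich[//|[k _ hk]]] := hh (c t).
  have /nb_nrP : nr (c t) (fun z => ~ zat h z) /\ ~ zat h (c t).
    by split=> //; apply: nrS (hasord_discrete hk) => z _; exact: hasord_zat.
  move=> [d d0 hd]; have [d' d'0 hd'] := cd t d d0.
  by exists d' => // s /hd' /hd.
Qed.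

Lemma mero_nzm h : mero h -> nzm h \/ forall a, zat h a.
Proof.
move=> hh; have [[a ha]|n] := pselect (exists a, zat h a); [right | left] => b.
  exact: identity_theorem ha.
by have [m /ordge_dich[hb|[k _ hk]]] := hh b; [case: n; exists b | exists k].
Qed.

(* [ord h a = 0] if [h] vanishes identically near [a]. *)
Definition ord h a : int := xget 0 [set m | hasord h a m].

Lemma ordP h a : nzm h -> hasord h a (ord h a).
Proof. by move=> /(_ a)[m hm]; exact: (@xgetPex _ _ [set m | hasord h a m] (ex_intro _ m hm)). Qed.

Lemma ordE h a m : hasord h a m -> ord h a = m.
Proof.
move=> hm; have := @xgetPex _ 0 [set m | hasord h a m] (ex_intro _ m hm).
by move=> /= h'; exact: hasord_uniq h' hm.
Qed.

Lemma ord_ge h a m : nzm h -> ordge h a m -> (m <= ord h a)%R.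
Proof. by move=> /(ordP a); exact: hasord_uniq_le. Qed.

Lemma nzmM f g : nzm f -> nzm g -> nzm (fun z => f z * g z).
Proof. by move=> hf hg a; exists (ord f a + ord g a); apply: hasordM; exact: ordP. Qed.

Lemma nzmV f : nzm f -> nzm (fun z => (f z)^-1).
Proof. by move=> hf a; exists (- ord f a); apply: hasordV; exact: ordP. Qed.

Lemma nzmX f n : nzm f -> nzm (fun z => f z ^+ n).
Proof. by move=> hf a; exists (ord f a *+ n); apply: hasordX; exact: ordP. Qed.

(** Required at every point of the plane, not only at points of [B]; so [B] is closed as well as
    discrete. *)
Definition discr (B : set C) := forall a, nr a (fun z => ~ B z).

Lemma discrU A B : discr A -> discr B -> discr (A `|` B).
Proof. by move=> hA hB a; apply: nrS2 (hA a) (hB a) => z _ ? ? []. Qed.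

Lemma discr_sub A B : A `<=` B -> discr B -> discr A.
Proof. by move=> AB hB a; apply: nrS (hB a) => z _ nB /AB. Qed.

Lemma square_compact (r : R) : compact [set z : C | `|Re z| <= r /\ `|Im z| <= r].
Proof.
pose F (p : R * R) : C := p.1 +i* p.2.
have -> : [set z : C | `|Re z| <= r /\ `|Im z| <= r] = F @` (`[- r, r] `*` `[- r, r]).
  apply/seteqP; split=> [[x y] /= [hx hy]|_ [[x y] [/= hx hy] <-]].
    by exists (x, y) => //=; rewrite !in_itv /= -!ler_norml.
  by rewrite /F /= !ler_norml; move: hx hy; rewrite !in_itv.
apply: continuous_compact; last by apply: compact_setX; exact: segment_compact.
apply: continuous_subspaceT => p; apply: (cvgCI (FF := nbhs_filter p)) => e e0.
have e2 : 0 < e / 2 by rewrite divr_gt0.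
exists ([set x | `|x - p.1| < e / 2], [set y | `|y - p.2| < e / 2]).
  by split; exact: (nearRI e2).
move=> [x y] /= [hx hy]; apply: le_lt_trans (nrm_le_ReIm _) _.
by rewrite [e]splitr cReD cReN cImD cImN /= ltrD.
Qed.

(** If the set were infinite, the sets containing all but finitely many of its points would form a
    proper filter on a compact square, and a cluster point of it would be an accumulation point of
    [B]. *)
Lemma discr_finite B (r : R) : discr B -> finite_set (B `&` [set z | nrm z <= r]).
Proof.
move=> hB; apply: contrapT => infS; set S := B `&` _ in infS.
pose F : set (set C) := [set A | finite_set (S `\` A)].
have FF : ProperFilter F.
  split; first by rewrite /F /= setD0.
  split; rewrite /F /=.
  - by rewrite setDT.
  - by move=> P Q /= fP fQ; rewrite /= setDIr finite_setU.
  - by move=> P Q PQ; apply: sub_finite_set => z [Sz nQ]; split => // /PQ.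
have [|a [_ ca]] := @square_compact r F FF _.
  rewrite /F /= (_ : _ `\` _ = set0) // -subset0 => z [[_ zr]] /=; apply.
  by split; [exact: le_trans (Re_le_nrm z) zr | exact: le_trans (Im_le_nrm z) zr].
have [d d0 hd] := hB a.
have [] := ca (S `\ a) [set z | nrm (z - a) < d].
- rewrite /F /= setDD; apply: (@sub_finite_set _ _ [set a]) => [z [_ ]|] //=.
- exact: (nearCI d0).
- by move=> z [[[Bz _] za] zd]; apply: (hd z) => //; apply/eqP.
Qed.

End Meromorphic.

(** * Mean values of logarithms *)

Section RealMean.
Context {R : realType}.
Local Notation C := R[i].
Implicit Types (u v : C -> R) (f g : C -> C).

Definition rmean u (r : R) : R := Re (cmean (fun z => (u z)%:C) r).
Definition rcon (r : R) u := con r (fun z => (u z)%:C).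

Let twopi : 0 <= 2 * pi :> R.
Proof. by rewrite mulr_ge0 // pi_ge0. Qed.

Lemma rmean_ge0 u (r : R) : 0 <= r -> rcon r u -> (forall z, nrm z = r -> 0 <= u z) -> 0 <= rmean u r.
Proof.
move=> r0 cu hu; rewrite /rmean /cmean cReMr mulr_ge0 ?invr_ge0 // /cint cReD cReN subr_ge0.
set U := prim _.
have dU t : 0 <= t <= 2 * pi -> is_derive t (1 : R) (fun s => Re (U s)) (u (circ r t)).
  move=> /andP[t0 _]; have := rd_prim cu t0; by rewrite -/U => /rdP[].
have cU : {within `[0, 2 * pi], continuous (fun s => Re (U s))}.
  apply/continuous_in_subspaceT => t; rewrite inE /= in_itv /= => h.
  exact: is_derive_continuousR (dU t h).
have [|c hc e] := @MVT_segment R (fun s => Re (U s)) (fun t => u (circ r t)) 0 (2 * pi) twopi _ cU.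
  by move=> t; rewrite in_itv /= => /andP[t0 t1]; apply: dU; rewrite !ltW.
by rewrite -subr_ge0 e subr0 mulr_ge0 // hu // nrm_circ.
Qed.

Lemma Im_cmean_real u (r : R) : rcon r u -> Im (cmean (fun z => (u z)%:C) r) = 0.
Proof.
move=> cu; rewrite /cmean cImMr /cint cImD cImN; set U := prim _.
have := @rd_cst R (fun t => (Im (U t))%:C) 0 (2 * pi) twopi _.
move=> h; have /(f_equal Re) /= -> : (Im (U (2 * pi)))%:C = (Im (U 0))%:C.
  apply: h => t /andP[t0 _]; have := rd_prim cu t0; rewrite -/U => /rdP[_ /= h].
  apply/rdP; split => /=; [exact: h | exact: is_derive_cst].
by rewrite subrr mulr0.
Qed.

Lemma rmeanD u v (r : R) : rcon r u -> rcon r v ->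
  rmean (fun z => u z + v z) r = rmean u r + rmean v r.
Proof.
move=> cu cv; rewrite /rmean -cReD -cmeanD //; congr (Re (cmean _ r)).
by apply/funext => z; rewrite rcD.
Qed.

Lemma rmeanZ c u (r : R) : rcon r u -> rmean (fun z => c * u z) r = c * rmean u r.
Proof.
move=> cu; rewrite /rmean -cReMr -cmeanZ //; congr (Re (cmean _ r)).
by apply/funext => z; rewrite rcM.
Qed.

Lemma rcon_cst (r c : R) : rcon r (fun=> c). Proof. exact: con_cst. Qed.

Lemma rcon_ext (r : R) u v : (forall z, u z = v z) -> rcon r u -> rcon r v.
Proof. by move=> /funext ->. Qed.

Lemma rconD (r : R) u v : rcon r u -> rcon r v -> rcon r (fun z => u z + v z).
Proof.
move=> cu cv t; have := conD cu cv t; congr (rc _ t).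
by apply/funext => s; rewrite rcD.
Qed.

Lemma rconM (r : R) u v : rcon r u -> rcon r v -> rcon r (fun z => u z * v z).
Proof.
move=> cu cv t; have := conM cu cv t; congr (rc _ t).
by apply/funext => s; rewrite rcM.
Qed.

Lemma rconZ (r c : R) u : rcon r u -> rcon r (fun z => c * u z).
Proof. by move=> cu; apply: rconM => //; exact: rcon_cst. Qed.

Lemma rconN (r : R) u : rcon r u -> rcon r (fun z => - u z).
Proof. by move=> /(rconZ (- 1)); apply: rcon_ext => z; rewrite mulN1r. Qed.

Lemma rconB (r : R) u v : rcon r u -> rcon r v -> rcon r (fun z => u z - v z).
Proof. by move=> cu cv; apply: rconD => //; exact: rconN. Qed.

Lemma rcon_sum (r : R) I (s : seq I) (F : I -> C -> R) :
  (forall i, rcon r (F i)) -> rcon r (fun z => \sum_(i <- s) F i z).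
Proof.
move=> cF; elim: s => [|i s IH].
  by apply: (@rcon_ext r (fun=> 0)); [move=> z; rewrite big_nil | exact: rcon_cst].
by apply: rcon_ext (rconD (cF i) IH) => z; rewrite big_cons.
Qed.

Lemma rmean_cst c (r : R) : rmean (fun=> c) r = c.
Proof. by rewrite /rmean cmean_cst. Qed.

Lemma rmeanB u v (r : R) : rcon r u -> rcon r v ->
  rmean (fun z => u z - v z) r = rmean u r - rmean v r.
Proof.
move=> cu cv.
have -> : (fun z => u z - v z) = (fun z => u z + - 1 * v z).
  by apply/funext => z; rewrite mulN1r.
rewrite rmeanD; [|exact: cu|exact: rconZ].
by rewrite (rmeanZ _ cv) mulN1r.
Qed.

Lemma rmean_le u v (r : R) : 0 <= r -> rcon r u -> rcon r v ->
  (forall z, nrm z = r -> u z <= v z) -> rmean u r <= rmean v r.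
Proof.
move=> r0 cu cv h; rewrite -subr_ge0 -rmeanB //; apply: rmean_ge0 => //; first exact: rconB.
by move=> z /h; rewrite subr_ge0.
Qed.

Lemma rmean_eq u v (r : R) : 0 <= r -> rcon r u -> rcon r v ->
  (forall z, nrm z = r -> u z = v z) -> rmean u r = rmean v r.
Proof.
move=> r0 cu cv h; apply/eqP; rewrite eq_le.
by apply/andP; split; apply: rmean_le => // z zr; rewrite h.
Qed.

Lemma rmean_sum (r : R) I (s : seq I) (F : I -> C -> R) : (forall i, rcon r (F i)) ->
  rmean (fun z => \sum_(i <- s) F i z) r = \sum_(i <- s) rmean (F i) r.
Proof.
move=> cF; elim: s => [|i s IH].
  have -> : (fun z => \sum_(i <- [::]) F i z) = (fun=> 0).
    by apply/funext => z; rewrite big_nil.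
  by rewrite rmean_cst big_nil.
have -> : (fun z => \sum_(j <- i :: s) F j z) = (fun z => F i z + \sum_(j <- s) F j z).
  by apply/funext => z; rewrite big_cons.
rewrite rmeanD; [|exact: cF|exact: rcon_sum].
by rewrite IH big_cons.
Qed.

Lemma rcon_comp (r : R) u (phi : R -> R) : 0 <= r -> rcon r u ->
  (forall z, nrm z = r -> {for u z, continuous phi}) -> rcon r (fun z => phi (u z)).
Proof.
move=> r0 cu hphi t e e0.
have := hphi _ (nrm_circ t r0).
move=> /(@cvgRE _ _ _ (nbhs_filter _) phi) /(_ e e0) /nearRP[d d0 hd].
have [d' d'0 hd'] := cu t d d0; exists d' => // s /hd'.
by rewrite -!rcB !nrm_real; exact: hd.
Qed.

Lemma rcon_nrm (r : R) f : con r f -> rcon r (fun z => nrm (f z)).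
Proof.
move=> cf t e e0; have [d d0 hd] := cf t e e0; exists d => // s /hd.
rewrite -rcB nrm_real; apply: le_lt_trans; rewrite ler_norml.
by apply/andP; split; last exact: nrmBD; rewrite lerNl opprB nrmB nrmBD.
Qed.

Lemma rcon_Re (r : R) f : con r f -> rcon r (fun z => Re (f z)).
Proof.
move=> cf t e e0; have [d d0 hd] := cf t e e0; exists d => // s /hd.
by rewrite -rcB nrm_real; apply: le_lt_trans; rewrite -cReN -cReD Re_le_nrm.
Qed.

Lemma rcon_Im (r : R) f : con r f -> rcon r (fun z => Im (f z)).
Proof.
move=> cf t e e0; have [d d0 hd] := cf t e e0; exists d => // s /hd.
by rewrite -rcB nrm_real; apply: le_lt_trans; rewrite -cImN -cImD Im_le_nrm.
Qed.

Lemma rcon_abs (r : R) u : rcon r u -> rcon r (fun z => `|u z|).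
Proof. by move=> cu; apply: rcon_ext (rcon_nrm cu) => z; rewrite nrm_real. Qed.

Lemma rcon_ln (r : R) u : 0 <= r -> rcon r u -> (forall z, nrm z = r -> 0 < u z) ->
  rcon r (fun z => ln (u z)).
Proof. by move=> r0 cu h; apply: rcon_comp => // z zr; apply: continuous_ln; exact: h. Qed.

Lemma rmean_Re f (r : R) : con r f -> rmean (fun z => Re (f z)) r = Re (cmean f r).
Proof.
move=> cf; have E : f = (fun z => (Re (f z))%:C + 'i * (Im (f z))%:C).
  by apply/funext => z; rewrite -complexE.
have cR := rcon_Re cf; have cI := rcon_Im cf.
rewrite [in RHS]E cmeanD //; last by apply: conM => //; exact: con_cst.
have iE : cmean (fun z => 'i * (Im (f z))%:C) r = 'i * cmean (fun z => (Im (f z))%:C) r.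
  exact: cmeanZ.
have iR (w : C) : Re ('i * w) = - Im w by rewrite cReM /= mul0r mul1r sub0r.
by rewrite iE cReD iR Im_cmean_real // oppr0 addr0.
Qed.

Lemma ball_convex (r : R) : convexC [set z : C | nrm z <= r].
Proof.
move=> p q t /= pr qr /andP[t0 t1].
have -> : p + t%:C * (q - p) = (1 - t)%:C * p + t%:C * q by rewrite rcB; ring.
apply: le_trans (nrmD _ _) _; rewrite !nrmM !nrm_real !ger0_norm ?subr_ge0 //.
by apply: le_trans (lerD (ler_wpM2l _ pr) (ler_wpM2l t0 qr)) _; rewrite ?subr_ge0 // -mulrDl subrK mul1r.
Qed.

Lemma ball_closed (r : R) : closedC [set z : C | nrm z <= r].
Proof.
move=> z h /=; apply/ler_addgt0Pl => e /h[w /= wr wz].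
by have := nrmBD z w; rewrite nrmB in wz => ?; lra.
Qed.

Lemma hol_primitive f (rho : R) : 0 < rho -> hol_on (fun z => nrm z < rho) f ->
  exists2 L, L 0 = 0 & forall z, nrm z < rho -> cd L z (f z).
Proof.
move=> rho0 hf; exists (fun z => sint f 0 z - sint f 0 0); first by rewrite subrr.
move=> z zr; rewrite -[f z]subr0; apply: gdB; last exact: gd_cst.
pose r := (nrm z + rho) / 2.
have [zr1 rr] : nrm z < r /\ r < rho by rewrite /r; split; lra.
apply: (@cd_sint _ [set z | nrm z <= r]).
- exact: ball_convex.
- exact: ball_closed.
- by move=> w /= wr; apply: hf; exact: le_lt_trans rr.
- by rewrite /= nrm0; apply: le_trans (ltW zr1).
- exists (r - nrm z); first by rewrite subr_gt0.
  by move=> w /= wz; have := nrmD (w - z) z; rewrite subrK => ?; lra.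
Qed.

(** The logarithm [L] is a primitive of [f' / f]; then [f * cexp (- L)] has derivative [0]. *)
Lemma zero_free_exp f (rho : R) : 0 < rho -> hol_on (fun z => nrm z < rho) f ->
  (forall z, nrm z < rho -> f z != 0) ->
  exists L, [/\ hol_on (fun z => nrm z < rho) L, L 0 = 0,
    (forall z, nrm z < rho -> cd L z (derive1 f z / f z)) &
    forall z, nrm z < rho -> f z = f 0 * cexp (L z)].
Proof.
move=> rho0 hf f0.
have [f' [df hf']] := hol_derive_disc hf.
have f'E z : nrm z < rho -> derive1 f z = f' z by move=> /df /cd_derivable[].
have hq : hol_on (fun z => nrm z < rho) (fun z => f' z * (f z)^-1).
  move=> z zr; have [l hl] := hf' z zr; eexists; apply: gdM; first exact: hl.
  by apply: gdV; [exact: f0 | exact: df].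
have [L L0 dL] := hol_primitive rho0 hq.
exists L; split=> //.
- by move=> z /dL; eexists; eassumption.
- by move=> z zr; rewrite f'E //; exact: dL.
move=> z zr; pose G w := f w * cexp (- L w).
have dG w : nrm w < rho -> cd G w 0.
  move=> wr; have := gdM (df w wr) (gd_comp (u := fun z => - L z) (cd_cexp _) (gdN (dL w wr))).
  have -> : f' w * cexp (- L w) + f w * (cexp (- L w) * - (f' w * (f w)^-1)) = 0.
    by field; exact: f0.
  by [].
have GE : G z = G 0.
  have := @rd_cst R (fun t => G (t%:C * z)) 0 1 ler01.
  rewrite mul0r mul1r; apply=> t /andP[t0 t1].
  have tz : nrm (t%:C * z) < rho.
    by rewrite nrmM nrm_real ger0_norm //; apply: le_lt_trans zr; rewrite ler_piMl.
  rewrite -[0](mul0r z); apply: (gd_comp (u := fun t => t%:C * z)); first exact: dG.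
  by have := rd_affine 0 z t; apply: gd_near; exists 1 => // s _; rewrite add0r.
have := GE; rewrite /G L0 oppr0 [cexp 0](_ : _ = 1); last by rewrite /cexp /= expR0 cis0 mul1r.
rewrite mulr1 => <-; rewrite -mulrA -cexpD addNr.
by rewrite [cexp 0](_ : _ = 1) ?mulr1 // /cexp /= expR0 cis0 mul1r.
Qed.

Lemma ln_nrm_exp (c w : C) : c != 0 -> ln (nrm (c * cexp w)) = ln (nrm c) + Re w.
Proof.
by move=> c0; rewrite nrmM nrm_cexp lnM ?posrE ?nrm_gt0 ?expR_gt0 // expRK.
Qed.

Lemma rcon_ln_nrm (r : R) f : 0 <= r -> con r f -> (forall z, nrm z = r -> f z != 0) ->
  rcon r (fun z => ln (nrm (f z))).
Proof.
move=> r0 cf h; apply: rcon_ln => //; first exact: rcon_nrm.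
by move=> z /h; rewrite nrm_gt0.
Qed.

Lemma rmean_ln_zero_free f (rho r : R) : 0 <= r -> r < rho ->
  hol_on (fun z => nrm z < rho) f -> (forall z, nrm z < rho -> f z != 0) ->
  rmean (fun z => ln (nrm (f z))) r = ln (nrm (f 0)).
Proof.
move=> r0 rr hf f0; have rho0 : 0 < rho by exact: le_lt_trans rr.
have [L [hL L0 _ fE]] := zero_free_exp rho0 hf f0.
have f00 : f 0 != 0 by apply: f0; rewrite nrm0.
have cL : con r L by exact: con_hol hL.
have cf : con r f by exact: con_hol hf.
rewrite (@rmean_eq _ (fun z => ln (nrm (f 0)) + Re (L z))) //.
- rewrite rmeanD; [|exact: rcon_cst|exact: rcon_Re].
  by rewrite rmean_cst rmean_Re // (mean_value r0 rr hL) L0 /= addr0.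
- by apply: rcon_ln_nrm => // z zr; apply: f0; rewrite zr.
- by apply: rconD; [exact: rcon_cst | exact: rcon_Re].
- by move=> z zr; rewrite fE ?zr // ln_nrm_exp.
Qed.

(* For [|a| < r] reflect [a] in the circle: [|z - a| = |r - conj a z / r|] there. *)
Lemma reflect_circle (a z : C) (r : R) : 0 < r -> nrm z = r ->
  nrm (z - a) = nrm (r%:C - (conjc a / r%:C) * z).
Proof.
move=> r0 zr; have rc0 : r%:C != 0 :> C by rewrite rc_eq0 gt_eqF.
have nc w : nrm (conjc w) = nrm w :> R.
  by rewrite !nrm_sqrt; case: w => x y /=; rewrite sqrrN.
have zz : z * conjc z = r%:C * r%:C.
  by apply: complex_ext; move: zr; rewrite nrm_sqrt => h; rewrite ?cReM ?cImM; case: z h => x y /= <-;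
   rewrite ?mulrN ?opprK ?mul0r ?mulr0 ?subr0 -?expr2 ?sqr_sqrtr ?addr_ge0 ?sqr_ge0 // mulrC addNr addr0.
have -> : r%:C - conjc a / r%:C * z = conjc (z - a) * z / r%:C.
  have -> : conjc (z - a) = conjc z - conjc a by exact: rmorphB.
  rewrite mulrBl [conjc z * z]mulrC zz; by field.
by rewrite !nrmM nrmV nc nrm_real zr ger0_norm ?ltW // mulfK // gt_eqF.
Qed.

Lemma hol_on_affine (D : C -> Prop) (p q : C) : hol_on D (fun z => p - q * z).
Proof.
move=> z _; eexists; apply: gdB; first exact: gd_cst.
by apply: gdZ; exact: gd_emb.
Qed.

(* On the circle [|z| = r] the function [z - a] has the modulus of an affine
   function without zeros in a disc larger than [r]. *)
Lemma zero_free_model (a : C) (r : R) : 0 < r -> nrm a != r ->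
  exists p q (rho : R), [/\ r < rho, (forall z, nrm z < rho -> p - q * z != 0),
    nrm p = Num.max r (nrm a) &
    forall z, nrm z = r -> nrm (z - a) = nrm (p - q * z)].
Proof.
move=> r0 ar; have rc0 : r%:C != 0 :> C by rewrite rc_eq0 gt_eqF.
have [ra|ra] := ltP r (nrm a).
  exists (- a), (- 1), (nrm a); split => //.
  - move=> z za; rewrite mulN1r opprK addrC subr_eq0.
    by apply: contraTneq za => ->; rewrite ltxx.
  - by rewrite nrmN.
  - by move=> z _; congr nrm; ring.
have {ra ar} ra : nrm a < r by rewrite lt_def eq_sym ar.
exists r%:C, (conjc a / r%:C).
have nc : nrm (conjc a / r%:C) < 1.
  rewrite nrmM nrmV nrm_real ger0_norm ?ltW // ltr_pdivrMr // mul1r.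
  by move: ra; rewrite !nrm_sqrt; case: (a) => x y /=; rewrite sqrrN.
pose m := (nrm (conjc a / r%:C) + 1) / 2.
have m0 : 0 < m by rewrite /m divr_gt0 // ltr_wpDl.
have m1 : m < 1 by rewrite /m; lra.
have nm : nrm (conjc a / r%:C) < m by rewrite /m; lra.
exists (r / m); split.
- by rewrite ltr_pdivlMr // gtr_pMr.
- move=> z; rewrite ltr_pdivlMr // => zr; rewrite subr_eq0; apply/eqP => /(congr1 nrm).
  rewrite nrm_real ger0_norm ?ltW // nrmM => E; move: zr; rewrite E mulrC ltNge.
  by rewrite ler_wpM2r // ltW.
- by rewrite nrm_real ger0_norm ?ltW // max_l ?ltW.
- by move=> z zr; exact: reflect_circle.
Qed.

Lemma con_sub_neq0 (a z : C) (r : R) : nrm a != r -> nrm z = r -> z - a != 0.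
Proof. by move=> ar zr; rewrite subr_eq0; apply: contraNneq ar => <-; rewrite zr. Qed.

Lemma rmean_ln_sub (a : C) (r : R) : 0 < r -> nrm a != r ->
  rmean (fun z => ln (nrm (z - a))) r = ln (Num.max r (nrm a)).
Proof.
move=> r0 ar; have [p [q [rho [rr nz np E]]]] := zero_free_model r0 ar.
have r0' := ltW r0.
have hq : hol_on (fun z => nrm z < rho) (fun z => p - q * z) by exact: hol_on_affine.
rewrite (@rmean_eq _ (fun z => ln (nrm (p - q * z)))) //.
- by rewrite (rmean_ln_zero_free r0' rr hq nz) mulr0 subr0 np.
- by apply: rcon_ln_nrm => //; [exact: con_sub | move=> z; exact: con_sub_neq0].
- apply: rcon_ln_nrm => //; first exact: con_hol hq.
  by move=> z zr; apply: nz; rewrite zr.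
- by move=> z zr; rewrite E.
Qed.

Lemma Re_sqrtc_ge0 (z : C) : 0 <= Re (sqrtc z).
Proof. by case: z => x y /=; rewrite sqrtr_ge0. Qed.

(** The root has nonnegative real part, so [sqrtc z + sqrtc w] stays away from [0], and the
    increment is [(z - w) / (sqrtc z + sqrtc w)]. *)
Lemma cd_sqrtc (w : C) : 0 < Re w -> exists l, cd (@sqrtc R) w l.
Proof.
move=> w0; set s := @sqrtc R.
have sq z : s z * s z = z by rewrite -expr2 sqr_sqrtc.
have p0 : 0 < Re (s w).
  rewrite lt_def Re_sqrtc_ge0 andbT; apply/eqP => h.
  by move: w0; rewrite -[w]sq cReM h mul0r sub0r oppr_gt0 ltNge -expr2 sqr_ge0.
have sw0 : s w != 0 by rewrite -nrm_gt0; exact: lt_le_trans p0 (le_trans (ler_norm _) (Re_le_nrm _)).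
have lower z : Re (s w) <= nrm (s z + s w).
  apply: le_trans (Re_le_nrm _); rewrite cReD ger0_norm ?addr_ge0 ?(ltW p0) ?Re_sqrtc_ge0 //.
  by rewrite lerDr Re_sqrtc_ge0.
have sum0 z : s z + s w != 0 by rewrite -nrm_gt0; exact: lt_le_trans (lower z).
have dif z : s z - s w = (z - w) / (s z + s w).
  apply: (mulIf (sum0 z)); rewrite divfK //.
  have -> : (s z - s w) * (s z + s w) = s z * s z - s w * s w by ring.
  by rewrite !sq.
have lip z : nrm (s z - s w) <= nrm (z - w) / Re (s w).
  by rewrite dif nrmM nrmV ler_wpM2l // lef_pV2 ?posrE // (lt_le_trans p0).
exists (2 * s w)^-1 => e e0.
exists (e * (2 * nrm (s w) * (Re (s w)) ^+ 2)).
  by rewrite !mulr_gt0 ?exprn_gt0 // nrm_gt0.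
move=> z zw.
have -> : s z - s w - (2 * s w)^-1 * (z - w) = (z - w) * ((s w - s z) / (2 * s w * (s z + s w))).
  by rewrite dif; field; rewrite sw0 sum0.
rewrite nrmM mulrC ler_wpM2r // nrmM nrmV !nrmM nrm_nat ler_pdivrMr; last first.
  by rewrite !mulr_gt0 ?nrm_gt0.
rewrite nrmB; apply: le_trans (lip z) _; rewrite ler_pdivrMr //.
apply: le_trans (ltW zw) _; rewrite -!mulrA ler_pM2l // ler_pM2l // ler_pM2l ?nrm_gt0 //.
by rewrite expr2 ler_wpM2r // ltW.
Qed.

(* Kolmogorov's trick: [sqrt (p / (p - q z))] is holomorphic with argument in
   [(-pi/4, pi/4)], so its modulus is controlled by its real part, whose mean is 1. *)
Lemma rmean_sqrt_pole (a : C) (r : R) : 1 <= r -> nrm a != r ->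
  rmean (fun z => Num.sqrt (nrm (z - a))^-1) r <= 2.
Proof.
move=> r1 ar; have r0 : 0 < r by exact: lt_le_trans r1.
have r0' := ltW r0.
have [p [q [rho [rr nz np E]]]] := zero_free_model r0 ar.
have p0 : p != 0 by rewrite -nrm_gt0 np lt_max r0.
have p1 : 1 <= nrm p by rewrite np le_max r1.
have rho0 : 0 < rho by exact: lt_trans rr.
pose G z := p / (p - q * z).
(* For [q != 0] the zero [p / q] of the affine function lies outside the disc. *)
have q1 z : nrm z < rho -> nrm (q * z) < nrm p.
  move=> zr; rewrite ltNge; apply/negP => h.
  have q0 : q != 0 by apply: contraTneq h => ->; rewrite mul0r nrm0 -ltNge nrm_gt0.
  have q00 : 0 < nrm q by rewrite nrm_gt0.
  have := nz (p / q); rewrite [q * _]mulrC divfK // subrr eqxx nrmM nrmV => /(_ _)/negP; apply => //.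
  rewrite nrmM in h; rewrite ltr_pdivrMr //; apply: le_lt_trans h _.
  by rewrite mulrC ltr_pM2r.
have ReG z : nrm z < rho -> 0 < Re (G z).
  move=> zr; have n0 := nz z zr.
  have -> : G z = (nrm (p - q * z) ^+ 2)^-1%:C * (p * conjc (p - q * z)).
    rewrite rcV rmorphXn /= nrmE sqr_normc /G.
    set w := p - q * z in n0 *; have n1 : conjc w != 0 by rewrite conjc_eq0.
    have aux (x y : C) : x != 0 -> y != 0 -> p / x = (x * y)^-1 * (p * y).
      by move=> x0 y0; field; rewrite x0 y0.
    exact: aux.
  rewrite cReMr mulr_gt0 ?invr_gt0 ?exprn_gt0 ?nrm_gt0 //.
  have -> : conjc (p - q * z) = conjc p - conjc (q * z) by exact: rmorphB.
  rewrite mulrBr cReD cReN.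
  have -> : Re (p * conjc p) = nrm p ^+ 2.
    by rewrite cReM nrm_sqrt sqr_sqrtr ?addr_ge0 ?sqr_ge0 //; case: (p) => x y /=; rewrite mulrN opprK !expr2.
  rewrite subr_gt0; apply: le_lt_trans (ler_norm _) _; apply: le_lt_trans (Re_le_nrm _) _.
  rewrite nrmM expr2 ltr_pM2l ?nrm_gt0 //; apply: le_lt_trans (q1 z zr).
  by rewrite !nrm_sqrt; case: (q * z) => x y /=; rewrite sqrrN.
pose F z := sqrtc (G z).
have hF : hol_on (fun z => nrm z < rho) F.
  move=> z zr; have [l hl] := cd_sqrtc (ReG z zr); eexists; apply: gd_comp; first exact: hl.
  apply: gdZ; apply: gdV; first exact: nz.
  by apply: gdB; [exact: gd_cst | apply: gdZ; exact: gd_emb].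
have cF : con r F by exact: con_hol hF.
have sq z : F z * F z = G z by rewrite -expr2 sqr_sqrtc.
(* [Re (F z ^+ 2) > 0] means that [Im (F z)] is smaller in modulus than [Re (F z)]. *)
have FRe z : nrm z < rho -> nrm (F z) <= 2 * Re (F z).
  move=> zr; have R0 := Re_sqrtc_ge0 (G z); rewrite -/(F z) in R0.
  have := ReG z zr; rewrite -[G z]sq cReM subr_gt0 -!expr2 => h.
  apply: le_trans (nrm_le_ReIm _) _; rewrite (ger0_norm R0) mulr_natl mulr2n lerD2l.
  rewrite -[leRHS](ger0_norm R0) -(@ler_pXn2r _ 2) ?nnegrE //.
  by rewrite !real_normK ?num_real // ltW.
have F0 : F 0 = 1 by rewrite /F /G mulr0 subr0 divff // sqrtc1.
have sqc : rcon r (fun z => Num.sqrt (nrm (z - a))^-1).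
  apply: rcon_comp => //; last by move=> z _; exact: sqrt_continuous.
  apply: rcon_ext (rcon_nrm (conV r0' (con_sub a r) _)); first by move=> z; rewrite nrmV.
  by move=> z; exact: con_sub_neq0.
(* Here [1 <= r] enters: it gives [nrm p >= 1], so [nrm (F z)] dominates the inverse square root of
   [nrm (z - a)]. *)
apply: le_trans (_ : rmean (fun z => 2 * Re (F z)) r <= _).
  apply: rmean_le => //; first by apply: rconZ; exact: rcon_Re.
  move=> z zr; rewrite -zr in rr; apply: le_trans (FRe z rr).
  have -> : nrm (F z) = Num.sqrt (nrm p / nrm (p - q * z)).
    by rewrite -nrmV -nrmM -/(G z) -[G z]sq nrmM -expr2 sqrtr_sqr ger0_norm.
  rewrite E // ler_wsqrtr // ler_peMl // invr_ge0 //.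
by rewrite rmeanZ ?rmean_Re //; [rewrite (mean_value r0' rr hF) F0 /= mulr1 | exact: rcon_Re].
Qed.

End RealMean.

(** * Logarithmic derivatives and polynomials of meromorphic functions *)

Section PolyOrders.
Context {R : realType}.
Local Notation C := R[i].
Implicit Types (f g h u v : C -> C) (a z t : C) (m k : int) (Q : {poly C}).

Local Opaque derive1.

Lemma nr_and a (P Q : C -> Prop) : nr a P -> nr a Q -> nr a (fun z => P z /\ Q z).
Proof. exact: nrS2. Qed.

Definition eqm f g := forall a, nr a (fun z => f z = g z).
Definition logd h z := derive1 h z / h z.

Lemma cd_poly Q u z l : cd u z l -> cd (fun w => Q.[u w]) z (Q^`().[u z] * l).
Proof.
move=> ul; elim/poly_ind: Q => [|Q c IH].
  rewrite deriv0 horner0 mul0r; apply: (@cd_near _ (fun=> 0)); last exact: gd_cst.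
  by apply: nbW => w; rewrite horner0.
apply: (@cd_near _ (fun w => Q.[u w] * u w + c)).
  by apply: nbW => w; rewrite hornerMXaddC.
have := gdD (gdM IH ul) (gd_cst (fun z : C => z) c z).
rewrite derivMXaddC hornerD hornerMX.
by have -> : Q^`().[u z] * l * u z + Q.[u z] * l + 0 = (Q.[u z] + Q^`().[u z] * u z) * l by ring.
Qed.

Lemma hol_poly Q u a : hol u a -> hol (fun z => Q.[u z]) a.
Proof. by apply: nbS => z [l ul]; exists (Q^`().[u z] * l); exact: cd_poly. Qed.

Lemma mero_poly Q h : mero h -> mero (fun z => Q.[h z]).
Proof.
move=> hh; elim/poly_ind: Q => [|Q c IH].
  have -> : (fun z => (0 : {poly C}).[h z]) = (fun=> 0) by apply/funext => z; rewrite horner0.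
  exact: mero_cst.
have -> : (fun z => (Q * 'X + c%:P).[h z]) = (fun z => Q.[h z] * h z + c).
  by apply/funext => z; rewrite hornerMXaddC.
by apply: meroD; [apply: meroM | exact: mero_cst].
Qed.

Lemma derive_poly Q h a : mero h ->
  nr a (fun z => derive1 (fun w => Q.[h w]) z = derive1 h z * Q^`().[h z]).
Proof.
move=> hh; apply: nrS (mero_cd a hh) => z _ hz.
by have [_ ->] := cd_derivable (cd_poly Q hz); rewrite mulrC.
Qed.

Lemma hasord_cst (c : C) a : c != 0 -> hasord (fun=> c) a 0.
Proof. by move=> c0; apply: hol_hasord0 => //; exact: hol_cst. Qed.

Lemma hasord_poly_pole Q h a m : (m < 0)%R -> hasord h a m -> Q != 0 ->
  hasord (fun z => Q.[h z]) a (m * (size Q).-1%:Z).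
Proof.
move=> m0 hm; elim/poly_ind: Q => [|Q c IH]; first by rewrite eqxx.
move=> Q0; apply: (@hasord_ext R (fun z => Q.[h z] * h z + c)).
  by apply: nrW => z _; rewrite hornerMXaddC.
have [Q0'|Qn0] := eqVneq Q 0.
  move: Q0; rewrite Q0' mul0r add0r polyC_eq0 => c0.
  rewrite size_polyC c0 mulr0; apply: hasord_ext (hasord_cst a c0).
  by apply: nrW => z _; rewrite horner0 mul0r add0r.
have sQ : (0 < size Q)%N by rewrite size_poly_gt0.
have -> : m * (size (Q * 'X + c%:P)).-1%:Z = m * (size Q).-1%:Z + m.
  by rewrite size_MXaddC (negbTE Qn0) /= -{1}(prednK sQ) [in LHS]intS mulrDr mulr1 addrC.
apply: hasordD; first exact: hasordM (IH Qn0) hm.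
apply: (@ordge_weak _ _ _ 0); last by apply: hol_ordge; exact: hol_cst.
have : (m * (size Q).-1%:Z <= 0)%R by rewrite nmulr_rle0.
by lia.
Qed.

Lemma ordge0_hol h a : ordge h a 0 -> exists2 u, hol u a & nr a (fun z => h z = u z).
Proof. by move=> [u hu e]; exists u => //; apply: nrS e => z _ ->; rewrite expr0z mulr1. Qed.

Lemma ordge0_poly Q h a : ordge h a 0 -> ordge (fun z => Q.[h z]) a 0.
Proof.
move=> /ordge0_hol[u hu e]; apply: (@ordge_ext R (fun z => Q.[u z])).
  by apply: nrS e => z _ ->.
by apply: hol_ordge; exact: hol_poly.
Qed.

Lemma hasord0_poly Q h u a : hol u a -> nr a (fun z => h z = u z) -> Q.[u a] != 0 ->
  hasord (fun z => Q.[h z]) a 0.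
Proof.
move=> hu e Qa; apply: (@hasord_ext R (fun z => Q.[u z])).
  by apply: nrS e => z _ ->.
by apply: hol_hasord0 => //; exact: hol_poly.
Qed.

Lemma hasord_pos_hol h u a m : hasord h a m -> (0 < m)%R -> hol u a ->
  nr a (fun z => h z = u z) -> u a = 0.
Proof.
move=> hm m0 hu e; apply/eqP; apply: contraT => ua.
have h0 : hasord h a 0.
  by apply: hasord_ext (hol_hasord0 hu ua); apply: nrS e => z _ ->.
by have := hasord_uniq hm h0; lia.
Qed.

(** Roots are simple, so [Q.[h]] inherits the multiplicities of the root points of [h], and they are
    nonzero, so [h] and [Q.[h]] have no common zeros. *)
Definition sf Q := forall t, Q.[t] = 0 -> t != 0 /\ Q^`().[t] != 0.

Lemma poly_order_cases Q h a m : nzm (fun z => Q.[h z]) -> Q.[0] != 0 -> hasord h a m ->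
  [/\ (m < 0)%R -> ord (fun z => Q.[h z]) a = m * (size Q).-1%:Z,
      (0 < m)%R -> ord (fun z => Q.[h z]) a = 0,
      (0 <= m)%R -> (0 <= ord (fun z => Q.[h z]) a)%R &
      (0 < ord (fun z => Q.[h z]) a)%R -> m = 0 /\ exists v : C, Q.[v] = 0 /\
        (Q^`().[v] != 0 -> hasord (fun z => h z - v) a (ord (fun z => Q.[h z]) a))].
Proof.
move=> nQ Q0 hm; have Qn0 : Q != 0 by apply: contraNneq Q0 => ->; rewrite horner0.
have H1 : (m < 0)%R -> ord (fun z => Q.[h z]) a = m * (size Q).-1%:Z.
  by move=> m0; apply: ordE; exact: hasord_poly_pole.
have H2 : (0 < m)%R -> ord (fun z => Q.[h z]) a = 0.
  move=> m0; apply: ordE.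
  have [u hu e] := ordge0_hol (ordge_weak (ltW m0) (hasord_ge hm)).
  by apply: (hasord0_poly hu e); rewrite (hasord_pos_hol hm m0 hu e).
split=> //; first by move=> m0; apply: ord_ge nQ _; apply: ordge0_poly; apply: ordge_weak m0 (hasord_ge hm).
move=> x0; have [mn|mp|m0] := ltgtP m 0.
- by move: x0; rewrite H1 // ltNge; case/negP; rewrite nmulr_rle0.
- by move: x0; rewrite H2 // ltxx.
split=> //; rewrite m0 in hm; have [u hu e] := ordge0_hol (hasord_ge hm).
exists (u a); have Qu : Q.[u a] = 0.
  apply/eqP; apply: contraT => Qu; have := ordE (hasord0_poly hu e Qu).
  by move: x0 => /[swap] ->; rewrite ltxx.
split=> // dQ.
have /factor_theorem[S QE] : root Q (u a) by apply/eqP.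
have Su : S.[u a] != 0.
  by move: dQ; rewrite QE derivM hornerD !hornerM hornerXsubC subrr mulr0 add0r derivXsubC hornerC mulr1.
have hS := hasord0_poly hu e Su.
have := hasord_div (ordP a nQ) hS; rewrite subr0; apply: hasord_ext.
apply: nrS (hasord_neq0 hS) => z _ Sz.
by rewrite QE hornerM hornerXsubC mulrC mulKf.
Qed.

Lemma derive1_subC h c a : mero h ->
  nr a (fun z => derive1 (fun w => h w - c) z = derive1 h z).
Proof.
move=> hh; apply: nrS (mero_cd a hh) => z _ hz.
have := gdB hz (gd_cst (fun z : C => z) c z); rewrite subr0 => h1.
by have [_ ->] := cd_derivable h1.
Qed.

Lemma hasord_derive_sub h c a m : mero h -> (0 < m)%R -> hasord (fun z => h z - c) a m ->
  hasord (derive1 h) a (m - 1).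
Proof.
move=> hh m0 hm; apply: hasord_ext (derive1_subC c a hh) _.
by apply: hasord_derive => //; lia.
Qed.

Lemma hasord_sub_neq h c a m : (0 < m)%R -> c != 0 -> hasord (fun z => h z - c) a m -> hasord h a 0.
Proof.
move=> m0 c0 hm; apply: (@hasord_ext R (fun z => c + (h z - c))).
  by apply: nrW => z _; rewrite addrC subrK.
apply: hasordD; first exact: hasord_cst.
by rewrite add0r; apply: ordge_weak (hasord_ge hm); lia.
Qed.

(** Source of the high-order zeros of the functions [Psi]: subtracting a constant leaves the
    derivative alone, and [c != 0] keeps the denominator from vanishing. *)
Lemma hasord_logd_sub h c a m : mero h -> (0 < m)%R -> c != 0 -> hasord (fun z => h z - c) a m ->
  hasord (logd h) a (m - 1).
Proof.
move=> hh m0 c0 hm; rewrite -[m - 1]subr0; apply: hasord_div.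
  exact: hasord_derive_sub hm.
exact: hasord_sub_neq hm.
Qed.

Lemma logdM_pt u v z : (exists l, cd u z l) -> (exists l, cd v z l) -> u z != 0 -> v z != 0 ->
  logd (fun w => u w * v w) z = logd u z + logd v z.
Proof.
move=> [l ul] [k vk] u0 v0; rewrite /logd.
have [_ ->] := cd_derivable (gdM ul vk); have [_ ->] := cd_derivable ul.
by have [_ ->] := cd_derivable vk; field; rewrite u0 v0.
Qed.

Lemma logdV_pt u z : (exists l, cd u z l) -> u z != 0 ->
  logd (fun w => (u w)^-1) z = - logd u z.
Proof.
move=> [l ul] u0; rewrite /logd.
have [_ ->] := cd_derivable (gdV u0 ul); have [_ ->] := cd_derivable ul.
by field.
Qed.

Lemma nzm_cd h a : nzm h -> nr a (fun z => (exists l, cd h z l) /\ h z != 0).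
Proof.
move=> nh; apply: nrS2 (mero_cd a (nzm_mero nh)) (hasord_neq0 (ordP a nh)) => z _ h1 h2.
by split=> //; exists (derive1 h z).
Qed.

Lemma ordM f g a : nzm f -> nzm g -> ord (fun z => f z * g z) a = ord f a + ord g a.
Proof. by move=> nf ng; apply: ordE; apply: hasordM; exact: ordP. Qed.

Lemma ordV f a : nzm f -> ord (fun z => (f z)^-1) a = - ord f a.
Proof. by move=> nf; apply: ordE; apply: hasordV; exact: ordP. Qed.

Lemma ordX f n a : nzm f -> ord (fun z => f z ^+ n) a = ord f a *+ n.
Proof. by move=> nf; apply: ordE; apply: hasordX; exact: ordP. Qed.

Lemma ordge_logd h a : nzm h -> ordge (logd h) a (-1).
Proof. by move=> nh; exact: ordge_logder (ordP a nh). Qed.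

Lemma mero_logd h : nzm h -> mero (logd h).
Proof. by move=> nh a; exists (-1); exact: ordge_logd. Qed.

Definition D u v z := logd u z - logd v z.

Lemma mero_D u v : nzm u -> nzm v -> mero (D u v).
Proof. by move=> nu nv; apply: meroB; exact: mero_logd. Qed.

Lemma ordge_D u v a : nzm u -> nzm v -> ordge (D u v) a (-1).
Proof. by move=> nu nv; apply: ordgeB; exact: ordge_logd. Qed.

Lemma ordge_D_eq u v a : nzm u -> nzm v -> ord u a = ord v a -> ordge (D u v) a 0.
Proof. by move=> nu nv e; apply: ordge_logder_sub (ordP a nu) _; rewrite e; exact: ordP. Qed.

Lemma hasord_D_neq u v a : nzm u -> nzm v -> ord u a != ord v a -> hasord (D u v) a (-1).
Proof.
move=> nu nv ne; have [p hp e1] := hasord_logder (ordP a nu).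
have [q hq e2] := hasord_logder (ordP a nv).
exists (fun z => (ord u a - ord v a)%:~R + (p z - q z) * (z - a)); split.
- apply: holD; [exact: hol_cst | apply: holM; [exact: holB | exact: hol_sub]].
- by rewrite subrr mulr0 addr0 intr_eq0 subr_eq0.
apply: nrS2 e1 e2 => z /subC_neq0 za h1 h2.
have -> : D u v z = (ord u a)%:~R / (z - a) + p z - ((ord v a)%:~R / (z - a) + q z).
  exact: (congr2 (fun x y => x - y) h1 h2).
by rewrite exprN1 intrB; field.
Qed.

Lemma hol_vanish v a : hol v a -> v a = 0 -> ordge v a 1.
Proof.
move=> hv v0; have [z0|[m [g [hg g0 e]]]] := hol_zero_or_factor hv.
  by exists (fun=> 0); [exact: hol_cst | apply: nrS (nb_nr z0) => z _ ->; rewrite mul0r].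
have := proj2 ((nb_nrP _ _).1 e); case: m {e} (nb_nr e) => [|m] e.
  by rewrite expr0 mul1r v0 => h; move: g0; rewrite -h eqxx.
move=> _; apply: (@ordge_weak _ _ _ m.+1%:Z); first by lia.
by exists g => //; apply: nrS e => z _ ->; rewrite mulrC.
Qed.

Lemma derive_zat_cst h : mero h -> (forall a, zat (derive1 h) a) -> exists c, eqm h (fun=> c).
Proof.
move=> hh dz; have [m hm] := hh 0.
have [b _ hb] : exists2 b, b != 0 & nb b (fun z => exists l, cd h z l).
  by apply: nr_ex; apply: nrS (nr_nb (ordge_cd hm)) => z _; apply: nbS => w; eexists; eassumption.
exists (h b); have hs : mero (fun z => h z - h b) by apply: meroB => //; exact: mero_cst.
have [ns|zs] := mero_nzm hs; last by move=> a; apply: nrS (zs a) => z _ /eqP; rewrite subr_eq0 => /eqP.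
exfalso; have hhb : hol (fun z => h z - h b) b by apply: holB => //; exact: hol_cst.
have k := ord_ge ns (hol_vanish hhb (subrr _)).
by apply: hasord_zat (dz b); apply: hasord_derive_sub (ordP b ns).
Qed.

Lemma D_zat u v : nzm u -> nzm v -> (forall a, zat (D u v) a) ->
  exists2 c, c != 0 & eqm u (fun z => c * v z).
Proof.
move=> nu nv dz; have nq : nzm (fun z => u z * (v z)^-1) by apply: nzmM => //; exact: nzmV.
have [|c hc] := @derive_zat_cst (fun z => u z * (v z)^-1) (nzm_mero nq).
  move=> a; have h1 := nr_and (nzm_cd a nu) (nzm_cd a nv).
  apply: nrS2 h1 (dz a) => z _ [[du u0] [dv v0]]; rewrite /D => dz0.
  have dv' : exists l, cd (fun z => (v z)^-1) z l.
    by case: dv => l dv; exists (- l / v z ^+ 2); exact: gdV.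
  have : logd (fun z => u z * (v z)^-1) z = 0.
    by rewrite logdM_pt ?invr_eq0 // logdV_pt.
  by move=> /eqP; rewrite /logd mulf_eq0 invr_eq0 !mulf_eq0 invr_eq0 (negbTE u0) (negbTE v0) !orbF => /eqP.
have E : eqm u (fun z => c * v z).
  by move=> a; apply: nrS2 (hc a) (nzm_cd a nv) => z _ <- [_ v0]; rewrite mulfVK.
exists c => //; apply/eqP => c0; apply: (hasord_zat (ordP 0 nu)).
by apply: nrS (E 0) => z _ ->; rewrite c0 mul0r.
Qed.

Lemma eqm_ord f g a : eqm f g -> ord f a = ord g a.
Proof.
move=> e; rewrite /ord; congr (xget _ _); apply/seteqP; split=> m /= h.
  by apply: hasord_ext (e a) h.
by apply: hasord_ext h; apply: nrS (e a) => z _ ->.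
Qed.

(* At a simple zero of [X] the function [(1/X)'] has residue [0], so its logarithmic
   derivative is [-2/(z - a)] up to a function vanishing at [a]. *)
Lemma logd_simple_zero X a : nzm X -> nzm (derive1 X) -> ord X a = 1 ->
  ordge (fun z => logd (derive1 X) z - 2 * logd X z - (- 2) / (z - a)) a 1.
Proof.
move=> nX nX' o1; have [u [hu u0 e]] := ordP a nX; rewrite o1 in e.
have e' : nr a (fun z => derive1 X z = derive1 u z * (z - a) + u z).
  apply: nrS (derive_factor hu e) => z _ ->; by rewrite mul1r subrr expr0z mulr1.
pose w z := derive1 u z * (z - a) + u z.
have hw : hol w a by apply: holD => //; apply: holM; [exact: hol_derive | exact: hol_sub].
have wa : w a = u a by rewrite /w subrr mulr0 add0r.
have w0 : w a != 0 by rewrite wa.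
pose v z := derive1 w z * (w z)^-1 - 2 * (derive1 u z * (u z)^-1).
have hv : hol v a.
  apply: holB; first by apply: holM; [exact: hol_derive | exact: holV].
  apply: holM; [exact: hol_cst | apply: holM; [exact: hol_derive | exact: holV]].
have va : v a = 0.
  have h1 : cd w a (derive1 (derive1 u) a * (a - a) + derive1 u a * 1 + derive1 u a).
    apply: gdD; last exact: hol_cd.
    apply: gdM; first by apply: hol_cd; exact: hol_derive.
    by have := gdB (gd_emb (fun z : C => z) a) (gd_cst (fun z : C => z) a a); rewrite subr0.
  have [_ dwE] := cd_derivable h1.
  have -> : v a = derive1 w a * (u a)^-1 - 2 * (derive1 u a * (u a)^-1).
    by congr (_ * _^-1 - _).
  move: dwE u0; move: (derive1 w a) (derive1 (derive1 u) a) (derive1 u a) (u a) => d p q r -> r0.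
  by field.
apply: ordge_ext (hol_vanish hv va).
have cw := mero_cd a (nzm_mero nX').
have eX := derive1_near e' cw.
have eu := nb_nr (cc_neq0 (hol_cc hu) u0); have ew := nb_nr (cc_neq0 (hol_cc hw) w0).
have dX := derive_factor hu e.
have alg (q y d p r : C) : r != 0 -> p != 0 -> y = d * r + p ->
    q - 2 * (d / p) = q - 2 * (y / (p * r)) - (- 2) / r.
  by move=> r0 p0 ->; field; rewrite r0 p0.
apply: nrS3 (nr_and e e') (nr_and eX dX) (nr_and eu ew) => z /subC_neq0 za [e1 e2] [e3 e4] [uz wz].
rewrite /v /logd e3 -/(w z) e2 -/(w z) e1 expr1z.
set dw := derive1 _ z.
have ww : w z = derive1 u z * (z - a) + u z by [].
exact: alg.
Qed.

(** [V] is the test function of the second main theorem. Zeros of [h] and of [Q.[h]] become simple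
    poles whatever their multiplicity, which truncates them to one, while a pole of order [p]
    becomes a zero of order [d p - 1]. *)
Lemma ord_smt h Q d a : nzm h -> nzm (derive1 h) -> nzm (fun z => Q.[h z]) -> sf Q ->
  size Q = d.+1 ->
  let V := fun z => derive1 h z * (h z * Q.[h z])^-1 in
  [/\ (ord h a < 0)%R -> ord V a = - (d%:Z * ord h a) - 1,
      (0 < ord h a)%R -> ord V a = -1,
      (0 < ord (fun z => Q.[h z]) a)%R -> ord V a = -1 &
      ord h a = 0 -> ord (fun z => Q.[h z]) a = 0 ->
        ord V a = ord (derive1 h) a /\ (0 <= ord (derive1 h) a)%R].
Proof.
move=> nh nh' nQ hQ sQ V.
have Q0 : Q.[0] != 0 by apply/eqP => /hQ[]; rewrite eqxx.
have [H1 H2 _ H4] := poly_order_cases nQ Q0 (ordP a nh).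
have VE : ord V a = ord (derive1 h) a - ord h a - ord (fun z => Q.[h z]) a.
  by rewrite ordM ?ordV ?ordM //; [lia | exact: nzmM | apply: nzmV; exact: nzmM].
have dE : ord h a != 0 -> ord (derive1 h) a = ord h a - 1.
  by move=> m0; apply: ordE; apply: hasord_derive => //; exact: ordP.
split.
- by move=> m0; rewrite VE dE ?H1 // ?sQ /=; [lia | rewrite lt_eqF].
- by move=> m0; rewrite VE dE ?H2 //; [lia | rewrite gt_eqF].
- move=> x0; have [m0 [v [Qv hv]]] := H4 x0; have [v0 /hv{}hv] := hQ v Qv.
  have := hasord_derive_sub (nzm_mero nh) x0 hv => /ordE E.
  by rewrite VE E m0; lia.
move=> m0 x0; rewrite VE m0 x0; split; first by lia.
by apply: ord_ge nh' _; apply: ordge_derive0; rewrite -m0; apply: hasord_ge; exact: ordP.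
Qed.

Definition psum Q : R := \sum_(i < size Q) nrm Q`_i.

Lemma psum_ge0 Q : 0 <= psum Q.
Proof. by rewrite sumr_ge0. Qed.

Lemma poly_upper Q w : nrm Q.[w] <= psum Q * (1 + nrm w) ^+ (size Q).-1.
Proof.
rewrite horner_coef; apply: le_trans (nrm_sum _ _ _) _.
rewrite /psum mulr_suml; apply: ler_sum => i _; rewrite nrmM nrmX ler_wpM2l //.
have w1 : 1 <= 1 + nrm w by rewrite lerDl.
apply: le_trans (_ : (1 + nrm w) ^+ i <= _).
  by rewrite lerXn2r ?nnegrE ?addr_ge0 // lerDr.
by rewrite ler_weXn2l //; case: (size Q) i => [[]|n i] //=; rewrite -ltnS.
Qed.

Lemma poly_lower Q d : size Q = d.+1 -> exists rho k : R, [/\ 1 <= rho, 0 <= k &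
  forall w, rho <= nrm w -> (1 + nrm w) ^+ d <= k * nrm Q.[w]].
Proof.
move=> sQ; have lc0 : 0 < nrm Q`_d.
  by rewrite nrm_gt0 -[d]/(d.+1.-1) -sQ -lead_coefE lead_coef_eq0 -size_poly_gt0 sQ.
set l := nrm Q`_d in lc0.
(* Beyond this radius the lower terms are at most half of the leading one; [2 ^+ d] pays for
   [1 + nrm w <= 2 * nrm w]. *)
exists (Num.max 1 (2 * psum Q / l)), (2 ^+ d * (2 / l)); split.
- by rewrite le_max lexx.
- by rewrite mulr_ge0 ?exprn_ge0 ?divr_ge0 // ltW.
move=> w; rewrite ge_max => /andP[w1 w2].
have wp : 0 < nrm w by exact: lt_le_trans w1.
apply: le_trans (_ : (2 * nrm w) ^+ d <= _).
  by rewrite lerXn2r ?nnegrE ?addr_ge0 ?mulr_ge0 // mulr_natl mulr2n lerD2r.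
rewrite exprMn -mulrA ler_pM2l ?exprn_gt0 //.
rewrite mulrAC ler_pdivlMr //.
have E : Q.[w] = \sum_(i < d) Q`_i * w ^+ i + Q`_d * w ^+ d.
  by rewrite horner_coef sQ big_ord_recr.
have low : nrm (\sum_(i < d) Q`_i * w ^+ i) * nrm w <= psum Q * nrm w ^+ d.
  apply: le_trans (ler_wpM2r (ltW wp) (nrm_sum _ _ _)) _.
  rewrite mulr_suml /psum sQ big_ord_recr /= mulrDl.
  apply: le_trans (_ : \sum_(i < d) nrm Q`_i * nrm w ^+ d <= _).
    apply: ler_sum => i _; rewrite nrmM nrmX -mulrA -exprSr ler_wpM2l //.
    by rewrite ler_weXn2l.
  by rewrite mulr_suml lerDl mulr_ge0 // exprn_ge0.
have h1 : l * nrm w ^+ d <= nrm Q.[w] + nrm (\sum_(i < d) Q`_i * w ^+ i).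
  have := nrmBD (Q`_d * w ^+ d) (- (\sum_(i < d) Q`_i * w ^+ i)).
  by rewrite opprK addrC E nrmN nrmM nrmX -/l [Q`_d * _ + _]addrC; lra.
have h2 : 2 * nrm (\sum_(i < d) Q`_i * w ^+ i) <= l * nrm w ^+ d.
  have wd : 0 <= nrm w ^+ d by rewrite exprn_ge0.
  rewrite -(ler_pM2r wp); apply: le_trans (_ : 2 * (psum Q * nrm w ^+ d) <= _).
    by rewrite -mulrA ler_pM2l.
  rewrite ler_pdivrMr // in w2.
  have -> : l * nrm w ^+ d * nrm w = (nrm w * l) * nrm w ^+ d by ring.
  by rewrite mulrA ler_wpM2r.
by rewrite [_ * l]mulrC; lra.
Qed.

(** [Q] and [z Q'] are coprime, so a Bezout identity bounds the sum on the right below on a disc;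
    [poly_lower] serves outside. At [w = h z], multiplication by [h' / (h Q(h))] turns the two terms
    of that sum into the logarithmic derivatives of [h] and [Q(h)]. *)
Lemma sf_bound Q d : size Q = d.+1 -> sf Q -> exists2 k : R, 0 <= k &
  forall w, (1 + nrm w) ^+ d <= k * (nrm Q.[w] + nrm (w * Q^`().[w])).
Proof.
move=> sQ hQ; have [rho [k1 [rho1 k10 h1]]] := poly_lower sQ.
have cop : coprimep Q ('X * Q^`()).
  apply: Pdiv.ClosedField.root_coprimep => t /eqP/hQ[t0 dQ].
  by rewrite hornerM hornerX mulf_neq0.
have [[U V] /= UV] := Bezout_eq1_coprimepP _ _ cop.
have [b bE] : exists b : R, b = (1 + rho) ^+ (size U + size V) by eexists.
have rho0 : 0 <= rho by exact: le_trans rho1.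
have b0 : 0 <= b by rewrite bE exprn_ge0 // addr_ge0.
pose k2 := (1 + rho) ^+ d * ((psum U + psum V) * b).
have k20 : 0 <= k2 by rewrite mulr_ge0 ?exprn_ge0 ?addr_ge0 // mulr_ge0 // addr_ge0 ?psum_ge0.
have bnd (S : {poly C}) w : (size S <= size U + size V)%N -> nrm w <= rho -> nrm S.[w] <= psum S * b.
  move=> sS wr; apply: le_trans (poly_upper _ _) _; rewrite ler_wpM2l ?psum_ge0 //.
  apply: le_trans (_ : (1 + rho) ^+ (size S).-1 <= _).
    by rewrite lerXn2r ?nnegrE ?addr_ge0 // lerD2l.
  by rewrite bE ler_weXn2l ?lerDl // (leq_trans (leq_pred _)).
exists (k1 + k2) => [|w]; first exact: addr_ge0.
have n1 := nrm_ge0 Q.[w]; have n2 := nrm_ge0 (w * Q^`().[w]).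
rewrite mulrDl; have [wr|wr] := leP rho (nrm w).
  rewrite -[leLHS]addr0; apply: lerD; last by rewrite mulr_ge0 // addr_ge0.
  by apply: le_trans (h1 w wr) _; rewrite ler_wpM2l // lerDl.
rewrite -[leLHS]add0r; apply: lerD; first by rewrite mulr_ge0 // addr_ge0.
have wr' := ltW wr.
apply: le_trans (_ : (1 + rho) ^+ d * 1 <= _).
  by rewrite mulr1 lerXn2r ?nnegrE ?addr_ge0 // lerD2l.
rewrite /k2 -[leRHS]mulrA ler_wpM2l ?exprn_ge0 ?addr_ge0 //.
have : 1 <= nrm (U.[w] * Q.[w] + V.[w] * (w * Q^`().[w])).
  have := congr1 (fun S : {poly C} => nrm S.[w]) UV.
  by rewrite hornerD !hornerM hornerX hornerC nrm1 => ->.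
move=> /le_trans; apply; apply: le_trans (nrmD _ _) _; rewrite !nrmM -(nrmM w).
have hU := bnd U w (leq_addr _ _) wr'; have hV := bnd V w (leq_addl _ _) wr'.
have pU := psum_ge0 U; have pV := psum_ge0 V.
rewrite mulrDr; apply: lerD; apply: ler_wpM2r => //.
  by apply: le_trans hU _; rewrite ler_wpM2r // lerDl.
by apply: le_trans hV _; rewrite ler_wpM2r // lerDr.
Qed.

End PolyOrders.

(** * Nonconstant meromorphic functions and exceptional points *)

Section Nonconstant.
Context {R : realType}.
Local Notation C := R[i].
Implicit Types (f g h u v : C -> C) (z : C) (Q : {poly C}).

Local Opaque derive1.

Definition nonc h := mero h /\ forall c, ~ eqm h (fun=> c).

Lemma nonc_sub h c : nonc h -> nzm (fun z => h z - c).
Proof.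
move=> [mh nc]; have [//|zs] := mero_nzm (meroB mh (mero_cst c)).
by case: (nc c) => w; apply: nrS (zs w) => z _ /eqP; rewrite subr_eq0 => /eqP.
Qed.

Lemma nonc_nzm h : nonc h -> nzm h.
Proof.
move=> H; have E : (fun z => h z - 0) = h by apply/funext => z; rewrite subr0.
by rewrite -E; exact: nonc_sub.
Qed.

Lemma nonc_derive h : nonc h -> nzm (derive1 h).
Proof.
move=> [mh nc]; have [//|/(derive_zat_cst mh)[c hc]] := mero_nzm (mero_derive mh).
by case: (nc c).
Qed.

Lemma nzm_cst (c : C) : c != 0 -> nzm (fun=> c).
Proof. by move=> c0 w; exists 0; exact: hasord_cst. Qed.

Lemma nonc_poly Q h : nonc h -> Q != 0 -> nzm (fun z => Q.[h z]).
Proof.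
move=> nh Q0; have [r QE] := closed_field_poly_normal Q.
have -> : (fun z => Q.[h z]) = (fun z => lead_coef Q * \prod_(t <- r) (h z - t)).
  apply/funext => z; rewrite {1}QE hornerZ horner_prod; congr (_ * _).
  by apply: eq_bigr => t _; rewrite hornerXsubC.
apply: nzmM; first by apply: nzm_cst; rewrite lead_coef_eq0.
elim: r {QE} => [|t r IH].
  have -> : (fun z => \prod_(t <- [::]) (h z - t)) = (fun=> 1).
    by apply/funext => z; rewrite big_nil.
  by apply: nzm_cst; exact: oner_neq0.
have -> : (fun z => \prod_(s <- t :: r) (h z - s)) = (fun z => (h z - t) * \prod_(s <- r) (h z - s)).
  by apply/funext => z; rewrite big_cons.
by apply: nzmM => //; exact: nonc_sub.
Qed.

(** The zero of [h - p] is the witness that the characteristic of [h] is unbounded, which ends every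
    growth argument. *)
Lemma nonc_value h : nonc h -> exists p z, (0 < ord (fun w => h w - p) z)%R.
Proof.
move=> nh; have [b _ hb] : exists2 b, b != 0 & nb b (fun z => exists l, cd h z l).
  apply: nr_ex; apply: nrS (nr_nb (mero_cd 0 nh.1)) => z _; apply: nbS => w.
  by exists (derive1 h w).
exists (h b), b; have ns := nonc_sub (h b) nh.
have hhb : hol (fun z => h z - h b) b by apply: holB => //; exact: hol_cst.
by have := ord_ge ns (hol_vanish hhb (subrr _)); lia.
Qed.

Lemma nonc_polyc Q h c : nonc h -> (1 < size Q)%N -> ~ eqm (fun z => Q.[h z]) (fun=> c).
Proof.
move=> nh sQ e; have Qc : Q - c%:P != 0.
  by apply: contraTneq sQ => /subr0_eq ->; rewrite size_polyC; case: (_ == _).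
apply: (hasord_zat (ordP 0 (nonc_poly nh Qc))).
by apply: nrS (e 0) => z _ E; rewrite hornerD hornerN hornerC E subrr.
Qed.

(* Empty for functions vanishing on an open set. *)
Definition badz h : set C := [set z | nzm h /\ ~ (hol h z /\ h z != 0)].

Lemma discr_badz h : discr (badz h).
Proof.
move=> z; have [nh|nh] := pselect (nzm h); last by apply: nrW => w _ [].
have [m [u [hu u0 e]]] := nh z.
have eu := nb_nr (cc_neq0 (hol_cc hu) u0).
apply: nrS3 (nr_and e eu) (nr_nb e) (nb_nr (hol_nb hu)) => w wz [e1 u1] e2 h1 [_]; apply; split.
  apply: (@hol_ext R (fun w => u w * (w - z) ^ m)); first by apply: nbS e2 => y ->.
  by apply: holM => //; apply: hol_exprz; [rewrite subr_eq0 | exact: hol_sub].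
by rewrite e1 mulf_neq0 // expfz_neq0 // subr_eq0.
Qed.

End Nonconstant.

(** * Local comparison of two functions sharing values *)

Section Orders.
Context {R : realType}.
Local Notation C := R[i].
Implicit Types (f g h u v : C -> C) (z : C) (Q : {poly C}).

Local Opaque derive1.

Variables (n : nat) (a b : C).
Hypothesis hn : (3 <= n)%N.
Hypothesis a0 : a != 0.
Hypothesis b0 : b != 0.
Definition uniqP : {poly C} := 'X^n + a *: 'X^(n - 1) + b%:P.
Local Notation P := uniqP.

Lemma hornerP (w : C) : P.[w] = w ^+ n + a * w ^+ (n - 1) + b.
Proof. by rewrite /uniqP !hornerD hornerZ !hornerXn hornerC. Qed.

Lemma P0 : P.[0] = b.
Proof.
by rewrite hornerP !expr0n; move: hn; case: n => [|[|[|m]]] //= _; rewrite mulr0 !add0r.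
Qed.

Lemma size_P : size P = n.+1.
Proof.
rewrite /uniqP -addrA size_polyDl size_polyXn // (leq_ltn_trans (size_polyD _ _)) //.
rewrite gtn_max size_polyC (leq_ltn_trans (size_scale_leq _ _)) ?size_polyXn; last by lia.
by rewrite (leq_ltn_trans (leq_b1 _)) //; lia.
Qed.

Lemma P_neq0 : P != 0.
Proof. by rewrite -size_poly_gt0 size_P. Qed.

Lemma derivP : P^`() = n%:R *: 'X^(n - 1) + (a * (n - 1)%:R) *: 'X^(n - 2).
Proof.
rewrite /uniqP !derivD derivZ !derivXn derivC addr0.
have -> : n.-1 = (n - 1)%N by lia.
have -> : (n - 1).-1 = (n - 2)%N by lia.
by rewrite -scalerA !scaler_nat.
Qed.

(* The nonzero root of [P^`()]. *)
Definition crit : C := - (a * (n - 1)%:R / n%:R).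

Lemma nC0 : n%:R != 0 :> C.
Proof. by rewrite pnatr_eq0; lia. Qed.

Lemma horner_dP (w : C) : P^`().[w] = n%:R * (w ^+ (n - 2) * (w - crit)).
Proof.
rewrite derivP hornerD !hornerZ !hornerXn /crit.
have -> : (n - 1 = (n - 2).+1)%N by lia.
by rewrite exprSr; field; exact: nC0.
Qed.

Lemma sf_P : (forall z : C, (mup z P <= 1)%N) -> sf P.
Proof.
move=> hP t Pt; split.
  by apply/eqP => t0; move: Pt; rewrite t0 P0; apply/eqP.
apply/eqP => dP; have := hP t; rewrite leqNgt => /negP; apply.
rewrite mup_geq ?P_neq0 //.
have /factor_theorem[S PE] : root P t by apply/eqP.
have : root S t.
  move: dP; rewrite PE derivM hornerD !hornerM hornerXsubC subrr mulr0 add0r derivXsubC hornerC mulr1.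
  by move=> /eqP.
move=> /factor_theorem[S' SE]; rewrite PE SE -mulrA -expr2.
exact: dvdp_mull.
Qed.

Variable h : C -> C.
Hypothesis nh : nonc h.
Let X z := P.[h z].
(** Equals [1 + a / h + b / h^n]. At a pole of [h] it takes the value [1], with the order of the
    pole as multiplicity, so poles can be treated like value points. *)
Definition Gof z := P.[h z] * (h z ^+ n)^-1.
(* [Wof] is [- (1 / P(h))']. *)
Definition Wof z := derive1 (fun z => P.[h z]) z * (P.[h z] * P.[h z])^-1.

Let nzh := nonc_nzm nh.

Lemma nzX : nzm (fun z => P.[h z]).
Proof. by apply: nonc_poly => //; exact: P_neq0. Qed.

Lemma nzX' : nzm (derive1 (fun z => P.[h z])).
Proof.
apply: nonc_derive; split; first exact/mero_poly/nh.1.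
by move=> c; apply: nonc_polyc => //; rewrite size_P; lia.
Qed.

Lemma nzG : nzm Gof.
Proof. by apply: nzmM; [exact: nzX | apply: nzmV; exact: nzmX]. Qed.

Lemma nzW : nzm Wof.
Proof. by apply: nzmM; [exact: nzX' | apply: nzmV; apply: nzmM; exact: nzX]. Qed.

Lemma X_cases z : [/\ (ord h z < 0)%R -> ord X z = ord h z * n%:Z,
  (0 < ord h z)%R -> ord X z = 0, (0 <= ord h z)%R -> (0 <= ord X z)%R &
  (0 < ord X z)%R -> ord h z = 0].
Proof.
have P00 : P.[0] != 0 by rewrite P0.
have [H1 H2 H3 H4] := poly_order_cases nzX P00 (ordP z nzh).
by split=> //; [move=> m0; rewrite /X H1 // size_P | move=> /H4[]].
Qed.

Lemma ord_G z : ord Gof z = ord X z - n%:Z * ord h z.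
Proof.
rewrite /Gof (ordM z nzX (nzmV (nzmX n nzh))) (ordV z (nzmX n nzh)) (ordX n z nzh).
by rewrite -mulr_natl natz.
Qed.

Lemma ord_W z : ord Wof z = ord (derive1 X) z - 2 * ord X z.
Proof.
rewrite /Wof (ordM z nzX' (nzmV (nzmM nzX nzX))) (ordV z (nzmM nzX nzX)) (ordM z nzX nzX).
by rewrite mulr_natl mulr2n opprD.
Qed.

Lemma logd_S1 z : sf P -> (0 < ord X z)%R -> hasord (logd h) z (ord X z - 1).
Proof.
move=> sP x0; have P00 : P.[0] != 0 by rewrite P0.
have [_ _ _ H4] := poly_order_cases nzX P00 (ordP z nzh).
have [m0 [v [Pv hv]]] := H4 x0; have [v0 /hv h1] := sP v Pv.
exact: (hasord_logd_sub nh.1 x0 v0 h1).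
Qed.

(** [P(h) - b = h^(n-1) (h + a)], so a zero of [h] of order [m] is a [b]-point of [P(h)] of
    multiplicity [(n - 1) m], and [b] is not [0]. *)
Lemma logd_zero z : (0 < ord h z)%R -> hasord (logd X) z ((n - 1)%:Z * ord h z - 1).
Proof.
move=> m0; have hm := ordP z nzh.
have e0 : (0 < (n - 1)%:Z * ord h z)%R by rewrite pmulr_lgt0 //; lia.
have ha : hasord (fun w => h w + a) z 0.
  apply: (@hasord_ext R (fun w => a + h w)); first by apply: nrW => w _; rewrite addrC.
  by apply: hasordD; [exact: hasord_cst | rewrite add0r; apply: ordge_weak (hasord_ge hm); lia].
apply: (hasord_logd_sub (c := b)) => //; first exact/mero_poly/nh.1.
apply: (@hasord_ext R (fun w => h w ^+ (n - 1) * (h w + a))).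
  apply: nrW => w _; rewrite /X hornerP addrK.
  have -> : h w ^+ n = h w * h w ^+ (n - 1) by rewrite -exprS; congr (_ ^+ _); lia.
  by ring.
have := hasordM (hasordX (n - 1) hm) ha.
by rewrite addr0 -mulr_natl natz.
Qed.

(** Near a pole the power [h^(n-1)] dominates the numerator of [G - 1 = (a h^(n-1) + b) / h^n],
    which leaves the order of [1 / h]. *)
Lemma logd_pole z : (ord h z < 0)%R -> hasord (logd Gof) z (- ord h z - 1).
Proof.
move=> m0; have hm := ordP z nzh.
apply: (hasord_logd_sub (c := 1)); rewrite ?oppr_gt0 ?oner_neq0 //; first exact: nzm_mero nzG.
apply: (@hasord_ext R (fun w => (a * h w ^+ (n - 1) + b) * (h w ^+ n)^-1)).
  apply: nrS (hasord_neq0 hm) => w _ w0; rewrite /Gof hornerP.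
  have wn : h w ^+ n != 0 by rewrite expf_neq0.
  by move: wn; move: (h w ^+ n) (h w ^+ (n - 1)) => p q p0; field.
have h1 : hasord (fun w => a * h w ^+ (n - 1) + b) z (ord h z *+ (n - 1)).
  apply: hasordD.
    by rewrite -[_ *+ _]add0r; apply: hasordM; [exact: hasord_cst | exact: hasordX].
  apply: (@ordge_weak _ _ _ 0); last by apply: hol_ordge; exact: hol_cst.
  have : (ord h z *+ (n - 1) < 0)%R by rewrite pmulrn_llt0 //; lia.
  by lia.
have := hasordM h1 (hasordV (hasordX n hm)).
have -> : ord h z *+ n = ord h z + ord h z *+ (n - 1) by rewrite -mulrS; congr (_ *+ _); lia.
by rewrite opprD addrCA subrr addr0.
Qed.

Lemma ord_X' z : ord (derive1 X) z =
  ord (derive1 h) z + ord h z *+ (n - 2) + ord (fun w => h w - crit) z.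
Proof.
have nd := nonc_derive nh; have ns := nonc_sub crit nh.
apply: ordE; have := hasordM (hasordM (ordP z nd) (hasordX (n - 2) (ordP z nzh))) (ordP z ns).
move=> /(hasordM (hasord_cst z nC0)); rewrite add0r; apply: hasord_ext.
apply: nrS (derive_poly P z nh.1) => w _ ->; rewrite horner_dP; ring.
Qed.

End Orders.

Section Pair.
Context {R : realType}.
Local Notation C := R[i].
Implicit Types (z : C).

Local Opaque derive1.

(* Multiplicities counted up to [t + 1] agree; [e <= 0] means that there is no point. *)
Definition mt (e e' : int) (t : nat) : Prop :=
  (0 < e)%R || (0 < e')%R -> e = e' \/ (t%:Z < e)%R /\ (t%:Z < e')%R.
(** Testing [e] alone suffices under [mt], where [e] is positive exactly when [e'] is. *)
Definition mis (e e' : int) : int := if (0 < e)%R && (e != e') then 1 else 0.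

(* Here [m], [x], [s], [v] are the orders of [f], [P(f)], [f - crit] and
   [f' / (f P(f))], the primed letters those for [g], and [h] is the order of [Hof]. *)
Lemma H_arith (n k1 k3 kp : nat) (m m' x y v v' h s s' : int) : (3 <= n)%N -> (4 <= k1)%N ->
  mt (- m) (- m') kp -> mt m m' k3 -> mt x y k1 ->
  ((m < 0)%R -> x = m * n%:Z) -> ((m' < 0)%R -> y = m' * n%:Z) ->
  ((0 <= m)%R -> (0 <= x)%R) -> ((0 <= m')%R -> (0 <= y)%R) ->
  ((0 < m)%R -> x = 0) -> ((0 < m')%R -> y = 0) ->
  ((0 < x)%R -> m = 0) -> ((0 < y)%R -> m' = 0) ->
  ((m < 0)%R -> v = - (n%:Z * m) - 1) -> ((m' < 0)%R -> v' = - (n%:Z * m') - 1) ->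
  ((0 < m)%R -> v = -1) -> ((0 < m')%R -> v' = -1) ->
  ((0 < x)%R -> v = -1) -> ((0 < y)%R -> v' = -1) ->
  (-1 <= h)%R -> (x = 1 -> y = 1 -> (1 <= h)%R) -> ((0 < x)%R -> x = y -> (0 <= h)%R) ->
  (m = 0 -> x = 0 -> m' = 0 -> y = 0 ->
    [/\ (0 <= v)%R, (0 <= v')%R, (0 <= s)%R, (0 <= s')%R & (0 <= h)%R \/ v + s <> v' + s']) ->
  (2 * n%:Z * (Num.max 0 (- m) + Num.max 0 (- m')) - (Num.max 0 x + Num.max 0 y)
   - 6 * (if (0 < - m)%R then 1 else 0) - 6 * (if (0 < m)%R then 1 else 0)
   - 2 * Num.max 0 s - 2 * Num.max 0 s' <= 2 * (v + v' + h))%R.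
Proof.
rewrite /mt => n3 k4 p1 p2 p3 c1 c2 e1 e2 d1 d2 f1 f2 V1 U1 V2 U2 V3 U3 h1 h2 h3 h4.
(* Common points: multiplicity [1] gives [h >= 1]; equal multiplicities from [2] on give [h >= 0]
   and [x + y >= 4]; distinct ones exceed [k1 >= 4], and [x + y] absorbs [h = -1]. *)
have [x0|x0] := ltP 0 x.
  have y0 : (0 < y)%R by clear -p3 x0 k4; lia.
  have m0 := f1 x0; have m1 := f2 y0; have := V3 x0; have := U3 y0.
  rewrite m0 m1 oppr0 maxxx addr0 mulr0 (max_r (ltW y0)) /=.
  by move: (h3 x0) p3; clear -h1 h2 k4 x0 y0; lia.
have y0 : (y <= 0)%R by clear -p3 x0 k4; lia.
have [m0|m0|m0] := ltgtP m 0.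
(* At common poles [v] and [v'] each lose [1] and [h >= -1], which doubled makes [6]; the same loss
   occurs at common zeros. *)
- have m1 : (m' < 0)%R by clear -p1 m0; lia.
  have n0 : (0 <= - m)%R by rewrite oppr_ge0 ltW.
  have n1 : (0 <= - m')%R by rewrite oppr_ge0 ltW.
  rewrite (max_r n0) (max_r n1) oppr_gt0 m0 (max_l y0) (V1 m0) (U1 m1).
  have -> : 2 * n%:Z * (- m - m') = 2 * (- (n%:Z * m)) + 2 * (- (n%:Z * m')) by ring.
  by clear -h1; lia.
- have m1 : (0 < m')%R by clear -p2 m0; lia.
  have n0 : (- m <= 0)%R by rewrite oppr_le0 ltW.
  have n1 : (- m' <= 0)%R by rewrite oppr_le0 ltW.
  rewrite (max_l n0) (max_l n1) (V2 m0) (U2 m1) addr0 mulr0 oppr_gt0 ltNge (ltW m0) /=.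
  by clear -h1 y0; lia.
have m1 : m' = 0 by clear -p1 p2 m0; lia.
have x00 : x = 0 by have := e1; rewrite m0 lexx => /(_ isT); clear -x0; lia.
have y00 : y = 0 by have := e2; rewrite m1 lexx => /(_ isT); clear -y0; lia.
(* If [h = -1], then [v + s] and [v' + s'] are distinct nonnegative integers, so their sum is at
   least [1]. *)
have [v0 u0 s0 s1 H] := h4 m0 x00 m1 y00.
rewrite m0 m1 oppr0 maxxx addr0 mulr0 /= y00 maxxx.
by clear -v0 u0 s0 s1 H h1; lia.
Qed.

Variables (n : nat) (a b : C).
Hypothesis hn : (3 <= n)%N.
Hypothesis a0 : a != 0.
Hypothesis b0 : b != 0.
Local Notation P := (uniqP n a b).
Hypothesis sP : sf P.
Variables (f g : C -> C).
Hypothesis nf : nonc f.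
Hypothesis ng : nonc g.
Variables k1 k3 kp : nat.
Local Notation X := (fun z => P.[f z]).
Local Notation Y := (fun z => P.[g z]).
Hypothesis hx : forall z, mt (ord X z) (ord Y z) k1.
Hypothesis hz : forall z, mt (ord f z) (ord g z) k3.
Hypothesis hp : forall z, mt (- ord f z) (- ord g z) kp.
Hypothesis fp : forall z, (ord f z < 0)%R -> (ord f z <= - 2)%R.
Hypothesis gp : forall z, (ord g z < 0)%R -> (ord g z <= - 2)%R.

Let nzf := nonc_nzm nf.
Let nzg := nonc_nzm ng.
Let nzXf := nzX hn a0 b0 nf.
Let nzXg := nzX hn a0 b0 ng.
Let nzGf := nzG hn a0 b0 nf.
Let nzGg := nzG hn a0 b0 ng.

Definition Psi1 := D X Y.
Definition Psi2 := D (Gof n a b f) (Gof n a b g).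
Definition Psi3 := D f g.

Lemma Psi3_ge z : ordge Psi3 z (k1%:Z * mis (ord X z) (ord Y z) - mis (ord f z) (ord g z)
  - mis (- ord f z) (- ord g z)).
Proof.
have [_ _ _ c1] := X_cases hn a0 b0 nf z; have [_ _ _ c2] := X_cases hn a0 b0 ng z.
have := @hx z; have := @hz z; have := @hp z; rewrite /mt => p1 p2 p3.
have [x0|x0] := ltP 0 (ord X z).
  have y0 : (0 < ord Y z)%R by move: p3; rewrite x0 => /(_ isT); lia.
  have m0 := c1 x0; have m1 := c2 y0.
  have -> : mis (ord f z) (ord g z) = 0 by rewrite /mis m0 ltxx.
  have -> : mis (- ord f z) (- ord g z) = 0 by rewrite /mis m0 oppr0 ltxx.
  rewrite !subr0 /mis x0 /=.
  case: eqVneq => [_|xy] /=; first by rewrite mulr0; apply: ordge_D_eq => //; rewrite m0 m1.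
  rewrite mulr1; apply: ordgeB.
    by apply: ordge_weak (hasord_ge (logd_S1 hn a0 b0 nf sP x0)); lia.
  by apply: ordge_weak (hasord_ge (logd_S1 hn a0 b0 ng sP y0)); lia.
have -> : mis (ord X z) (ord Y z) = 0 by rewrite /mis ltNge x0.
rewrite mulr0 sub0r; have [e|ne] := eqVneq (ord f z) (ord g z).
  by rewrite /mis e !eqxx !andbF subr0 oppr0; exact: ordge_D_eq.
apply: ordge_weak (ordge_D z nzf nzg).
by move: p1 p2 ne; rewrite /mis; do 2 case: ifP; lia.
Qed.

(** Both estimates rest on [(n - 1) m - 1 >= 2 m - 1] at a zero of order [m]. The first feeds the
    linear system for the mismatches; the second counts every zero of [f] once and later shows that
    zeros are rare. *)
Lemma Psi1_ge z : ordge Psi1 z ((2 * k3 + 1)%:Z * mis (ord f z) (ord g z) - mis (ord X z) (ord Y z)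
  - mis (- ord f z) (- ord g z)) /\
  ordge Psi1 z ((if (0 < ord f z)%R then 1 else 0) - mis (ord X z) (ord Y z)
  - mis (- ord f z) (- ord g z)).
Proof.
have [c1 d1 e1 f1] := X_cases hn a0 b0 nf z; have [c2 d2 e2 f2] := X_cases hn a0 b0 ng z.
have := @hx z; have := @hz z; have := @hp z; rewrite /mt => p1 p2 p3.
have [m0|m0] := ltP 0 (ord f z).
  have m1 : (0 < ord g z)%R by move: p2; rewrite m0 => /(_ isT); lia.
  have -> : mis (ord X z) (ord Y z) = 0 by rewrite /mis d1 // ltxx.
  have -> : mis (- ord f z) (- ord g z) = 0 by rewrite /mis oppr_gt0 ltNge (ltW m0).
  rewrite !subr0; have h1 := hasord_ge (logd_zero hn a0 b0 nf m0).
  have h2 := hasord_ge (logd_zero hn a0 b0 ng m1).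
  have l1 : (2 * ord f z <= (n - 1)%:Z * ord f z)%R by rewrite ler_pM2r //; lia.
  have l2 : (2 * ord g z <= (n - 1)%:Z * ord g z)%R by rewrite ler_pM2r //; lia.
  split; last by apply: ordgeB; [apply: ordge_weak h1 | apply: ordge_weak h2]; lia.
  rewrite /mis m0; case: eqVneq => [e|ne] /=; last first.
    by rewrite mulr1; apply: ordgeB; [apply: ordge_weak h1 | apply: ordge_weak h2]; lia.
  by rewrite mulr0; apply: ordge_D_eq => //; rewrite d1 // d2.
have -> : mis (ord f z) (ord g z) = 0 by rewrite /mis ltNge m0.
rewrite mulr0 sub0r.
suff h : ordge Psi1 z (- mis (ord X z) (ord Y z) - mis (- ord f z) (- ord g z)) by split.
have [e|ne] := eqVneq (ord X z) (ord Y z).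
  apply: (@ordge_weak _ _ _ 0); last exact: ordge_D_eq.
  by rewrite /mis; do 2 case: ifP; lia.
apply: ordge_weak (ordge_D z nzXf nzXg).
have m1 : (ord g z <= 0)%R by move: p2; lia.
rewrite /mis; have [f0|f0] := ltP (ord f z) 0.
  have g0 : (ord g z < 0)%R by move: p1; lia.
  have : ord f z != ord g z by apply: contraNneq ne => e; rewrite c1 // c2 // e.
  by do 2 case: ifP; lia.
have g0 : (0 <= ord g z)%R by move: p1; lia.
by move: (e1 f0) (e2 g0) p3; do 2 case: ifP; lia.
Qed.

(** Both terms of [Psi2] vanish to order [p - 1] at poles of order [p]; [fp] and [gp] make this at
    least [1], so the second estimate counts every pole of [f]. *)
Lemma Psi2_ge z : ordge Psi2 z (kp%:Z * mis (- ord f z) (- ord g z) - mis (ord X z) (ord Y z)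
  - mis (ord f z) (ord g z)) /\
  ordge Psi2 z ((if (0 < - ord f z)%R then 1 else 0) - mis (ord X z) (ord Y z)
  - mis (ord f z) (ord g z)).
Proof.
have [c1 d1 e1 f1] := X_cases hn a0 b0 nf z; have [c2 d2 e2 f2] := X_cases hn a0 b0 ng z.
have := @hx z; have := @hz z; have := @hp z; rewrite /mt => p1 p2 p3.
have q1 := @fp z; have q2 := @gp z.
have G1 := ord_G hn a0 b0 nf z; have G2 := ord_G hn a0 b0 ng z.
have [m0|m0] := ltP (ord f z) 0.
  have m1 : (ord g z < 0)%R by move: p1; lia.
  have h1 := hasord_ge (logd_pole hn a0 b0 nf m0); have h2 := hasord_ge (logd_pole hn a0 b0 ng m1).
  have -> : mis (ord X z) (ord Y z) = 0.
    by rewrite /mis c1 // ltNge nmulr_rle0.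
  have -> : mis (ord f z) (ord g z) = 0 by rewrite /mis ltNge (ltW m0).
  rewrite !subr0 oppr_gt0 m0; split; last first.
    by apply: ordgeB; [apply: ordge_weak h1 | apply: ordge_weak h2]; lia.
  rewrite /mis oppr_gt0 m0 /=; case: eqVneq => [e|ne] /=.
    by rewrite mulr0; apply: ordgeB; [apply: ordge_weak h1 | apply: ordge_weak h2]; lia.
  by rewrite mulr1; apply: ordgeB; [apply: ordge_weak h1 | apply: ordge_weak h2]; lia.
have g0 : (0 <= ord g z)%R by move: p1; lia.
have -> : mis (- ord f z) (- ord g z) = 0 by rewrite /mis oppr_gt0 ltNge m0.
rewrite mulr0 oppr_gt0 ltNge m0 /= sub0r.
suff h : ordge Psi2 z (- mis (ord X z) (ord Y z) - mis (ord f z) (ord g z)) by split.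
have [e|ne] := eqVneq (ord (Gof n a b f) z) (ord (Gof n a b g) z).
  apply: (@ordge_weak _ _ _ 0); last exact: ordge_D_eq.
  by rewrite /mis; do 2 case: ifP; lia.
apply: ordge_weak (ordge_D z nzGf nzGg).
move: ne; rewrite G1 G2 => ne.
move: (e1 m0) (e2 g0) => x0 y0.
rewrite /mis; have [f0|f0] := ltP 0 (ord f z).
  have g1 : (0 < ord g z)%R by move: p2; lia.
  have : ord f z != ord g z by apply: contraNneq ne => e; rewrite d1 // d2 // e.
  by do 2 case: ifP; lia.
have f00 : ord f z = 0 by lia.
have g00 : ord g z = 0 by move: p2; lia.
by move: ne p3; rewrite f00 g00 mulr0 !subr0 /=; case: ifP; lia.
Qed.

Lemma zatD u v z m m' : zat (fun w => u w - v w) z -> hasord u z m -> hasord v z m' -> m = m'.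
Proof.
move=> uv hu hv; apply: hasord_uniq hu _; apply: hasord_ext hv.
by apply: nrS uv => w _ /eqP; rewrite subr_eq0 => /eqP.
Qed.

Lemma zat_D u v z : nzm u -> nzm v -> zat (D u v) z -> ord u z = ord v z.
Proof.
move=> nu nv h; apply/eqP; apply: contraPT h => ne.
exact: hasord_zat (hasord_D_neq nu nv ne).
Qed.

(** Two coinciding logarithmic derivatives have equal residues, and equal orders at the points where
    they vanish; together these determine all multiplicities. This settles the case in which some
    [Psi] yields no counting inequality. *)
Lemma no_mismatch z : [\/ zat Psi1 z, zat Psi2 z | zat Psi3 z] ->
  ord X z = ord Y z /\ ord f z = ord g z.
Proof.
have [c1 d1 e1 f1] := X_cases hn a0 b0 nf z; have [c2 d2 e2 f2] := X_cases hn a0 b0 ng z.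
have := @hx z; have := @hz z; have := @hp z; rewrite /mt => p1 p2 p3.
have G1 := ord_G hn a0 b0 nf z; have G2 := ord_G hn a0 b0 ng z.
have zeros : (0 < ord f z)%R -> zat (D X Y) z -> ord f z = ord g z.
  move=> m0 h; have m1 : (0 < ord g z)%R by move: p2; lia.
  have := zatD h (logd_zero hn a0 b0 nf m0) (logd_zero hn a0 b0 ng m1) => e.
  by apply: (@mulfI _ (n - 1)%:Z); lia.
have poles : (ord f z < 0)%R -> zat Psi2 z -> ord f z = ord g z.
  move=> m0 h; have m1 : (ord g z < 0)%R by move: p1; lia.
  by have := zatD h (logd_pole hn a0 b0 nf m0) (logd_pole hn a0 b0 ng m1); lia.
case=> h.
- have xy := zat_D nzXf nzXg h; split=> //.
  have [m0|m0|m0] := ltgtP (ord f z) 0; last by move: p1 p2; lia.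
    have m1 : (ord g z < 0)%R by move: p1; lia.
    by move: xy; rewrite c1 // c2 // => /mulIf; apply; lia.
  exact: zeros.
- have := zat_D nzGf nzGg h; rewrite G1 G2 => e.
  have [m0|m0|m0] := ltgtP (ord f z) 0.
  + have m1 : (ord g z < 0)%R by move: p1; lia.
    by have m01 := poles m0 h; rewrite c1 // c2 // m01.
  + have m1 : (0 < ord g z)%R by move: p2; lia.
    move: e; rewrite d1 // d2 // !sub0r => /oppr_inj /mulfI ->; [by [] | lia].
  have m1 : ord g z = 0 by move: p1 p2; lia.
  by move: e; rewrite m0 m1 mulr0 !subr0.
have mm := zat_D nzf nzg h; split=> //.
have [m0|m0|m0] := ltgtP (ord f z) 0.
- by rewrite c1 // c2 ?mm // -mm.
- by rewrite d1 // d2 // -mm.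
have [x0|x0] := ltP 0 (ord X z).
  have y0 : (0 < ord Y z)%R by move: p3; lia.
  by have := zatD h (logd_S1 hn a0 b0 nf sP x0) (logd_S1 hn a0 b0 ng sP y0); lia.
have l1 : (0 <= ord X z)%R by apply: e1; lia.
have l2 : (0 <= ord Y z)%R by apply: e2; lia.
by move: p3; lia.
Qed.

Lemma logd_W h z : nonc h -> nr z (fun w => logd (Wof n a b h) w =
  logd (derive1 (fun z => P.[h z])) w - 2 * logd (fun z => P.[h z]) w).
Proof.
move=> nh; apply: nrS2 (nzm_cd z (nzX' hn a0 b0 nh)) (nzm_cd z (nzX hn a0 b0 nh)).
move=> w _ [d1 n1] [d2 n2]; have [l hl] := d2.
have d3 : exists l, cd (fun z => P.[h z] * P.[h z]) w l by eexists; exact: (gdM hl hl).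
have n3 : P.[h w] * P.[h w] != 0 by rewrite mulf_neq0.
have [l' hl'] := d3; have d4 : exists l, cd (fun z => (P.[h z] * P.[h z])^-1) w l.
  by eexists; exact: (gdV (f := fun z => P.[h z] * P.[h z]) n3 hl').
by rewrite /Wof logdM_pt ?invr_eq0 // (logdV_pt d3 n3) (logdM_pt d2 d2) // mulr_natl mulr2n.
Qed.

Definition Hof := D (Wof n a b f) (Wof n a b g).
Local Notation Vf := (fun z => derive1 f z * (f z * P.[f z])^-1).
Local Notation Vg := (fun z => derive1 g z * (g z * P.[g z])^-1).
Local Notation c0 := (crit n a).

(** By [logd_simple_zero] both logarithmic derivatives have the polar part [- 2 / (w - z)] up to
    functions vanishing at [z], and the polar parts cancel. *)
Lemma Hof_ge1 z : ord X z = 1 -> ord Y z = 1 -> ordge Hof z 1.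
Proof.
move=> x1 y1; have h1 := logd_simple_zero nzXf (nzX' hn a0 b0 nf) x1.
have h2 := logd_simple_zero nzXg (nzX' hn a0 b0 ng) y1.
apply: ordge_ext (ordgeB h1 h2).
apply: nrS2 (logd_W z nf) (logd_W z ng) => w _ e1 e2.
rewrite /Hof /D e1 e2.
have alg (p q r : C) : p - r - (q - r) = p - q by ring.
exact: alg.
Qed.

Hypothesis k14 : (4 <= k1)%N.

(** The estimate is doubled so that the weight one half on the zeros of [X] and [Y] stays integral.
    The terms with [c0] pay for poles of [Hof] at zeros of the factors [f - c0] of [X'] and [g - c0]
    of [Y']. *)
Lemma Hof_ge z : nzm Hof ->
  (2 * n%:Z * (Num.max 0 (- ord f z) + Num.max 0 (- ord g z))
   - (Num.max 0 (ord X z) + Num.max 0 (ord Y z))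
   - 6 * (if (0 < - ord f z)%R then 1 else 0) - 6 * (if (0 < ord f z)%R then 1 else 0)
   - 2 * Num.max 0 (ord (fun w => f w - c0) z) - 2 * Num.max 0 (ord (fun w => g w - c0) z)
   <= 2 * (ord Vf z + ord Vg z + ord Hof z))%R.
Proof.
move=> nH; have [c1 d1 e1 f1] := X_cases hn a0 b0 nf z; have [c2 d2 e2 f2] := X_cases hn a0 b0 ng z.
have p1 := @hp z; have p2 := @hz z; have p3 := @hx z.
have nf' := nonc_derive nf; have ng' := nonc_derive ng.
have [V1 V2 V3 V4] := ord_smt z nzf nf' nzXf sP (size_P hn a0 b0).
have [U1 U2 U3 U4] := ord_smt z nzg ng' nzXg sP (size_P hn a0 b0).
have nzWf := nzW hn a0 b0 nf; have nzWg := nzW hn a0 b0 ng.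
have W1 := ord_W hn a0 b0 nf z; have W2 := ord_W hn a0 b0 ng z.
have X1 := ord_X' hn a0 b0 nf z; have Y1 := ord_X' hn a0 b0 ng z.
have H0 : ord (Wof n a b f) z = ord (Wof n a b g) z -> (0 <= ord Hof z)%R.
  by move=> e; apply: ord_ge nH (ordge_D_eq nzWf nzWg e).
apply: (H_arith (k1 := k1) (k3 := k3) (kp := kp)) => //.
- exact: ord_ge nH (ordge_D z nzWf nzWg).
- by move=> x1 y1; apply: ord_ge nH (Hof_ge1 x1 y1).
- move=> x0 xy; have D1 : ord (derive1 X) z = ord X z - 1.
    by apply: ordE; apply: hasord_derive; [rewrite gt_eqF | exact: ordP].
  have D2 : ord (derive1 Y) z = ord Y z - 1.
    by apply: ordE; apply: hasord_derive; [rewrite -xy gt_eqF | exact: ordP].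
  have D12 := etrans D1 (etrans (congr1 (fun p => p - 1) xy) (esym D2)).
  exact: H0 (etrans W1 (etrans (congr2 (fun p q => p - 2 * q) D12 xy) (esym W2))).
move=> m0 x00 m1 y00; have [-> v0] := V4 m0 x00; have [-> u0] := U4 m1 y00.
rewrite m0 mul0rn addr0 in X1; rewrite m1 mul0rn addr0 in Y1.
have s1 : (0 <= ord (fun w => f w - c0) z)%R.
  apply: ord_ge (nonc_sub c0 nf) _; apply: ordgeB; last by apply: hol_ordge; exact: hol_cst.
  by rewrite -m0; apply: hasord_ge; exact: ordP.
have s2 : (0 <= ord (fun w => g w - c0) z)%R.
  apply: ord_ge (nonc_sub c0 ng) _; apply: ordgeB; last by apply: hol_ordge; exact: hol_cst.
  by rewrite -m1; apply: hasord_ge; exact: ordP.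
split=> //; have [A1|A1] := eqVneq (ord (derive1 X) z) (ord (derive1 Y) z); last first.
  right=> E; move/eqP: A1; apply; exact: etrans X1 (etrans E (esym Y1)).
left.
exact: H0 (etrans W1 (etrans (congr2 (fun p q => p - 2 * q) A1 (etrans x00 (esym y00))) (esym W2))).
Qed.

Lemma inv_X_derive h z : nonc h ->
  nr z (fun w => derive1 (fun z => (P.[h z])^-1) w = - Wof n a b h w).
Proof.
move=> nh; apply: nrS2 (mero_cd z (nzm_mero (nzX hn a0 b0 nh))) (nzm_cd z (nzX hn a0 b0 nh)).
move=> w _ hl [_ n2]; have [_ ->] := cd_derivable (gdV (f := fun z => P.[h z]) n2 hl).
by rewrite /Wof expr2 mulNr.
Qed.

(** [Wof] is minus the derivative of [1 / P(h)], so a constant ratio of the two integrates to an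
    affine relation. *)
Lemma Hof_zero : (forall z, zat Hof z) ->
  exists c d, c != 0 /\ eqm (fun z => (P.[f z])^-1) (fun z => c * (P.[g z])^-1 + d).
Proof.
move=> hH; have nzWf := nzW hn a0 b0 nf; have nzWg := nzW hn a0 b0 ng.
have [c cn0 hc] := D_zat nzWf nzWg hH.
have mX := nzm_mero (nzmV nzXf); have mY := nzm_mero (nzmV nzXg).
have [||d hd] := @derive_zat_cst R (fun z => (P.[f z])^-1 - c * (P.[g z])^-1).
- by apply: meroB => //; apply: meroM => //; exact: mero_cst.
- move=> z; have h1 := nr_and (mero_cd z mX) (mero_cd z mY).
  have h2 := nr_and (inv_X_derive z nf) (inv_X_derive z ng).
  apply: nrS3 h1 h2 (hc z) => w _ [d1 d2] [e1 e2] e3.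
  have [_ ->] := cd_derivable (gdB d1 (gdZ c d2)).
  by rewrite e1 e2 e3 mulrN opprK addNr.
exists c, d; split=> // z; apply: nrS (hd z) => w _ <-.
by rewrite addrC subrK.
Qed.

(* [- a] is the only nonzero root of [P - b]. *)
Definition smt_data (Q : {poly C}) (u v : C -> C) (d : nat) :=
  [/\ sf Q, size Q = d.+1, d = 1 \/ d = 2 & forall z, (0 < ord (fun w => Q.[u w]) z)%R ->
    ord v z != 0 \/ d = 2 /\ (0 < ord (fun w => v w - (- a)) z)%R].

Lemma sf_XsubC (t : C) : t != 0 -> sf ('X - t%:P).
Proof.
move=> t0 s; rewrite hornerXsubC => /eqP; rewrite subr_eq0 => /eqP ->.
by rewrite derivXsubC hornerC oner_neq0.
Qed.

Lemma sf_pair (t1 t2 : C) : t1 != 0 -> t2 != 0 -> t1 != t2 -> sf (('X - t1%:P) * ('X - t2%:P)).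
Proof.
move=> h1 h2 h12 s; rewrite hornerM !hornerXsubC derivM !derivXsubC mul1r mulr1.
rewrite hornerD !hornerXsubC => /eqP; rewrite mulf_eq0 !subr_eq0 => /orP[] /eqP ->; split=> //.
  by rewrite subrr addr0 subr_eq0.
by rewrite subrr add0r subr_eq0 eq_sym.
Qed.

Lemma ordge0_of u z : nzm u -> (0 <= ord u z)%R -> ordge u z 0.
Proof. by move=> nu h; apply: ordge_weak h (hasord_ge (ordP z nu)). Qed.

Lemma ord_mul_pos (Q S : {poly C}) u z : nonc u -> Q.[0] != 0 -> Q * S != 0 ->
  (0 < ord (fun w => Q.[u w]) z)%R -> (0 < ord (fun w => (Q * S).[u w]) z)%R.
Proof.
move=> nu Q0 QS h; have nzu := nonc_nzm nu.
have Qn0 : Q != 0 by apply: contraNneq Q0 => ->; rewrite horner0.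
have Sn0 : S != 0 by apply: contraNneq QS => ->; rewrite mulr0.
have nQ := nonc_poly nu Qn0; have nS := nonc_poly nu Sn0.
have [_ _ _ /(_ h)[m0 _]] := poly_order_cases nQ Q0 (ordP z nzu).
have uz : ordge u z 0 by apply: ordge0_of => //; rewrite m0.
have := ord_ge nS (ordge0_poly S uz) => hS.
have -> : (fun w => (Q * S).[u w]) = (fun w => Q.[u w] * S.[u w]).
  by apply/funext => w; rewrite hornerM.
by rewrite ordM // ltr_wpDr.
Qed.

Lemma poly_root_nonzero (c d : C) : c != 0 -> d != 0 -> exists2 t, t != 0 & root (c%:P + d *: P) t.
Proof.
(* With constant term [0] the polynomial is [d z^(n-1) (z + a)], whose nonzero root is [- a]. *)
move=> cn0 dn0; have [e|e] := eqVneq (c + d * b) 0.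
  exists (- a); first by rewrite oppr_eq0.
  rewrite /root hornerD hornerC hornerZ hornerP.
  have -> : (- a) ^+ n = - a * (- a) ^+ (n - 1) by rewrite -exprS; congr (_ ^+ _); lia.
  by rewrite mulNr addNr add0r e.
have sQ : size (c%:P + d *: P) != 1.
  rewrite addrC size_polyDl size_scale // (size_P hn a0 b0) ?size_polyC; first by lia.
  by rewrite cn0; lia.
have [t rt] := closed_rootP _ sQ; exists t => //; apply/eqP => t0.
by move: rt; rewrite /root t0 hornerD hornerC hornerZ P0 // (negbTE e).
Qed.

(** The relation reads [1 / P(u) = (c + d P(v)) / P(v)]. Where [v] takes a nonzero root of
    [c + d P], the left-hand side vanishes, so [u] has a pole there. *)
Lemma smt_data_const (u v : C -> C) (c d : C) : nonc u -> nonc v -> c != 0 -> d != 0 ->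
  eqm (fun z => (P.[u z])^-1) (fun z => c * (P.[v z])^-1 + d) ->
  exists Q, smt_data Q v u 1.
Proof.
move=> nu nv cn0 dn0 e; have [t t0 rt] := poly_root_nonzero cn0 dn0.
have nX := nzX hn a0 b0 nu; have nY := nzX hn a0 b0 nv.
exists ('X - t%:P); split; [exact: sf_XsubC | by rewrite size_XsubC | by left | move=> z h; left].
have Q0 : ('X - t%:P).[0] != 0 by rewrite hornerXsubC sub0r oppr_eq0.
have /factor_theorem[S SE] := rt; rewrite mulrC in SE.
have Qn0 : ('X - t%:P) * S != 0.
  rewrite -SE -size_poly_gt0 addrC size_polyDl size_scale // (size_P hn a0 b0) //.
  by rewrite size_polyC cn0; lia.
have h1 := ord_mul_pos nv Q0 Qn0 h; rewrite -SE in h1.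
have nQ : nzm (fun w => (c%:P + d *: P).[v w]) by apply: nonc_poly => //; rewrite SE.
have E : ord (fun z => (P.[u z])^-1) z = ord (fun w => (c%:P + d *: P).[v w] * (P.[v w])^-1) z.
  apply: eqm_ord => y; apply: nrS2 (e y) (nzm_cd y nY) => w _ -> [_ w0].
  by rewrite hornerD hornerC hornerZ; field.
move: E; rewrite ordV // (ordM z nQ (nzmV nY)) ordV // => E.
have v0 : ord (fun z => ('X - t%:P).[v z]) z != 0 by rewrite gt_eqF.
have nT : nzm (fun w => ('X - t%:P).[v w]).
  by apply: nonc_poly => //; rewrite polyXsubC_eq0.
have [_ _ _ /(_ h)[m0 _]] := poly_order_cases nT Q0 (ordP z (nonc_nzm nv)).
have y0 : ord (fun w => P.[v w]) z = 0.
  have P00 : P.[0] != 0 by rewrite P0 //.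
  have [_ _ y0 y1] := poly_order_cases nY P00 (ordP z (nonc_nzm nv)).
  apply/eqP; rewrite eq_le y0 ?m0 // andbT leNgt; apply/negP => yp.
  have hv : ordge v z 0 by apply: ordge0_of; [exact: nonc_nzm | rewrite m0].
  have [w hw ew] := ordge0_hol hv.
  have Pw : P.[w z] = 0.
    apply/eqP; apply: contraT => Pw.
    by have := ordE (hasord0_poly hw ew Pw) => Z; rewrite Z ltxx in yp.
  have Qw : (c%:P + d *: P).[w z] = 0.
    apply/eqP; apply: contraT => Qw.
    by have := ordE (hasord0_poly hw ew Qw) => Z; rewrite Z ltxx in h1.
  by move/eqP: Qw; rewrite hornerD hornerC hornerZ Pw mulr0 addr0 (negbTE cn0).
rewrite y0 subr0 in E.
have [_ _ x0 _] := X_cases hn a0 b0 nu z.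
rewrite -E oppr_gt0 ltNge in h1; apply/eqP => u0; move/negP: h1; apply.
by apply: x0; rewrite u0.
Qed.

(** A single root [t1] would make the polynomial the [n]-th power of a linear factor, whose
    derivative is nonzero at [0]; but [P'] vanishes at [0] since [n >= 3]. *)
Lemma poly_two_roots (c : C) : c != 0 -> exists t1 t2, [/\ t1 != 0, t2 != 0, t1 != t2 &
  exists S, P - b%:P + c%:P = ('X - t1%:P) * ('X - t2%:P) * S].
Proof.
move=> cn0; set Q := P - b%:P + c%:P.
have QE : Q = 'X^n + a *: 'X^(n - 1) + c%:P by rewrite /Q /uniqP addrK.
have Q0 : Q.[0] = c by rewrite /Q hornerD hornerD hornerN !hornerC P0 // subrr add0r.
have sQ : size Q = n.+1.
  by rewrite /Q -addrA size_polyDl (size_P hn a0 b0) // -polyCN -polyCD (leq_ltn_trans (size_polyC_leq1 _)) //; lia.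
have lQ : lead_coef Q = 1.
  rewrite lead_coefE sQ QE !coefD coefZ !coefXn coefC eqxx.
  have -> : (n == n - 1)%N = false by lia.
  have -> : (n == 0)%N = false by lia.
  by rewrite mulr0 !addr0.
have [r rE] := closed_field_poly_normal Q; rewrite lQ scale1r in rE.
have nz t : t \in r -> t != 0.
  move=> tr; apply/eqP => t0; move/eqP: cn0; apply; rewrite -Q0 rE t0 in tr *.
  by rewrite horner_prod (big_rem 0) //= hornerXsubC subrr mul0r.
case: r rE nz => [rE _|t1 r rE nz].
  by move: sQ; rewrite rE big_nil size_poly1; lia.
have [/allP h|/allPn[t2 t2r t12]] := boolP (all (pred1 t1) r); last first.
  exists t1, t2; split; [|by apply: nz; rewrite in_cons t2r orbT|by rewrite eq_sym|].
    by apply: nz; rewrite mem_head.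
  exists (\prod_(z <- rem t2 r) ('X - z%:P)).
  by rewrite rE big_cons (big_rem t2) //= mulrA.
have t10 : t1 != 0 by apply: nz; rewrite mem_head.
exfalso; have E : Q = ('X - t1%:P) ^+ (size r).+1.
  rewrite rE big_cons exprS; congr (_ * _); elim: r h {rE nz} => [|s r IH] h.
    by rewrite big_nil expr0.
  rewrite big_cons /= exprS (eqP (h s (mem_head _ _))) IH // => x xr.
  by apply: h; rewrite in_cons xr orbT.
have sr : size r = n.-1 by have := sQ; rewrite E size_exp_XsubC; lia.
have dQ : Q^`().[0] = 0.
  rewrite /Q derivD derivB !derivC subr0 addr0 horner_dP // expr0n.
  have -> : (n - 2 == 0)%N = false by lia.
  by rewrite mul0r mulr0.
move: dQ; rewrite E deriv_exp derivXsubC mul1r /= hornerMn horner_exp hornerXsubC sub0r.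
move=> /eqP; rewrite mulrn_eq0 /= expf_eq0 oppr_eq0 (negbTE t10) andbF.
by [].
Qed.

(** [P(v) - b + (b - c b) = c u^(n-1) (u + a)], so where [v] takes a root of the polynomial on the
    left, [u] is [0] or [- a]. *)
Lemma smt_data_prop (u v : C -> C) (c : C) : nonc u -> nonc v -> c != 1 ->
  eqm (fun z => P.[v z]) (fun z => c * P.[u z]) -> exists Q, smt_data Q v u 2.
Proof.
move=> nu nv c1 e; have cb : b - c * b != 0.
  by rewrite -{1}[b]mul1r -mulrBl mulf_neq0 // subr_eq0 eq_sym.
have [t1 [t2 [t10 t20 t12 [S SE]]]] := poly_two_roots cb.
set Q := ('X - t1%:P) * ('X - t2%:P) in SE.
exists Q; split; [exact: sf_pair| |by right|].
  by rewrite size_mul ?polyXsubC_eq0 // !size_XsubC.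
move=> z h; have nzu := nonc_nzm nu.
have Q0 : Q.[0] != 0 by rewrite hornerM !hornerXsubC !sub0r mulrNN mulf_neq0.
have Tn0 : Q * S != 0.
  have v0 : (P - b%:P + (b - c * b)%:P).[0] = b - c * b.
    by rewrite hornerD hornerD hornerN !hornerC P0 // subrr add0r.
  by rewrite -SE; apply/eqP => E0; move: cb; rewrite -v0 E0 horner0 eqxx.
have h1 := ord_mul_pos nv Q0 Tn0 h; rewrite -SE in h1.
have [m0|m0] := eqVneq (ord u z) 0; [right | by left].
split=> //; have ns := nonc_sub (- a) nu.
have cn0 : c != 0.
  apply/eqP => c0; apply: (hasord_zat (ordP 0 (nzX hn a0 b0 nv))).
  by apply: nrS (e 0) => w _ ->; rewrite c0 mul0r.
have E : ord (fun w => (P - b%:P + (b - c * b)%:P).[v w]) z =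
    ord (fun w => c * (u w ^+ (n - 1) * (u w - (- a)))) z.
  apply: eqm_ord => y; apply: nrS (e y) => w _ ew.
  rewrite hornerD hornerD hornerN !hornerC ew hornerP.
  have -> : u w ^+ n = u w * u w ^+ (n - 1) by rewrite -exprS; congr (_ ^+ _); lia.
  by ring.
rewrite E in h1; have n1 := nzmX (n - 1) nzu; have n2 := nzm_cst cn0.
move: h1; rewrite (ordM z n2 (nzmM n1 ns)) (ordM z n1 ns) (ordX (n - 1) z nzu) m0 mul0rn add0r.
by rewrite (ordE (hasord_cst z cn0)) add0r.
Qed.

Lemma root_of_unity_neq1 : exists w : C, [/\ w != 1, w != 0 & w ^+ n = 1].
Proof.
have sS : size (\poly_(i < n) (1 : C)) = n.
  by rewrite size_poly_eq // oner_neq0.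
have s1 : size (\poly_(i < n) (1 : C)) != 1 by rewrite sS; lia.
have [w /eqP rw] := closed_rootP _ s1; exists w.
have wE : \sum_(i < n) w ^+ i = 0.
  by rewrite -[RHS]rw horner_poly; apply: eq_bigr => i _; rewrite mul1r.
have wn : w ^+ n = 1 by apply/eqP; rewrite -subr_eq0 subrX1 wE mulr0.
split=> //; apply/eqP => w1.
  move: wE; rewrite w1 (eq_bigr (fun=> 1)) => [|i _]; last by rewrite expr1n.
  by move/eqP; rewrite sumr_const card_ord pnatr_eq0; lia.
by move: wn; rewrite w1 expr0n; case: eqP => [|_ /eqP]; [lia | rewrite eq_sym oner_eq0].
Qed.

(** The values [0] and [oo] are omitted and [w] is totally ramified: three targets of total defect
    at least [1 + 1 + 1/2 > 2], which the second main theorem excludes for nonconstant [h]. *)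
Definition omega_data (h : C -> C) (w : C) := [/\ nonc h, w != 0, forall z, ord h z = 0 &
  forall z, (0 < ord (fun y => h y - w) z)%R -> (2 <= ord (fun y => h y - w) z)%R].

Lemma omega_factor (h : C -> C) w z : nzm h -> ord h z = 0 -> nzm (fun y => h y - w) ->
  w ^+ n = 1 -> (0 < ord (fun y => h y - w) z)%R ->
  hasord (fun y => h y ^+ n - 1) z (ord (fun y => h y - w) z).
Proof.
move=> nh h0 nw wn hw; have hu : ordge h z 0 by apply: ordge0_of => //; rewrite h0.
have [u hu' e] := ordge0_hol hu.
have uw : u z = w.
  apply/eqP; rewrite -subr_eq0; apply: contraT => uz.
  have hs : hol (fun y => u y - w) z by apply: holB => //; exact: hol_cst.
  have : hasord (fun y => h y - w) z 0.
    by apply: hasord_ext (hol_hasord0 hs uz); apply: nrS e => y _ ->.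
  by move=> /ordE E; rewrite E ltxx in hw.
have w0 : w != 0.
  by apply/eqP => w0; move: wn; rewrite w0 expr0n; case: eqP => [|_ /eqP]; [lia | rewrite eq_sym oner_eq0].
pose S : {poly C} := \sum_(i < n) 'X^(n.-1 - i) * (w ^+ i)%:P.
have SE y : y ^+ n - 1 = (y - w) * S.[y].
  rewrite -wn subrXX /S horner_sum; congr (_ * _); apply: eq_bigr => i _.
  by rewrite hornerM hornerXn hornerC.
have Sw : S.[u z] != 0.
  rewrite uw /S horner_sum (eq_bigr (fun=> w ^+ n.-1)) => [|i _].
    by rewrite sumr_const card_ord -mulr_natl mulf_neq0 ?expf_neq0 // pnatr_eq0; lia.
  by rewrite hornerM hornerXn hornerC -exprD; congr (_ ^+ _); case: i => i /= ; lia.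
have := hasordM (ordP z nw) (hasord0_poly hu' e Sw); rewrite addr0.
by apply: hasord_ext; apply: nrW => y _; rewrite SE.
Qed.

Lemma omega_case (h : C -> C) : nonc h -> (forall z, ord h z = 0) ->
  (forall z m, (0 < m)%R -> hasord (fun y => h y ^+ n - 1) z m ->
     (forall w, w ^+ n = 1 -> w != 1 -> hasord (fun y => h y - w) z m -> (2 <= m)%R)) ->
  exists w, omega_data h w.
Proof.
move=> nh h0 H; have [w [w1 w0 wn]] := root_of_unity_neq1.
exists w; split=> // z hw; have nw := nonc_sub w nh.
exact: (H z _ hw (omega_factor (nonc_nzm nh) (h0 z) nw wn hw) w wn w1 (ordP z nw)).
Qed.

Lemma quot_nonc : (forall k : C, k != 0 -> eqm f (fun z => k * g z) -> False) ->
  nonc (fun z => f z * (g z)^-1).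
Proof.
move=> H; have nq := nzmM nzf (nzmV nzg); split; first exact: nzm_mero.
move=> k hk; apply: (H k).
  apply/eqP => k0; apply: (hasord_zat (ordP 0 nq)).
  by apply: nrS (hk 0) => w _ ->.
by move=> z; apply: nrS2 (hk z) (nzm_cd z nzg) => w _ <- [_ g0]; rewrite divfK.
Qed.

Hypothesis fg : ~ eqm f g.

Lemma poly_eqm_zero (Q : {poly C}) : eqm (fun z => Q.[g z]) (fun=> 0) -> Q = 0.
Proof.
move=> h; apply/eqP; apply: contraT => Q0.
by case: (hasord_zat (ordP 0 (nonc_poly ng Q0))); exact: h.
Qed.

Lemma coef_two (p q r : C) (i j : nat) : i != j -> i != 0%N -> j != 0%N ->
  p *: 'X^i + q *: 'X^j + r%:P = 0 -> [/\ p = 0, q = 0 & r = 0].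
Proof.
move=> ij i0 j0 E; have c m : (p *: 'X^i + q *: 'X^j + r%:P)`_m = 0 by rewrite E coef0.
move: (c i) (c j) (c 0%N); rewrite !coefD !coefZ !coefXn !coefC !eqxx.
rewrite eq_sym in i0; rewrite eq_sym in j0.
rewrite (negbTE ij) [j == i]eq_sym (negbTE ij) (negbTE i0) (negbTE j0).
rewrite ![_ == 0%N]eq_sym (negbTE i0) (negbTE j0) !mulr0 !mulr1 !addr0 !add0r.
by move=> -> -> ->.
Qed.

Lemma kappa1 (k : C) : eqm f (fun z => k * g z) -> k ^+ n = 1 -> k ^+ (n - 1) = 1 -> False.
Proof.
move=> e kn kn1; apply: fg => z; apply: nrS (e z) => w _ ->.
suff -> : k = 1 by rewrite mul1r.
have : k ^+ n = k * k ^+ (n - 1) by rewrite -exprS; congr (_ ^+ _); lia.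
by rewrite kn kn1 mulr1.
Qed.

(** With [h = f / g] the identity reads [g (h^n - 1) = a (1 - h^(n-1))]. At a point where [h] is a
    root of unity [w != 1] the right-hand side is nonzero, so [g] has a pole whose order is the
    multiplicity of the [w]-point, at least [2] by [gp]. *)
Lemma X_eq_case : eqm X Y -> (forall z, ord f z = ord g z) ->
  exists h w, omega_data h w.
Proof.
move=> XY ofg; pose h z := f z * (g z)^-1; exists h; apply: omega_case.
- apply: quot_nonc => k k0 e.
  have [||||h1 h2 _] := @coef_two (k ^+ n - 1) (a * (k ^+ (n - 1) - 1)) 0 n (n - 1).
  + by lia.
  + by lia.
  + by lia.
  + apply: poly_eqm_zero => z; apply: nrS2 (e z) (XY z) => w _ e1.
    rewrite !hornerP e1 !hornerD !hornerZ !hornerXn hornerC !exprMn => e2.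
    have : k ^+ n * g w ^+ n + a * (k ^+ (n - 1) * g w ^+ (n - 1)) + b -
       (g w ^+ n + a * g w ^+ (n - 1) + b) = 0 by rewrite e2 subrr.
    by move=> E0; rewrite -[RHS]E0; ring.
  apply: (kappa1 e); apply/eqP; rewrite -subr_eq0; first by rewrite h1.
  by move/eqP: h2; rewrite mulf_eq0 (negbTE a0).
- by move=> z; rewrite /h (ordM z nzf (nzmV nzg)) ordV // ofg subrr.
move=> z m m0 hm w wn w1 hw.
have wn1 : w ^+ (n - 1) != 1.
  apply: contraNneq w1 => wn1; have : w ^+ n = w * w ^+ (n - 1) by rewrite -exprS; congr (_ ^+ _); lia.
  by rewrite wn wn1 mulr1 => <-.
have h1 : hasord (fun y => 1 - h y ^+ (n - 1)) z 0.
  have [u hu e] := ordge0_hol (ordge_weak (ltW m0) (hasord_ge hw)).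
  have u0 := hasord_pos_hol hw m0 hu e.
  have hv : hol (fun y => 1 - (u y + w) ^+ (n - 1)) z.
    by apply: holB; [exact: hol_cst | apply: holX; apply: holD => //; exact: hol_cst].
  apply: (@hasord_ext R (fun y => 1 - (u y + w) ^+ (n - 1))).
    by apply: nrS e => y _ <-; rewrite subrK.
  by apply: hol_hasord0 => //; rewrite u0 add0r subr_eq0 eq_sym.
have E : hasord (fun y => g y * (h y ^+ n - 1)) z 0.
  have := hasordM (hasord_cst z a0) h1; rewrite add0r; apply: hasord_ext.
  apply: nrS2 (nr_and (nzm_cd z nzf) (nzm_cd z nzg)) (XY z) => y _ [[_ f0] [_ g0]].
  have fE : f y = h y * g y by rewrite /h divfK.
  move: (h y) fE => s fE; rewrite !hornerP fE !exprMn.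
  have -> : g y ^+ n = g y * g y ^+ (n - 1) by rewrite -exprS; congr (_ ^+ _); lia.
  have gn : g y ^+ (n - 1) != 0 by rewrite expf_neq0.
  move: gn; move: (g y ^+ (n - 1)) => r; move: (s ^+ n) => p.
  move: (s ^+ (n - 1)) => q; move: (g y) => t r0 e1.
  apply: (mulIf r0); apply/eqP; rewrite -subr_eq0.
  have -> : a * (1 - q) * r - t * (p - 1) * r = - (p * (t * r) + a * (q * r) + b - (t * r + a * r + b)).
    by ring.
  by rewrite e1 subrr oppr0.
have := hasord_uniq (hasordM (ordP z nzg) hm) E => Eg.
by have := @gp z; lia.
Qed.

(** With [h = f / g] the identity reads [b (h^n - 1) = a (1 - h) f^(n-1)]. At a [w]-point of [h]
    with [w != 1] the function [f] must vanish, so the multiplicity is a positive multiple of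
    [n - 1 >= 2]. *)
Lemma G_eq_case : eqm (Gof n a b f) (Gof n a b g) -> (forall z, ord f z = ord g z) ->
  exists h w, omega_data h w.
Proof.
move=> GG ofg; pose h z := f z * (g z)^-1.
have key z : nr z (fun y => b * (h y ^+ n - 1) = a * (1 - h y) * f y ^+ (n - 1)).
  apply: nrS2 (nr_and (nzm_cd z nzf) (nzm_cd z nzg)) (GG z) => y _ [[_ f0] [_ g0]].
  rewrite /Gof !hornerP => e1.
  have fE : f y = h y * g y by rewrite /h divfK.
  have h0 : h y != 0 by rewrite /h mulf_neq0 ?invr_eq0.
  have e2 (u : C) : u ^+ n = u * u ^+ (n - 1) by rewrite -exprS; congr (_ ^+ _); lia.
  move: (h y) fE h0 => s fE h0.
  move: e1; rewrite fE !exprMn !(e2 (g y)) !(e2 s).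
  have gn : g y ^+ (n - 1) != 0 by rewrite expf_neq0.
  have hn' : s ^+ (n - 1) != 0 by rewrite expf_neq0.
  move: gn hn' g0; move: (g y ^+ (n - 1)) => p; move: (s ^+ (n - 1)) => q.
  move: (g y) => r p0 q0 r0 e1.
  have e3 : (s * q * (r * p) + a * (q * p) + b) = (r * p + a * p + b) * (s * q).
    have := congr1 (fun t => t * (s * q * (r * p))) e1.
    have -> : (s * q * (r * p) + a * (q * p) + b) / (s * q * (r * p)) * (s * q * (r * p)) =
      s * q * (r * p) + a * (q * p) + b by field; rewrite p0 q0 r0 h0.
    by move=> ->; field; rewrite p0 r0.
  have : b * (s * q - 1) - a * (1 - s) * (q * p) =
    (r * p + a * p + b) * (s * q) - (s * q * (r * p) + a * (q * p) + b) by ring.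
  by rewrite e3 subrr => /eqP; rewrite subr_eq0 => /eqP.
exists h; apply: omega_case.
- apply: quot_nonc => k k0 e.
  have [||||h1 h2 h3] := @coef_two (a * (1 - k) * k ^+ (n - 1)) 0 (- (b * (k ^+ n - 1))) (n - 1) n.
  + by lia.
  + by lia.
  + by lia.
  + apply: poly_eqm_zero => z; apply: nrS3 (e z) (key z) (nzm_cd z nzg) => w _ e1 e2 [_ g0].
    rewrite !hornerD !hornerZ !hornerXn hornerC mul0r addr0.
    have hk : h w = k by rewrite /h e1 mulfK.
    by move: e2; rewrite hk e1 exprMn => ->; ring.
  have k1' : k = 1.
    move/eqP: h1; rewrite !mulf_eq0 (negbTE a0) expf_eq0 (negbTE k0) andbF orbF subr_eq0 /=.
    by move=> /eqP.
  by apply: (kappa1 e); rewrite k1' expr1n.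
- by move=> z; rewrite /h (ordM z nzf (nzmV nzg)) ordV // ofg subrr.
move=> z m m0 hm w wn w1 hw.
have h1 : hasord (fun y => 1 - h y) z 0.
  have [u hu e] := ordge0_hol (ordge_weak (ltW m0) (hasord_ge hw)).
  have u0 := hasord_pos_hol hw m0 hu e.
  have hv : hol (fun y => 1 - (u y + w)) z.
    by apply: holB; [exact: hol_cst | apply: holD => //; exact: hol_cst].
  apply: (@hasord_ext R (fun y => 1 - (u y + w))).
    by apply: nrS e => y _ <-; rewrite subrK.
  by apply: hol_hasord0 => //; rewrite u0 add0r subr_eq0 eq_sym.
have E1 := hasordM (hasord_cst z b0) hm.
have E2 := hasordM (hasordM (hasord_cst z a0) h1) (hasordX (n - 1) (ordP z nzf)).
have := hasord_uniq E1 (hasord_ext _ E2); rewrite !add0r => Em.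
have {}Em : m = (n - 1)%:Z * ord f z.
  by rewrite Em; [rewrite -natz mulr_natl | apply: nrS (key z) => y _ ->].
have n10 : (0 < (n - 1)%:Z)%R by lia.
have f0 : (0 < ord f z)%R by move: m0; rewrite Em pmulr_rgt0.
have : ((n - 1)%:Z <= m)%R by rewrite Em ler_peMr //; lia.
by lia.
Qed.

(** At a common zero both [X] and [Y] take the value [b], which forces [b = c * b]. *)
Lemma no_zero_case (c : C) : c != 1 -> eqm X (fun z => c * P.[g z]) -> forall z, (ord f z <= 0)%R.
Proof.
move=> c1 e z; rewrite leNgt; apply/negP => m0.
have m1 : (0 < ord g z)%R by move: (@hz z); rewrite /mt m0 => /(_ isT); lia.
have [u hu eu] := ordge0_hol (ordge0_of nzf (ltW m0)).
have [v hv ev] := ordge0_hol (ordge0_of nzg (ltW m1)).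
have u0 := hasord_pos_hol (ordP z nzf) m0 hu eu.
have v0 := hasord_pos_hol (ordP z nzg) m1 hv ev.
have := @cc_agree R (fun w => P.[u w]) (fun w => c * P.[v w]) z.
rewrite u0 v0 P0 // => H; have : b = c * b.
  apply: H; first exact/hol_cc/hol_poly.
    by apply: hol_cc; apply: holM; [exact: hol_cst | exact: hol_poly].
  by apply: nrS3 (e z) eu ev => w _ h1 h2 h3; rewrite -h2 -h3.
move/eqP; rewrite -{1}[b]mul1r -subr_eq0 -mulrBl mulf_eq0 (negbTE b0) orbF subr_eq0 eq_sym.
by rewrite (negbTE c1).
Qed.

(** At a common pole both functions [Gof] take the value [1], which forces [c = 1]. *)
Lemma no_pole_case (c : C) : c != 1 -> eqm (Gof n a b f) (fun z => c * Gof n a b g z) ->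
  forall z, (0 <= ord f z)%R.
Proof.
move=> c1 e z; rewrite leNgt; apply/negP => m0.
have m1 : (ord g z < 0)%R by move: (@hp z); rewrite /mt oppr_gt0 m0 => /(_ isT); lia.
have G1 (h : C -> C) : nonc h -> (ord h z < 0)%R -> ordge (fun w => Gof n a b h w - 1) z 1.
  move=> nh mh; have nzh := nonc_nzm nh.
  have hi := ordge_weak _ (hasord_ge (hasordV (ordP z nzh))).
  have i1 : ordge (fun w => (h w)^-1) z 1 by apply: hi; lia.
  have i0 : ordge (fun w => (h w)^-1) z 0 by apply: hi; lia.
  have := ordgeM i1 (ordge0_poly (a%:P + b *: 'X^(n - 1)) i0); rewrite addr0; apply: ordge_ext.
  apply: nrS (nzm_cd z nzh) => w _ [_ h0]; rewrite hornerD hornerC hornerZ hornerXn /Gof hornerP.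
  have e2 : h w ^+ n = h w * h w ^+ (n - 1) by rewrite -exprS; congr (_ ^+ _); lia.
  have hn' : h w ^+ (n - 1) != 0 by rewrite expf_neq0.
  by rewrite e2 exprVn; field; rewrite hn' h0.
have h1 := G1 f nf m0; have h2 := G1 g ng m1.
have h3 := ordgeB h1 (ordgeM (hol_ordge (hol_cst c z)) h2).
have c10 : c - 1 != 0 by rewrite subr_eq0.
(* The nonzero constant [c - 1] has order [0], yet it is a combination of functions vanishing at
   [z]. *)
have : (1 <= (0 : int))%R; last by [].
apply: hasord_uniq_le (hasord_cst z c10) _; apply: ordge_ext h3.
by apply: nrS (e z) => w _ ->; ring.
Qed.

End Pair.

(** * Nevanlinna theory *)

Section Count.
Context {R : realType}.
Local Notation C := R[i].
Implicit Types (h u v : C -> C) (a z : C) (c : C -> R).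

Lemma hasord_exprz a z (m : int) : hasord (fun w => (w - a) ^ m) z (if z == a then m else 0).
Proof.
case: eqVneq => [->|za].
  by exists (fun=> 1); split; [exact: hol_cst | exact: oner_neq0 | apply: nrW => w _; rewrite mul1r].
have za0 : z - a != 0 by rewrite subr_eq0.
apply: hol_hasord0; last by rewrite expfz_neq0.
by apply: hol_exprz => //; exact: hol_sub.
Qed.

Lemma hasord_prod (s : seq C) (e : C -> int) z : uniq s ->
  hasord (fun w => \prod_(a <- s) (w - a) ^ e a) z (if z \in s then e z else 0).
Proof.
elim: s => [_|a s IH /= /andP[as_ us]].
  apply: (@hasord_ext R (fun=> 1)); first by apply: nrW => w _; rewrite big_nil.
  by apply: hol_hasord0; [exact: hol_cst | exact: oner_neq0].
apply: (@hasord_ext R (fun w => (w - a) ^ e a * \prod_(b <- s) (w - b) ^ e b)).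
  by apply: nrW => w _; rewrite big_cons.
have := hasordM (hasord_exprz a z (e a)) (IH us).
rewrite in_cons; case: eqVneq => [->|_] /=; last by rewrite add0r.
by rewrite (negbTE as_) addr0.
Qed.

Lemma hol_prod (s : seq C) (e : C -> int) z : z \notin s ->
  hol (fun w => \prod_(a <- s) (w - a) ^ e a) z.
Proof.
elim: s => [_|a s IH].
  by apply: hol_ext (hol_cst 1 z); apply: nbW => w; rewrite big_nil.
rewrite in_cons negb_or => /andP[za zs].
apply: (@hol_ext R (fun w => (w - a) ^ e a * \prod_(b <- s) (w - b) ^ e b)).
  by apply: nbW => w; rewrite big_cons.
apply: holM; last exact: IH.
by apply: hol_exprz; [rewrite subr_eq0 | exact: hol_sub].
Qed.

(** Holomorphic extensions across a removable point agree there, so choosing the extended value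
    point by point yields one function that serves at all of them. *)
Lemma regularize k : exists K : C -> C, forall z u, hol u z -> nr z (fun w => k w = u w) ->
  [/\ hol K z, K z = u z & nr z (fun w => k w = K w)].
Proof.
pose P w (u : C -> C) := hol u w /\ nr w (fun x => k x = u x).
pose K w := xget (fun=> 0) (P w) w.
have KE w u : P w u -> K w = u w.
  move=> Pu; have [hv ev] : P w (xget (fun=> 0) (P w)) by apply: xgetPex; exists u.
  apply: (@cc_agree R (xget (fun=> 0) (P w)) u); [exact: hol_cc hv | exact: hol_cc Pu.1 |].
  by apply: nrS2 ev Pu.2 => x _ -> ->.
exists K => z u hu ku; have e := KE z u (conj hu ku).
have KEn : nr z (fun w => K w = u w).
  apply: nrS2 (nb_nr (hol_nb hu)) (nr_nb ku) => w _ huw kuw.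
  by apply: KE; split=> //; exact: nb_nr.
split=> //; last by apply: nrS2 ku KEn => w _ -> ->.
by apply: hol_ext hu; apply/nb_nrP; split; [apply: nrS KEn => w _ -> | rewrite e].
Qed.

Variable B : set C.
Hypothesis dB : discr B.
Variable r0 : R.
Hypothesis r01 : 1 <= r0.

(* [B] is an exceptional discrete set, outside of which all functions considered
   are holomorphic and nonzero. *)
Definition goodr (r : R) := forall b, B b -> nrm b != r.
Definition reg h := nzm h /\ forall a, ~ B a -> hol h a /\ h a != 0.
Definition disk (r : R) : seq C :=
  finmap.enum_fset (fset_set (B `&` [set z | nrm z <= r])).

Let r0p : 0 < r0.
Proof. exact: lt_le_trans ltr01 r01. Qed.

Lemma mem_disk (r : R) a : a \in disk r <-> B a /\ nrm a <= r.
Proof.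
rewrite in_fset_set; last exact: discr_finite.
by rewrite in_setE.
Qed.

Lemma disk_uniq (r : R) : uniq (disk r).
Proof. exact: finmap.fset_uniq. Qed.

(** Discs contain finitely many points of [B], so some annulus just outside the circle of radius [x]
    is free of them. The density of good radii and the margin [rho] in [reg_factor] come from
    this. *)
Lemma radius_gap (x : R) : exists2 y, x < y & forall b, B b -> nrm b <= x \/ y <= nrm b.
Proof.
have H (s : seq C) : exists2 y, x < y & forall b, b \in s -> nrm b <= x \/ y <= nrm b.
  elim: s => [|a s [y xy hy]]; first by exists (x + 1); [rewrite ltrDl | by []].
  have [ax|ax] := leP (nrm a) x.
    exists y => // b; rewrite in_cons => /orP[/eqP ->|/hy //]; by left.
  exists (Num.min y (nrm a)); first by rewrite lt_min xy.
  move=> b; rewrite in_cons => /orP[/eqP ->|/hy [hb|hb]]; [right|by left|right].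
    by rewrite ge_min lexx orbT.
  by rewrite ge_min hb.
have [y xy hy] := H (disk (x + 1)).
exists (Num.min y (x + 1)); first by rewrite lt_min xy ltrDl ltr01.
move=> b Bb; have [b1|b1] := leP (nrm b) (x + 1).
  have /hy[hb|hb] : b \in disk (x + 1) by apply/mem_disk.
    by left.
  by right; rewrite ge_min hb.
by right; rewrite ge_min (ltW b1) orbT.
Qed.

Lemma goodr_ex (x y : R) : x < y -> exists r, [/\ x < r, r < y & goodr r].
Proof.
move=> xy; have [t xt ht] := radius_gap x.
have m1 : x < Num.min y t by rewrite lt_min xy.
have [r rE] : exists r, r = (x + Num.min y t) / 2 by eexists.
have [xr rt] : x < r /\ r < Num.min y t by rewrite rE; split; lra.
move: rt; rewrite lt_min => /andP[ry rt].
exists r; split=> // b /ht[hb|hb]; rewrite neq_lt; first by rewrite (le_lt_trans hb).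
by rewrite (lt_le_trans rt hb) orbT.
Qed.

Lemma reg_con h (r : R) : 0 <= r -> reg h -> goodr r -> con r h.
Proof.
move=> r0' [_ hr] gr; apply: conI => // z zr; apply: hol_cc.
by apply: (hr z _).1 => /gr; rewrite zr eqxx.
Qed.

Lemma reg_neq0 h (r : R) z : reg h -> goodr r -> nrm z = r -> h z != 0.
Proof. by move=> [_ hr] gr zr; apply: (hr z _).2 => /gr; rewrite zr eqxx. Qed.

Lemma reg_factor h (r : R) : reg h -> exists K (rho : R), [/\ r < rho,
  hol_on (fun z => nrm z < rho) K, (forall z, nrm z < rho -> K z != 0) &
  forall z, nrm z < rho -> ~ B z -> h z = (\prod_(a <- disk r) (z - a) ^ ord h a) * K z].
Proof.
move=> [nh hr]; have [rho rr hrho] := radius_gap r.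
pose p z := \prod_(a <- disk r) (z - a) ^ ord h a.
have op z : hasord p z (if z \in disk r then ord h z else 0) by exact/hasord_prod/disk_uniq.
pose k z := h z / p z.
have k0 z : nrm z < rho -> exists u, [/\ hol u z, u z != 0 & nr z (fun w => k w = u w)].
  move=> zr; have : hasord k z 0.
    have := hasord_div (ordP z nh) (op z); rewrite -/k.
    case: ifPn => [_|zd]; first by rewrite subrr.
    have Bz : ~ B z.
      by move=> Bz; have [hz|] := hrho z Bz; [move/negP: zd; apply; apply/mem_disk | rewrite leNgt zr].
    have [h1 h2] := hr z Bz.
    by rewrite subr0 (ordE (hol_hasord0 h1 h2)).
  move=> [u [hu u0 e]]; exists u; split=> //.
  by apply: nrS e => w _ ->; rewrite expr0z mulr1.
have [K hK] := regularize k.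
exists K, rho; split=> // [z /k0[u [hu _ e]]|z /k0[u [hu u0 e]]|z zr Bz].
- by have [/hol_at] := hK z u hu e.
- by have [_ ->] := hK z u hu e.
have pz : p z != 0.
  rewrite prodf_seq_neq0; apply/allP => a /mem_disk[Ba _]; apply/implyP => _.
  by rewrite expfz_neq0 // subr_eq0; apply/eqP => e; apply: Bz; rewrite e.
have [h1 h2] := hr z Bz.
have hp : hol p z.
  by apply: hol_prod; apply/negP => /mem_disk[].
have hk : hol k z by apply: holM => //; exact: holV.
have [_ -> _] := hK z k hk (nrW (fun w _ => erefl (k w))).
by rewrite /k mulrC divfK.
Qed.

(* [CNT c] is the counting function of [c] between the circles [r0] and [r]. *)
Definition W (r : R) a : R := ln (Num.max r (nrm a)) - ln (Num.max r0 (nrm a)).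
Definition CNT c (r : R) : R := \sum_(a <- disk r) c a * W r a.

Lemma W_ge0 (r : R) a : r0 <= r -> 0 <= W r a.
Proof.
move=> r0r; have rp := lt_le_trans r0p r0r; rewrite subr_ge0 ler_ln ?posrE ?lt_max ?r0p ?rp //.
by rewrite ge_max !le_max r0r lexx orbT.
Qed.

Lemma CNTD c c' (r : R) : CNT (fun a => c a + c' a) r = CNT c r + CNT c' r.
Proof. by rewrite /CNT -big_split /=; apply: eq_bigr => a _; rewrite mulrDl. Qed.

Lemma CNTZ (x : R) c (r : R) : CNT (fun a => x * c a) r = x * CNT c r.
Proof. by rewrite /CNT mulr_sumr; apply: eq_bigr => a _; rewrite mulrA. Qed.

Lemma CNT_le c c' (r : R) : r0 <= r -> (forall a, B a -> c a <= c' a) -> CNT c r <= CNT c' r.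
Proof.
move=> r0r h; rewrite /CNT [leLHS]big_seq [leRHS]big_seq; apply: ler_sum => a /mem_disk[Ba _].
by rewrite ler_wpM2r ?h ?W_ge0.
Qed.

Lemma CNT_ge0 c (r : R) : r0 <= r -> (forall a, B a -> 0 <= c a) -> 0 <= CNT c r.
Proof.
move=> r0r h; rewrite /CNT big_seq sumr_ge0 // => a /mem_disk[Ba _].
by rewrite mulr_ge0 ?h ?W_ge0.
Qed.

Lemma CNT_eq c c' (r : R) : (forall a, B a -> c a = c' a) -> CNT c r = CNT c' r.
Proof.
by move=> h; rewrite /CNT [LHS]big_seq [RHS]big_seq; apply: eq_bigr => a /mem_disk[/h -> _].
Qed.

Lemma CNT_point c b (r : R) : r0 <= r -> (forall a, B a -> 0 <= c a) -> B b -> nrm b <= r ->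
  c b * W r b <= CNT c r.
Proof.
move=> r0r h Bb br; rewrite /CNT (bigD1_seq b) ?disk_uniq //=; last exact/mem_disk.
rewrite lerDl big_seq_cond sumr_ge0 // => a /andP[/mem_disk[Ba _] _].
by rewrite mulr_ge0 ?h ?W_ge0.
Qed.

Lemma sum_disk_le (F : C -> R) (r1 r2 : R) : (forall a, B a -> 0 <= F a) -> r1 <= r2 ->
  \sum_(a <- disk r1) F a <= \sum_(a <- disk r2) F a.
Proof.
move=> h r12.
have sub a : a \in disk r1 -> a \in disk r2.
  by move=> /mem_disk[Ba ar]; apply/mem_disk; split=> //; exact: le_trans ar r12.
rewrite [leRHS](bigID (fun a => a \in disk r1)) /= -[leLHS]addr0.
apply: lerD; last first.
  by rewrite big_seq_cond sumr_ge0 // => a /andP[/mem_disk[Ba _] _]; exact: h.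
rewrite -[X in _ <= X]big_filter.
have pe : perm_eq [seq a <- disk r2 | a \in disk r1] (disk r1).
  apply: uniq_perm; [exact/filter_uniq/disk_uniq | exact: disk_uniq |].
  by move=> a; rewrite mem_filter; apply/andP/idP => [[]|ha] //; split=> //; exact: sub.
by rewrite (perm_big _ pe).
Qed.

Lemma CNT_mono c (r1 r2 : R) : (forall a, B a -> 0 <= c a) -> r0 <= r1 -> r1 <= r2 ->
  CNT c r1 <= CNT c r2.
Proof.
move=> h r01' r12; have r1p := lt_le_trans r0p r01'; have r2p := lt_le_trans r1p r12.
apply: le_trans (_ : \sum_(a <- disk r1) c a * W r2 a <= _).
  rewrite /CNT big_seq [leRHS]big_seq; apply: ler_sum => a /mem_disk[Ba _].
  rewrite ler_wpM2l ?h // lerD2r ler_ln ?posrE ?lt_max ?r1p ?r2p //.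
  by rewrite ge_max !le_max r12 lexx orbT.
apply: sum_disk_le => // a Ba; rewrite mulr_ge0 ?h // W_ge0 //.
exact: le_trans r12.
Qed.

(** Each point of the smaller disc has weight at least [ln r2 - ln r1]; this bounds the number of
    zeros and poles by the characteristic at a larger radius. *)
Lemma CNT_lower c (r1 r2 : R) : (forall a, B a -> 0 <= c a) -> r0 <= r1 -> r1 < r2 ->
  (\sum_(a <- disk r1) c a) * (ln r2 - ln r1) <= CNT c r2.
Proof.
move=> h r01' r12; have r1p := lt_le_trans r0p r01'.
apply: le_trans (sum_disk_le (F := fun a => c a * W r2 a) _ (ltW r12)); last first.
  by move=> a Ba; rewrite mulr_ge0 ?h // W_ge0 // (le_trans r01') // ltW.
rewrite mulr_suml big_seq [X in _ <= X]big_seq; apply: ler_sum => a /mem_disk[Ba ar].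
rewrite ler_wpM2l ?h // /W (max_l (le_trans ar (ltW r12))) lerB // ler_ln ?posrE //.
  by rewrite ge_max r01' ar.
by rewrite lt_max r0p.
Qed.

Lemma lnXz (x : R) (m : int) : 0 < x -> ln (x ^ m) = m%:~R * ln x.
Proof.
move=> x0; case: m => n; first by rewrite -exprnP lnXn // mulr_natl.
by rewrite NegzE -exprz_inv -exprnP lnXn ?invr_gt0 // lnV ?posrE // mulrNz mulNr mulr_natl mulNrn.
Qed.

Lemma ln_nrm_prod (s : seq C) (e : C -> int) z : z \notin s ->
  ln (nrm (\prod_(a <- s) (z - a) ^ e a)) = \sum_(a <- s) (e a)%:~R * ln (nrm (z - a)).
Proof.
elim: s => [_|a s IH]; first by rewrite !big_nil nrm1 ln1.
rewrite in_cons negb_or => /andP[za zs]; rewrite !big_cons nrmM lnM ?posrE ?nrm_gt0.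
- by rewrite IH // nrmXz lnXz // nrm_gt0 subr_eq0.
- by rewrite expfz_neq0 // subr_eq0.
- rewrite prodf_seq_neq0; apply/allP => b bs; apply/implyP => _.
  by rewrite expfz_neq0 // subr_eq0; apply: contraNneq zs => ->.
Qed.

Lemma good_notB (s : R) z : goodr s -> nrm z = s -> ~ B z.
Proof. by move=> gs zs /gs; rewrite zs eqxx. Qed.

Lemma good_notin (r s : R) z : goodr s -> nrm z = s -> z \notin disk r.
Proof. by move=> gs zs; apply/negP => /mem_disk[/(good_notB gs zs)]. Qed.

Lemma rcon_lnB (s : R) a : 0 < s -> goodr s -> B a -> rcon s (fun z => ln (nrm (z - a))).
Proof.
move=> s0 gs Ba; apply: rcon_ln_nrm; [exact: ltW | exact: con_sub |].
by move=> z; apply: con_sub_neq0; exact: gs.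
Qed.

Lemma rcon_sum_seq (r : R) (I : eqType) (s : seq I) (F : I -> C -> R) :
  (forall i, i \in s -> rcon r (F i)) -> rcon r (fun z => \sum_(i <- s) F i z).
Proof.
move=> cF; have := @rcon_sum R r I s (fun i z => if i \in s then F i z else 0).
move=> /(_ _)H; apply: rcon_ext (H _) => [z|i]; last first.
  by case: (boolP (i \in s)) => [/cF|_]; [by [] | exact: rcon_cst].
by rewrite [RHS]big_seq [LHS]big_seq; apply: eq_bigr => i ->.
Qed.

Lemma rmean_sum_seq (r : R) (I : eqType) (s : seq I) (F : I -> C -> R) :
  (forall i, i \in s -> rcon r (F i)) ->
  rmean (fun z => \sum_(i <- s) F i z) r = \sum_(i <- s) rmean (F i) r.
Proof.
move=> cF; have := @rmean_sum R r I s (fun i z => if i \in s then F i z else 0).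
have -> : (fun z => \sum_(i <- s) F i z) = (fun z => \sum_(i <- s) if i \in s then F i z else 0).
  by apply/funext => z; rewrite [LHS]big_seq [RHS]big_seq; apply: eq_bigr => i ->.
move=> ->; last by move=> i; case: (boolP (i \in s)) => [/cF|_]; [by [] | exact: rcon_cst].
by rewrite [LHS]big_seq [RHS]big_seq; apply: eq_bigr => i ->.
Qed.

Lemma rmean_ln_factor h K (rho r s : R) : reg h -> r < rho ->
  hol_on (fun z => nrm z < rho) K -> (forall z, nrm z < rho -> K z != 0) ->
  (forall z, nrm z < rho -> ~ B z -> h z = (\prod_(a <- disk r) (z - a) ^ ord h a) * K z) ->
  0 < s -> s <= r -> goodr s ->
  rmean (fun z => ln (nrm (h z))) s =
    \sum_(a <- disk r) (ord h a)%:~R * ln (Num.max s (nrm a)) + ln (nrm (K 0)).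
Proof.
move=> rh rr hK K0 hE s0 sr gs; have s0' := ltW s0; have srho := le_lt_trans sr rr.
have cK : rcon s (fun z => ln (nrm (K z))).
  apply: rcon_ln_nrm => //; first exact: con_hol hK.
  by move=> z zs; apply: K0; rewrite zs.
have cs a : a \in disk r -> rcon s (fun z => (ord h a)%:~R * ln (nrm (z - a))).
  by move=> /mem_disk[Ba _]; apply: rconZ; exact: rcon_lnB.
rewrite (@rmean_eq R _ (fun z => \sum_(a <- disk r) (ord h a)%:~R * ln (nrm (z - a)) +
  ln (nrm (K z)))) //.
- rewrite rmeanD; [|exact: rcon_sum_seq|exact: cK].
  rewrite (rmean_ln_zero_free s0' srho hK K0) rmean_sum_seq //; congr (_ + _).
  rewrite [LHS]big_seq [RHS]big_seq; apply: eq_bigr => a /mem_disk[Ba _].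
  by rewrite rmeanZ ?rmean_ln_sub //; [exact: gs | exact: rcon_lnB].
- apply: rcon_ln_nrm => //; first exact: reg_con.
  by move=> z zs; exact: reg_neq0 gs zs.
- by apply: rconD => //; exact: rcon_sum_seq.
move=> z zs; have zd := @good_notin r s z gs zs.
rewrite hE ?zs //; last exact: good_notB gs zs.
rewrite nrmM lnM ?posrE ?nrm_gt0 ?ln_nrm_prod ?K0 ?zs //.
rewrite prodf_seq_neq0; apply/allP => b bs; apply/implyP => _.
by rewrite expfz_neq0 // subr_eq0; apply: contraNneq zd => ->.
Qed.

Hypothesis gr0 : goodr r0.

(** Both circles are evaluated with the same factorisation, so the unknown term [ln (nrm (K 0))]
    cancels. *)
Lemma jensen h (r : R) : reg h -> goodr r -> r0 <= r ->
  rmean (fun z => ln (nrm (h z))) r - rmean (fun z => ln (nrm (h z))) r0 =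
  CNT (fun a => (ord h a)%:~R) r.
Proof.
move=> rh gr r0r; have [K [rho [rr hK K0 hE]]] := reg_factor r rh.
rewrite (rmean_ln_factor rh rr hK K0 hE _ _ gr) ?lexx ?(lt_le_trans r0p) //.
rewrite (rmean_ln_factor rh rr hK K0 hE _ r0r gr0) //.
rewrite opprD addrACA subrr addr0 -sumrB; apply: eq_bigr => a _.
by rewrite -mulrBr.
Qed.

(** [ln (1 + x)] replaces the positive part of [ln x], from which it differs by at most [ln 2]; it
    is subadditive under sums and products without extra constants. *)
Definition prox h (r : R) : R := rmean (fun z => ln (1 + nrm (h z))) r.
Definition pol h a : R := (Num.max 0 (- ord h a))%:~R.
Definition zer h a : R := (Num.max 0 (ord h a))%:~R.
Definition T h (r : R) : R := prox h r + CNT (pol h) r.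

Lemma pol_ge0 h a : 0 <= pol h a.
Proof. by rewrite /pol ler0z le_max lexx. Qed.

Lemma zer_ge0 h a : 0 <= zer h a.
Proof. by rewrite /zer ler0z le_max lexx. Qed.

Lemma zerBpol h a : zer h a - pol h a = (ord h a)%:~R.
Proof. by rewrite /zer /pol -intrB; congr (_%:~R); lia. Qed.

Lemma zerDpol h a : zer h a + pol h a = `|(ord h a)%:~R|.
Proof. by rewrite /zer /pol -intrD -intr_norm; congr (_%:~R); lia. Qed.

Lemma nrm1p_gt0 (w : C) : 0 < 1 + nrm w.
Proof. by rewrite ltr_pwDl. Qed.

Lemma rcon_ln1p (r : R) h : 0 <= r -> con r h -> rcon r (fun z => ln (1 + nrm (h z))).
Proof.
move=> r0' ch; apply: rcon_ln => //; last by move=> z _; exact: nrm1p_gt0.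
by apply: rconD; [exact: rcon_cst | exact: rcon_nrm].
Qed.

Lemma ln1p_ge0 (w : C) : 0 <= ln (1 + nrm w).
Proof. by rewrite ln_ge0 // lerDl. Qed.

Lemma prox_ge0 h (r : R) : 0 <= r -> con r h -> 0 <= prox h r.
Proof. by move=> r0' ch; apply: rmean_ge0 => //; [exact: rcon_ln1p | move=> z _; exact: ln1p_ge0]. Qed.

Lemma T_ge0 h (r : R) : r0 <= r -> con r h -> 0 <= T h r.
Proof.
move=> r0r ch; rewrite addr_ge0 ?prox_ge0 ?CNT_ge0 ?(le_trans (ltW r0p)) //.
by move=> a _; exact: pol_ge0.
Qed.

Lemma rcon_ln_reg h (r : R) : 0 <= r -> reg h -> goodr r -> rcon r (fun z => ln (nrm (h z))).
Proof. by move=> r0' rh gr; apply: rcon_ln_nrm => //; [exact: reg_con | move=> z; exact: reg_neq0]. Qed.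

Lemma rmean_ln_le_prox h (r : R) : 0 <= r -> reg h -> goodr r ->
  rmean (fun z => ln (nrm (h z))) r <= prox h r.
Proof.
move=> r0' rh gr; apply: rmean_le => //.
- exact: rcon_ln_reg.
- by apply: rcon_ln1p => //; exact: reg_con.
move=> z zr; have h0 : 0 < nrm (h z) by rewrite nrm_gt0 (reg_neq0 rh gr).
by rewrite ler_ln ?posrE ?nrm1p_gt0 // lerDr.
Qed.

(** The inner circle's share in Jensen's formula; it does not depend on [r] and is absorbed into the
    error terms. *)
Definition L0 h : R := rmean (fun z => ln (nrm (h z))) r0.

Lemma CNT_ord_le h (r : R) : reg h -> goodr r -> r0 <= r ->
  CNT (fun a => (ord h a)%:~R) r <= prox h r - L0 h.
Proof.
move=> rh gr r0r; rewrite -jensen // lerD2r rmean_ln_le_prox //.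
exact: le_trans (ltW r0p) r0r.
Qed.

Lemma CNT_zer_le h (r : R) : reg h -> goodr r -> r0 <= r -> CNT (zer h) r <= T h r - L0 h.
Proof.
move=> rh gr r0r; have := CNT_ord_le rh gr r0r.
rewrite -(CNT_eq _ (fun a _ => zerBpol h a)).
have := CNTD (zer h) (fun a => -1 * pol h a) r; rewrite CNTZ => E.
have -> : (fun a => zer h a - pol h a) = (fun a => zer h a + -1 * pol h a).
  by apply/funext => a; rewrite mulN1r.
by rewrite E /T; lra.
Qed.

Lemma ln_le_subr1 (x : R) : 0 < x -> ln x <= x - 1.
Proof. by move=> x0; have := expR_ge1Dx (ln x); rewrite lnK ?posrE //; lra. Qed.

Lemma ln2_le1 : ln 2 <= 1 :> R.
Proof. by have := @ln_le_subr1 2; lra. Qed.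

Lemma abs_ln_le (x : R) : 0 < x -> `|ln x| <= 2 * ln (1 + x) - ln x.
Proof.
move=> x0; have h1 : 0 <= ln (1 + x) by rewrite ln_ge0 // lerDl ltW.
have h2 : ln x <= ln (1 + x) by rewrite ler_ln ?posrE ?addr_gt0 // lerDr.
by rewrite ler_norml; apply/andP; split; lra.
Qed.

Lemma abs_ln_le2 (x : R) : 0 < x -> x <= 2 -> `|ln x| <= 2 * ln 2 - ln x.
Proof.
move=> x0 x2; have h1 : 0 <= ln 2 :> R by rewrite ln_ge0 // ler1n.
have h2 : ln x <= ln 2 by rewrite ler_ln ?posrE.
by rewrite ler_norml; apply/andP; split; lra.
Qed.

Lemma rmean_abs_ln h (r : R) : 0 <= r -> reg h -> goodr r ->
  rmean (fun z => `|ln (nrm (h z))|) r <= 2 * prox h r - rmean (fun z => ln (nrm (h z))) r.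
Proof.
move=> r0' rh gr; have c1 := rcon_ln_reg r0' rh gr.
have c2 := rcon_ln1p r0' (reg_con r0' rh gr).
have c3 := rconZ 2 c2.
rewrite /prox -(rmeanZ 2 c2) -(rmeanB c3 c1); apply: rmean_le => //.
- exact: rcon_abs.
- exact: rconB.
by move=> z zr; apply: abs_ln_le; rewrite nrm_gt0 (reg_neq0 rh gr).
Qed.

Lemma rmean_abs_ln_sub a (s : R) : 0 < s -> goodr s -> B a -> nrm a <= s ->
  rmean (fun z => `|ln (nrm (z - a)) - ln s|) s <= 2.
Proof.
move=> s0 gs Ba as_; have s0' := ltW s0; have c1 := rcon_lnB s0 gs Ba.
have c0 := rcon_cst s (ln s); have c2 := rconB c1 c0.
have c3 := rcon_cst s (2 * ln 2).
apply: le_trans (_ : rmean (fun z => 2 * ln 2 - (ln (nrm (z - a)) - ln s)) s <= _).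
  apply: rmean_le => //; [exact: rcon_abs | exact: rconB |] => z zs.
  have za : 0 < nrm (z - a) by rewrite nrm_gt0; apply: con_sub_neq0 zs; exact: gs.
  rewrite -ln_div ?posrE //; apply: abs_ln_le2; first exact: divr_gt0.
  by rewrite ler_pdivrMr // mulr_natl mulr2n (le_trans (nrmD _ _)) // nrmN zs lerD2l.
rewrite (rmeanB c3 c2) (rmeanB c1 c0) !rmean_cst rmean_ln_sub ?gs // max_l //.
by have := ln2_le1; lra.
Qed.

(** The Cauchy integral for [L'] involves all of [L]. Adding an integral that is zero, with a kernel
    conjugate to the first one on the circle, leaves only [Re L] in the integrand. *)
Lemma Re_derivative_bound L (rho s : R) w l : nrm w < s -> s < rho ->
  hol_on (fun z => nrm z < rho) L -> cd L w l ->
  nrm l <= 4 * rmean (fun z => `|Re (L z)|) s * (s / (s - nrm w) ^+ 2).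
Proof.
move=> ws srho hL dl.
have s0 : 0 < s by apply: le_lt_trans ws.
have s0' := ltW s0.
have cL : con s L by exact: con_hol hL.
pose ka z := z * ((z - w)^-1 * (z - w)^-1).
have cka : con s ka.
  by apply: conM; [exact: con_id | apply: conM; exact: con_kernel].
have lE : l = cmean (fun z => L z * ka z) s.
  have cu : con s (fun z => L z * z) by apply: conM => //; exact: con_id.
  have := cd_kernel1 cu ws.
  have -> : (fun z => L z * z * ((z - w)^-1 * (z - w)^-1)) = (fun z => L z * ka z).
    by apply/funext => z; rewrite /ka mulrA.
  move=> h1; apply: cd_unique dl _; apply: cd_near h1.
  exists (s - nrm w); first by rewrite subr_gt0.
  move=> v vw; rewrite -(@cauchy_formula _ _ v rho s) //.
  by have := nrmD (v - w) w; rewrite subrK => ?; lra.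
pose q z := (s ^+ 2)%:C - conjc w * z.
(* On the circle this is the conjugate of [ka], rewritten with [conjc z = s^2 / z] so as to be
   holomorphic inside; its factor [z] makes the mean of [L * kb] vanish. *)
pose kb z := (s ^+ 2)%:C * (z * ((q z)^-1 * (q z)^-1)).
have [t tE] : exists t, t = (nrm w + s) / 2 by eexists.
have w0 := nrm_ge0 w.
have [wt ts] : nrm w < t /\ t < s by rewrite tE; split; lra.
have t0 : 0 < t by exact: le_lt_trans wt.
(* Since [nrm w < t < s], the bound [s^2 / t] exceeds [s] but stays short of the zero of [q]. *)
have [rho2 r2E] : exists x : R, x = Num.min rho (s ^+ 2 / t) by eexists.
have sr2 : s < rho2.
  by rewrite r2E lt_min srho ltr_pdivlMr // expr2 ltr_pM2l.
have q0 z : nrm z < rho2 -> q z != 0.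
  rewrite r2E lt_min => /andP[_]; rewrite ltr_pdivlMr // => zs.
  rewrite subr_eq0; apply/eqP => /(congr1 nrm); rewrite nrm_real ger0_norm ?sqr_ge0 // nrmM.
  have -> : nrm (conjc w) = nrm w by rewrite !nrm_sqrt; case: (w) => x y /=; rewrite sqrrN.
  move=> e; move: zs; rewrite e mulrC ltNge => /negP; apply.
  by apply: ler_wpM2r => //; exact: ltW.
have hkb : hol_on (fun z => nrm z < rho2) (fun z => L z * kb z).
  move=> z zr; have [l1 hl1] : exists l, cd L z l.
    by apply: hL; apply: lt_le_trans zr _; rewrite r2E ge_min lexx.
  have [l2 hl2] : exists l, cd q z l by exact: (@hol_on_affine _ (fun=> True)).
  have h3 := gdV (q0 z zr) hl2.
  by eexists; apply: gdM hl1 _; apply: gdZ; apply: gdM (gd_emb _ _) (gdM h3 h3).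
have cLb : con s (fun z => L z * kb z) by exact: con_hol hkb.
have mLb : cmean (fun z => L z * kb z) s = 0.
  by rewrite (mean_value s0' sr2 hkb) /kb mul0r !mulr0.
have ckab z : nrm z = s -> kb z = conjc (ka z).
  move=> zs; have zw := circle_sub_neq0 ws zs.
  have zz : z * conjc z = (s ^+ 2)%:C.
    by rewrite -sqr_normc -nrmE zs rmorphXn.
  have qE : q z = z * conjc (z - w).
    by rewrite /q -zz (_ : conjc (z - w) = conjc z - conjc w) ?rmorphB //; ring.
  have z0 : z != 0 by rewrite -nrm_gt0 zs.
  have c0 : conjc (z - w) != 0 by rewrite conjc_eq0.
  have -> : conjc (ka z) = conjc z * ((conjc (z - w))^-1 * (conjc (z - w))^-1).
    by rewrite /ka !rmorphM /= !fmorphV.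
  rewrite /kb qE -zz; move: (conjc (z - w)) c0 (conjc z) => x x0 y.
  by field; rewrite z0 x0.
have kan z : nrm z = s -> nrm (ka z) <= s / (s - nrm w) ^+ 2.
  move=> zs; rewrite /ka !nrmM !nrmV zs ler_pM2l // -invfM -expr2.
  have d0 : 0 < s - nrm w by rewrite subr_gt0.
  have d1 : s - nrm w <= nrm (z - w) by rewrite -zs nrmBD.
  by rewrite lef_pV2 ?posrE ?exprn_gt0 ?(lt_le_trans d0) // ler_pXn2r ?nnegrE // ltW.
have cA := rcon_abs (rcon_Re cL).
(* With [c] equal to [1], [-1], ['i], [- 'i] this bounds the real and imaginary parts of [l], whence
   the factor [4]. *)
have key (c : C) : nrm c = 1 -> Re (c * l) <= 2 * (rmean (fun z => `|Re (L z)|) s * (s / (s - nrm w) ^+ 2)).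
  move=> c1; rewrite lE.
  have cLa : con s (fun z => L z * ka z) by exact: conM.
  have cl1 : con s (fun z => c * (L z * ka z)) by apply: conM => //; exact: con_cst.
  have cl2 : con s (fun z => conjc c * (L z * kb z)) by apply: conM => //; exact: con_cst.
  have -> : c * cmean (fun z => L z * ka z) s =
      cmean (fun z => c * (L z * ka z) + conjc c * (L z * kb z)) s.
    by rewrite (cmeanD cl1 cl2) (cmeanZ _ cLa) (cmeanZ _ cLb) mLb mulr0 addr0.
  rewrite -rmean_Re; last exact: conD.
  rewrite [rmean _ _ * _]mulrC mulrA -rmeanZ //; apply: rmean_le => //.
  - by apply: rcon_Re; exact: conD.
  - exact: rconZ.
  move=> z zs; rewrite ckab //.
  have -> : c * (L z * ka z) + conjc c * (L z * conjc (ka z)) = (2 * Re (c * ka z))%:C * L z.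
    have cj (x : C) : (2 * Re x)%:C = x + conjc x.
      by apply: complex_ext; case: x => x y /=; rewrite ?subrr // mulr_natl mulr2n.
    have -> : conjc c * (L z * conjc (ka z)) = L z * conjc (c * ka z).
      by rewrite (_ : conjc (c * ka z) = conjc c * conjc (ka z)) ?rmorphM //; ring.
    by rewrite cj; ring.
  rewrite cReMr; apply: le_trans (ler_norm _) _; rewrite normrM.
  apply: ler_wpM2r => //; rewrite normrM ger0_norm // ler_pM2l //.
  by apply: le_trans (Re_le_nrm _) _; rewrite nrmM c1 mul1r kan.
have ni : nrm ('i : C) = 1 by rewrite nrm_sqrt /= expr0n expr1n add0r sqrtr1.
have h1 := key 1 nrm1; rewrite mul1r in h1.
have h2 : - Re l <= 2 * (rmean (fun z => `|Re (L z)|) s * (s / (s - nrm w) ^+ 2)).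
  by rewrite -cReN -mulN1r; apply: key; rewrite nrmN nrm1.
have il : Re ('i * l) = - Im l by rewrite cReM /= mul0r mul1r sub0r.
have h3 := key 'i ni; rewrite il in h3.
have h4 := key (- 'i) (etrans (nrmN _) ni); rewrite mulNr cReN il in h4. apply: le_trans (nrm_le_ReIm _) _.
have a1 : `|Re l| <= 2 * (rmean (fun z => `|Re (L z)|) s * (s / (s - nrm w) ^+ 2)).
  by rewrite ler_norml h1 andbT lerNl.
have a2 : `|Im l| <= 2 * (rmean (fun z => `|Re (L z)|) s * (s / (s - nrm w) ^+ 2)).
  by rewrite ler_norml lerNl h3 /= -[Im l]opprK.
by apply: le_trans (lerD a1 a2) _; rewrite -mulrA; lra.
Qed.

Lemma cd_prod (s : seq C) (e : C -> int) z : z \notin s ->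
  cd (fun w => \prod_(a <- s) (w - a) ^ e a) z
     ((\prod_(a <- s) (z - a) ^ e a) * \sum_(a <- s) (e a)%:~R / (z - a)).
Proof.
elim: s => [_|a s IH].
  rewrite !big_nil mulr0; apply: (@cd_near _ (fun=> 1)); last exact: gd_cst.
  by apply: nbW => w; rewrite big_nil.
rewrite in_cons negb_or => /andP[za zs].
apply: (@cd_near _ (fun w => (w - a) ^ e a * \prod_(b <- s) (w - b) ^ e b)).
  by apply: nbW => w; rewrite big_cons.
have := gdM (cd_sub_exprz (e a) za) (IH zs); rewrite !big_cons.
have za0 : z - a != 0 by rewrite subr_eq0.
rewrite expfzDr // -exprN1.
set X := (z - a) ^ e a; set Y := \prod_(b <- s) _; set S := \sum_(b <- s) _.
have -> : X * Y * ((e a)%:~R / (z - a) + S) =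
    (e a)%:~R * (X * (z - a)^-1) * Y + X * (Y * S) by field.
by rewrite exprN1.
Qed.

Lemma ler_sum_sqr (I : Type) (s : seq I) (y : I -> R) : (forall i, 0 <= y i) ->
  \sum_(i <- s) y i ^+ 2 <= (\sum_(i <- s) y i) ^+ 2.
Proof.
move=> y0; elim: s => [|i s IH]; first by rewrite !big_nil expr0n.
rewrite !big_cons sqrrD -addrA lerD2l; apply: le_trans IH _.
by rewrite lerDr mulrn_wge0 // mulr_ge0 // sumr_ge0.
Qed.

Lemma int_le_sqr (m : int) : `|m%:~R : R| <= `|m%:~R| ^+ 2.
Proof.
have [->|m0] := eqVneq m 0; first by rewrite normr0 expr0n.
by rewrite expr2 ler_peMl // -intr_norm ler1z; lia.
Qed.

Lemma ln1pD_le (x y : R) : 0 <= x -> 0 <= y -> ln (1 + (x + y)) <= ln (1 + x) + ln (1 + y).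
Proof.
move=> x0 y0; have x1 : 0 < 1 + x by rewrite ltr_pwDl.
have y1 : 0 < 1 + y by rewrite ltr_pwDl.
rewrite -lnM ?posrE // ler_ln ?posrE ?mulr_gt0 // ?ltr_pwDl ?addr_ge0 //.
by have := mulr_ge0 x0 y0; lra.
Qed.

(* Concavity of the logarithm in the form of the tangent at [1 + A]. *)
Lemma ln1p_tangent (A y : R) : 0 <= A -> 0 <= y ->
  ln (1 + y) <= ln (1 + A) + (1 + A)^-1 * (y - A).
Proof.
move=> A0 y0; have A1 : 0 < 1 + A by rewrite ltr_pwDl.
have y1 : 0 < 1 + y by rewrite ltr_pwDl.
have := ln_le_subr1 (divr_gt0 y1 A1); rewrite ln_div ?posrE //.
have -> : (1 + y) / (1 + A) - 1 = (1 + A)^-1 * (y - A) by field; lra.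
by lra.
Qed.

(** By factorisation [h' / h] is the sum of the terms [ord h a / (z - a)] and [K' / K]. The latter
    is bounded pointwise by [A] through the mean of [Re (log K)]. The sum is at most [Y^2], where
    [Y] adds up the inverse square roots of the distances; the mean of [Y] is at most [2 n] by
    [rmean_sqrt_pole], and concavity of the logarithm carries this over to [ln (1 + Y)]. *)
Lemma prox_logder_disc h (r s n A : R) : reg h -> goodr r -> goodr s -> 1 <= r -> r < s ->
  n = \sum_(a <- disk s) `|(ord h a)%:~R : R| ->
  A = 4 * (2 * prox h s - rmean (fun z => ln (nrm (h z))) s + 2 * n) *
    (s / (s - r) ^+ 2) ->
  prox (fun z => derive1 h z / h z) r <= ln (1 + A) + 2 * ln (1 + 2 * n).
Proof.
move=> rh gr gs r1 rs nE AE.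
have rp : 0 < r by exact: lt_le_trans r1.
have r0' := ltW rp; have sp : 0 < s by exact: lt_trans rs.
have s0' := ltW sp.
have [K [rho [srho hK K0 hE]]] := reg_factor s rh.
have rho0 : 0 < rho by exact: lt_trans srho.
have [L [hL L0' dL KE]] := zero_free_exp rho0 hK K0.
pose m a : R := (ord h a)%:~R.
pose q a z : R := `|m a| * Num.sqrt (nrm (z - a))^-1.
have n0 : 0 <= n by rewrite nE sumr_ge0.
have logderE z : nrm z < rho -> ~ B z -> derive1 h z / h z =
    \sum_(a <- disk s) (ord h a)%:~R / (z - a) + derive1 K z / K z.
  move=> zr Bz; have zd : z \notin disk s by apply/negP => /mem_disk[].
  have [l hl] := hK z zr; have [_ lE] := cd_derivable hl.
  have h1 := gdM (cd_prod (fun a => ord h a) zd) hl.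
  have h2 : cd h z ((\prod_(a <- disk s) (z - a) ^ ord h a) *
      (\sum_(a <- disk s) (ord h a)%:~R / (z - a)) * K z +
      (\prod_(a <- disk s) (z - a) ^ ord h a) * l).
    apply: cd_near h1; apply/nb_nrP; split; last by rewrite hE.
    have zn : nb z (fun w => nrm w < rho).
      exists (rho - nrm z); first by rewrite subr_gt0.
      by move=> w wz; have := nrmD (w - z) z; rewrite subrK => ?; lra.
    by apply: nrS2 (nb_nr zn) (dB z) => w _ wr wB; rewrite hE.
  have [_ ->] := cd_derivable h2; rewrite hE // lE.
  have p0 : \prod_(a <- disk s) (z - a) ^ ord h a != 0.
    rewrite prodf_seq_neq0; apply/allP => b bs; apply/implyP => _.
    by rewrite expfz_neq0 // subr_eq0; apply: contraNneq zd => ->.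
  move: p0 (K0 z zr); move: (\prod_(a <- disk s) _) (\sum_(a <- disk s) _) (K z) => p S k p0 k0.
  by field; rewrite p0 k0.
(* The added constant turns [Re L1] into [ln (nrm h)] minus the sum of
   [m a * (ln (nrm (z - a)) - ln s)] on the circle; normalised by [ln s], each logarithm has
   absolute mean at most [2]. *)
pose L1 z := (ln (nrm (K 0)) + \sum_(a <- disk s) m a * ln s)%:C + L z.
have hL1 : hol_on (fun z => nrm z < rho) L1.
  by move=> z /hL[l hl]; eexists; apply: gdD hl; exact: gd_cst.
have K00 : K 0 != 0 by apply: K0; rewrite nrm0.
have cL1 : con s L1 by exact: con_hol hL1.
have c1 := rcon_ln_reg s0' rh gs.
have c2 a : a \in disk s -> rcon s (fun z => `|m a| * `|ln (nrm (z - a)) - ln s|).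
  move=> /mem_disk[Ba _]; apply: rconZ; apply: rcon_abs; apply: rconB; last exact: rcon_cst.
  exact: rcon_lnB.
have mean1 : rmean (fun z => `|Re (L1 z)|) s <=
    2 * prox h s - rmean (fun z => ln (nrm (h z))) s + 2 * n.
  apply: le_trans (_ : rmean (fun z => `|ln (nrm (h z))| +
     \sum_(a <- disk s) `|m a| * `|ln (nrm (z - a)) - ln s|) s <= _).
    apply: rmean_le => //; [exact: rcon_abs (rcon_Re cL1) | |].
      by apply: rconD; [exact: rcon_abs | exact: rcon_sum_seq].
    move=> z zs; have zr : nrm z < rho by rewrite zs.
    have zd := @good_notin s s z gs zs.
    have p0 : \prod_(a <- disk s) (z - a) ^ ord h a != 0.
      rewrite prodf_seq_neq0; apply/allP => b bs; apply/implyP => _.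
      by rewrite expfz_neq0 // subr_eq0; apply: contraNneq zd => ->.
    have E : Re (L1 z) = ln (nrm (h z)) - \sum_(a <- disk s) m a * (ln (nrm (z - a)) - ln s).
      rewrite hE ?zs //; last exact: good_notB gs zs.
      rewrite nrmM lnM ?posrE ?nrm_gt0 ?K0 // ln_nrm_prod // KE // ln_nrm_exp //.
      rewrite /L1 cReD /= .
      have -> : \sum_(a <- disk s) m a * (ln (nrm (z - a)) - ln s) =
        \sum_(a <- disk s) m a * ln (nrm (z - a)) - \sum_(a <- disk s) m a * ln s.
        by rewrite -sumrB; apply: eq_bigr => a _; rewrite mulrBr.
      by rewrite /m; lra.
    rewrite E; apply: le_trans (ler_normB _ _) _; rewrite lerD2l.
    apply: le_trans (ler_norm_sum _ _ _) _; apply: ler_sum => a _.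
    by rewrite normrM.
  rewrite rmeanD; [|exact: rcon_abs|exact: rcon_sum_seq].
  apply: lerD; first exact: rmean_abs_ln.
  rewrite rmean_sum_seq // nE mulr_sumr big_seq [leRHS]big_seq; apply: ler_sum => a ad.
  have /mem_disk[Ba as_] := ad.
  rewrite rmeanZ; last by apply/rcon_abs/rconB; [exact: rcon_lnB | exact: rcon_cst].
  by rewrite mulrC ler_wpM2r // rmean_abs_ln_sub.
have A0 : 0 <= A.
  rewrite AE mulr_ge0 ?divr_ge0 ?exprn_ge0 ?subr_ge0 ?(ltW rs) // mulr_ge0 //.
  by apply: le_trans mean1; apply: rmean_ge0 => //; exact: rcon_abs (rcon_Re cL1).
have cq a : a \in disk s -> rcon r (q a).
  move=> /mem_disk[Ba _]; apply: rconZ; apply: rcon_comp => //; last by move=> z _; exact: sqrt_continuous.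
  have za z : nrm z = r -> z - a != 0 by apply: con_sub_neq0; exact: gr.
  by apply: rcon_ext (rcon_nrm (conV r0' (con_sub a r) za)) => z; rewrite nrmV.
have q0 a z : 0 <= q a z by rewrite mulr_ge0 // sqrtr_ge0.
pose Y z := \sum_(a <- disk s) q a z.
have Y0 z : 0 <= Y z by rewrite sumr_ge0.
have cY : rcon r Y by exact: rcon_sum_seq.
have mY : rmean Y r <= 2 * n.
  rewrite rmean_sum_seq // nE mulr_sumr big_seq [leRHS]big_seq; apply: ler_sum => a ad.
  have /mem_disk[Ba _] := ad.
  rewrite /q rmeanZ.
    by rewrite mulrC ler_wpM2r // rmean_sqrt_pole // gr.
  apply: rcon_comp => //; last by move=> z _; exact: sqrt_continuous.
  have za z : nrm z = r -> z - a != 0 by apply: con_sub_neq0; exact: gr.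
  by apply: rcon_ext (rcon_nrm (conV r0' (con_sub a r) za)) => z; rewrite nrmV.
have lY0 : 0 <= 1 + 2 * n by rewrite addr_ge0 // mulr_ge0.
(* Tangent of the logarithm at [2 n], the bound for the mean of [Y], so the linear term has a mean
   that is not positive. *)
pose U z := ln (1 + A) + 2 * (ln (1 + 2 * n) + (1 + 2 * n)^-1 * (Y z - 2 * n)).
have cU1 : rcon r (fun z => (1 + 2 * n)^-1 * (Y z - 2 * n)).
  by apply: rconZ; apply: rconB => //; exact: rcon_cst.
have cU2 := rconD (rcon_cst r (ln (1 + 2 * n))) cU1.
have cU : rcon r U by apply: rconD; [exact: rcon_cst | exact: rconZ].
have cld : con r (fun z => derive1 h z / h z).
  apply: conI => // z zr; have Bz := good_notB gr zr; have [hz h0] := rh.2 z Bz.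
  apply: gcM; first exact: hol_cc (hol_derive hz).
  by apply: gcV => //; exact: hol_cc.
apply: le_trans (_ : rmean U r <= _); last first.
  rewrite /U rmeanD; [|exact: rcon_cst|exact: rconZ].
  rewrite rmean_cst (rmeanZ _ cU2) rmeanD; [|exact: rcon_cst|exact: cU1].
  rewrite rmean_cst rmeanZ; last by apply: rconB => //; exact: rcon_cst.
  rewrite (rmeanB cY (rcon_cst _ _)) rmean_cst lerD2l ler_pM2l // gerDl.
  by apply: mulr_ge0_le0; rewrite ?invr_ge0 // subr_le0.
apply: rmean_le => //; first exact: rcon_ln1p.
move=> z zr; have Bz := good_notB gr zr.
have zs : nrm z < s by rewrite zr.
have zrho := lt_trans zs srho.
have dLz := dL z zrho.
have b1 : nrm (derive1 K z / K z) <= A.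
  have d1 : cd L1 z (derive1 K z / K z).
    by rewrite -[_ / _]add0r; apply: gdD; [exact: gd_cst | exact: dLz].
  apply: le_trans (Re_derivative_bound zs srho hL1 d1) _; rewrite zr AE.
  apply: ler_wpM2r; first by rewrite divr_ge0 // sqr_ge0.
  by rewrite ler_pM2l.
have b2 : nrm (\sum_(a <- disk s) (ord h a)%:~R / (z - a)) <= Y z ^+ 2.
  apply: le_trans (nrm_sum _ _ _) _; apply: le_trans (ler_sum_sqr _ (fun a => q0 a z)).
  apply: ler_sum => a _; rewrite nrmM nrmV /q exprMn sqr_sqrtr ?invr_ge0 //.
  rewrite ler_wpM2r ?invr_ge0 //.
  have -> : nrm ((ord h a)%:~R : C) = `|m a|.
    by rewrite -nrm_real /m; congr nrm; exact/esym/rmorph_int.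
  exact: int_le_sqr.
rewrite /U; apply: le_trans (_ : ln (1 + (A + Y z ^+ 2)) <= _).
  rewrite ler_ln ?posrE ?nrm1p_gt0 ?ltr_pwDl ?addr_ge0 ?sqr_ge0 // lerD2l logderE //.
  by apply: le_trans (nrmD _ _) _; rewrite addrC; apply: lerD.
apply: le_trans (ln1pD_le A0 (sqr_ge0 _)) _; rewrite lerD2l.
have Y1 : 0 < 1 + Y z by rewrite ltr_pwDl.
apply: le_trans (_ : ln ((1 + Y z) ^+ 2) <= _).
  rewrite ler_ln ?posrE ?exprn_gt0 ?ltr_pwDl ?sqr_ge0 // sqrrD expr1n mul1r.
  by rewrite lerD2r lerDl mulrn_wge0.
rewrite lnXn // -[ln _ *+ 2]mulr_natl ler_pM2l //; apply: ln1p_tangent => //.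
by rewrite mulr_ge0.
Qed.

(** * Error terms and the growth of the characteristic *)

Section Growth.
Variable Tot : R -> R.
Implicit Types (U V : R -> R).

(** Error terms at [r] involve the characteristic at slightly larger radii, hence a bound [M] valid
    up to some [rho > r] in place of [Tot r] itself. *)
Definition ctx (r rho M : R) := [/\ goodr r, r0 <= r, r < rho, 1 <= M &
  forall s, goodr s -> r0 <= s -> s < rho -> Tot s <= M].

(* [small U] is the relation [U = O(log r + log Tot)] outside an exceptional set,
   in the form given by Borel's growth argument before the exceptional set is removed. *)
Definition ubd (E : R -> R -> R) U := exists2 c : R, 0 <= c &
  forall r rho M, ctx r rho M -> U r <= c * E M (rho / (rho - r)).
Definition small U := ubd (fun M q => 1 + ln M + ln q) U.
Definition big U := ubd (fun M q => M + q) U.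

Lemma ctx_quot (r rho M : R) : ctx r rho M -> 1 <= rho / (rho - r).
Proof.
move=> [_ r0r rr _ _]; have rp := lt_le_trans r0p r0r.
by rewrite ler_pdivlMr ?subr_gt0 // mul1r gerBl ltW.
Qed.

Lemma ubdD E U V : ubd E U -> ubd E V -> ubd E (fun r => U r + V r).
Proof.
move=> [c c0 hc] [d d0 hd]; exists (c + d); first exact: addr_ge0.
by move=> r rho M h; rewrite mulrDl; apply: lerD; [exact: hc | exact: hd].
Qed.

Lemma ubdZ E (k : R) U : 0 <= k -> ubd E U -> ubd E (fun r => k * U r).
Proof.
move=> k0 [c c0 hc]; exists (k * c); first exact: mulr_ge0.
by move=> r rho M /hc h; rewrite -mulrA ler_wpM2l.
Qed.

Lemma ubd_le E U V : (forall r, goodr r -> r0 <= r -> U r <= V r) -> ubd E V -> ubd E U.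
Proof.
move=> h [c c0 hc]; exists c => // r rho M k; apply: le_trans (hc _ _ _ k).
by case: k => gr r0r _ _ _; exact: h.
Qed.

Lemma small_cst (k : R) : small (fun=> k).
Proof.
exists `|k| => // r rho M h; have q1 := ctx_quot h; case: h => _ _ _ M1 _.
apply: le_trans (ler_norm k) _; rewrite ler_peMr // -addrA lerDl addr_ge0 ?ln_ge0 //.
Qed.

Lemma small_big U : small U -> big U.
Proof.
move=> [c c0 hc]; exists c => // r rho M h; apply: le_trans (hc _ _ _ h) _.
have q1 := ctx_quot h; case: h => _ _ _ M1 _; rewrite ler_wpM2l //.
have := @ln_le_subr1 M (lt_le_trans ltr01 M1).
by have := @ln_le_subr1 _ (lt_le_trans ltr01 q1); lra.
Qed.

Lemma big_Tot : big Tot.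
Proof.
exists 1 => // r rho M h; have q1 := ctx_quot h; case: h => gr r0r rr M1 /(_ r gr r0r rr) h.
by rewrite mul1r (le_trans h) // lerDl (le_trans ler01).
Qed.

(** [X = k q^3 N] dominates both [A] and [2 n], so the left-hand side is at most three times
    [ln (1 + X)]. By [N <= c M q] the argument is at most [(1 + k c) M q^4], and the exponent is the
    [4] in the constant. *)
Lemma logder_numeric (A n q N M c : R) : 1 <= q -> 1 <= M -> 0 <= n -> 0 <= N -> 0 <= c ->
  N <= c * (M * q) -> n <= 6 * q * N -> A <= 4 * (13 * q * N) * (36 * q ^+ 2) ->
  ln (1 + A) + 2 * ln (1 + 2 * n) <= 3 * (ln (1 + 4 * (13 * 36) * c) + 4) * (1 + ln M + ln q).
Proof.
move=> q1 M1 n0 N0 c0 Nc nN AN.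
have qp : 0 < q by exact: lt_le_trans q1.
have Mp : 0 < M by exact: lt_le_trans M1.
have [k kE] : exists x : R, x = 4 * (13 * 36) by eexists.
rewrite -kE; have k12 : 12 <= k by rewrite kE; lra.
have k0 : 0 <= k by apply: le_trans k12.
have [X XE] : exists X : R, X = k * q ^+ 3 * N by eexists.
have q30 : 0 <= q ^+ 3 by rewrite exprn_ge0 // ltW.
have X0 : 0 <= X by rewrite XE mulr_ge0 // mulr_ge0.
have q3 : q <= q ^+ 3 by rewrite ler_eXnr.
have AX : A <= X.
  apply: le_trans AN _; rewrite XE kE le_eqVlt; apply/orP; left; apply/eqP; ring.
have nX : 2 * n <= X.
  apply: le_trans (ler_wpM2l _ nN) _ => //.
  rewrite XE mulrA ler_wpM2r //.
  apply: le_trans (_ : 12 * q ^+ 3 <= _); first by lra.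
  by rewrite ler_wpM2r.
have aux (x : R) : x <= X -> ln (1 + x) <= ln (1 + X).
  move=> xX; have [x1|x1] := ltP 0 (1 + x).
    by rewrite ler_ln ?posrE ?lerD2l // ltr_pwDl.
  by rewrite ln0 // ln_ge0 // lerDl.
apply: le_trans (_ : 3 * ln (1 + X) <= _).
  by have := aux A AX; have := aux (2 * n) nX; lra.
rewrite -mulrA ler_pM2l //.
have Z1 : 1 <= M * q ^+ 4 by rewrite -[1]mulr1 ler_pM // exprn_ege1.
have big1 : 1 + X <= (1 + k * c) * (M * q ^+ 4).
  have : X <= k * c * (M * q ^+ 4).
    have -> : k * c * (M * q ^+ 4) = k * q ^+ 3 * (c * (M * q)) by ring.
    by rewrite XE ler_wpM2l // mulr_ge0.
  by lra.
have kp : 1 <= 1 + k * c by rewrite lerDl mulr_ge0.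
have kp' : 0 < 1 + k * c by exact: lt_le_trans kp.
apply: le_trans (_ : ln ((1 + k * c) * (M * q ^+ 4)) <= _).
  by rewrite ler_ln ?posrE ?mulr_gt0 ?exprn_gt0 // ltr_pwDl.
have q4 : 0 < q ^+ 4 by rewrite exprn_gt0.
rewrite (lnM (x := 1 + k * c)) ?posrE ?mulr_gt0 // (lnM (x := M)) ?posrE // lnXn //.
rewrite -[ln q *+ 4]mulr_natl.
have lk := ln_ge0 kp; have lM := ln_ge0 M1; have lq := ln_ge0 q1.
have p1 := mulr_ge0 lk lM; have p2 := mulr_ge0 lk lq.
by lra.
Qed.

(** [ln s2 - ln s1 >= 1 - s1 / s2 >= d / rho], and [d / rho] is [1 / (6 q)]. *)
Lemma count_numeric (n d rho s1 s2 N q : R) : 0 < s1 -> 0 < s2 -> s2 <= rho -> 0 < d ->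
  d <= s2 - s1 -> rho = 6 * d * q -> 0 < q -> 0 <= n -> n * (ln s2 - ln s1) <= N -> n <= 6 * q * N.
Proof.
move=> s1p s2p s2r dp ds rq qp n0 h4.
have h3 : d / rho <= ln s2 - ln s1.
  have := ln_le_subr1 (divr_gt0 s1p s2p); rewrite ln_div ?posrE // => h3.
  have : d / rho <= 1 - s1 / s2.
    have -> : 1 - s1 / s2 = (s2 - s1) / s2 by rewrite mulrBl divff // gt_eqF.
    rewrite ler_pdivrMr ?(lt_le_trans s2p) // mulrAC ler_pdivlMr //.
    by apply: ler_pM => //; exact: ltW.
  by lra.
have : n * (d / rho) <= N by apply: le_trans (ler_wpM2l n0 h3) h4.
rewrite rq; have -> : n * (d / (6 * d * q)) = n / (6 * q) by field; rewrite !gt_eqF.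
by rewrite ler_pdivrMr ?mulr_gt0 // mulrC.
Qed.

Lemma mean_abs_numeric h (s E : R) : reg h -> goodr s -> r0 <= s -> T h s <= E ->
  2 * prox h s - rmean (fun z => ln (nrm (h z))) s <= 2 * E + `|L0 h|.
Proof.
move=> rh gs r0s TE; have sp := lt_le_trans r0p r0s.
have := jensen rh gs r0s.
rewrite -(CNT_eq _ (fun a _ => zerBpol h a)).
have := CNTD (zer h) (fun a => -1 * pol h a) s; rewrite CNTZ.
have -> : (fun a => zer h a - pol h a) = (fun a => zer h a + -1 * pol h a).
  by apply/funext => a; rewrite mulN1r.
move=> ->; rewrite -/(L0 h).
have h1 : 0 <= CNT (zer h) s by apply: CNT_ge0 => // a _; exact: zer_ge0.
have h2 : 0 <= CNT (pol h) s by apply: CNT_ge0 => // a _; exact: pol_ge0.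
have h3 : 0 <= prox h s by rewrite prox_ge0 ?(ltW sp) //; apply: reg_con => //; exact: ltW.
have l2 := ler_norm (- L0 h); rewrite normrN in l2.
by move: TE; rewrite /T; lra.
Qed.

Lemma CNT_abs_le h (s E : R) : reg h -> goodr s -> r0 <= s -> T h s <= E ->
  CNT (fun a => `|(ord h a)%:~R : R|) s <= 2 * E + `|L0 h|.
Proof.
move=> rh gs r0s TE; have sp := lt_le_trans r0p r0s.
have -> : CNT (fun a => `|(ord h a)%:~R : R|) s = CNT (zer h) s + CNT (pol h) s.
  by rewrite -CNTD; apply: CNT_eq => a _; rewrite zerDpol.
have h1 := CNT_zer_le rh gs r0s.
have h2 : CNT (pol h) s <= T h s.
  by rewrite lerDr prox_ge0 ?(ltW sp) //; apply: reg_con => //; exact: ltW.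
have l2 := ler_norm (- L0 h); rewrite normrN in l2.
by lra.
Qed.

(** Two auxiliary radii [r < s1 < s2 < rho] are needed: the estimate in the disc is taken at [s1],
    and the number of zeros and poles up to [s1] is bounded through the counting function at
    [s2]. *)
Lemma prox_logder h : reg h -> big (T h) -> small (prox (fun z => derive1 h z / h z)).
Proof.
move=> rh [c c0 hc].
have [c1 c1E] : exists x : R, x = 8 * c + `|L0 h| by eexists.
have c10 : 0 <= c1 by rewrite c1E addr_ge0 // mulr_ge0.
exists (3 * (ln (1 + 4 * (13 * 36) * c1) + 4)).
  by rewrite mulr_ge0 // addr_ge0 // ln_ge0 // lerDl mulr_ge0 // mulr_ge0 // mulr_ge0.
move=> r rho M h'; have q1 := ctx_quot h'; case: (h') => gr r0r rr M1 hM.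
have [q qE] : exists q : R, q = rho / (rho - r) by eexists.
rewrite -qE in q1 *; have rp := lt_le_trans r0p r0r.
have rhop : 0 < rho by exact: lt_trans rr.
have qp : 0 < q by exact: lt_le_trans q1.
(* Sixths leave room for good radii in [(r + d, r + 2 d)] and [(r + 3 d, r + 4 d)], and a gap of
   [2 d] below [rho]. *)
have [d dE] : exists d : R, d = (rho - r) / 6 by eexists.
have dp : 0 < d by rewrite dE divr_gt0 // subr_gt0.
have rE : rho = r + 6 * d by rewrite dE; field.
have rq : rho = 6 * d * q by rewrite qE dE; field; rewrite subr_eq0 gt_eqF.
have [s1 [s1l s1u g1]] : exists s, [/\ r + d < s, s < r + 2 * d & goodr s].
  by apply: goodr_ex; lra.
have [s2 [s2l s2u g2]] : exists s, [/\ r + 3 * d < s, s < r + 4 * d & goodr s].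
  by apply: goodr_ex; lra.
(* The gap gives [rho - s >= 2 d], so [rho / (rho - s) <= 3 q]. *)
have Tb s : goodr s -> r + d < s -> s < r + 4 * d -> T h s <= c * (M + 3 * q).
  move=> gs sl su; apply: le_trans (hc s rho M _) _.
    by split=> //; [lra | lra].
  rewrite ler_wpM2l // lerD2l ler_pdivrMr; last by lra.
  rewrite rq -subr_ge0.
  have -> : 3 * q * (6 * d * q - s) - 6 * d * q = 3 * q * (6 * d * q - s - 2 * d) by ring.
  by rewrite mulr_ge0 ?mulr_ge0 ?(ltW qp) // -rq; lra.
have [E EE] : exists E : R, E = c * (M + 3 * q) by eexists.
have T1 : T h s1 <= E by rewrite EE Tb //; lra.
have T2 : T h s2 <= E by rewrite EE Tb //; lra.
have E0 : 0 <= E by rewrite EE mulr_ge0 // addr_ge0 ?mulr_ge0 //; lra.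
have [N NE] : exists N : R, N = 2 * E + `|L0 h| by eexists.
have N0 : 0 <= N by rewrite NE addr_ge0 // mulr_ge0.
have r01s : r0 <= s1 by lra.
have r02s : r0 <= s2 by lra.
have s1p := lt_le_trans r0p r01s; have s2p := lt_le_trans r0p r02s.
have [n nE] : exists n : R, n = \sum_(a <- disk s1) `|(ord h a)%:~R : R| by eexists.
have n0 : 0 <= n by rewrite nE sumr_ge0.
have nb : n <= 6 * q * N.
  have s12 : s1 < s2 by lra.
  apply: (@count_numeric n d rho s1 s2 N q) => //; [lra | lra |].
  rewrite nE NE; apply: le_trans (CNT_abs_le rh g2 r02s T2).
  exact: (@CNT_lower (fun a => `|(ord h a)%:~R : R|) s1 s2).
have mb := mean_abs_numeric rh g1 r01s T1; rewrite -NE in mb.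
have r1 : 1 <= r by exact: le_trans r0r.
have rs : r < s1 by lra.
apply: le_trans (prox_logder_disc rh gr g1 r1 rs nE erefl) _.
apply: (@logder_numeric _ n q N M c1) => //.
  have Mq1 : 1 <= M * q by rewrite -[1]mulr1 ler_pM.
  have e1 : M + 3 * q <= 4 * (M * q).
    have : M <= M * q by rewrite ler_peMr //; apply: le_trans M1.
    have : q <= M * q by rewrite ler_peMl //; exact: ltW.
    by lra.
  have e2 : `|L0 h| <= `|L0 h| * (M * q) by rewrite ler_peMr.
  have e3 : E <= c * (4 * (M * q)) by rewrite EE ler_wpM2l.
  by rewrite NE c1E; move: e2 e3; lra.
have f1 : s1 / (s1 - r) ^+ 2 <= 36 * q ^+ 2.
  rewrite ler_pdivrMr ?exprn_gt0 ?subr_gt0 //.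
  apply: le_trans (_ : rho <= _); first by lra.
  apply: le_trans (_ : 36 * q ^+ 2 * d ^+ 2 <= _); last first.
    have dd : d ^+ 2 <= (s1 - r) ^+ 2.
      by rewrite ler_pXn2r ?nnegrE ?subr_ge0 ?(ltW dp) ?(ltW rs) //; lra.
    by apply: ler_wpM2l dd; rewrite mulr_ge0 // sqr_ge0.
  have -> : 36 * q ^+ 2 * d ^+ 2 = rho ^+ 2 by rewrite rq; ring.
  by rewrite expr2 ler_peMl ?(ltW rhop) //; lra.
(* [13 = 1 + 2 * 6]: [N] for the mean and [6 q N] for each copy of [n], with [q >= 1]. *)
have f2 : 2 * prox h s1 - rmean (fun z => ln (nrm (h z))) s1 + 2 * n <= 13 * q * N.
  apply: le_trans (lerD mb (ler_wpM2l _ nb)) _ => //.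
  have : N <= q * N by rewrite ler_peMl.
  by lra.
have f3 : 0 <= 13 * q * N by rewrite !mulr_ge0 // ltW.
have f4 : 0 <= s1 / (s1 - r) ^+ 2 by rewrite divr_ge0 ?sqr_ge0 // ltW.
apply: le_trans (ler_wpM2r f4 (ler_wpM2l _ f2)) _ => //.
by apply: ler_wpM2l f1; rewrite mulr_ge0.
Qed.

(** Borel's lemma is replaced by the supremum [F] of [Tot t * (X - t) / X] over good [t < X = 2 s],
    finite by local boundedness. The hypothesis at [t], with [rho] halfway to [X] and [M] twice
    [F1 * X / (X - t)], yields [F <= c * (5 + ln F1)] where [c] does not depend on [s]. At [t = s]
    the weight is [1 / 2], so [Tot s <= 2 F]. *)
Lemma Tot_bounded : small Tot ->
  (forall x, exists K, forall s, goodr s -> r0 <= s -> s < x -> Tot s <= K) ->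
  exists K, forall s, goodr s -> r0 <= s -> Tot s <= K.
Proof.
move=> [c c0 hc] loc.
have [K0 K0E] : exists K0 : R, K0 = c * (5 + ln (2 * c + 1)) by eexists.
have c21 : 1 <= 2 * c + 1 by rewrite lerDr mulr_ge0.
have c21p : 0 < 2 * c + 1 by exact: lt_le_trans c21.
exists (2 * Num.max 1 (2 * K0)) => s gs r0s.
have sp := lt_le_trans r0p r0s.
have [X XE] : exists X : R, X = 2 * s by eexists.
pose S : set R := [set y | exists t, [/\ goodr t, r0 <= t, t < X & y = Tot t * ((X - t) / X)]].
have Xp : 0 < X by rewrite XE mulr_gt0.
have [K hK] := loc X.
have Ss : S (Tot s * ((X - s) / X)) by exists s; split=> //; rewrite XE; lra.
have ubS : ubound S `|K|.
  move=> y [t [gt r0t tX ->]].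
  have t0 : 0 < t := lt_le_trans r0p r0t.
  have w0 : 0 <= (X - t) / X by rewrite divr_ge0 ?subr_ge0 ?(ltW tX) // ltW.
  have w1 : (X - t) / X <= 1 by rewrite ler_pdivrMr // mul1r gerBl ltW.
  apply: le_trans (ler_wpM2r w0 (le_trans (hK t gt r0t tX) (ler_norm K))) _.
  by rewrite ler_piMr.
have hS : has_sup S by split; [exists (Tot s * ((X - s) / X)) | exists `|K|].
have [F FE] : exists F : R, F = sup S by eexists.
have ubF y : S y -> y <= F by move=> Sy; rewrite FE; apply: sup_upper_bound.
have [F1 F1E] : exists F1 : R, F1 = Num.max 1 F by eexists.
have F11 : 1 <= F1 by rewrite F1E le_max lexx.
have F1F : F <= F1 by rewrite F1E le_max lexx orbT.
have F1p : 0 < F1 by exact: lt_le_trans F11.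
have main : F <= c * (5 + ln F1).
  rewrite FE; apply: sup_le_ub; first by exists (Tot s * ((X - s) / X)).
  move=> y [t [gt r0t tX ->]].
  have tp := lt_le_trans r0p r0t.
  have Xt : 0 < X - t by rewrite subr_gt0.
  have [x xE] : exists x : R, x = X / (X - t) by eexists.
  have x1 : 1 <= x by rewrite xE ler_pdivlMr // mul1r gerBl ltW.
  have xp : 0 < x by exact: lt_le_trans x1.
  have -> : (X - t) / X = x^-1 by rewrite xE invf_div.
  rewrite ler_pdivrMr //.
  have [rho rhoE] : exists rho : R, rho = (t + X) / 2 by eexists.
  have trho : t < rho by rewrite rhoE; lra.
  have cx : ctx t rho (2 * F1 * x).
    split=> //; first by rewrite -[1]mulr1 ler_pM //; lra.
    move=> u gu r0u ur.
    have uX : u < X by move: ur; rewrite rhoE; lra.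
    have Xu : 0 < X - u by rewrite subr_gt0.
    have := ubF _ (ex_intro _ u (And4 gu r0u uX erefl)).
    rewrite mulrA ler_pdivrMr // -ler_pdivlMr // => h1.
    apply: le_trans h1 _; rewrite ler_pdivrMr // xE.
    apply: le_trans (ler_wpM2r (ltW Xp) F1F) _.
    have -> : 2 * F1 * (X / (X - t)) * (X - u) = F1 * X * ((2 * (X - u)) / (X - t)).
      by field; rewrite gt_eqF.
    rewrite ler_peMr ?mulr_ge0 ?(ltW F1p) ?(ltW Xp) // ler_pdivlMr // mul1r.
    by move: ur; rewrite rhoE; lra.
  apply: le_trans (hc _ _ _ cx) _; rewrite -[leRHS]mulrA ler_wpM2l //.
  have q1 := ctx_quot cx.
  have qx : rho / (rho - t) <= 2 * x.
    rewrite ler_pdivrMr ?subr_gt0 // xE rhoE.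
    have -> : 2 * (X / (X - t)) * ((t + X) / 2 - t) = X by field; rewrite gt_eqF.
    by lra.
  have h1 : ln (rho / (rho - t)) <= ln 2 + ln x.
    have qp := lt_le_trans ltr01 q1.
    by rewrite -lnM ?posrE // ler_ln ?posrE // mulr_gt0.
  have -> : ln (2 * F1 * x) = ln 2 + ln F1 + ln x by rewrite !lnM ?posrE ?mulr_gt0.
  have l2 := ln2_le1; have lx := ln_le_subr1 xp.
  have lF := ln_ge0 F11.
  have := ler_wpM2l lF x1; rewrite mulr1 => h2.
  by lra.
(* Tangent of the logarithm at [2 * c + 1], chosen so that [F1] enters the bound for [F] with a
   coefficient of at most [1 / 2]. *)
have lnb : ln F1 <= F1 / (2 * c + 1) + ln (2 * c + 1).
  have := ln_le_subr1 (divr_gt0 F1p c21p); rewrite ln_div ?posrE //; lra.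
have h1 : c * (F1 / (2 * c + 1)) <= F1 / 2.
  rewrite mulrCA ler_wpM2l ?(ltW F1p) // ler_pdivrMr //; lra.
have FK : F <= Num.max 1 (2 * K0).
  have h2 : F <= K0 + F1 / 2.
    apply: le_trans main _; rewrite K0E.
    by have := ler_wpM2l c0 lnb; lra.
  rewrite le_max; have [//|F1'] := leP F 1.
  have F1F' : F1 = F by rewrite F1E max_r // ltW.
  by apply/orP; right; move: h2; rewrite F1F'; lra.
have := ubF _ Ss.
have -> : (X - s) / X = 1 / 2 by rewrite XE; field; rewrite gt_eqF.
by lra.
Qed.

Lemma ln1pM_le (x y : R) : 0 <= x -> 0 <= y -> ln (1 + x * y) <= ln (1 + x) + ln (1 + y).
Proof.
move=> x0 y0; have x1 : 0 < 1 + x by rewrite ltr_pwDl.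
have y1 : 0 < 1 + y by rewrite ltr_pwDl.
have xy := mulr_ge0 x0 y0.
rewrite -lnM ?posrE // ler_ln ?posrE ?mulr_gt0 // ?ltr_pwDl //.
by lra.
Qed.

Lemma ln1p_le (x y : R) : 0 <= x -> x <= y -> ln (1 + x) <= ln (1 + y).
Proof.
move=> x0 xy; have x1 : 0 < 1 + x by rewrite ltr_pwDl.
by rewrite ler_ln ?posrE ?lerD2l // (lt_le_trans x1) // lerD2l.
Qed.

Lemma ln1pXz_le (x : R) (m : int) : 0 < x ->
  ln (1 + x ^ m) <= ln 2 + `|m%:~R : R| * `|ln x|.
Proof.
move=> x0; have xm : 0 < x ^ m by rewrite exprz_gt0.
have [h|h] := leP (x ^ m) 1.
  apply: le_trans (_ : ln 2 <= _); last by rewrite lerDl mulr_ge0.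
  by apply: ln1p_le; [exact: ltW | exact: h].
apply: le_trans (_ : ln (2 * x ^ m) <= _).
  rewrite ler_ln ?posrE ?mulr_gt0 // ?(ltr_pwDl _ (ltW xm)) //.
  by rewrite mulr_natl mulr2n lerD2r ltW.
rewrite lnM ?posrE // lerD2l lnXz //.
by apply: le_trans (ler_norm _) _; rewrite normrM.
Qed.

Lemma hol_on_bounded K (rho r : R) : 0 <= r -> r < rho -> hol_on (fun z => nrm z < rho) K ->
  exists2 M : R, 0 <= M & forall z, nrm z <= r -> nrm (K z) <= M.
Proof.
move=> r0' rr hK; have [s sE] : exists s, s = (r + rho) / 2 by eexists.
have [rs sr] : r < s /\ s < rho by rewrite sE; split; lra.
have sp : 0 < s by exact: le_lt_trans rs.
have cK : con s K by exact: (con_hol (ltW sp) sr hK).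
have [M M0 hM] := circle_bounded cK.
have dp : 0 < s - r by rewrite subr_gt0.
exists (2 * (M * s * (s - r)^-1)).
  by rewrite !mulr_ge0 ?invr_ge0 // ltW.
move=> z zr; have zs : nrm z < s by exact: le_lt_trans rs.
rewrite (cauchy_formula zs sr hK).
apply: cmean_bound; first exact: ltW.
  by apply: conM; [apply: conM => //; exact: con_id | exact: con_kernel].
move=> t ht; move: (circ s t) (nrm_circ t (ltW sp)) (hM t ht) => v vs hv.
rewrite !nrmM nrmV vs.
apply: ler_pM; rewrite ?mulr_ge0 ?invr_ge0 ?(ltW sp) //.
  by rewrite ler_wpM2r ?(ltW sp).
have := nrmBD v z; rewrite vs => h.
have h1 : s - r <= nrm (v - z) by lra.
by rewrite lef_pV2 ?posrE // (lt_le_trans dp).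
Qed.

Lemma ln1p_prod_le (I : eqType) (s : seq I) (F : I -> C) (y : R) : 0 <= y ->
  ln (1 + nrm (\prod_(i <- s) F i) * y) <= \sum_(i <- s) ln (1 + nrm (F i)) + ln (1 + y).
Proof.
move=> y0; elim: s => [|i s IH]; first by rewrite !big_nil nrm1 mul1r add0r.
rewrite !big_cons nrmM -mulrA; apply: le_trans (ln1pM_le _ _) _ => //; first exact: mulr_ge0.
by rewrite -addrA lerD2l.
Qed.

(** On good circles close to a pole [h] has no uniform pointwise bound, but the means of
    [ln (nrm (z - a))] do; so the factorisation is estimated factor by factor. *)
Lemma T_locally_bounded h (x : R) : reg h ->
  exists K, forall s, goodr s -> r0 <= s -> s < x -> T h s <= K.
Proof.
move=> rh; have [r [xr _ gr]] : exists r, [/\ Num.max x r0 < r, r < Num.max x r0 + 1 & goodr r].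
  by apply: goodr_ex; rewrite ltrDl.
move: xr; rewrite gt_max => /andP[xr r0r].
have rp := lt_trans r0p r0r.
have [K [rho [rr hK K0 hE]]] := reg_factor r rh.
have [M M0 hM] := hol_on_bounded (ltW rp) rr hK.
pose b a : R := ln 2 + `|(ord h a)%:~R : R| * (2 * ln (1 + 2 * r)).
exists ((\sum_(a <- disk r) b a + ln (1 + M)) + CNT (pol h) r) => s gs r0s sx.
have sr : s < r by exact: lt_trans xr.
have sp := lt_le_trans r0p r0s; have s0' := ltW sp.
apply: lerD; last by apply: CNT_mono => //; [move=> a _; exact: pol_ge0 | exact: ltW].
pose u a z : R := ln 2 + `|(ord h a)%:~R : R| * `|ln (nrm (z - a))|.
have cl a : B a -> rcon s (fun z => `|ln (nrm (z - a))|).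
  by move=> Ba; apply: rcon_abs; exact: rcon_lnB.
have cu a : a \in disk r -> rcon s (u a).
  by move=> /mem_disk[Ba _]; apply: rconD; [exact: rcon_cst | apply: rconZ; exact: cl].
apply: le_trans (_ : rmean (fun z => \sum_(a <- disk r) u a z + ln (1 + M)) s <= _).
  apply: rmean_le => //.
  - by apply: rcon_ln1p => //; exact: reg_con.
  - by apply: rconD; [exact: rcon_sum_seq | exact: rcon_cst].
  move=> z zs; have zd := @good_notin r s z gs zs.
  have zr : nrm z < rho by rewrite zs (lt_trans sr).
  rewrite hE //; last exact: good_notB gs zs.
  rewrite nrmM; apply: le_trans (ln1p_prod_le _ _ _) _ => //; apply: lerD.
    rewrite big_seq [leRHS]big_seq; apply: ler_sum => a ad.
    rewrite nrmXz; apply: ln1pXz_le; rewrite nrm_gt0 subr_eq0.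
    by apply: contraNneq zd => ->.
  by apply: ln1p_le => //; apply: hM; rewrite zs ltW.
rewrite rmeanD; [|exact: rcon_sum_seq|exact: rcon_cst].
rewrite rmean_cst lerD2r rmean_sum_seq //.
rewrite big_seq [leRHS]big_seq; apply: ler_sum => a /mem_disk[Ba ar].
rewrite rmeanD; [|exact: rcon_cst|by apply: rconZ; exact: cl].
rewrite rmean_cst lerD2l rmeanZ; last exact: cl.
apply: ler_wpM2l => //.
have c1 := rcon_lnB sp gs Ba.
have c2 := rcon_cst s (2 * ln (1 + 2 * r)).
apply: le_trans (_ : rmean (fun z => 2 * ln (1 + 2 * r) - ln (nrm (z - a))) s <= _).
  apply: rmean_le => //; [exact: cl | exact: rconB |] => z zs.
  have za : 0 < nrm (z - a) by rewrite nrm_gt0; apply: con_sub_neq0 zs; exact: gs.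
  apply: le_trans (abs_ln_le za) _; rewrite lerD2r ler_pM2l //; apply: ln1p_le => //.
  by apply: le_trans (nrmD _ _) _; rewrite nrmN zs; lra.
rewrite (rmeanB c2 c1) rmean_cst rmean_ln_sub ?gs // gerBl ln_ge0 //.
by rewrite le_max (le_trans r01 r0s).
Qed.

Lemma CNT_bounded_zero (c : C -> R) (K : R) b : (forall a, B a -> 0 <= c a) -> B b ->
  (forall r, goodr r -> r0 <= r -> CNT c r <= K) -> 1 <= c b -> False.
Proof.
move=> c0 Bb hK cb.
have [x xE] : exists x, x = Num.max r0 (nrm b) by eexists.
have x0 : 0 < x by rewrite xE lt_max r0p.
(* From this radius on, the single point [b] already has weight at least [ln y - ln x], which is one
   more than the modulus of [K]. *)
have [y yE] : exists y, y = expR (`|K| + 1) * x by eexists.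
have yx : x <= y.
  by rewrite yE ler_peMl ?(ltW x0) // -expR0 ler_expR addr_ge0.
have [r [yr _ gr]] : exists r, [/\ y < r, r < y + 1 & goodr r] by apply: goodr_ex; rewrite ltrDl.
have xr : x < r := le_lt_trans yx yr.
have rp := lt_trans x0 xr.
have [r0r br] : r0 <= r /\ nrm b <= r.
  by move: (ltW xr); rewrite xE ge_max => /andP[].
have := CNT_point r0r c0 Bb br; rewrite /W (max_l br) -xE => h1.
have h2 := hK r gr r0r.
have : ln y <= ln r by rewrite ler_ln ?posrE ?(lt_le_trans x0) // ltW.
rewrite yE lnM ?posrE ?expR_gt0 // expRK => h3.
have h4 : 0 <= ln r - ln x by have := normr_ge0 K; lra.
have := ler_wpM2r h4 cb; have := ler_norm K; lra.
Qed.

Lemma T_bounded_no_zero h (K : R) : reg h -> (forall r, goodr r -> r0 <= r -> T h r <= K) ->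
  forall a, (ord h a <= 0)%R.
Proof.
move=> rh hK b; rewrite leNgt; apply/negP => hb.
have Bb : B b.
  apply: contrapT => nB; have [h1 h2] := rh.2 b nB.
  by move: hb; rewrite (ordE (hol_hasord0 h1 h2)).
apply: (@CNT_bounded_zero (zer h) (K - L0 h) b) => //.
- by move=> a _; exact: zer_ge0.
- by move=> r gr r0r; apply: le_trans (CNT_zer_le rh gr r0r) _; rewrite lerD2r hK.
by rewrite /zer ler1z; lia.
Qed.

Lemma regM u v : reg u -> reg v -> reg (fun z => u z * v z).
Proof.
move=> [nu hu] [nv hv]; split; first exact: nzmM.
by move=> a aB; have [h1 h2] := hu a aB; have [h3 h4] := hv a aB; split; [exact: holM | rewrite mulf_neq0].
Qed.

Lemma regV u : reg u -> reg (fun z => (u z)^-1).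
Proof.
move=> [nu hu]; split; first exact: nzmV.
by move=> a aB; have [h1 h2] := hu a aB; split; [exact: holV | rewrite invr_eq0].
Qed.

Lemma reg_cd u (r : R) z : reg u -> goodr r -> nrm z = r -> (exists l, cd u z l) /\ u z != 0.
Proof.
move=> ru gr zr; have [h1 h2] := ru.2 z (good_notB gr zr); split=> //.
exact: hol_at.
Qed.

Lemma con_logd u (r : R) : 0 <= r -> reg u -> goodr r -> con r (logd u).
Proof.
move=> r0' ru gr; apply: conI => // z zr; have [hz h0] := ru.2 z (good_notB gr zr).
apply: gcM; first exact: hol_cc (hol_derive hz).
by apply: gcV => //; exact: hol_cc.
Qed.

Lemma prox_le_add f g h (r : R) : 0 <= r -> con r f -> con r g -> con r h ->
  (forall z, nrm z = r -> nrm (h z) <= nrm (f z) + nrm (g z)) -> prox h r <= prox f r + prox g r.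
Proof.
move=> r0' cf cg ch H; have c1 := rcon_ln1p r0' cf; have c2 := rcon_ln1p r0' cg.
rewrite /prox -(rmeanD c1 c2); apply: rmean_le => //; [exact: rcon_ln1p | exact: rconD |].
move=> z /H h1; apply: le_trans (ln1pD_le (nrm_ge0 _) (nrm_ge0 _)).
exact: ln1p_le.
Qed.

Lemma small_prox_add f g h :
  (forall r, goodr r -> r0 <= r -> [/\ con r f, con r g, con r h &
    forall z, nrm z = r -> nrm (h z) <= nrm (f z) + nrm (g z)]) ->
  small (prox f) -> small (prox g) -> small (prox h).
Proof.
move=> H sf sg; apply: ubd_le (ubdD sf sg) => r gr r0r.
have [cf cg ch h1] := H r gr r0r; apply: prox_le_add => //.
exact: le_trans (ltW r0p) r0r.
Qed.

Lemma small_logdM u v : reg u -> reg v -> small (prox (logd u)) -> small (prox (logd v)) ->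
  small (prox (logd (fun z => u z * v z))).
Proof.
move=> ru rv; apply: small_prox_add => r gr r0r; have r0' := le_trans (ltW r0p) r0r.
split; [exact: con_logd | exact: con_logd | apply: con_logd => //; exact: regM |].
move=> z zr; have [d1 n1] := reg_cd ru gr zr; have [d2 n2] := reg_cd rv gr zr.
by rewrite logdM_pt // nrmD.
Qed.

Lemma small_logdV u : reg u -> small (prox (logd u)) -> small (prox (logd (fun z => (u z)^-1))).
Proof.
move=> ru; apply: ubd_le => r gr r0r; have r0' := le_trans (ltW r0p) r0r.
apply: rmean_le => //; [apply: rcon_ln1p => //; apply: con_logd => //; exact: regV
  |apply: rcon_ln1p => //; exact: con_logd|].
by move=> z zr; have [d1 n1] := reg_cd ru gr zr; rewrite logdV_pt // nrmN.
Qed.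

Lemma regX u n : reg u -> reg (fun z => u z ^+ n).
Proof.
move=> [nu hu]; split; first exact: nzmX.
by move=> a aB; have [h1 h2] := hu a aB; split; [exact: holX | rewrite expf_neq0].
Qed.

Lemma small_logdX u n : reg u -> small (prox (logd u)) ->
  small (prox (logd (fun z => u z ^+ n.+1))).
Proof.
move=> ru su; elim: n => [|n IH].
  by have -> : (fun z => u z ^+ 1) = u by apply/funext => z; rewrite expr1.
have -> : (fun z => u z ^+ n.+2) = (fun z => u z * u z ^+ n.+1).
  by apply/funext => z; rewrite exprS.
by apply: small_logdM => //; exact: regX.
Qed.

Lemma small_prox_D u v : reg u -> reg v -> small (prox (logd u)) -> small (prox (logd v)) ->
  small (prox (D u v)).
Proof.
move=> ru rv; apply: small_prox_add => r gr r0r; have r0' := le_trans (ltW r0p) r0r.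
have c1 := con_logd r0' ru gr; have c2 := con_logd r0' rv gr.
split=> //; first by apply: conD => //; exact: conN.
by move=> z zr; apply: le_trans (nrmD _ _) _; rewrite nrmN.
Qed.

Lemma small_CNT_ord h : reg h -> small (prox h) -> small (CNT (fun a => (ord h a)%:~R)).
Proof.
move=> rh sh; apply: ubd_le (ubdD sh (small_cst (- L0 h))) => r gr r0r.
exact: CNT_ord_le.
Qed.

Lemma T_poly (Q : {poly C}) h (r : R) : reg h -> reg (fun z => Q.[h z]) -> goodr r -> r0 <= r ->
  T (fun z => Q.[h z]) r <= (size Q).-1%:R * T h r + ln (1 + psum Q).
Proof.
move=> rh rQ gr r0r; have r0' := le_trans (ltW r0p) r0r.
have ch := reg_con r0' rh gr; have cQ := reg_con r0' rQ gr.
have c1 := rcon_ln1p r0' ch; have c2 := rconZ (size Q).-1%:R c1.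
have Qn0 : Q != 0.
  apply/eqP => Q0; apply: (hasord_zat (ordP 0 rQ.1)).
  by apply: nrW => z _; rewrite Q0 horner0.
rewrite /T mulrDr -addrA [_ + ln _]addrC addrA; apply: lerD; last first.
  rewrite -CNTZ; apply: CNT_le => // a _; rewrite /pol.
  have [m0|m0] := ltP (ord h a) 0.
    rewrite (ordE (hasord_poly_pole m0 (ordP a rh.1) Qn0)) pmulrn -intrM ler_int.
    rewrite max_r; last by rewrite oppr_ge0 nmulr_rle0.
    have n0 : (0 <= - ord h a)%R by rewrite oppr_ge0 ltW.
    by rewrite (max_r n0) mulrN mulrC.
  have h1 : ordge h a 0 by apply: ordge_weak m0 (hasord_ge (ordP a rh.1)).
  have := ord_ge rQ.1 (ordge0_poly Q h1) => h2.
  by rewrite !max_l ?oppr_le0 // mulr0.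
rewrite -(rmeanZ _ c1) -(rmean_cst (ln (1 + psum Q)) r) -rmeanD //; last exact: rcon_cst.
apply: rmean_le => //; [exact: rcon_ln1p | by apply: rconD => //; exact: rcon_cst |].
move=> z zr; have w1 : 1 <= 1 + nrm (h z) by rewrite lerDl.
have p0 := psum_ge0 Q.
have e1 : 1 <= (1 + nrm (h z)) ^+ (size Q).-1 by rewrite exprn_ege1.
have e0 := lt_le_trans ltr01 e1.
apply: le_trans (_ : ln ((1 + nrm (h z)) ^+ (size Q).-1 * (1 + psum Q)) <= _).
  rewrite ler_ln ?posrE ?nrm1p_gt0 ?mulr_gt0 ?ltr_pwDl //.
  by have := poly_upper Q (h z); lra.
by rewrite lnM ?posrE ?ltr_pwDl // lnXn ?nrm1p_gt0 // mulr_natl.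
Qed.

Lemma big_T_poly (Q : {poly C}) h : reg h -> reg (fun z => Q.[h z]) -> big (T h) ->
  big (T (fun z => Q.[h z])).
Proof.
move=> rh rQ bh; apply: ubd_le (ubdD (ubdZ (ler0n _ (size Q).-1) bh)
  (small_big (small_cst (ln (1 + psum Q))))) => r gr r0r.
exact: T_poly.
Qed.

Lemma big_T_derive h : reg h -> reg (derive1 h) -> big (T h) -> big (T (derive1 h)).
Proof.
move=> rh rh' bh.
have two : 0 <= 2 :> R by [].
apply: ubd_le (ubdD (ubdZ two bh) (small_big (prox_logder rh bh))) => r gr r0r.
have r0' := le_trans (ltW r0p) r0r.
have h1 : prox (derive1 h) r <= prox h r + prox (logd h) r.
  have ch := reg_con r0' rh gr; have cl := con_logd r0' rh gr.
  have c1 := rcon_ln1p r0' ch; have c2 := rcon_ln1p r0' cl.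
  rewrite /prox -(rmeanD c1 c2); apply: rmean_le => //.
  - by apply: rcon_ln1p => //; exact: reg_con.
  - exact: rconD.
  move=> z zr; have hz := reg_neq0 rh gr zr.
  have -> : derive1 h z = h z * logd h z by rewrite /logd mulrC divfK.
  by rewrite nrmM ln1pM_le.
have h2 : CNT (pol (derive1 h)) r <= 2 * CNT (pol h) r.
  rewrite -CNTZ; apply: CNT_le => // a _; rewrite /pol.
  have [m0|m0] := ltP (ord h a) 0.
    have := hasord_derive (negbT (lt_eqF m0)) (ordP a rh.1) => /ordE ->.
    by rewrite (_ : 2 = 2%:~R) // -intrM ler_int; lia.
  have h2 : ordge h a 0 by apply: ordge_weak m0 (hasord_ge (ordP a rh.1)).
  have := ord_ge rh'.1 (ordge_derive0 h2) => h3.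
  by rewrite !max_l ?oppr_le0 // mulr0.
have h3 : 0 <= prox h r by rewrite prox_ge0 //; exact: reg_con.
by rewrite /T; move: h1 h2 h3; rewrite /logd; lra.
Qed.

(** * The second main theorem *)

Definition smtV h (Q : {poly C}) z := derive1 h z * (h z * Q.[h z])^-1.

Lemma reg_smtV h (Q : {poly C}) : reg h -> reg (derive1 h) -> reg (fun z => Q.[h z]) ->
  reg (smtV h Q).
Proof. by move=> rh rh' rQ; apply: regM => //; apply: regV; exact: regM. Qed.

(** Jensen's formula for [V] replaces its orders by the mean of [ln (nrm V)]; [sf_bound] then bounds
    [(1 + nrm h)^d * nrm V] by logarithmic derivatives of [h] and [Q(h)], whose proximity is
    small. *)
Lemma smt_ord h (Q : {poly C}) d : reg h -> reg (derive1 h) -> reg (fun z => Q.[h z]) ->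
  sf Q -> size Q = d.+1 -> big (T h) ->
  small (fun r => CNT (fun a => (ord (smtV h Q) a)%:~R) r + d%:R * prox h r).
Proof.
move=> rh rh' rQ hQ sQ bh; have [k k0 hk] := sf_bound sQ hQ.
have rV := reg_smtV rh rh' rQ.
have s1 := prox_logder rh bh; have s2 := prox_logder rQ (big_T_poly rh rQ bh).
apply: ubd_le (ubdD (ubdD s1 s2) (small_cst (ln (1 + k) - L0 (smtV h Q)))) => r gr r0r.
have r0' := le_trans (ltW r0p) r0r.
rewrite -jensen // -/(L0 _).
have ch := rcon_ln1p r0' (reg_con r0' rh gr); have cV := rcon_ln_reg r0' rV gr.
have c1 := rcon_ln1p r0' (con_logd r0' rh gr); have c2 := rcon_ln1p r0' (con_logd r0' rQ gr).
have c3 := rconD (rcon_cst r (ln (1 + k))) (rconD c1 c2).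
have cL := rconD cV (rconZ d%:R ch).
have := rmean_le r0' cL c3; rewrite (rmeanD cV (rconZ d%:R ch)) (rmeanZ _ ch).
rewrite (rmeanD (rcon_cst r (ln (1 + k))) (rconD c1 c2)) (rmeanD c1 c2) rmean_cst => H.
suff : forall z, nrm z = r -> ln (nrm (smtV h Q z)) + d%:R * ln (1 + nrm (h z)) <=
    ln (1 + k) + (ln (1 + nrm (logd h z)) + ln (1 + nrm (logd (fun z => Q.[h z]) z))).
  by move=> /H; rewrite /prox /logd; lra.
move=> z zr; have [[l hl] h0] := reg_cd rh gr zr; have [_ Qz] := reg_cd rQ gr zr.
have V0 := reg_neq0 rV gr zr.
have E1 : nrm (smtV h Q z) * nrm Q.[h z] = nrm (logd h z).
  rewrite -nrmM; congr nrm; rewrite /smtV /logd; have [_ ->] := cd_derivable hl.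
  by field; rewrite h0 Qz.
have E2 : nrm (smtV h Q z) * nrm (h z * Q^`().[h z]) = nrm (logd (fun z => Q.[h z]) z).
  rewrite -nrmM; congr nrm; rewrite /smtV /logd; have [_ ->] := cd_derivable hl.
  have [_ ->] := cd_derivable (cd_poly Q hl).
  by field; rewrite h0 Qz.
have V1 : 0 < nrm (smtV h Q z) by rewrite nrm_gt0.
have w1 := nrm1p_gt0 (h z).
have L1 := nrm_ge0 (logd h z); have L2 := nrm_ge0 (logd (fun z => Q.[h z]) z).
apply: le_trans (_ : ln (1 + k * (nrm (logd h z) + nrm (logd (fun z => Q.[h z]) z))) <= _).
  rewrite mulr_natl -lnXn // -lnM ?posrE ?exprn_gt0 //.
  rewrite ler_ln ?posrE ?mulr_gt0 ?exprn_gt0 // ?ltr_pwDl ?mulr_ge0 ?addr_ge0 //.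
  apply: le_trans (ler_wpM2l (ltW V1) (hk (h z))) _.
  by rewrite mulrCA mulrDr E1 E2 lerDr.
apply: le_trans (ln1pM_le k0 (addr_ge0 L1 L2)) _; rewrite lerD2l.
exact: ln1pD_le.
Qed.

Definition pos (e : int) : R := (0 < e)%R%:R.

(** Second main theorem for the [d + 2] values [oo], [0] and the roots of [Q], each point counted
    once; the factor of [T] is the number of values minus [2]. *)
Lemma smt h (Q : {poly C}) d : reg h -> reg (derive1 h) -> reg (fun z => Q.[h z]) ->
  sf Q -> size Q = d.+1 -> big (T h) ->
  small (fun r => d%:R * T h r - CNT (fun a => pos (- ord h a)) r - CNT (fun a => pos (ord h a)) r
    - CNT (fun a => pos (ord (fun z => Q.[h z]) a)) r).
Proof.
move=> rh rh' rQ hQ sQ bh; apply: ubd_le (smt_ord rh rh' rQ hQ sQ bh) => r gr r0r.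
have : CNT (fun a => d%:R * pol h a + (-1 * pos (- ord h a) + (-1 * pos (ord h a) +
    -1 * pos (ord (fun z => Q.[h z]) a)))) r <= CNT (fun a => (ord (smtV h Q) a)%:~R) r.
  apply: CNT_le => // a _.
  have [V1 V2 V3 V4] := ord_smt a rh.1 rh'.1 rQ.1 hQ sQ.
  have Q0 : Q.[0] != 0 by apply/eqP => /hQ[]; rewrite eqxx.
  have [H1 H2 H3 _] := poly_order_cases rQ.1 Q0 (ordP a rh.1).
  rewrite /pol /pos oppr_gt0; have [m0|m0|m0] := ltgtP (ord h a) 0.
  - rewrite V1 // max_r; last by rewrite oppr_ge0 ltW.
    rewrite H1 // sQ /=.
    have -> : (- (d%:Z * ord h a) - 1)%:~R = d%:R * (- ord h a)%:~R - 1 :> R.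
      by rewrite intrB -mulrN intrM -pmulrn.
    have -> : (0 < ord h a * d)%R = false by apply/negbTE; rewrite -leNgt nmulr_rle0.
    by rewrite /=; lra.
  - have n0 : (- ord h a <= 0)%R by rewrite oppr_le0 ltW.
    rewrite V2 // H2 // ltxx (max_l n0).
    by rewrite mulrN1z mulr0z mulr0 /=; lra.
  rewrite m0 oppr0 maxxx mulr0.
  have := H3; rewrite m0 lexx => /(_ isT); rewrite le_eqVlt => /orP[/eqP x0|x0].
    by have [-> h0] := V4 m0 (esym x0); rewrite -x0 ltxx !mulr0 !addr0 ler0z.
  by rewrite V3 // x0 mulrN1z /=; lra.
by rewrite !CNTD !CNTZ /T; lra.
Qed.

Lemma big_of_le U : (forall r, goodr r -> r0 <= r -> U r <= Tot r) -> big U.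
Proof. by move=> h; apply: ubd_le h big_Tot. Qed.

Definition cz (u : C -> int) : R -> R := CNT (fun z => (u z)%:~R).

Lemma cz_lin (k : nat) (u v w : C -> int) (r : R) :
  cz (fun z => k%:Z * u z - v z - w z) r = k%:R * cz u r - cz v r - cz w r.
Proof.
rewrite /cz -CNTZ.
have -> : (fun z => (k%:Z * u z - v z - w z)%:~R : R) =
    (fun z => k%:R * (u z)%:~R + ((- 1) * (v z)%:~R + (- 1) * (w z)%:~R)).
  by apply/funext => z; rewrite !intrB intrM -pmulrn; ring.
by rewrite !CNTD !CNTZ; ring.
Qed.

Lemma small_cz_ordge h (u : C -> int) : reg h -> small (prox h) ->
  (forall z, ordge h z (u z)) -> small (cz u).
Proof.
move=> rh sh hu; apply: ubd_le (small_CNT_ord rh sh) => r gr r0r.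
by apply: CNT_le => // z _; rewrite ler_int; apply: ord_ge (hu z); exact: rh.1.
Qed.

Lemma small_zero U : (forall r, goodr r -> r0 <= r -> U r <= 0) -> small U.
Proof. by move=> h; apply: ubd_le h (small_cst 0). Qed.

Lemma cz_zero (u : C -> int) : (forall z, u z = 0) -> small (cz u).
Proof.
move=> h; apply: small_zero => r _ _.
by rewrite /cz /CNT big1 // => z _; rewrite h mul0r.
Qed.

(** * Mismatches, zeros and poles are rare *)

Section Apply.
Variables (n : nat) (a b : C).
Hypothesis hn : (3 <= n)%N.
Hypothesis a0 : a != 0.
Hypothesis b0 : b != 0.
Local Notation P := (uniqP n a b).
Hypothesis sP : sf P.

Lemma small_logdX_P h : reg h -> reg (fun z => P.[h z]) -> big (T h) ->
  small (prox (logd (fun z => P.[h z]))).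
Proof. by move=> rh rX bh; apply: prox_logder => //; exact: big_T_poly. Qed.

Lemma reg_G h : reg h -> reg (fun z => P.[h z]) -> reg (Gof n a b h).
Proof. by move=> rh rX; apply: regM => //; apply: regV; exact: regX. Qed.

Lemma reg_W h : reg (fun z => P.[h z]) -> reg (derive1 (fun z => P.[h z])) -> reg (Wof n a b h).
Proof. by move=> rX rX'; apply: regM => //; apply: regV; exact: regM. Qed.

Lemma small_logdG h : reg h -> reg (fun z => P.[h z]) -> big (T h) ->
  small (prox (logd (Gof n a b h))).
Proof.
move=> rh rX bh; have sX := small_logdX_P rh rX bh; have sh := prox_logder rh bh.
apply: small_logdM => //; first by apply: regV; exact: regX.
apply: small_logdV; first exact: regX.
have -> : n = n.-1.+1 by move: hn; case: n.
exact: small_logdX.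
Qed.

Lemma small_logdW h : reg h -> reg (fun z => P.[h z]) -> reg (derive1 (fun z => P.[h z])) ->
  big (T h) -> small (prox (logd (Wof n a b h))).
Proof.
move=> rh rX rX' bh; have sX := small_logdX_P rh rX bh.
have bX := big_T_poly rh rX bh.
have sX' := prox_logder rX' (big_T_derive rX rX' bX).
apply: small_logdM => //; first by apply: regV; exact: regM.
by apply: small_logdV; [exact: regM | exact: small_logdM].
Qed.

Variables (f g : C -> C).
Hypothesis nf : nonc f.
Hypothesis ng : nonc g.
Variables k1 k3 kp : nat.
Local Notation X := (fun z => P.[f z]).
Local Notation Y := (fun z => P.[g z]).
Hypothesis hx : forall z, mt (ord X z) (ord Y z) k1.
Hypothesis hz : forall z, mt (ord f z) (ord g z) k3.
Hypothesis hp : forall z, mt (- ord f z) (- ord g z) kp.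
Hypothesis fp : forall z, (ord f z < 0)%R -> (ord f z <= - 2)%R.
Hypothesis gp : forall z, (ord g z < 0)%R -> (ord g z <= - 2)%R.
Hypothesis k14 : (4 <= k1)%N.
Hypothesis det : (k1 + (2 * k3 + 1) + kp + 2 < k1 * (2 * k3 + 1) * kp)%N.
Hypothesis rf : reg f.
Hypothesis rg : reg g.
Hypothesis rX : reg X.
Hypothesis rY : reg Y.
Hypothesis bf : big (T f).
Hypothesis bg : big (T g).
Local Notation Psi1 := (Psi1 n a b f g).
Local Notation Psi2 := (Psi2 n a b f g).
Local Notation Psi3 := (Psi3 f g).
Hypothesis rPsi1 : nzm Psi1 -> reg Psi1.
Hypothesis rPsi2 : nzm Psi2 -> reg Psi2.
Hypothesis rPsi3 : nzm Psi3 -> reg Psi3.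

Let misX z := mis (ord X z) (ord Y z).
Let mis0 z := mis (ord f z) (ord g z).
Let misoo z := mis (- ord f z) (- ord g z).

Let s1 : small (prox Psi1).
Proof. by apply: small_prox_D => //; exact: small_logdX_P. Qed.
Let s2 : small (prox Psi2).
Proof. by apply: small_prox_D; [exact: reg_G | exact: reg_G | exact: small_logdG | exact: small_logdG]. Qed.
Let s3 : small (prox Psi3).
Proof. by apply: small_prox_D => //; exact: prox_logder. Qed.

(** Cramer's rule: the multipliers, such as [y z - 1], [z + 1], [y + 1] for [A], are the nonnegative
    entries of the adjugate, and their combination leaves one unknown times the determinant. *)
Lemma det_small (x y z : R) (A B' C' U V W : R -> R) : 0 <= x * y - 1 -> 0 <= y * z - 1 ->
  0 <= x * z - 1 -> 0 <= x -> 0 <= y -> 0 <= z -> 1 <= x * y * z - x - y - z - 2 ->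
  (forall r, goodr r -> r0 <= r -> [/\ 0 <= A r, 0 <= B' r & 0 <= C' r]) ->
  small (fun r => x * A r - B' r - C' r) -> small (fun r => y * B' r - A r - C' r) ->
  small (fun r => z * C' r - A r - B' r) -> [/\ small A, small B' & small C'].
Proof.
move=> xy yz xz x0 y0 z0 d nn h1 h2 h3.
have p (t : R) : 0 <= t -> 0 <= t + 1 by move=> t0; rewrite addr_ge0.
have mn (t : R) : 0 <= t -> t <= (x * y * z - x - y - z - 2) * t by move=> t0; rewrite ler_peMl.
split.
- apply: ubd_le (ubdD (ubdD (ubdZ yz h1) (ubdZ (p _ z0) h2)) (ubdZ (p _ y0) h3)) => r gr r0r.
  have [n1 n2 n3] := nn r gr r0r; apply: le_trans (mn _ n1) _.
  by rewrite le_eqVlt; apply/orP; left; apply/eqP; ring.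
- apply: ubd_le (ubdD (ubdD (ubdZ xz h2) (ubdZ (p _ z0) h1)) (ubdZ (p _ x0) h3)) => r gr r0r.
  have [n1 n2 n3] := nn r gr r0r; apply: le_trans (mn _ n2) _.
  by rewrite le_eqVlt; apply/orP; left; apply/eqP; ring.
apply: ubd_le (ubdD (ubdD (ubdZ xy h3) (ubdZ (p _ y0) h1)) (ubdZ (p _ x0) h2)) => r gr r0r.
have [n1 n2 n3] := nn r gr r0r; apply: le_trans (mn _ n3) _.
by rewrite le_eqVlt; apply/orP; left; apply/eqP; ring.
Qed.

Lemma mis_ge0 e e' : (0 <= mis e e')%R.
Proof. by rewrite /mis; case: ifP. Qed.

(** Each [Psi] that is not identically zero gives one inequality of the linear system; if one of
    them vanishes, there are no mismatches at all by [no_mismatch]. *)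
Lemma mismatch_small : [/\ small (cz misX), small (cz mis0) & small (cz misoo)].
Proof.
have eq0 : (forall z, ord X z = ord Y z /\ ord f z = ord g z) ->
    [/\ small (cz misX), small (cz mis0) & small (cz misoo)].
  move=> h; split; apply: cz_zero => z; have [e1 e2] := h z.
  - by rewrite /misX /mis e1 eqxx andbF.
  - by rewrite /mis0 /mis e2 eqxx andbF.
  by rewrite /misoo /mis e2 eqxx andbF.
have nm := no_mismatch hn a0 b0 sP nf ng hx hz hp.
have m1 : mero Psi1 by apply: mero_D; [exact: rX.1 | exact: rY.1].
have m2 : mero Psi2 by apply: mero_D; [exact: nzG | exact: nzG].
have m3 : mero Psi3 by apply: mero_D; [exact: rf.1 | exact: rg.1].
have [n1|h] := mero_nzm m1; last by apply: eq0 => z; apply: nm; exact: Or31.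
have [n2|h] := mero_nzm m2; last by apply: eq0 => z; apply: nm; exact: Or32.
have [n3|h] := mero_nzm m3; last by apply: eq0 => z; apply: nm; exact: Or33.
have h3 := small_cz_ordge (rPsi3 n3) s3 (Psi3_ge hn a0 b0 sP nf ng hx hz hp).
have h1 := small_cz_ordge (rPsi1 n1) s1 (fun z => (Psi1_ge hn a0 b0 nf ng hx hz hp z).1).
have h2 := small_cz_ordge (rPsi2 n2) s2 (fun z => (Psi2_ge hn a0 b0 nf ng hx hz hp fp gp z).1).
have Npos (i j : nat) : (1 <= i * j)%N -> 0 <= i%:R * j%:R - 1 :> R.
  by move=> ij; rewrite -natrM subr_ge0 ler1n.
have kp0 : (1 <= kp)%N by move: det; case: kp => //; rewrite muln0.
apply: (@det_small k1%:R (2 * k3 + 1)%:R kp%:R _ _ _ (fun=> 0) (fun=> 0) (fun=> 0)) => //.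
- by apply: Npos; rewrite muln_gt0; lia.
- by apply: Npos; rewrite muln_gt0; lia.
- by apply: Npos; rewrite muln_gt0; lia.
- have : (k1 + (2 * k3 + 1) + kp + 3 <= k1 * (2 * k3 + 1) * kp)%N by move: det; lia.
  by move: (2 * k3 + 1)%N => y; rewrite -(ler_nat R) !natrD !natrM; lra.
- by move=> r gr r0r; split; apply: CNT_ge0 => // z _; rewrite ler0z mis_ge0.
- by apply: ubd_le h3 => r gr r0r; rewrite cz_lin.
- apply: ubd_le h1 => r gr r0r; rewrite cz_lin.
  by rewrite le_eqVlt; apply/orP; left; apply/eqP; rewrite /misX /mis0 /misoo; ring.
by apply: ubd_le h2 => r gr r0r; rewrite cz_lin.
Qed.

Let zero z : int := if (0 < ord f z)%R then 1 else 0.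
Let pole z : int := if (0 < - ord f z)%R then 1 else 0.

(** The second estimate of [Psi1_ge] counts all zeros of [f] up to mismatches, which are already
    rare; the alternative premise serves the case [Psi1 = 0]. *)
Lemma zeros_small : nzm Psi1 \/ (forall z, (ord f z <= 0)%R) -> small (cz zero).
Proof.
case=> [n1|h]; last by apply: cz_zero => z; rewrite /zero ltNge h.
have [A B' C'] := mismatch_small.
have h1 := small_cz_ordge (rPsi1 n1) s1 (fun z => (Psi1_ge hn a0 b0 nf ng hx hz hp z).2).
apply: ubd_le (ubdD h1 (ubdD A C')) => r gr r0r.
have -> : cz (fun z => zero z - mis (ord X z) (ord Y z) - mis (- ord f z) (- ord g z)) r =
  1%:R * cz zero r - cz misX r - cz misoo r.
  by rewrite -cz_lin; congr (cz _ r); apply/funext => z; rewrite mul1r.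
by rewrite mul1r le_eqVlt; apply/orP; left; apply/eqP; ring.
Qed.

Lemma poles_small : nzm Psi2 \/ (forall z, (0 <= ord f z)%R) -> small (cz pole).
Proof.
case=> [n1|h]; last by apply: cz_zero => z; rewrite /pole oppr_gt0 ltNge h.
have [A B' C'] := mismatch_small.
have h1 := small_cz_ordge (rPsi2 n1) s2 (fun z => (Psi2_ge hn a0 b0 nf ng hx hz hp fp gp z).2).
apply: ubd_le (ubdD h1 (ubdD A B')) => r gr r0r.
have -> : cz (fun z => pole z - mis (ord X z) (ord Y z) - mis (ord f z) (ord g z)) r =
  1%:R * cz pole r - cz misX r - cz mis0 r.
  by rewrite -cz_lin; congr (cz _ r); apply/funext => z; rewrite mul1r.
by rewrite mul1r le_eqVlt; apply/orP; left; apply/eqP; ring.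
Qed.

Hypothesis sz : small (cz zero).
Hypothesis sp : small (cz pole).
Hypothesis rf' : reg (derive1 f).
Hypothesis rg' : reg (derive1 g).

Lemma CNT_zer_poly (Q : {poly C}) h (r : R) : reg h -> reg (fun z => Q.[h z]) -> goodr r -> r0 <= r ->
  CNT (zer (fun z => Q.[h z])) r <=
    (size Q).-1%:R * T h r + (ln (1 + psum Q) - L0 (fun z => Q.[h z])).
Proof.
move=> rh rQ gr r0r; apply: le_trans (CNT_zer_le rQ gr r0r) _.
by rewrite addrA lerD2r T_poly.
Qed.

Lemma CNT_zer_sub (c : C) h (r : R) : reg h -> reg (fun z => h z - c) -> goodr r -> r0 <= r ->
  CNT (zer (fun z => h z - c)) r <=
    T h r + (ln (1 + psum ('X - c%:P)) - L0 (fun z => h z - c)).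
Proof.
have -> : (fun z => h z - c) = (fun z => ('X - c%:P).[h z]).
  by apply/funext => z; rewrite hornerXsubC.
move=> rh rQ gr r0r; have := CNT_zer_poly rh rQ gr r0r.
by rewrite size_XsubC mul1r.
Qed.

(** The second main theorem for both functions yields [n * Tot]. Zeros of [X] and [Y], weighted by
    one half, cost [n / 2 * Tot], and the points over [crit] cost [Tot]. What remains is
    [n / 2 - 1 >= 1 / 2], hence the overall factor [2]. *)
Lemma T_small_of_H : reg (derive1 X) -> reg (derive1 Y) -> reg (Hof n a b f g) ->
  reg (fun z => f z - crit n a) -> reg (fun z => g z - crit n a) ->
  small (fun r => T f r + T g r).
Proof.
move=> rX' rY' rH rfc rgc.
have sH : small (prox (Hof n a b f g)).
  by apply: small_prox_D; [exact: reg_W|exact: reg_W|exact: small_logdW|exact: small_logdW].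
have hH := small_CNT_ord rH sH.
have hf := smt_ord rf rf' rX sP (size_P hn a0 b0) bf.
have hg := smt_ord rg rg' rY sP (size_P hn a0 b0) bg.
pose c0 := crit n a.
pose cst : R := (ln (1 + psum P) - L0 X) / 2 + (ln (1 + psum P) - L0 Y) / 2 +
  (ln (1 + psum ('X - c0%:P)) - L0 (fun z => f z - c0)) +
  (ln (1 + psum ('X - c0%:P)) - L0 (fun z => g z - c0)).
have two : 0 <= 2 :> R by [].
have three : 0 <= 3 :> R by [].
apply: ubd_le (ubdZ two (ubdD (ubdD (ubdD hf hg) hH)
  (ubdD (ubdZ three (ubdD sz sp)) (small_cst cst)))) => r gr r0r.
have r0' := le_trans (ltW r0p) r0r.
have H : CNT (fun z => n%:R * (pol f z + pol g z) + ((- 2^-1) * (zer X z + zer Y z) +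
    ((- 3) * (pole z)%:~R + ((- 3) * (zero z)%:~R + ((- 1) * zer (fun z => f z - c0) z +
      (- 1) * zer (fun z => g z - c0) z))))) r <=
    CNT (fun z => (ord (smtV f P) z)%:~R + ((ord (smtV g P) z)%:~R + (ord (Hof n a b f g) z)%:~R)) r.
  apply: CNT_le => // z _.
  have := Hof_ge hn a0 b0 sP nf ng hx hz hp k14 z rH.1.
  rewrite -(ler_int R) /pol /zer /pole /zero /smtV.
  rewrite !(intrB, intrD, intrM) -!pmulrn; lra.
move: H; rewrite !(CNTD, CNTZ).
have z1 := CNT_zer_poly rf rX gr r0r; have z2 := CNT_zer_poly rg rY gr r0r.
have z3 := CNT_zer_sub rf rfc gr r0r; have z4 := CNT_zer_sub rg rgc gr r0r.
move: z1 z2 z3 z4; rewrite (size_P hn a0 b0) /= -/c0.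
have Tf := T_ge0 r0r (reg_con r0' rf gr); have Tg := T_ge0 r0r (reg_con r0' rg gr).
have n3 : 3 <= n%:R :> R by rewrite ler_nat.
have h1 : 3 * (T f r + T g r) <= n%:R * (T f r + T g r) by rewrite ler_wpM2r // addr_ge0.
move: h1 Tf Tg; rewrite /cst /cz !mulrDr /T; lra.
Qed.

(** Root points of [Q(u)] are zeros or poles of [v], which are rare, or for [d = 2] points where
    [v = - a], at most [T v] many. Adding the same estimate with [u] and [v] exchanged leaves
    [T u + T v]. *)
Lemma small_smt_data (Q : {poly C}) (u v : C -> C) d : smt_data a Q u v d ->
  reg u -> reg v -> reg (derive1 u) -> reg (fun z => Q.[u z]) -> reg (fun z => v z - (- a)) -> big (T u) ->
  small (CNT (fun z => pos (- ord u z))) -> small (CNT (fun z => pos (ord u z))) ->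
  small (CNT (fun z => pos (- ord v z))) -> small (CNT (fun z => pos (ord v z))) ->
  small (fun r => d%:R * T u r - (d%:R - 1) * T v r).
Proof.
move=> [sQ szQ d12 hQ] ru rv ru' rQ rva bu p1 p2 p3 p4.
have hs := smt ru ru' rQ sQ szQ bu.
have d1 : 0 <= d%:R - 1 :> R by case: d12 => ->; lra.
pose cst : R := ln (1 + psum ('X - (- a)%:P)) - L0 (fun z => v z - (- a)).
apply: ubd_le (ubdD (ubdD (ubdD hs p1) (ubdD p2 p3)) (ubdD p4 (ubdZ d1 (small_cst cst)))) => r gr r0r.
have H : CNT (fun z => pos (ord (fun y => Q.[u y]) z)) r <= CNT (fun z => pos (- ord v z) +
    (pos (ord v z) + (d%:R - 1) * zer (fun y => v y - (- a)) z)) r.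
  apply: CNT_le => // z _; rewrite /pos; case: ltP => [h|_]; last first.
    by rewrite !addr_ge0 ?mulr_ge0 ?zer_ge0.
  have [v0|[-> v0]] := hQ z h.
    rewrite addrA; apply: ler_wpDr; first by rewrite mulr_ge0 ?zer_ge0.
    have [m0|m0|m0] := ltgtP (ord v z) 0; last by rewrite m0 in v0.
      by rewrite oppr_gt0 m0 lerDl.
    by rewrite lerDr.
  have z1 : 1 <= zer (fun y => v y - - a) z by rewrite /zer ler1z; lia.
  have q1 : 0 <= (0 < - ord v z)%R%:R :> R by [].
  have q2 : 0 <= (0 < ord v z)%R%:R :> R by [].
  by rewrite /=; lra.
move: H; rewrite !(CNTD, CNTZ).
have := CNT_zer_sub rv rva gr r0r; rewrite -/cst => h1.
have := ler_wpM2l d1 h1; rewrite mulrDr.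
lra.
Qed.

End Apply.

(** Small growth makes [Tot], hence the characteristic of [h - p], bounded, whereas the counting
    function of a single zero grows like [ln r]. *)
Lemma growth_contra h p z : reg h -> reg (fun w => h w - p) -> (0 < ord (fun w => h w - p) z)%R ->
  (forall r, goodr r -> r0 <= r -> T h r <= Tot r) -> small Tot ->
  (forall x, exists K, forall s, goodr s -> r0 <= s -> s < x -> Tot s <= K) -> False.
Proof.
move=> rh rhp hz' hT sT loc; have [K hK] := Tot_bounded sT loc.
have E : (fun w => h w - p) = (fun w => ('X - p%:P).[h w]).
  by apply/funext => w; rewrite hornerXsubC.
have := T_bounded_no_zero (K := K + ln (1 + psum ('X - p%:P))) rhp.
have H r : goodr r -> r0 <= r -> T (fun w => h w - p) r <= K + ln (1 + psum ('X - p%:P)).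
  move=> gr r0r; rewrite E; apply: le_trans (T_poly rh _ gr r0r) _; first by rewrite -E.
  by rewrite size_XsubC mul1r lerD2r (le_trans (hT r gr r0r)) // hK.
by move=> /(_ H z); rewrite leNgt hz'.
Qed.

End Growth.

(** The second main theorem bounds [T] by the number of distinct [w]-points; each has multiplicity
    at least [2], so up to small terms [T <= T / 2]. *)
Lemma omega_contra h w p z : omega_data h w -> reg h -> reg (derive1 h) ->
  reg (fun y => ('X - w%:P).[h y]) -> reg (fun y => h y - p) ->
  (0 < ord (fun y => h y - p) z)%R -> False.
Proof.
move=> [nh w0 h0 hw] rh rh' rQ rp pz.
have bh : big (T h) (T h) by apply: big_of_le.
have hs := smt rh rh' rQ (sf_XsubC w0) (size_XsubC w) bh.
pose c : R := ln (1 + psum ('X - w%:P)) - L0 (fun y => ('X - w%:P).[h y]).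
have two : 0 <= 2 :> R by [].
have sT : small (T h) (T h).
  apply: ubd_le (ubdD (ubdZ two hs) (small_cst (T h) c)) => r gr r0r.
  have z1 : CNT (fun a => pos (- ord h a)) r = 0.
    by rewrite /CNT big1 // => a _; rewrite h0 oppr0 /pos ltxx mul0r.
  have z2 : CNT (fun a => pos (ord h a)) r = 0.
    by rewrite /CNT big1 // => a _; rewrite h0 /pos ltxx mul0r.
  have z3 : 2 * CNT (fun a => pos (ord (fun y => ('X - w%:P).[h y]) a)) r <=
      CNT (zer (fun y => ('X - w%:P).[h y])) r.
    rewrite -CNTZ; apply: CNT_le => // a _; rewrite /pos /zer.
    have E : (fun y => ('X - w%:P).[h y]) = (fun y => h y - w).
      by apply/funext => y; rewrite hornerXsubC.
    rewrite E; case: ltP => [ha|_]; last by rewrite mulr0.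
    by rewrite mulr1 (_ : 2 = 2%:~R) // ler_int; have := hw a ha; lia.
  have := CNT_zer_poly rh rQ gr r0r; rewrite size_XsubC mul1r -/c.
  by rewrite z1 z2; lra.
apply: (growth_contra rh rp pz _ sT) => // x.
exact: T_locally_bounded.
Qed.

Section PairContra.
Variables (n : nat) (a b : C).
Hypothesis hn : (3 <= n)%N.
Hypothesis a0 : a != 0.
Hypothesis b0 : b != 0.
Local Notation P := (uniqP n a b).
Hypothesis sP : sf P.
Variables (f g : C -> C).
Hypothesis nf : nonc f.
Hypothesis ng : nonc g.
Variables k1 k3 kp : nat.
Local Notation X := (fun z => P.[f z]).
Local Notation Y := (fun z => P.[g z]).
Hypothesis hx : forall z, mt (ord X z) (ord Y z) k1.
Hypothesis hz : forall z, mt (ord f z) (ord g z) k3.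
Hypothesis hp : forall z, mt (- ord f z) (- ord g z) kp.
Hypothesis fp : forall z, (ord f z < 0)%R -> (ord f z <= - 2)%R.
Hypothesis gp : forall z, (ord g z < 0)%R -> (ord g z <= - 2)%R.
Hypothesis k14 : (4 <= k1)%N.
Hypothesis det : (k1 + (2 * k3 + 1) + kp + 2 < k1 * (2 * k3 + 1) * kp)%N.

(** The last premise separates [H != 0], settled by [T_small_of_H], from [H = 0], where the
    estimates of [small_smt_data] for both orders of the pair add up to [Tot]. *)
Lemma pair_contra p z : reg f -> reg g -> reg X -> reg Y -> reg (derive1 f) -> reg (derive1 g) ->
  reg (fun w => f w - p) -> (0 < ord (fun w => f w - p) z)%R ->
  (nzm (Psi1 n a b f g) -> reg (Psi1 n a b f g)) ->
  (nzm (Psi2 n a b f g) -> reg (Psi2 n a b f g)) ->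
  (nzm (Psi3 f g) -> reg (Psi3 f g)) ->
  nzm (Psi1 n a b f g) \/ (forall z, (ord f z <= 0)%R) ->
  nzm (Psi2 n a b f g) \/ (forall z, (0 <= ord f z)%R) ->
  [/\ reg (derive1 X), reg (derive1 Y), reg (Hof n a b f g),
      reg (fun z => f z - crit n a) & reg (fun z => g z - crit n a)] \/
  (exists Q1 Q2 d, smt_data a Q1 f g d /\ smt_data a Q2 g f d /\
    [/\ reg (fun z => Q1.[f z]), reg (fun z => Q2.[g z]), reg (fun z => f z - (- a)) &
      reg (fun z => g z - (- a))]) -> False.
Proof.
move=> rf rg rX rY rf' rg' rp pz r1 r2 r3 Z1 Z2 alt.
pose Tot r := T f r + T g r.
have Tf0 r : goodr r -> r0 <= r -> 0 <= T f r.
  by move=> gr r0r; apply: T_ge0 => //; apply: reg_con => //; exact: le_trans (ltW r0p) r0r.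
have Tg0 r : goodr r -> r0 <= r -> 0 <= T g r.
  by move=> gr r0r; apply: T_ge0 => //; apply: reg_con => //; exact: le_trans (ltW r0p) r0r.
have bf : big Tot (T f) by apply: big_of_le => r gr r0r; rewrite lerDl Tg0.
have bg : big Tot (T g) by apply: big_of_le => r gr r0r; rewrite lerDr Tf0.
have sz := zeros_small hn a0 b0 sP nf ng hx hz hp fp gp k14 det rf rg rX rY bf bg r1 r2 r3 Z1.
have sp := poles_small hn a0 b0 sP nf ng hx hz hp fp gp k14 det rf rg rX rY bf bg r1 r2 r3 Z2.
have sT : small Tot Tot.
  case: alt => [[rX' rY' rH rfc rgc]|[Q1 [Q2 [d [d1 [d2 [q1 q2 fa ga]]]]]]].
    exact: (T_small_of_H hn a0 b0 sP nf ng hx hz hp k14 rf rg rX rY bf bg sz sp rf' rg' rX' rY' rH rfc rgc).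
  have pf : small Tot (CNT (fun z => pos (ord f z))).
    apply: ubd_le sz => r gr r0r; rewrite le_eqVlt; apply/orP; left; apply/eqP.
    by apply: CNT_eq => y _; rewrite /pos; case: ifP.
  have pof : small Tot (CNT (fun z => pos (- ord f z))).
    apply: ubd_le sp => r gr r0r; rewrite le_eqVlt; apply/orP; left; apply/eqP.
    by apply: CNT_eq => y _; rewrite /pos; case: ifP.
  have pg : small Tot (CNT (fun z => pos (ord g z))).
    apply: ubd_le pf => r gr r0r; rewrite le_eqVlt; apply/orP; left; apply/eqP.
    apply: CNT_eq => y _; rewrite /pos; congr (nat_of_bool _)%:R.
    by have := @hz y; rewrite /mt; lia.
  have pog : small Tot (CNT (fun z => pos (- ord g z))).
    apply: ubd_le pof => r gr r0r; rewrite le_eqVlt; apply/orP; left; apply/eqP.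
    apply: CNT_eq => y _; rewrite /pos; congr (nat_of_bool _)%:R.
    by have := @hp y; rewrite /mt; lia.
  have s1 := small_smt_data hn a0 b0 k14 det d1 rf rg rf' q1 ga bf pof pf pog pg.
  have s2 := small_smt_data hn a0 b0 k14 det d2 rg rf rg' q2 fa bg pog pg pof pf.
  apply: ubd_le (ubdD s1 s2) => r gr r0r.
  by rewrite le_eqVlt; apply/orP; left; apply/eqP; rewrite /Tot; ring.
apply: (growth_contra rf rp pz _ sT) => [r gr r0r|x]; first by rewrite lerDl Tg0.
have [K1 h1] := T_locally_bounded x rf; have [K2 h2] := T_locally_bounded x rg.
by exists (K1 + K2) => s gs r0s sx; apply: lerD; [exact: h1 | exact: h2].
Qed.

End PairContra.

End Count.

(** * Uniqueness *)

Section Bad.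
Context {R : realType}.
Local Notation C := R[i].

Fixpoint fmem (h : C -> C) (l : seq (C -> C)) : Prop :=
  if l is u :: l' then u = h \/ fmem h l' else False.

(** The exceptional points of a finite list of functions together, so that one set [B] and one
    radius [r0] serve a whole argument. *)
Definition badU (l : seq (C -> C)) : set C := [set z | exists2 h, fmem h l & badz h z].

Lemma discr_badU l : discr (badU l).
Proof.
elim: l => [|u l IH]; first by move=> z; apply: nrW => w _ [].
apply: discr_sub (discrU (discr_badz u) IH) => z [h [<-|hl] bz]; first by left.
by right; exists h.
Qed.

Lemma reg_badU l h : fmem h l -> nzm h -> reg (badU l) h.
Proof.
move=> hl nh; split=> // z nb; apply: contrapT => bz; apply: nb.
by exists h => //; split.
Qed.

Lemma omega_false (h : C -> C) (w : C) : omega_data h w -> False.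
Proof.
move=> od; have [nh w0 h0 hw] := od.
have [p [z pz]] := nonc_value nh.
pose l := [:: h; derive1 h; (fun y => ('X - w%:P).[h y]); (fun y => h y - p)].
have dB := discr_badU l.
have [r0 [r01 _ gr0]] : exists r : R, [/\ 1 < r, r < 2 & goodr (badU l) r].
  by apply: goodr_ex => //; rewrite ltr1n.
have rQ : nzm (fun y => ('X - w%:P).[h y]) by apply: nonc_poly => //; rewrite polyXsubC_eq0.
apply: (omega_contra dB (ltW r01) gr0 od (p := p) (z := z)) => //; apply: reg_badU => //.
- by left.
- exact: nonc_nzm.
- by right; left.
- exact: nonc_derive.
- by right; right; left.
- by right; right; right; left.
exact: nonc_sub.
Qed.

End Bad.

Lemma fmem_nth (R : realType) (s : seq (R[i] -> R[i])) k :
  (k < size s)%N -> fmem (nth (fun=> 0) s k) s.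
Proof. by elim: s k => [//|u s IH] [|k] /= ks; [left | right; exact: IH]. Qed.

Section Uniqueness.
Context {R : realType}.
Local Notation C := R[i].
Variables (n : nat) (a b : C).
Hypothesis hn : (3 <= n)%N.
Hypothesis a0 : a != 0.
Hypothesis b0 : b != 0.
Local Notation P := (uniqP n a b).
Hypothesis sP : sf P.
Variables (f g : C -> C).
Hypothesis nf : nonc f.
Hypothesis ng : nonc g.
Variables k1 k3 kp : nat.
Local Notation X := (fun z => P.[f z]).
Local Notation Y := (fun z => P.[g z]).
Hypothesis hx : forall z, mt (ord X z) (ord Y z) k1.
Hypothesis hz : forall z, mt (ord f z) (ord g z) k3.
Hypothesis hp : forall z, mt (- ord f z) (- ord g z) kp.
Hypothesis fp : forall z, (ord f z < 0)%R -> (ord f z <= - 2)%R.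
Hypothesis gp : forall z, (ord g z < 0)%R -> (ord g z <= - 2)%R.
Hypothesis k14 : (4 <= k1)%N.
Hypothesis det : (k1 + (2 * k3 + 1) + kp + 2 < k1 * (2 * k3 + 1) * kp)%N.
Hypothesis fg : ~ eqm f g.
Local Notation Psi1 := (Psi1 n a b f g).
Local Notation Psi2 := (Psi2 n a b f g).
Local Notation Psi3 := (Psi3 f g).

Lemma eqm_XY_false : eqm X Y -> False.
Proof.
move=> e; have z1 w : zat Psi1 w.
  have fd := mero_cd w (nzm_mero (nzX hn a0 b0 nf)).
  apply: nrS2 (derive1_near (e w) fd) (e w) => z _ E1 E2.
  by rewrite /Psi1 /D /logd E1 E2 subrr.
have sm w : ord f w = ord g w.
  by apply: (no_mismatch hn a0 b0 sP nf ng hx hz hp _).2; constructor 1; apply: z1.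
have [h [w /omega_false//]] := X_eq_case hn a0 nf ng gp k14 fg e sm.
Qed.

(** If [Psi1] vanishes, then [X = c * Y]. The case [c = 1] is refuted by the ramified root of unity,
    and [c != 1] rules out common zeros. *)
Lemma Psi1_cases : nzm Psi1 \/ forall z, (ord f z <= 0)%R.
Proof.
have [|z1] := mero_nzm (mero_D (nzX hn a0 b0 nf) (nzX hn a0 b0 ng)); first by left.
right; have [c _ e] := D_zat (nzX hn a0 b0 nf) (nzX hn a0 b0 ng) z1.
have [c1|c1] := eqVneq c 1; last exact: (no_zero_case hn b0 nf ng hz k14 c1 e).
case: eqm_XY_false => w; apply: nrS (e w) => z _ ->; by rewrite c1 mul1r.
Qed.

Lemma Psi2_cases : nzm Psi2 \/ forall z, (0 <= ord f z)%R.
Proof.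
have nGf := nzG hn a0 b0 nf; have nGg := nzG hn a0 b0 ng.
have [|z1] := mero_nzm (mero_D (nGf) (nGg)); first by left.
right; have [c _ e] := D_zat (nGf) (nGg) z1.
have [c1|c1] := eqVneq c 1; last exact: (no_pole_case hn nf ng hp k14 c1 e).
have sm w : ord f w = ord g w.
  by apply: (no_mismatch hn a0 b0 sP nf ng hx hz hp _).2; constructor 2; apply: z1.
have e1 : eqm (Gof n a b f) (Gof n a b g).
  by move=> w; apply: nrS (e w) => z _ ->; rewrite c1 mul1r.
have [h [w /omega_false//]] := G_eq_case hn a0 b0 nf ng k14 fg e1 sm.
Qed.

(** In [1/X = c/Y + d], a nonzero [d] gives degree [1]; for [d = 0] the functions [X] and [Y] are
    proportional, which gives degree [2]. Inverting the relation exchanges the roles of [f] and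
    [g]. *)
Lemma smt_datas : (forall z, zat (Hof n a b f g) z) ->
  exists Q1 Q2 d, smt_data a Q1 f g d /\ smt_data a Q2 g f d.
Proof.
move=> /(Hof_zero hn a0 b0 nf ng)[c [d [c0 e]]].
have [d0|d0] := eqVneq d 0; last first.
  have [Q2 h2] := smt_data_const hn a0 b0 k14 nf ng c0 d0 e.
  have c0' : c^-1 != 0 by rewrite invr_neq0.
  have d0' : - d / c != 0 by rewrite mulf_neq0 ?oppr_eq0.
  have [|Q1 h1] := smt_data_const hn a0 b0 k14 (u := g) (v := f) ng nf c0' d0'.
    move=> w; apply: nrS (e w) => z _ E.
    have alg (p q : C) : q = c * p + d -> p = c^-1 * q + - d / c.
      by move=> ->; field.
    exact: alg.
  by exists Q1, Q2, 1%N.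
have [c1|c1] := eqVneq c 1.
  exfalso; apply: eqm_XY_false => w; apply: nrS (e w) => z _.
  by rewrite c1 d0 mul1r addr0 => /invr_inj.
have e1 : eqm Y (fun z => c * X z).
  move=> w; apply: nrS2 (e w) (nzm_cd w (nzX hn a0 b0 nf)) => z _ E [_ x0].
  rewrite d0 addr0 in E.
  have alg (p q : C) : p != 0 -> p^-1 = c * q^-1 -> q = c * p.
    by move=> p0 E'; rewrite -[LHS]invrK -[q^-1](mulKf c0) -E' invfM !invrK.
  exact: alg x0 E.
have c1' : c^-1 != 1 by rewrite invr_eq1.
have e2 : eqm X (fun z => c^-1 * Y z).
  by move=> w; apply: nrS (e1 w) => z _ ->; rewrite mulKf.
have [Q2 h2] := smt_data_prop hn a0 b0 k14 nf ng c1 e1.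
have [Q1 h1] := smt_data_prop hn a0 b0 k14 ng nf c1' e2.
by exists Q1, Q2, 2%N.
Qed.

(** The exceptional set must be fixed before the radius, but [Q1] and [Q2] are available only when
    [H] vanishes; so [fin] is stated for an arbitrary list [s] and applied to a different list in
    each case. *)
Lemma distinct_false : False.
Proof.
have [p [z pz]] := nonc_value nf.
pose l := [:: f; g; X; Y; derive1 f; derive1 g; (fun w => f w - p); Psi1; Psi2; Psi3].
have good s : exists r : R, [/\ 1 < r, r < 2 & goodr (badU s) r].
  by apply: goodr_ex; [exact: discr_badU | rewrite ltr1n].
have fin s : fmem f s -> fmem g s -> fmem X s -> fmem Y s -> fmem (derive1 f) s ->
    fmem (derive1 g) s -> fmem (fun w => f w - p) s -> fmem Psi1 s -> fmem Psi2 s -> fmem Psi3 s ->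
    [/\ fmem (derive1 X) s, fmem (derive1 Y) s, fmem (Hof n a b f g) s,
      fmem (fun z => f z - crit n a) s & fmem (fun z => g z - crit n a) s] /\
      nzm (Hof n a b f g) \/
    (exists Q1 Q2 d, smt_data a Q1 f g d /\ smt_data a Q2 g f d /\
      [/\ fmem (fun z => Q1.[f z]) s, fmem (fun z => Q2.[g z]) s,
        fmem (fun z => f z - (- a)) s & fmem (fun z => g z - (- a)) s]) -> False.
  move=> i1 i2 i3 i4 i5 i6 i7 i8 i9 i10 alt.
  have [r0 [r01 _ gr0]] := good s.
  apply: (pair_contra (discr_badU s) (ltW r01) gr0 hn a0 b0 sP nf ng hx hz hp fp gp k14 det
    (p := p) (z := z)) => //.
  - exact/reg_badU/nonc_nzm.
  - exact/reg_badU/nonc_nzm.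
  - by apply: reg_badU => //; apply: nzX.
  - by apply: reg_badU => //; apply: nzX.
  - exact/reg_badU/nonc_derive.
  - exact/reg_badU/nonc_derive.
  - exact/reg_badU/nonc_sub.
  - exact: reg_badU.
  - exact: reg_badU.
  - exact: reg_badU.
  - exact: Psi1_cases.
  - exact: Psi2_cases.
  case: alt => [[[j1 j2 j3 j4 j5] nH]|[Q1 [Q2 [d [h1 [h2 [j1 j2 j3 j4]]]]]]].
    left; split.
    + exact: (reg_badU j1 (nzX' hn a0 b0 nf)).
    + exact: (reg_badU j2 (nzX' hn a0 b0 ng)).
    + exact: reg_badU.
    + exact/reg_badU/nonc_sub.
    + exact/reg_badU/nonc_sub.
  right; exists Q1, Q2, d; split=> //; split=> //.
  have sQ (Q : {poly C}) u v : smt_data a Q u v d -> Q != 0.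
    by case=> _ sz _ _; rewrite -size_poly_gt0 sz.
  split.
  - apply: reg_badU => //; exact: (nonc_poly nf (sQ _ _ _ h1)).
  - apply: reg_badU => //; exact: (nonc_poly ng (sQ _ _ _ h2)).
  - exact/reg_badU/nonc_sub.
  - exact/reg_badU/nonc_sub.
have [nH|/smt_datas[Q1 [Q2 [d [h1 h2]]]]] := mero_nzm (mero_D (nzW hn a0 b0 nf) (nzW hn a0 b0 ng)).
  pose s := l ++ [:: derive1 X; derive1 Y; Hof n a b f g; (fun z => f z - crit n a);
    (fun z => g z - crit n a)].
  have i k : (k < size s)%N -> fmem (nth (fun=> 0) s k) s := @fmem_nth _ s k.
  apply: (fin s (i 0 isT) (i 1 isT) (i 2 isT) (i 3 isT) (i 4 isT) (i 5 isT) (i 6 isT) (i 7 isT)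
    (i 8 isT) (i 9 isT))%N.
  left; split; last exact: nH.
  by split; [exact: (i 10%N) | exact: (i 11%N) | exact: (i 12%N) | exact: (i 13%N) |
    exact: (i 14%N)].
pose s := l ++ [:: (fun z => Q1.[f z]); (fun z => Q2.[g z]); (fun z => f z - (- a));
    (fun z => g z - (- a))].
have i k : (k < size s)%N -> fmem (nth (fun=> 0) s k) s := @fmem_nth _ s k.
apply: (fin s (i 0 isT) (i 1 isT) (i 2 isT) (i 3 isT) (i 4 isT) (i 5 isT) (i 6 isT) (i 7 isT)
    (i 8 isT) (i 9 isT))%N.
right; exists Q1, Q2, d; split=> //; split=> //.
by split; [exact: (i 10%N) | exact: (i 11%N) | exact: (i 12%N) | exact: (i 13%N)].
Qed.

End Uniqueness.

(** * Functions with values in the Riemann sphere *)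

Section Bridge.
Context {R : realType}.
Local Notation C := R[i].
Local Opaque derive1.

(** Meromorphy at one point with the order of the pole made explicit, a form that passes to
    derivatives. *)
Definition msp (f : C -> option C) (z : C) : Prop :=
  [/\ f z <> None, nb z (fun y => f y <> None) & hol (finpart f) z] \/
  [/\ f z = None, nr z (fun y => f y <> None) &
    exists2 m : nat, (0 < m)%N & hasord (finpart f) z (- m%:Z)].

Lemma finpartP (f : C -> option C) z : f z <> None -> f z = Some (finpart f z).
Proof. by rewrite /finpart; case: (f z). Qed.

Lemma pole_order (F : C -> C) (z : C) : nr z (fun y => exists l, cd F y l) ->
  (forall M : R, nr z (fun y => M < nrm (F y))) ->
  exists2 m : nat, (0 < m)%N & hasord F z (- m%:Z).
Proof.
move=> dF FM; have F0 : nr z (fun y => F y != 0).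
  by apply: nrS (FM 0) => y _; rewrite nrm_gt0.
have [||g hg Fg] := @hol_removable R (fun y => (F y)^-1) z 1.
- apply: nrS (FM 1) => y _ h; rewrite nrmV; have y0 := lt_trans ltr01 h.
  by rewrite invf_le1 ?ltW.
- by apply: nrS2 dF F0 => y _ [l hl] y0; eexists; exact: gdV y0 hl.
have [g0|[m [u [hu u0 gu]]]] := hol_zero_or_factor hg.
  case: (@nr_false R z); apply: nrS3 Fg F0 (nb_nr g0) => y _ E /invr_neq0 + E'.
  by rewrite E E' eqxx.
have hm : hasord F z (- m%:Z).
  apply: (@hasord_ext R (fun y => (g y)^-1)).
    by apply: nrS Fg => y _ <-; rewrite invrK.
  apply: hasordV; exists u; split=> //.
  by apply: nrS (nb_nr gu) => y _ ->; rewrite mulrC.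
exists m => //; rewrite lt0n; apply/eqP => m0; move: hm; rewrite m0 oppr0 => hm.
have [v hv Fv] := ordge0_hol (hasord_ge hm).
case: (@nr_false R z).
apply: nrS3 Fv (FM (nrm (v z) + 1)) (nb_nr (nr_bounded (hol_cc hv))) => y _ ->.
by move=> h1 h2; have := lt_le_trans h1 h2; rewrite ltxx.
Qed.

Lemma meromorphic_msp (f : C -> option C) : meromorphic f -> forall z, msp f z.
Proof.
move=> mf z; have := mf z; case E : (f z) => [c|].
  move=> [h1 /holP h2]; left; split=> //; first by rewrite E.
  exact/nb_nbhsP.
move=> [h1 h2]; right; have {}h1 := (nr_nbhsP z _).2 h1; split=> //.
  by apply: nrS h1 => y _ [].
apply: pole_order.
  by apply: nrS h1 => y _ [_ /derivable_cd]; exists (derive1 (finpart f) y).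
move=> M; have H : \forall y \near z^', M%:C < `|finpart f y|.
  apply: (h2 [set x : C | M%:C < x]).
  exists (M%:C); split=> //.
  by apply/complex_realP; exists M.
by apply: nrS ((nr_nbhsP z _).2 H) => y _; rewrite -nrmE ltcR.
Qed.

Lemma msp_derive (f : C -> option C) z : (forall y, msp f y) ->
  [/\ msp (mderive f) z, mderive f z = None <-> f z = None &
    forall m, f z = None -> hasord (finpart f) z (- m%:Z) -> hasord (finpart (mderive f)) z (- (m.+1)%:Z)].
Proof.
move=> hf; have N y : mderive f y = None <-> f y = None by rewrite /mderive; case: (f y).
have E y : f y <> None -> finpart (mderive f) y = derive1 (finpart f) y.
  by rewrite /finpart /mderive; case: (f y).
have P m : (0 < m)%N -> nr z (fun y => f y <> None) -> hasord (finpart f) z (- m%:Z) ->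
    hasord (finpart (mderive f)) z (- (m.+1)%:Z).
  move=> m0 h1 h2; apply: (@hasord_ext R (derive1 (finpart f))).
    by apply: nrS h1 => y _ /E.
  have -> : - (m.+1)%:Z = - m%:Z - 1 by lia.
  by apply: hasord_derive h2; lia.
split=> //; have [[h1 h2 h3]|[h1 h2 [m m0 h3]]] := hf z.
- left; split; first by rewrite N.
    by apply: nbS h2 => y; rewrite N.
  apply: (@hol_ext R (derive1 (finpart f))); last exact: hol_derive.
  by apply: nbS h2 => y /E.
- right; split; [by rewrite N | by apply: nrS h2 => y _; rewrite N |].
  by exists m.+1 => //; exact: P.
- by move=> m /h1.
by move=> m' _ h; have mm := hasord_uniq h3 h; apply: P => //; lia.
Qed.

Lemma msp_deriven (f : C -> option C) k : (forall y, msp f y) ->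
  [/\ forall z, msp (mderiven k f) z, forall z, mderiven k f z = None <-> f z = None &
    forall z (m : nat), f z = None -> hasord (finpart f) z (- m%:Z) ->
      hasord (finpart (mderiven k f)) z (- (m + k)%:Z)].
Proof.
move=> hf; elim: k => [|k [h1 h2 h3]]; first by split=> // z m _; rewrite addn0.
split=> z; have [g1 g2 g3] := msp_derive z h1.
- exact: g1.
- by rewrite /mderiven iterS g2 h2.
by move=> m /[dup] fz /(h3 _ _)/[apply]; rewrite addnS; apply: g3; rewrite h2.
Qed.

Lemma msp_mero (f : C -> option C) : (forall y, msp f y) -> mero (finpart f).
Proof.
move=> hf z; have [[_ _ /hol_ordge]|[_ _ [m _ /hasord_ge]]] := hf z; first by exists 0.
by exists (- m%:Z).
Qed.

Lemma msp_nonc (f : C -> option C) : (forall y, msp f y) -> nonconstant f -> nonc (finpart f).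
Proof.
move=> hf nf; split; first exact: msp_mero.
move=> c e; apply: nf; exists (Some c) => z.
have [[h1 _ h3]|[_ _ [m m0 h3]]] := hf z.
  by rewrite (finpartP h1) (cc_agree (hol_cc h3) (hol_cc (hol_cst c z)) (e z)).
have h : ordge (finpart f) z 0.
  by apply: (@ordge_ext R (fun=> c)); [apply: nrS (e z) | apply: hol_ordge; exact: hol_cst].
by have := hasord_uniq_le h3 h; lia.
Qed.

Lemma msp_pole (f : C -> option C) z : nzm (finpart f) -> msp f z ->
  (ord (finpart f) z < 0)%R <-> f z = None.
Proof.
move=> nf [[h1 _ /hol_ordge h3]|[h1 _ [m m0 /ordE h3]]]; split=> //.
- by have := ord_ge nf h3; lia.
- by rewrite h3; lia.
Qed.

Lemma point_finite (f : C -> option C) w z p : nonc (finpart f) -> msp f z ->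
  point_of_mult f (Some w) z p <-> (0 < p)%N /\ ord (fun y => finpart f y - w) z = p.
Proof.
move=> nf mz; split=> [[p0 _ [u [hu u0 fu]]]|[p0 op]].
  split=> //; apply: ordE; exists u; split=> //; first exact/holP.
  by move/nr_nbhsP: fu; apply: nrS => y _ E; rewrite /finpart E /= addrC addKr mulrC.
have := ordP z (nonc_sub w nf); rewrite op => hp.
have [u [hu u0 fu]] := hp.
have [[h1 h2 h3]|[_ _ [m m0 h3]]] := mz; last first.
  have : hasord (fun y => finpart f y - w) z (- m%:Z).
    apply: hasordD h3 _; apply: (@ordge_weak _ _ _ 0); first by lia.
    by apply: hol_ordge; exact: hol_cst.
  by move=> /(hasord_uniq hp); lia.
have E : finpart f z = w.
  apply/eqP; rewrite -subr_eq0; apply/eqP; apply: (hasord_pos_hol (u := fun y => finpart f y - w) hp) => //.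
    by apply: holB => //; exact: hol_cst.
  exact: nrW.
split=> //; first by rewrite (finpartP h1) E.
exists u; split=> //; first exact/holP.
apply/nr_nbhsP; apply: nrS2 fu (nb_nr h2) => y _ fy /finpartP ->.
by rewrite -exprnP mulrC in fy; rewrite -fy addrC subrK.
Qed.

Lemma point_pole (f : C -> option C) z p : nonc (finpart f) -> msp f z ->
  point_of_mult f None z p <-> (0 < p)%N /\ - ord (finpart f) z = p.
Proof.
move=> nf mz; split=> [[p0 _ [u [hu u0 fu]]]|[p0 op]].
  split=> //; suff -> : ord (finpart f) z = - p%:Z by rewrite opprK.
  apply: ordE; exists u; split=> //; first exact/holP.
  by move/nr_nbhsP: fu; apply: nrS => y _ E; rewrite /finpart E /= -exprnN.
have nz := nonc_nzm nf.
have := ordP z nz; have -> : ord (finpart f) z = - p%:Z by lia.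
move=> [u [hu u0 fu]].
split=> //; first by apply/(msp_pole nz mz); lia.
exists u; split=> //; first exact/holP.
have h2 : nr z (fun y => f y <> None) by case: mz => [[_ /nb_nr//]|[]].
apply/nr_nbhsP; apply: nrS2 fu h2 => y _ fy /finpartP ->.
by rewrite fy -exprnN.
Qed.

(** A count up to [m] is the multiplicity itself, while the count [m.+1] reveals only that the
    multiplicity exceeds [m]; these are the two alternatives in [mt]. *)
Lemma mt_of_counts (e e' : C -> int) (m : nat) :
  [set x : C * nat | exists2 p : nat, (0 < p)%N /\ e x.1 = p & x.2 = if (p <= m)%N then p else m.+1] =
  [set x : C * nat | exists2 p : nat, (0 < p)%N /\ e' x.1 = p & x.2 = if (p <= m)%N then p else m.+1] ->
  forall z, mt (e z) (e' z) m.
Proof.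
have half (d d' : C -> int) z :
    [set x : C * nat | exists2 p : nat, (0 < p)%N /\ d x.1 = p & x.2 = if (p <= m)%N then p else m.+1] `<=`
    [set x : C * nat | exists2 p : nat, (0 < p)%N /\ d' x.1 = p & x.2 = if (p <= m)%N then p else m.+1] ->
    (0 < d z)%R -> d z = d' z \/ (m%:Z < d z)%R /\ (m%:Z < d' z)%R.
  move=> S d0; pose p := `|d z|%N.
  have [|q [q0 /= eq] /=] := S (z, if (p <= m)%N then p else m.+1).
    by exists p => //=; rewrite /p; split; lia.
  rewrite eq /p; case: ifP => h1; case: ifP => h2 E; [left | left | left | right]; lia.
move=> E z /orP[h|h]; first by apply: half => //; rewrite E.
have [||h1|[]] := half e' e z; [by rewrite E | by [] | by left | by right].
Qed.

Lemma ord_poly_root (Q : {poly C}) (h : C -> C) (t z : C) (p : nat) : Q.[t] = 0 -> Q^`().[t] != 0 ->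
  (0 < p)%N -> hasord (fun y => h y - t) z p -> hasord (fun y => Q.[h y]) z p.
Proof.
move=> Qt dQ p0 hp; have /factor_theorem[S QE] : root Q t by apply/eqP.
have St : S.[t] != 0.
  apply: contraNneq dQ => S0; rewrite QE derivM hornerD !hornerM hornerXsubC subrr mulr0 add0r.
  by rewrite derivXsubC hornerC mulr1 S0.
have [u hu hE] : exists2 u, hol u z & nr z (fun y => h y = u y).
  apply: ordge0_hol; apply: (@ordge_ext R (fun y => (h y - t) + t)).
    by apply: nrW => y _; rewrite subrK.
  apply: ordgeD; first by apply: ordge_weak (hasord_ge hp).
  by apply: hol_ordge; exact: hol_cst.
have ut : u z = t.
  apply/eqP; rewrite -subr_eq0; apply/eqP; apply: (hasord_pos_hol (u := fun y => u y - t) hp) => //.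
    by apply: holB => //; exact: hol_cst.
  by apply: nrS hE => y _ ->.
have := hasordM (hasord0_poly (Q := S) hu hE _) hp; rewrite ut add0r => /(_ St).
by apply: hasord_ext; apply: nrW => y _; rewrite [in RHS]QE hornerM hornerXsubC.
Qed.

Lemma Epoints_mem (f : C -> option C) S m (x : C * nat) : Eset f S m x <->
  exists2 alpha, S alpha & exists2 p : nat, point_of_mult f alpha x.1 p &
             x.2 = if (p <= m)%N then p else m.+1.
Proof. by []. Qed.

Lemma Eset_zero (f : C -> option C) m : nonc (finpart f) -> (forall z, msp f z) ->
  Eset f [set Some 0] m =
  [set x : C * nat | exists2 p : nat, (0 < p)%N /\ ord (finpart f) x.1 = p &
    x.2 = if (p <= m)%N then p else m.+1].
Proof.
move=> nf hf; have E0 : (fun y => finpart f y - 0) = finpart f by apply/funext => y; rewrite subr0.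
apply/seteqP; split=> x.
  move=> /Epoints_mem[_ ->] [p /(point_finite 0 _ nf (hf _)) h e]; exists p => //.
  by move: h; rewrite E0.
move=> [p h e]; apply/Epoints_mem; exists (Some 0) => //; exists p => //.
by apply/(point_finite 0 _ nf (hf _)); rewrite E0.
Qed.

Lemma Eset_pole (f : C -> option C) m : nonc (finpart f) -> (forall z, msp f z) ->
  Eset f [set None] m =
  [set x : C * nat | exists2 p : nat, (0 < p)%N /\ - ord (finpart f) x.1 = p &
    x.2 = if (p <= m)%N then p else m.+1].
Proof.
move=> nf hf; apply/seteqP; split=> x.
  by move=> /Epoints_mem[_ ->] [p /(point_pole _ nf (hf _)) h e]; exists p.
move=> [p h e]; apply/Epoints_mem; exists None => //; exists p => //.
exact/(point_pole _ nf (hf _)).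
Qed.

Lemma Eset_roots (Q : {poly C}) (f : C -> option C) m : sf Q -> nonc (finpart f) ->
  (forall z, msp f z) ->
  Eset f [set Some t | t in [set t | Q.[t] = 0]] m =
  [set x : C * nat | exists2 p : nat, (0 < p)%N /\ ord (fun y => Q.[finpart f y]) x.1 = p &
    x.2 = if (p <= m)%N then p else m.+1].
Proof.
move=> sQ nf hf.
have Q0 : Q.[0] != 0 by apply/eqP => /sQ[]; rewrite eqxx.
have Qn0 : Q != 0 by apply: contraNneq Q0 => ->; rewrite horner0.
apply/seteqP; split=> x.
  move=> /Epoints_mem[_ [t /= Qt <-]] [p /(point_finite t _ nf (hf _)) [p0 h] e]; exists p => //.
  split=> //; apply: ordE; apply: (ord_poly_root Qt _ p0); first by case: (sQ _ Qt).
  by rewrite -h; apply: ordP; exact: nonc_sub.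
move=> [p [p0 h] e]; have [_ _ _ H] := poly_order_cases (nonc_poly nf Qn0) Q0 (ordP x.1 (nonc_nzm nf)).
have [|_ [t [Qt ht]]] := H; first by rewrite h.
apply/Epoints_mem; exists (Some t); first by exists t.
exists p => //; apply/(point_finite t _ nf (hf _)); split=> //; rewrite -h.
by apply: ordE; apply: ht; have [] := sQ _ Qt.
Qed.

End Bridge.

Theorem theorem1p1 (R : realType) (n k : nat) (hn : (3 <= n)%N) (hk : (1 <= k)%N)
  (a b : R[i]) (ha : a != 0) (hb : b != 0)
  (hP : forall z : R[i], (mup z ('X^n + a *: 'X^(n - 1) + b%:P) <= 1)%N)
  (S1 S2 S3 : set (option R[i]))
  (hS1 : S1 = [set Some z | z in [set z : R[i] | z ^+ n + a * z ^+ (n - 1) + b = 0]])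
  (hS2 : S2 = [set None])
  (hS3 : S3 = [set Some 0])
  (f g : R[i] -> option R[i])
  (hf : meromorphic f) (hg : meromorphic g)
  (hfc : nonconstant f) (hgc : nonconstant g)
  (hfkc : nonconstant (mderiven k f)) (hgkc : nonconstant (mderiven k g))
  (k1 k2 k3 : nat) (hk1 : (4 <= k1)%N)
  (hE1 : Eset (mderiven k f) S1 k1 = Eset (mderiven k g) S1 k1)
  (hE2 : Eset f S2 k2 = Eset g S2 k2)
  (hE3 : Eset (mderiven k f) S3 k3 = Eset (mderiven k g) S3 k3)
  (hineq : 2 * k1%:Z * k2%:Z * k3%:Z >
     k1%:Z + k2%:Z + 2 * k3%:Z + k%:Z - 2 * k%:Z * k1%:Z * k3%:Z
     - k1%:Z * k2%:Z - k%:Z * k1%:Z + 3) :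
  forall z : R[i], mderiven k f z = mderiven k g z.
Proof.
have mf := meromorphic_msp hf; have mg := meromorphic_msp hg.
have [mF Fnone Ford] := msp_deriven k mf; have [mG Gnone Gord] := msp_deriven k mg.
have nf0 := msp_nonc mf hfc; have ng0 := msp_nonc mg hgc.
have nF := msp_nonc mF hfkc; have nG := msp_nonc mG hgkc.
have nz := @nonc_nzm R.
set F := finpart (mderiven k f) in nF *; set G := finpart (mderiven k g) in nG *.
have sP : sf (uniqP n a b) := sf_P hn ha hb hP.
have hz z : mt (ord F z) (ord G z) k3.
  by apply: (mt_of_counts (e := ord F) (e' := ord G)); rewrite -!Eset_zero // -hS3.
have hx z : mt (ord (fun y => (uniqP n a b).[F y]) z) (ord (fun y => (uniqP n a b).[G y]) z) k1.
  apply: (mt_of_counts (e := ord (fun y => (uniqP n a b).[F y]))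
    (e' := ord (fun y => (uniqP n a b).[G y]))).
  rewrite -!Eset_roots //.
  have -> : [set t | (uniqP n a b).[t] = 0] = [set z : R[i] | z ^+ n + a * z ^+ (n - 1) + b = 0].
    by apply/funext => t; rewrite /= hornerP.
  by rewrite -hS1.
have hp0 z : mt (- ord (finpart f) z) (- ord (finpart g) z) k2.
  apply: (mt_of_counts (e := fun z => - ord (finpart f) z) (e' := fun z => - ord (finpart g) z)).
  by rewrite -!Eset_pole // -hS2.
have polE (h : R[i] -> option R[i]) z : (forall y, msp h y) -> nonc (finpart h) ->
    nonc (finpart (mderiven k h)) -> (ord (finpart (mderiven k h)) z < 0)%R ->
    (ord (finpart h) z < 0)%R /\ ord (finpart (mderiven k h)) z = ord (finpart h) z - k%:Z.
  move=> mh nh nH; have [mH Hnone Hord] := msp_deriven k mh.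
  move=> /(msp_pole (nz _ nH) (mH z)) /Hnone hN.
  split; first exact/(msp_pole (nz _ nh) (mh z)).
  have o0 := (msp_pole (nz _ nh) (mh z)).2 hN.
  have := ordP z (nz _ nh); have -> : ord (finpart h) z = - (`|ord (finpart h) z|%N)%:Z by lia.
  by move=> /(Hord _ _ hN)/ordE ->; lia.
have polE' (h : R[i] -> option R[i]) z : (forall y, msp h y) -> nonc (finpart h) ->
    nonc (finpart (mderiven k h)) -> (ord (finpart h) z < 0)%R ->
    ord (finpart (mderiven k h)) z = ord (finpart h) z - k%:Z.
  move=> mh nh nH; have [mH Hnone _] := msp_deriven k mh.
  move=> /(msp_pole (nz _ nh) (mh z)) /Hnone /(msp_pole (nz _ nH) (mH z)).
  by case/(polE _ _ mh nh nH).
have pF z : (ord F z < 0)%R -> (ord (finpart f) z < 0)%R /\ ord F z = ord (finpart f) z - k%:Z.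
  exact: polE mf nf0 nF.
have pG z : (ord G z < 0)%R -> (ord (finpart g) z < 0)%R /\ ord G z = ord (finpart g) z - k%:Z.
  exact: polE mg ng0 nG.
have qF z : (ord (finpart f) z < 0)%R -> ord F z = ord (finpart f) z - k%:Z.
  exact: polE' mf nf0 nF.
have qG z : (ord (finpart g) z < 0)%R -> ord G z = ord (finpart g) z - k%:Z.
  exact: polE' mg ng0 nG.
(* Differentiating [k] times raises every pole order by [k], so agreement at level [k2] becomes
   agreement at level [k2 + k]. *)
have hp z : mt (- ord F z) (- ord G z) (k2 + k).
  move: (pF z) (pG z) (qF z) (qG z) (hp0 z); rewrite /mt => {}pF {}pG {}qF {}qG {}hp0 h.
  have h0 : (0 < - ord (finpart f) z)%R || (0 < - ord (finpart g) z)%R.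
    by case/orP: h => h; apply/orP; [left; have [] := pF ltac:(lia) | right; have [] := pG ltac:(lia)]; lia.
  have [e|[e1 e2]] := hp0 h0.
    by left; rewrite qF ?qG //; lia.
  by right; rewrite qF ?qG //; lia.
(* Poles of a derivative are multiple; [k >= 1] enters here. *)
have fp z : (ord F z < 0)%R -> (ord F z <= - 2)%R by move=> /pF[]; lia.
have gp z : (ord G z < 0)%R -> (ord G z <= - 2)%R by move=> /pG[]; lia.
(* Expanding the product gives [hineq] with its negative terms moved to the larger side. *)
have det : (k1 + (2 * k3 + 1) + (k2 + k) + 2 < k1 * (2 * k3 + 1) * (k2 + k))%N.
  by clear - hineq; lia.
have FG : eqm F G.
  apply: contrapT; exact: (distinct_false hn ha hb sP nF nG hx hz hp fp gp hk1 det).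
(* [eqm] compares punctured neighbourhoods only; at [z] itself finite values agree by continuity,
   and poles because the orders agree. *)
move=> z; have oFG := eqm_ord z FG.
have [[h1 _ h2]|[h1 _ _]] := mF z; have [[h1' _ h2']|[h1' _ _]] := mG z; last by rewrite h1 h1'.
- by rewrite (finpartP h1) (finpartP h1') (cc_agree (hol_cc h2) (hol_cc h2') (FG z)).
- by have := (msp_pole (nz _ nG) (mG z)).2 h1'; rewrite -oFG => /(msp_pole (nz _ nF) (mF z)).
- by have := (msp_pole (nz _ nF) (mF z)).2 h1; rewrite oFG => /(msp_pole (nz _ nG) (mG z)).
Qed.
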